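(* Let $\Omega\subset\mathbb{R}^d$ be convex and compact and $\vartheta>0$. Then for every $p>2$ there exists a constant $C$, depending only on $d$, $\operatorname{diam}\Omega$, $\vartheta$ and $p$ and growing linearly in $p$, such that for all $\mu,\nu\in\mathcal{K}_\vartheta$, $$\operatorname{dist}_{W_2}(\mathcal{M}_\mu,\mathcal{M}_\nu)\le C\,W_2(\mu,\nu)^{\frac{p-2}{6p-4}}.$$
   Context: $\Theta(\mu)=\inf_{\theta\in\mathbb{S}^{d-1}}\int_{\mathbb{R}^d}|y\cdot\theta|\,d\mu(y)$ and $\mathcal{K}_\vartheta=\{\mu\in\mathscr{P}(\Omega):\ \mu\text{ has barycenter at the origin and }\Theta(\mu)\ge\vartheta\}$. For $\mu\in\mathscr{P}_1(\mathbb{R}^d)$, $\mathscr{E}_\mu(\varrho)=H(\varrho)+\mathcal{T}(\varrho,\mu)$ with $H(\varrho)=\int\varrho\log\varrho$ if $\varrho\ll$ Lebesgue ($+\infty$ otherwise) and $\mathcal{T}(\varrho,\mu)=\sup_{\gamma\in\Pi(\varrho,\mu)}\int\langle x,y\rangle d\gamma$; $\mathcal{M}_\mu=\operatorname{argmin}_{\mathscr{P}_1(\mathbb{R}^d)}\mathscr{E}_\mu$ (the set of Gibbs measures $e^{-\psi}$ of moment measure representations $\mu=(\nabla\psi)_\sharp e^{-\psi}$, unique up to translation). $W_2$ is the quadratic Wasserstein distance and $\operatorname{dist}_{W_2}(A,B)=\inf_{a\in A,b\in B}W_2(a,b)$. *)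

(* Defs.v *)
From HB Require Import structures.
From mathcomp Require Import all_boot all_order all_algebra.
From mathcomp Require Import all_classical all_reals all_analysis.
Set Implicit Arguments. Unset Strict Implicit. Unset Printing Implicit Defensive.
Import Order.TTheory GRing.Theory Num.Theory.
Import numFieldNormedType.Exports.
Local Open Scope classical_set_scope.
Local Open Scope ring_scope.

Section Defs.
Variable R : realType.
Variable d : nat.

Definition Rd : Type := g_sigma_algebraType (@open 'rV[R]_d).
HB.instance Definition _ := Measurable.on Rd.

Definition dotv (x y : 'rV[R]_d) : R := \sum_(i < d) x 0 i * y 0 i.
Definition eucl (x : 'rV[R]_d) : R := Num.sqrt (dotv x x).

Definition diam (O : set 'rV[R]_d) : R := sup [set eucl (x - y) | x in O & y in O].

Definition is_convex (O : set 'rV[R]_d) : Prop :=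
  forall x y t, O x -> O y -> 0 <= t <= 1 -> O (t *: x + (1 - t) *: y).

Definition box (a b : 'rV[R]_d) : set Rd :=
  [set x : Rd | forall i, a 0 i <= (x : 'rV[R]_d) 0 i <= b 0 i].
Definition is_lebesgue (leb : {measure set Rd -> \bar R}) : Prop :=
  forall a b : 'rV[R]_d, (forall i, a 0 i <= b 0 i) ->
    leb (box a b) = (\prod_(i < d) (b 0 i - a 0 i))%:E.

Notation prob := (probability Rd R).

Definition supported_in (O : set 'rV[R]_d) (mu : prob) : Prop :=
  mu (~` (O : set Rd)) = 0%E.

Definition finite_first_moment (mu : prob) : Prop :=
  (\int[mu]_y (eucl y)%:E < +oo)%E.

Definition centered (mu : prob) : Prop :=
  forall i : 'I_d, (\int[mu]_y ((y : 'rV[R]_d) 0 i)%:E = 0)%E.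

Definition Theta (mu : prob) : \bar R :=
  ereal_inf [set (\int[mu]_y (`| dotv y th |)%:E)%E | th in [set th | eucl th = 1]].

Definition Kset (O : set 'rV[R]_d) (th : R) : set prob :=
  [set mu | supported_in O mu /\ centered mu /\ (th%:E <= Theta mu)%E].

Definition coupling (rho mu : prob) (g : probability (Rd * Rd)%type R) : Prop :=
  forall A : set Rd, measurable A ->
    g (A `*` setT) = rho A /\ g (setT `*` A) = mu A.

Definition density_of (leb : {measure set Rd -> \bar R}) (rho : prob) (f : Rd -> R) : Prop :=
  measurable_fun setT f /\ (forall x, 0 <= f x) /\
  forall A : set Rd, measurable A -> rho A = (\int[leb]_(x in A) (f x)%:E)%E.

(** entropy: int rho log rho if rho << Lebesgue, +oo otherwise
    (empty infimum = +oo; all densities agree a.e. so the value is well defined) *)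
Definition entropy (leb : {measure set Rd -> \bar R}) (rho : prob) : \bar R :=
  ereal_inf [set (\int[leb]_x (f x * ln (f x))%:E)%E | f in density_of leb rho].

Definition Tcost (rho mu : prob) : \bar R :=
  ereal_sup [set (\int[g]_z (dotv z.1 z.2)%:E)%E | g in coupling rho mu].

Definition Efun (leb : {measure set Rd -> \bar R}) (mu rho : prob) : \bar R :=
  (entropy leb rho + Tcost rho mu)%E.

Definition Mset (leb : {measure set Rd -> \bar R}) (mu : prob) : set prob :=
  [set rho | finite_first_moment rho /\
     forall rho', finite_first_moment rho' -> (Efun leb mu rho <= Efun leb mu rho')%E].

Definition W2sq (a b : prob) : \bar R :=
  ereal_inf [set (\int[g]_z (eucl (z.1 - z.2) ^+ 2)%:E)%E | g in coupling a b].

Definition W2 (a b : prob) : \bar R :=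
  match W2sq a b with
  | r%:E => (Num.sqrt r)%:E
  | +oo%E => +oo%E
  | -oo%E => 0%E
  end.

Definition distW2 (A B : set prob) : \bar R :=
  ereal_inf [set W2 a b | a in A & b in B].

End Defs.

(* Main.v *)
(* The Gibbs measure rho0 = exp(- Psi) of mu is obtained by maximizing the integral of exp(- psi) over
   convex Lipschitz psi whose Legendre transform has nonpositive mu-integral; duality for semidiscrete
   transport shows that it minimizes the energy.  Let w > W2 mu nu and let u, v be nearly optimal dual
   potentials for the quadratic transport between rho0 and rho1.  Shifting rho0 and rho1 by small vectors
   and coupling the moment measure identities through mu and nu gives, for the second differences of u
   and v with step a, E D_a u + E D_a v <= 2 |a|^2 (1 + C w), up to lower order.  The Fenchel inequality
   applied with unequal steps in geometric progression improves this to D_a u = |a|^2 and D_a v = |a|^2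
   in L1, up to C sqrt w |a|^2.  Summing second differences along the segments from a uniform point Z of
   a cube to X ~ rho0, whose intermediate points have density at most C rho0 by log-concavity, yields
   E q(X) >= E q(Z) - err for q = u - |.|^2 / 2, and similarly for q' = v - |.|^2 / 2 and Y ~ rho1.
   As q + q' >= 0 on the diagonal, W2 rho0 rho1 ^+ 2 is at most 4 err plus the small slack of the
   potentials.  Truncating the segments at a suitable radius gives W2 rho0 rho1 <= C w^(1/6), and
   (p - 2) / (6 p - 4) < 1 / 6. *)
Require Import Defs.
From HB Require Import structures.
From mathcomp Require Import all_boot all_order all_algebra.
From mathcomp Require Import all_classical all_reals all_analysis.
From mathcomp Require Import measurable_realfun.
From mathcomp Require Import ring lra.
Set Implicit Arguments. Unset Strict Implicit. Unset Printing Implicit Defensive.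
Import Order.TTheory GRing.Theory Num.Theory.
Import numFieldNormedType.Exports.
Local Open Scope classical_set_scope.
Local Open Scope ring_scope.

(** * Euclidean geometry and Lebesgue measure *)

(** The moment measure identity only controls a trace: testing the score against X gives E X.M <= d,
    and nothing direction by direction. To bound the second differences along one vector a, the
    vectors a_i e_j - a_j e_i are added to a, which makes a tight frame. Summed over the frame, the
    energy bound costs |a|^2 (d + C w) for each of u and v, while Fenchel on the diagonal bounds
    every extra direction from below; the difference leaves 2 |a|^2 (1 + C w) for a itself. No
    differentiability and no exact optimal plan is used: a density is compared with its translates,
    plans are optimal up to a slack, and slacks are fixed after the step lengths, so only finitely
    many scales can be treated at once. A step ratio 1 + t costs t^2 |a|^2 per scale and contracts
    by (1 + t)^-2, so the accumulated error is of order t as soon as w <= t^2; this is the origin of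
    sqrt w. With w = s^6 and t = s^3 all later losses are of order s^2, which bounds the squared
    distance. Both argmin sets contain the Gibbs measures constructed here, so the infimum defining
    the distance is at most their W2 distance. *)

Section Euclid.
Context {R : realType} {d : nat}.
Implicit Types x y z : 'rV[R]_d.

Lemma dotvC x y : dotv x y = dotv y x.
Proof. by apply: eq_bigr => i _; rewrite mulrC. Qed.

Lemma dotvDl x y z : dotv (x + y) z = dotv x z + dotv y z.
Proof. by rewrite /dotv -big_split; apply: eq_bigr => i _; rewrite mxE mulrDl. Qed.

Lemma dotvZl a x z : dotv (a *: x) z = a * dotv x z.
Proof. by rewrite /dotv mulr_sumr; apply: eq_bigr => i _; rewrite mxE mulrA. Qed.

Lemma dotvDr x y z : dotv x (y + z) = dotv x y + dotv x z.
Proof. by rewrite dotvC dotvDl !(dotvC x). Qed.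

Lemma dotvZr a x z : dotv x (a *: z) = a * dotv x z.
Proof. by rewrite dotvC dotvZl dotvC. Qed.

Lemma dotvNl x z : dotv (- x) z = - dotv x z.
Proof. by rewrite -scaleN1r dotvZl mulN1r. Qed.

Lemma dotvNr x z : dotv x (- z) = - dotv x z.
Proof. by rewrite dotvC dotvNl dotvC. Qed.

Lemma dotvBl x y z : dotv (x - y) z = dotv x z - dotv y z.
Proof. by rewrite dotvDl dotvNl. Qed.

Lemma dotvBr x y z : dotv x (y - z) = dotv x y - dotv x z.
Proof. by rewrite dotvDr dotvNr. Qed.

Lemma dotvv_ge0 x : 0 <= dotv x x.
Proof. by apply: sumr_ge0 => i _; rewrite -expr2 sqr_ge0. Qed.

Lemma eucl_ge0 x : 0 <= eucl x.
Proof. exact: sqrtr_ge0. Qed.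

Lemma eucl_sqr x : eucl x ^+ 2 = dotv x x.
Proof. by rewrite sqr_sqrtr // dotvv_ge0. Qed.

Lemma euclN x : eucl (- x) = eucl x.
Proof. by rewrite /eucl dotvNl dotvNr opprK. Qed.

Lemma euclZ a x : eucl (a *: x) = `|a| * eucl x.
Proof.
by rewrite /eucl dotvZl dotvZr mulrA -expr2 sqrtrM ?sqr_ge0// sqrtr_sqr.
Qed.

Lemma eucl_distC x y : eucl (x - y) = eucl (y - x).
Proof. by rewrite -euclN opprB. Qed.

Lemma dotv_le x y : dotv x y <= eucl x * eucl y.
Proof.
have X := eucl_ge0 x; have Y := eucl_ge0 y.
have [Y0|Y0] := eqVneq (eucl y) 0.
  rewrite Y0 mulr0 le_eqVlt; apply/orP; left; apply/eqP.
  have : dotv y y = 0 by rewrite -eucl_sqr Y0 expr0n.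
  move=> /eqP; rewrite psumr_eq0 => [/allP h|i _]; last by rewrite -expr2 sqr_ge0.
  apply: big1 => i _; have := h i (mem_index_enum _); rewrite -expr2 sqrf_eq0.
  by move=> /eqP ->; rewrite mulr0.
have Yp : 0 < eucl y by rewrite lt_def Y0.
(* Cauchy-Schwarz: the vector is |y| times the component of [x] orthogonal to [y], so its squared
   norm is |y|^2 (|x|^2 - q^2) with q = x.y / |y|. *)
have h := dotvv_ge0 (eucl y *: x - (dotv x y / eucl y) *: y).
rewrite !(dotvBl, dotvBr, dotvZl, dotvZr) -!eucl_sqr (dotvC y x) in h.
have e : dotv x y = (dotv x y / eucl y) * eucl y by rewrite divfK.
move: h e; set p := dotv x y; set q := p / eucl y; move=> h e.
have h4 : q ^+ 2 <= eucl x ^+ 2.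
  move: h; rewrite e => h.
  have : 0 <= eucl y ^+ 2 * (eucl x ^+ 2 - q ^+2) by nra.
  by rewrite pmulr_rge0 ?exprn_gt0// subr_ge0.
have : q <= eucl x.
  by apply: le_trans (ler_norm _) _; rewrite -(ler_pXn2r (n:=2)) ?nnegrE// real_normK ?num_real.
by rewrite e => /(ler_wpM2r Y).
Qed.

Lemma dotv_abs_le x y : `|dotv x y| <= eucl x * eucl y.
Proof. by rewrite ler_norml lerNl -dotvNl -{1}(euclN x) !dotv_le. Qed.

Lemma eucl_triangle x y : eucl (x + y) <= eucl x + eucl y.
Proof.
rewrite -(ler_pXn2r (n:=2)) ?nnegrE ?addr_ge0 ?eucl_ge0//.
rewrite eucl_sqr dotvDl !dotvDr -!eucl_sqr (dotvC y x).
have := dotv_le x y; lra.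
Qed.

Lemma euclB_le x y : eucl (x - y) <= eucl x + eucl y.
Proof. by rewrite -(euclN y); exact: eucl_triangle. Qed.

Lemma eucl_sub_le x y : eucl x - eucl y <= eucl (x - y).
Proof. by have := eucl_triangle (x - y) y; rewrite subrK; lra. Qed.

Lemma coord_le_eucl x i : `|x 0 i| <= eucl x.
Proof.
rewrite -(ler_pXn2r (n:=2)) ?nnegrE ?eucl_ge0// eucl_sqr real_normK ?num_real//.
rewrite /dotv (bigD1 i)//= expr2 lerDl; apply: sumr_ge0 => j _.
by rewrite -expr2 sqr_ge0.
Qed.

Lemma eucl_le_sum x : eucl x <= \sum_i `|x 0 i|.
Proof.
have S0 : 0 <= \sum_i `|x 0 i| by apply: sumr_ge0.
rewrite -(ler_pXn2r (n:=2)) ?nnegrE ?eucl_ge0// eucl_sqr expr2 mulr_suml.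
apply: ler_sum => i _; apply: le_trans (ler_norm _) _; rewrite normrM.
by apply: ler_wpM2l => //; rewrite (bigD1 i)//= lerDl; apply: sumr_ge0.
Qed.

Lemma eucl_le_max x (r : R) : (forall i, `|x 0 i| <= r) -> eucl x <= d%:R * r.
Proof.
move=> h; apply: le_trans (eucl_le_sum x) _.
have -> : d%:R * r = \sum_(i < d) r by rewrite sumr_const card_ord mulr_natl.
exact: ler_sum.
Qed.

Lemma dotv_delta x i : dotv x (delta_mx 0 i) = x 0 i.
Proof.
rewrite /dotv (bigD1 i)//= mxE !eqxx mulr1 big1 ?addr0// => j ji.
by rewrite mxE eqxx (negbTE ji) mulr0.
Qed.

(* Lagrange's identity: [a] and the [a_i e_j - a_j e_i] form a tight frame. *)
Lemma lagrange_frame (a x y : 'rV[R]_d) :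
  dotv x a * dotv a y + 2^-1 * \sum_i \sum_j
    dotv x (a 0 i *: delta_mx 0 j - a 0 j *: delta_mx 0 i) *
    dotv (a 0 i *: delta_mx 0 j - a 0 j *: delta_mx 0 i) y
  = dotv a a * dotv x y.
Proof.
under eq_bigr => i _.
  under eq_bigr => j _.
    rewrite dotvBr !dotvZr !dotv_delta dotvBl !dotvZl !(dotvC _ y) !dotv_delta.
    rewrite (_ : _ * _ = a 0 i * a 0 i * (x 0 j * y 0 j) + x 0 i * y 0 i * (a 0 j * a 0 j)
       - a 0 i * x 0 i * (a 0 j * y 0 j) - a 0 i * y 0 i * (a 0 j * x 0 j)); last by ring.
  over.
  rewrite !sumrB big_split /= -!mulr_sumr.
over.
rewrite !sumrB big_split /= -!mulr_suml.
rewrite /dotv.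
rewrite (eq_bigr (fun i => a 0 i * x 0 i)) => [|i _]; last by rewrite mulrC.
move: (\sum_i _) (\sum_i _) (\sum_i _) (\sum_i _) => A B C E. by field.
Qed.

Lemma frame_norm (a : 'rV[R]_d) i j :
  dotv (a 0 i *: delta_mx 0 j - a 0 j *: delta_mx 0 i)
       (a 0 i *: delta_mx 0 j - a 0 j *: delta_mx 0 i)
  = a 0 i * a 0 i + a 0 j * a 0 j - (i == j)%:R * (2 * (a 0 i * a 0 j)).
Proof.
rewrite dotvBr !dotvZr !dotv_delta !mxE !eqxx /= (eq_sym j i).
have [->|ij] := eqVneq i j; first by move: (a 0 j) => v; rewrite ?eqxx; ring.
by rewrite ?(negbTE ij) ?(eq_sym i j) ?(negbTE ij); move: (a 0 i) (a 0 j) => u v; ring.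
Qed.

(** Trace of the frame identity: the extra directions weigh (d - 1) |a|^2 in total. This is the
    amount that the lower bounds along them remove from the trace bound d |a|^2. *)
Lemma lagrange_frame_norm (a : 'rV[R]_d) :
  dotv a a + 2^-1 * \sum_i \sum_j
    dotv (a 0 i *: delta_mx 0 j - a 0 j *: delta_mx 0 i)
         (a 0 i *: delta_mx 0 j - a 0 j *: delta_mx 0 i)
  = d%:R * dotv a a.
Proof.
have e i : \sum_j dotv (a 0 i *: delta_mx 0 j - a 0 j *: delta_mx 0 i)
    (a 0 i *: delta_mx 0 j - a 0 j *: delta_mx 0 i) =
    d%:R * (a 0 i * a 0 i) + dotv a a - 2 * (a 0 i * a 0 i).
  rewrite (eq_bigr _ (fun j _ => frame_norm a i j)) sumrB big_split /=.
  rewrite sumr_const card_ord mulr_natl -/(dotv a a); congr (_ - _).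
  rewrite (bigD1 i)//= eqxx mul1r big1 ?addr0// => j ji.
  by rewrite eq_sym (negbTE ji) mul0r.
rewrite (eq_bigr _ (fun i _ => e i)) sumrB big_split /= -!mulr_sumr sumr_const card_ord.
rewrite -!/(dotv a a) -[dotv a a *+ d]mulr_natl.
move: (dotv a a) (d%:R : R) => u k; by field.
Qed.

End Euclid.

(** * Borel structure of R^d: boxes, coordinates, vector operations *)

Section MeasurableRd.
Context {R : realType} {d : nat}.
Local Notation T := (Rd R d).
Local Notation V := 'rV[R]_d.

Definition boxes : set (set T) := [set B | exists a b : V, B = box a b].

Lemma measurable_open (U : set V) : open U -> measurable (U : set T).
Proof. by move=> oU; apply: sub_sigma_algebra. Qed.

Lemma measurable_closed (U : set V) : closed U -> measurable (U : set T).
Proof.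
move=> oU; rewrite -(setCK (U : set T)); apply: measurableC.
by apply: measurable_open; rewrite openC.
Qed.

Lemma box_closed (a b : V) : closed (box a b : set V).
Proof.
rewrite (_ : (box a b : set V) = \bigcap_(i in [set: 'I_d])
    ((fun x : V => x 0 i) @^-1` `[a 0 i, b 0 i]%classic)).
  apply: closed_bigI => i _.
  apply: preimage_closed; last exact: itv_closed.
  by move=> x _; exact: coord_continuous.
apply/seteqP; split => x /= h i; first by move=> _ /=; rewrite in_itv/=; exact: h.
by have := h i I; rewrite /= in_itv.
Qed.

Lemma measurable_box (a b : V) : measurable (box a b : set T).
Proof. by apply: measurable_closed; exact: box_closed. Qed.

(** The norm on row vectors is the sup norm, so an open set is the union of the boxes with rational
    centre and half-side 1 / (n + 1) that it contains. [F p] replaces the other boxes by the empty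
    set, which keeps the union indexed by a countable type. *)
Lemma boxes_measurable : (measurable : set (set T)) = <<s boxes >>.
Proof.
apply/seteqP; split; last first.
  apply: smallest_sub; first exact: sigma_algebra_measurable.
  by move=> _ [a [b ->]]; exact: measurable_box.
apply: smallest_sub; first exact: smallest_sigma_algebra.
move=> U oU.
pose B (p : 'rV[rat]_d * nat) : set T :=
  box (\row_i (ratr (p.1 0 i) - p.2.+1%:R^-1)) (\row_i (ratr (p.1 0 i) + p.2.+1%:R^-1)).
pose F p : set T := if `[< B p `<=` U >] then B p else set0.
have -> : U = \bigcup_p F p.
  apply/seteqP; split => x; last first.
    by move=> [p _]; rewrite /F; case: ifPn => [/asboolP BU /BU //|_ //].
  move=> Ux; have /nbhs_ballP[e /= e0 eU] : nbhs (x : V) U by exact: open_nbhs_nbhs.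
  have [n ne] : exists n, n.+1%:R^-1 < e / 2 :> R.
    by have := near_infty_natSinv_lt (PosNum (divr_gt0 e0 (ltr0n R 2))) => -[n _ /(_ n (leqnn _))]; exists n.
  have n0 : 0 < n.+1%:R^-1 :> R by rewrite invr_gt0.
  pose r : R := n.+1%:R^-1; rewrite -/r in ne n0.
  have /choice[q qP] : forall i, exists q : rat, `|(x : V) 0 i - ratr q| < r.
    move=> i; have /rat_in_itvoo[q] : (x : V) 0 i - r < (x : V) 0 i + r by lra.
    by rewrite in_itv /= => /andP[h1 h2]; exists q; rewrite ltr_norml; lra.
  exists (\row_i q i, n) => //; rewrite /F.
  have xB : B (\row_i q i, n) x.
    by move=> i; rewrite !mxE /= -/r; have := qP i; rewrite ltr_norml; lra.
  case: ifPn => // /asboolP[y yB]; apply: eU; split => // i j; rewrite ord1.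
  have := yB j; have := qP j; rewrite !mxE /= -/r /ball /= !ltr_norml; lra.
apply: (@countable_bigcupT_measurable _ (g_sigma_algebraType boxes)) => [|p].
  exact: countableP.
rewrite /F; case: ifP => _; last exact: measurable0.
by apply: sub_sigma_algebra; do 2 eexists.
Qed.

Lemma measurable_coord i : measurable_fun [set: T] (fun x : T => (x : V) 0 i).
Proof.
apply: (measurability _ (RGenOpens.measurableE R)).
move=> _ [_ [a [b ->]] <-]; rewrite setTI; apply: measurable_open.
apply: open_comp; last exact: itv_open.
by move=> x _; exact: coord_continuous.
Qed.

Lemma measurable_fun_Rd {dS} {S : measurableType dS} (f : S -> T) :
  (forall i, measurable_fun setT (fun s => (f s : V) 0 i)) -> measurable_fun setT f.
Proof.
move=> mf; apply: (measurability _ boxes_measurable).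
move=> _ [_ [a [b ->]] <-]; rewrite setTI.
rewrite (_ : _ @^-1` _ = \bigcap_(i in [set: 'I_d])
    ((fun s => (f s : V) 0 i) @^-1` `[a 0 i, b 0 i]%classic)).
  apply: fin_bigcap_measurable => [|i _]; first exact: finite_finset.
  by rewrite -[X in measurable X]setTI; apply: mf.
apply/seteqP; split => x /= h i; first by move=> _ /=; rewrite in_itv/=; exact: h.
by have := h i I; rewrite /= in_itv.
Qed.

Context {dS : measure_display} {S : measurableType dS}.
Implicit Types f g : S -> T.

Lemma measurable_coord_comp f i : measurable_fun setT f ->
  measurable_fun setT (fun s => (f s : V) 0 i).
Proof. by move=> mf; apply: (measurableT_comp (measurable_coord i) mf). Qed.

Lemma measurable_addv f g : measurable_fun setT f -> measurable_fun setT g ->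
  measurable_fun setT (fun s => (f s : V) + (g s : V) : T).
Proof.
move=> mf mg; apply: measurable_fun_Rd => i; under eq_fun do rewrite mxE.
by apply: measurable_funD; exact: measurable_coord_comp.
Qed.

Lemma measurable_scalev (k : S -> R) f : measurable_fun setT k -> measurable_fun setT f ->
  measurable_fun setT (fun s => k s *: (f s : V) : T).
Proof.
move=> mk mf; apply: measurable_fun_Rd => i; under eq_fun do rewrite mxE.
by apply: measurable_funM => //; exact: measurable_coord_comp.
Qed.

Lemma measurable_oppv f : measurable_fun setT f ->
  measurable_fun setT (fun s => - (f s : V) : T).
Proof.
move=> mf; apply: measurable_fun_Rd => i; under eq_fun do rewrite mxE.
by apply: measurableT_comp => //; exact: measurable_coord_comp.
Qed.

Lemma measurable_subv f g : measurable_fun setT f -> measurable_fun setT g ->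
  measurable_fun setT (fun s => (f s : V) - (g s : V) : T).
Proof. by move=> mf mg; apply: measurable_addv => //; exact: measurable_oppv. Qed.

Lemma measurable_dotv f g : measurable_fun setT f -> measurable_fun setT g ->
  measurable_fun setT (fun s => dotv (f s) (g s)).
Proof.
move=> mf mg; rewrite /dotv.
apply: (@measurable_sum _ _ _ _ _ _ (fun i s => (f s : V) 0 i * (g s : V) 0 i)) => i.
by apply: measurable_funM; exact: measurable_coord_comp.
Qed.

Lemma measurable_eucl f : measurable_fun setT f -> measurable_fun setT (fun s => eucl (f s)).
Proof.
move=> mf.
have ms : measurable_fun setT (@Num.sqrt R) by apply: continuous_measurable_fun; exact: sqrt_continuous.
rewrite /eucl; apply: (@measurableT_comp _ _ _ _ _ _ (@Num.sqrt R)) => //.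
exact: measurable_dotv.
Qed.

End MeasurableRd.

(** * Lebesgue measure, known only through its values on boxes *)

Section Lebesgue.
Context {R : realType} {d : nat} (leb : {measure set (Rd R d) -> \bar R}).
Hypothesis Hleb : is_lebesgue leb.
Local Notation T := (Rd R d).
Local Notation V := 'rV[R]_d.

Definition cube (r : R) : set T := box (const_mx (- r)) (const_mx r).

Lemma cubeP r (x : V) : cube r x <-> forall i, `|x 0 i| <= r.
Proof. by split => h i; have := h i; rewrite !mxE ler_norml. Qed.

Lemma measurable_cube r : measurable (cube r).
Proof. exact: measurable_box. Qed.

Lemma leb_cube r : 0 <= r -> leb (cube r) = ((2 * r) ^+ d)%:E.
Proof.
move=> r0; rewrite Hleb => [|i]; last by rewrite !mxE; lra.
congr _%:E; under eq_bigr do rewrite !mxE opprK.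
by rewrite prodr_const card_ord -mulr2n mulr_natl.
Qed.

Lemma cube_cover : \bigcup_n cube n%:R = [set: T].
Proof.
apply/seteqP; split => // x _.
exists (Num.truncn (eucl x)).+1 => //; apply/cubeP => i.
apply: le_trans (coord_le_eucl _ _) _; apply: ltW; exact: truncnS_gt.
Qed.

Lemma leb_sigma_finite : sigma_finite setT leb.
Proof.
exists (fun n => cube n%:R); first by rewrite cube_cover.
by move=> n; split; [exact: measurable_cube|rewrite leb_cube// ltry].
Qed.

(** Boxes are stable under intersection, generate the Borel sets, and include an exhausting sequence
    of finite measure, so values on boxes determine the measure. Invariance under translation and
    reflection is read off from this. *)
Lemma leb_unique (m : {measure set T -> \bar R}) :
  (forall a b : V, (forall i, a 0 i <= b 0 i) -> m (box a b) = (\prod_i (b 0 i - a 0 i))%:E) ->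
  forall A, measurable A -> m A = leb A.
Proof.
move=> hm; apply: (measure_unique boxes (fun n => cube n%:R)).
- exact: boxes_measurable.
- move=> _ _ [a [b ->]] [a' [b' ->]].
  exists (\row_i Num.max (a 0 i) (a' 0 i)), (\row_i Num.min (b 0 i) (b' 0 i)).
  apply/seteqP; split => x /=.
    move=> [h h'] i; rewrite !mxE ge_max le_min.
    by have /andP[-> ->] := h i; have /andP[-> ->] := h' i.
  move=> h; split => i; have := h i; rewrite !mxE ge_max le_min;
    by move=> /andP[/andP[h1 h2] /andP[h3 h4]]; rewrite ?h1 ?h2 ?h3 ?h4.
- by move=> n; do 2 eexists.
- exact: cube_cover.
- move=> _ [a [b ->]]; have [h|h] := pselect (forall i, a 0 i <= b 0 i).
    by rewrite hm// Hleb.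
  suff -> : box a b = set0 by rewrite !measure0.
  apply/seteqP; split => x // hx; apply: h => i.
  by have /andP[h1 h2] := hx i; exact: le_trans h2.
- by move=> n; rewrite hm ?ltry// => i; rewrite !mxE; have := ler0n R n; lra.
Qed.

Lemma measurable_shift (t : V) : measurable_fun [set: T] (fun x : T => (x : V) + t : T).
Proof. by apply: measurable_addv => //; exact: measurable_id. Qed.

Lemma leb_shift (t : V) (A : set T) : measurable A ->
  leb ((fun x : T => (x : V) + t : T) @^-1` A) = leb A.
Proof.
move=> mA.
apply: (@leb_unique (pushforward leb (fun x : T => (x : V) + t : T))) => // [|mf a b ab].
  exact: measurable_shift.
transitivity (leb (box (a - t) (b - t))).
  by congr (leb _); apply/seteqP; split => x /= h i; have := h i; rewrite !mxE; lra.
rewrite Hleb => [|i]; last by rewrite !mxE lerB.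
by congr _%:E; apply: eq_bigr => i _; rewrite !mxE; ring.
Qed.

Lemma leb_opp (A : set T) : measurable A ->
  leb ((fun x : T => - (x : V) : T) @^-1` A) = leb A.
Proof.
move=> mA.
apply: (@leb_unique (pushforward leb (fun x : T => - (x : V) : T))) => // [|mf a b ab].
  by apply: measurable_oppv; exact: measurable_id.
transitivity (leb (box (- b) (- a))).
  by congr (leb _); apply/seteqP; split => x /= h i; have := h i; rewrite !mxE; lra.
rewrite Hleb => [|i]; last by rewrite !mxE lerN2.
by congr _%:E; apply: eq_bigr => i _; rewrite !mxE; ring.
Qed.

Lemma ge0_integral_shift (t : V) (f : T -> \bar R) :
  measurable_fun setT f -> (forall x, (0 <= f x)%E) ->
  (\int[leb]_x f ((x : V) + t)%R = \int[leb]_x f x)%E.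
Proof.
move=> mf f0.
have := ge0_integral_pushforward (measurable_shift t) leb measurableT mf (fun x _ => f0 x).
rewrite preimage_setT => <-; apply: eq_measure_integral => [|mt A mA _]; first exact: measurable_shift.
exact: leb_shift.
Qed.

Lemma ge0_integral_opp (f : T -> \bar R) :
  measurable_fun setT f -> (forall x, (0 <= f x)%E) ->
  (\int[leb]_x f (- (x : V))%R = \int[leb]_x f x)%E.
Proof.
move=> mf f0.
have mo : measurable_fun [set: T] (fun x : T => - (x : V) : T).
  by apply: measurable_oppv; exact: measurable_id.
have := ge0_integral_pushforward mo leb measurableT mf (fun x _ => f0 x).
rewrite preimage_setT => <-; by apply: eq_measure_integral => A mA _; exact: leb_opp.
Qed.

End Lebesgue.

(** * Densities, expectations and laws *)

Section DensityMeasure.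
Context {dT : measure_display} {T : measurableType dT} {R : realType}.
Variables (m nu : {measure set T -> \bar R}) (k : T -> R).
Hypotheses (mk : measurable_fun setT k) (k0 : forall x, 0 <= k x).
Hypothesis nuE : forall A, measurable A -> nu A = (\int[m]_(x in A) (k x)%:E)%E.
Import HBNNSimple.

Lemma integral_density_nnsfun (f : {nnsfun T >-> R}) :
  (\int[nu]_x (f x)%:E = \int[m]_x (f x * k x)%:E)%E.
Proof.
under [LHS]eq_integral do rewrite fimfunE -fsumEFin//.
under [RHS]eq_integral do rewrite fimfunE mulrC mulr_fsumr -?fsumEFin//.
rewrite [LHS]ge0_integral_fsum//; last 2 first.
- by move=> r; exact/measurable_EFinP/measurableT_comp.
- by move=> n x _; rewrite EFinM nnfun_muleindic_ge0.
rewrite [RHS]ge0_integral_fsum//; last 2 first.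
- by move=> r; apply/measurable_EFinP; apply: measurable_funM => //; exact: measurableT_comp.
- by move=> n x _; rewrite lee_fin mulr_ge0// -lee_fin EFinM nnfun_muleindic_ge0.
apply: eq_fsbigr => r _; rewrite integralZl_indic_nnsfun// integral_indic//= setIT nuE//.
have [r0|r0] := leP 0 r; last first.
  rewrite preimage_nnfun0// integral_set0 mule0; apply/esym/integral0_eq => x _.
  by rewrite indicE in_set0 !mulr0.
rewrite -ge0_integralZl//; last 2 first.
- by apply/measurable_EFinP; exact: measurable_funTS.
- by move=> x _; rewrite lee_fin.
rewrite integral_mkcond; apply: eq_integral => x _.
rewrite patchE indicE; case: ifPn => _; rewrite ?mulr1 ?mulr0//.
by rewrite -EFinM mulrC.
Qed.

Lemma ge0_integral_density (f : T -> \bar R) :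
  measurable_fun setT f -> (forall x, 0 <= f x)%E ->
  (\int[nu]_x f x = \int[m]_x (f x * (k x)%:E))%E.
Proof.
move=> mf f0.
pose f_ := nnsfun_approx measurableT mf.
have E n : (\int[nu]_x (f_ n x)%:E = \int[m]_x ((f_ n x)%:E * (k x)%:E))%E.
  by rewrite integral_density_nnsfun.
transitivity (lim (\int[nu]_x (f_ n x)%:E @[n --> \oo])%E).
  rewrite -monotone_convergence//=.
  - apply: eq_integral => ? /[!inE] xD; apply/esym/cvg_lim => //=.
    exact: cvg_nnsfun_approx.
  - by move=> n; exact/measurable_EFinP/measurable_funTS.
  - by move=> n ? _; rewrite lee_fin.
  - by move=> ? _ ? ? mn; rewrite lee_fin; exact/lefP/nd_nnsfun_approx.
under eq_fun do rewrite E.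
rewrite -monotone_convergence//=.
- apply: eq_integral => x /[!inE] xD; apply/cvg_lim => //=.
  by apply: cvgeZr => //; exact: cvg_nnsfun_approx.
- by move=> n; apply: emeasurable_funM; exact/measurable_EFinP.
- by move=> n ? _; rewrite -EFinM lee_fin mulr_ge0.
- move=> x _ ? ? mn; rewrite -!EFinM lee_fin ler_wpM2r//; exact/lefP/nd_nnsfun_approx.
Qed.

Lemma integrable_density (f : T -> R) : measurable_fun setT f ->
  nu.-integrable setT (EFin \o f) <-> m.-integrable setT (EFin \o (fun x => f x * k x)).
Proof.
move=> mf.
have e : (\int[nu]_x `|(EFin \o f) x| = \int[m]_x `|(f x * k x)%:E|)%E.
  rewrite ge0_integral_density//.
    by apply: eq_integral => x _ /=; rewrite -EFinM normrM (ger0_norm (k0 x)).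
  by apply: measurableT_comp => //; exact/measurable_EFinP.
split => /integrableP[_ h]; apply/integrableP; split.
- by apply/measurable_EFinP; exact: measurable_funM.
- by rewrite -e.
- exact/measurable_EFinP.
- by rewrite e.
Qed.

Lemma Rintegral_density (f : T -> R) : measurable_fun setT f ->
  \int[nu]_x f x = \int[m]_x (f x * k x).
Proof.
move=> mf; rewrite /Rintegral; congr fine; rewrite integralE [RHS]integralE.
have mfE : measurable_fun setT (EFin \o f) by exact/measurable_EFinP.
rewrite ge0_integral_density//; last exact: measurable_funepos.
rewrite ge0_integral_density//; last exact: measurable_funeneg.
congr (_ - _)%E; apply: eq_integral => x _.
- by rewrite !funeposE -!EFin_max -EFinM maxr_pMl// mul0r.
- by rewrite !funenegE -!EFinN -!EFin_max -EFinM maxr_pMl// mul0r mulNr.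
Qed.

End DensityMeasure.

Section MkDensity.
Context {dT : measure_display} {T : measurableType dT} {R : realType}.
Variables (m : {measure set T -> \bar R}) (k : T -> R).

Lemma density_probability : measurable_fun setT k -> (forall x, 0 <= k x) ->
  (\int[m]_x (k x)%:E = 1)%E ->
  exists P : probability T R, forall A, measurable A -> P A = (\int[m]_(x in A) (k x)%:E)%E.
Proof.
move=> mk k0 k1.
have mkE : measurable_fun setT (EFin \o k) by exact/measurable_EFinP.
pose P A := (\int[m]_(x in A) (k x)%:E)%E.
have P0 : P set0 = 0%E by rewrite /P integral_set0.
have Pge0 A : (0 <= P A)%E by apply: integral_ge0 => x _; rewrite lee_fin.
have Psa : semi_sigma_additive P.
  by apply: semi_sigma_additive_nng_induced => // x; rewrite lee_fin.
pose Pm : {measure set T -> \bar R} := HB.pack P (isMeasure.Build _ _ _ P P0 Pge0 Psa).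
pose PP : probability T R := HB.pack P (Measure.class Pm) (Measure_isProbability.Build _ _ _ Pm k1).
by exists PP.
Qed.

End MkDensity.

Section Expectation.
Context {dT : measure_display} {T : measurableType dT} {R : realType}.
Variable m : {measure set T -> \bar R}.
Implicit Types f g : T -> R.

Definition intg f := m.-integrable setT (EFin \o f).

Lemma intg_measurable f : intg f -> measurable_fun setT f.
Proof. by move=> /measurable_int /measurable_EFinP. Qed.

Lemma intgD f g : intg f -> intg g -> intg (fun x => f x + g x).
Proof. by move=> hf hg; exact: (integrableD measurableT hf hg). Qed.

Lemma intgB f g : intg f -> intg g -> intg (fun x => f x - g x).
Proof. by move=> hf hg; exact: (integrableB measurableT hf hg). Qed.

Lemma intgZ a f : intg f -> intg (fun x => a * f x).
Proof. by move=> hf; exact: (integrableZl measurableT a hf). Qed.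

Lemma intgZr a f : intg f -> intg (fun x => f x * a).
Proof. by move=> hf; under eq_fun do rewrite mulrC; exact: intgZ. Qed.

Lemma intgN f : intg f -> intg (fun x => - f x).
Proof. by move=> hf; under eq_fun do rewrite -mulN1r; exact: intgZ. Qed.

Lemma intg_norm f : intg f -> intg (fun x => `|f x|).
Proof. by move=> hf; exact: (integrable_norm hf). Qed.

Lemma intg_sum (I : Type) (s : seq I) (F : I -> T -> R) : (forall i, intg (F i)) ->
  intg (fun x => \sum_(i <- s) F i x).
Proof.
move=> h; rewrite /intg (_ : EFin \o _ = fun x => (\sum_(i <- s) (F i x)%:E)%E).
  by apply: integrable_sum => // i _; exact: h.
by apply/funext => x /=; rewrite sumEFin.
Qed.

Lemma intg_le f g : measurable_fun setT f -> (forall x, `|f x| <= g x) -> intg g -> intg f.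
Proof.
move=> mf fg ig; apply: (le_integrable measurableT _ _ ig); first exact/measurable_EFinP.
by move=> x _ /=; rewrite lee_fin; apply: le_trans (fg x) (ler_norm _).
Qed.

Lemma intg_fin f : measurable_fun setT f -> (forall x, 0 <= f x) ->
  (\int[m]_x (f x)%:E < +oo)%E -> intg f.
Proof.
move=> mf f0 h; apply/integrableP; split; first exact/measurable_EFinP.
by under eq_integral do rewrite /= ger0_norm//.
Qed.

Lemma EE_fineK f : intg f -> (\int[m]_x (f x)%:E = (\int[m]_x f x)%:E)%E.
Proof. by move=> h; rewrite /Rintegral fineK//; exact: integrable_fin_num. Qed.

Lemma EED f g : intg f -> intg g -> \int[m]_x (f x + g x) = \int[m]_x f x + \int[m]_x g x.
Proof. by move=> hf hg; exact: RintegralD. Qed.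

Lemma EEB f g : intg f -> intg g -> \int[m]_x (f x - g x) = \int[m]_x f x - \int[m]_x g x.
Proof. by move=> hf hg; exact: RintegralB. Qed.

Lemma EEZ a f : intg f -> \int[m]_x (a * f x) = a * \int[m]_x f x.
Proof. by move=> hf; exact: RintegralZl. Qed.

Lemma EEZr a f : intg f -> \int[m]_x (f x * a) = \int[m]_x f x * a.
Proof. by move=> hf; exact: RintegralZr. Qed.

Lemma EEN f : intg f -> \int[m]_x (- f x) = - \int[m]_x f x.
Proof. by move=> hf; rewrite -mulN1r -EEZ//; apply: eq_Rintegral => x _; rewrite mulN1r. Qed.

Lemma EE_sum (I : Type) (s : seq I) (F : I -> T -> R) : (forall i, intg (F i)) ->
  \int[m]_x (\sum_(i <- s) F i x) = \sum_(i <- s) \int[m]_x F i x.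
Proof.
move=> h; elim: s => [|i s IH].
  rewrite big_nil -[RHS](Rintegral_set0 m (fun=> 0)) /Rintegral integral_set0.
  by under eq_integral do rewrite big_nil; rewrite integral0.
rewrite big_cons -IH -EED//; last exact: intg_sum.
by apply: eq_Rintegral => x _; rewrite big_cons.
Qed.

Lemma EE_le f g : intg f -> intg g -> (forall x, f x <= g x) ->
  \int[m]_x f x <= \int[m]_x g x.
Proof. by move=> hf hg fg; apply: le_Rintegral. Qed.

Lemma EE_ge0 f : (forall x, 0 <= f x) -> 0 <= \int[m]_x f x.
Proof. by move=> h; apply: Rintegral_ge0. Qed.

Lemma EE_abs f : intg f -> `|\int[m]_x f x| <= \int[m]_x `|f x|.
Proof. by move=> hf; exact: le_normr_Rintegral. Qed.

(** Replacing [g] by max(f, g) changes it only on a null set and makes the inequality hold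
    everywhere. *)
Lemma EE_le_ae f g : intg f -> intg g -> {ae m, forall x, f x <= g x} ->
  \int[m]_x f x <= \int[m]_x g x.
Proof.
move=> hf hg fg.
have hM : intg (fun x => Num.max (f x) (g x)).
  apply: (intg_le (g := fun x => `|f x| + `|g x|)).
  - by apply: measurable_maxr; exact: intg_measurable.
  - by move=> x; have := normr_ge0 (f x); have := normr_ge0 (g x); rewrite ler_norml; have := ler_norm (f x); have := ler_norm (g x); have := ler_norm (- f x); have := ler_norm (- g x); rewrite !normrN; have [_|_] := leP (f x) (g x); lra.
  - by apply: intgD; exact: intg_norm.
have -> : \int[m]_x g x = \int[m]_x Num.max (f x) (g x).
  rewrite /Rintegral; congr fine; apply: ae_eq_integral => //.
  - exact/measurable_EFinP/intg_measurable.
  - exact/measurable_EFinP/intg_measurable.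
  - by apply: filterS fg => x h _; rewrite max_r.
by apply: EE_le => // x; rewrite le_max lexx.
Qed.

Lemma EE_lee f (c : R) : measurable_fun setT f -> (forall x, 0 <= f x) ->
  (\int[m]_x (f x)%:E <= c%:E)%E -> intg f /\ \int[m]_x f x <= c.
Proof.
move=> mf f0 h; have i : intg f by apply: intg_fin => //; apply: le_lt_trans h (ltry _).
by split => //; rewrite -lee_fin -EE_fineK.
Qed.

End Expectation.

Section ProbExpectation.
Context {dT : measure_display} {T : measurableType dT} {R : realType}.
Variable P : probability T R.

Lemma intg_cst (a : R) : intg P (fun=> a).
Proof. exact: finite_measure_integrable_cst. Qed.

Lemma EE_cst (a : R) : \int[P]_x a = a.
Proof. by rewrite Rintegral_cst//= probability_setT mulr1. Qed.

Lemma intg_bounded (f : T -> R) (c : R) : measurable_fun setT f -> (forall x, `|f x| <= c) -> intg P f.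
Proof. by move=> mf h; apply: intg_le mf h _; exact: intg_cst. Qed.

Lemma ae_prob1 (A : set T) : measurable A -> P A = 1%E -> {ae P, forall x, A x}.
Proof.
move=> mA PA; exists (~` A); split => //; first exact: measurableC.
by rewrite probability_setC// PA subee.
Qed.

End ProbExpectation.

Section Laws.
Context {dS dT : measure_display} {S : measurableType dS} {T : measurableType dT} {R : realType}.
Variables (P : probability S R) (X : S -> T) (rho : probability T R).
Hypotheses (mX : measurable_fun setT X) (lX : forall A, measurable A -> P (X @^-1` A) = rho A).

Lemma law_ge0 (f : T -> \bar R) : measurable_fun setT f -> (forall x, 0 <= f x)%E ->
  (\int[P]_s f (X s) = \int[rho]_x f x)%E.
Proof.
move=> mf f0.
have := ge0_integral_pushforward mX P measurableT mf (fun x _ => f0 x).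
rewrite preimage_setT => <-; apply: eq_measure_integral => A mA _; exact: lX.
Qed.

Lemma law_intg (f : T -> R) : measurable_fun setT f -> intg P (f \o X) <-> intg rho f.
Proof.
move=> mf.
have e : (\int[P]_s `|(f (X s))%:E| = \int[rho]_x `|(f x)%:E|)%E.
  by rewrite -(law_ge0 (f := fun x => `|(f x)%:E|%E))//; apply: measurableT_comp => //; exact/measurable_EFinP.
split => /integrableP[_ h]; apply/integrableP; split.
- exact/measurable_EFinP.
- by rewrite -e.
- by apply/measurable_EFinP; exact: measurableT_comp.
- by rewrite /= e.
Qed.

Lemma law_EE (f : T -> R) : measurable_fun setT f -> \int[P]_s f (X s) = \int[rho]_x f x.
Proof.
move=> mf; have mfE : measurable_fun setT (EFin \o f) by exact/measurable_EFinP.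
rewrite /Rintegral; congr fine; rewrite integralE [RHS]integralE.
rewrite -(law_ge0 (measurable_funepos mfE) (fun x => funepos_ge0 _ x)).
rewrite -(law_ge0 (measurable_funeneg mfE) (fun x => funeneg_ge0 _ x)).
by congr (_ - _)%E; apply: eq_integral => x _; rewrite ?funeposE ?funenegE.
Qed.

End Laws.

(** * Null hyperplanes and integrability of decaying functions *)

Section LebesgueMore.
Context {R : realType} {d : nat} (leb : {measure set (Rd R d) -> \bar R}).
Hypothesis Hleb : is_lebesgue leb.
Local Notation T := (Rd R d).
Local Notation V := 'rV[R]_d.

Lemma measurable_hyperplane (a : V) (c : R) : measurable [set x : T | dotv x a = c].
Proof.
rewrite (_ : [set _ | _] = [set: T] `&` (fun x : T => dotv x a) @^-1` [set c]); last first.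
  by apply/seteqP; split => x //= [].
apply: measurable_dotv => //; exact: measurable_cst.
Qed.

(** Since some a_i is nonzero, the translates of the bounded piece H inside [cube n] by e_i / (j +
    1) are pairwise disjoint, have equal measure and stay in [cube n.+1]. Arbitrarily many copies of
    that measure thus fit into a finite one, which forces it to vanish. *)
Lemma leb_hyperplane (a : V) (c : R) : a != 0 -> leb [set x : T | dotv x a = c] = 0%E.
Proof.
move=> a0; have mH := measurable_hyperplane a c; set H := [set x : T | _] in mH *.
have [i ai] : exists i, a 0 i != 0.
  apply/existsP; apply: contraNT a0; rewrite negb_exists => /forallP h.
  by apply/eqP/rowP => i; rewrite mxE; apply/eqP; have := h i; rewrite negbK.
pose e : V := delta_mx 0 i.
have cube0 n : leb (H `&` cube n%:R) = 0%E.
  pose F j : set T := (fun x : T => (x : V) + (- (j.+1%:R^-1 *: e)) : T) @^-1` (H `&` cube n%:R).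
  have mF j : measurable (F j).
    by rewrite -[F j]setTI; apply: measurable_shift => //; apply: measurableI => //; exact: measurable_cube.
  have FE j : leb (F j) = leb (H `&` cube n%:R).
    by apply: leb_shift => //; apply: measurableI => //; exact: measurable_cube.
  have tF : trivIset setT F.
    move=> j k _ _ [x [[h1 _] [h2 _]]]; move: h1 h2; rewrite /H /= => h1 h2.
    move: h1; rewrite -h2 !dotvDl !dotvNl !dotvZl.
    move=> /addrI /oppr_inj; rewrite dotvC dotv_delta => /(mulIf ai) /invr_inj /eqP.
    by rewrite eqr_nat => /eqP [].
  have Fsub N : \big[setU/set0]_(j < N) F j `<=` cube n.+1%:R.
    move=> x; rewrite -bigcup_mkord => -[j _ [_ /cubeP h]]; apply/cubeP => k.
    have := h k; rewrite !mxE eqxx /=.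
    have : 0 <= (j.+1%:R^-1 : R) <= 1 by rewrite invr_ge0 ler0n invf_le1 ?ltr0n// ler1n.
    move: (j.+1%:R^-1 : R) => r hr; rewrite !ler_norml -natr1; case: (k == i) => /=; lra.
  have Nm N : (N%:R%:E * leb (H `&` cube n%:R) <= leb (cube n.+1%:R))%E.
    have := le_measure leb; move/(_ (\big[setU/set0]_(j < N) F j) (cube n.+1%:R)).
    have mU : measurable (\big[setU/set0]_(j < N) F j) by apply: bigsetU_measurable => j _; exact: mF.
    rewrite !inE => /(_ mU (measurable_cube _) (Fsub N)).
    rewrite measure_bigsetU// (eq_bigr (fun=> leb (H `&` cube n%:R))); last by move=> j _; exact: FE.
    rewrite (_ : \sum_(i0 < N) _ = N%:R%:E * leb (H `&` cube n%:R))%E //.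
    rewrite big_const_ord; clear mU; elim: N => [|N IH]; first by rewrite mul0e.
    by rewrite iterS IH -natr1 EFinD ge0_muleDl ?lee_fin ?ler0n ?ler01// mul1e addeC.
  have fin : leb (H `&` cube n%:R) \is a fin_num.
    rewrite ge0_fin_numE//; apply: (@le_lt_trans _ _ (leb (cube n%:R))); last by rewrite leb_cube// ltry.
    apply: le_measure; rewrite ?inE; [|exact: measurable_cube|exact: subIsetr].
    by apply: measurableI => //; exact: measurable_cube.
  move: Nm; rewrite leb_cube// -(fineK fin); set r := fine _ => Nm.
  have r0 : 0 <= r by rewrite fine_ge0.
  congr _%:E; apply/eqP; rewrite eq_le r0 andbT leNgt; apply/negP => rp.
  have /(_ (Num.truncn (((2 * n.+1%:R) ^+ d) / r)).+1) := Nm.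
  rewrite -EFinM lee_fin -ler_pdivlMr// leNgt => /negP; apply.
  exact: truncnS_gt.
have -> : H = \bigcup_n (H `&` cube n%:R) by rewrite -setI_bigcupr cube_cover setIT.
have mHc n : measurable (H `&` cube n%:R) by apply: measurableI => //; exact: measurable_cube.
apply: measure_negligible; first exact: bigcupT_measurable.
by apply: negligible_bigcup => n; exists (H `&` cube n%:R); split.
Qed.

Lemma measurable_decay :
  measurable_fun setT (fun x : T => ((1 + eucl x) ^- (d.+2))%:E).
Proof.
apply/measurable_EFinP.
have ci : continuous (fun t : R => (1 + `|t|) ^- d.+2).
  move=> t; apply: cvgV; first by rewrite expf_neq0// gt_eqF//; have := normr_ge0 t; lra.
  apply: (@continuous_comp _ _ _ (fun t : R => 1 + `|t|) (fun s : R => s ^+ d.+2)); last exact: exprn_continuous.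
  by apply: cvgD; [exact: cvg_cst|exact: norm_continuous].
have me := measurable_eucl (@measurable_id _ T setT).
have := measurableT_comp (continuous_measurable_fun ci) me.
by congr measurable_fun; apply/funext => x /=; rewrite ger0_norm ?eucl_ge0.
Qed.

(* Cube shells: the shell between cube N and cube N+1 contributes at most 2^d/(N+1)^2. *)
Lemma integral_decay_le :
  (\int[leb]_x ((1 + eucl x) ^- (d.+2))%:E <= (3 * 2 ^+ d)%:E)%E.
Proof.
pose f (x : T) : \bar R := ((1 + eucl x) ^- (d.+2))%:E.
have e1 (x : T) : 0 < 1 + eucl x by have := eucl_ge0 x; lra.
have mf : measurable_fun setT f by exact: measurable_decay.
have f0 x : (0 <= f x)%E by rewrite lee_fin invr_ge0 exprn_ge0// ltW.
(* With n = N + 1, the shell contribution 2^d / n^2 is absorbed by 2^d (2 / n - 2 / (n + 1)), as 1 /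
   n^2 <= 2 / (n (n + 1)) for n >= 1. The initial value 1 is needed in dimension 0, where the
   degenerate cube has measure one. *)
have step N : (\int[leb]_(x in cube N%:R) f x <= (2 ^+ d * (3 - 2 / N.+1%:R))%:E)%E.
  elim: N => [|N IH].
    apply: (@le_trans _ _ (\int[leb]_(x in cube 0) (cst 1%E) x)%E).
      apply: ge0_le_integral => //; [exact: measurable_cube|exact: measurable_funTS|].
      move=> x _; rewrite lee_fin invf_le1 ?exprn_gt0//; apply: exprn_ege1.
      by have := eucl_ge0 x; lra.
    rewrite integral_cst; last exact: measurable_cube.
    rewrite mul1e leb_cube// lee_fin mulr0 divr1 expr0n.
    have : 1 <= 2 ^+ d :> R by apply: exprn_ege1; lra.
    case: (d == 0%N) => /=; lra.
  have cS : (cube N%:R : set T) `<=` cube N.+1%:R.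
    by move=> x /cubeP h; apply/cubeP => i; apply: le_trans (h i) _; rewrite ler_nat.
  have mS : measurable ((cube N.+1%:R : set T) `\` cube N%:R) by apply: measurableD; exact: measurable_cube.
  rewrite -(setDUK cS) ge0_integral_setU//; [|exact: measurable_cube|exact: measurable_funTS|]; last first.
    by rewrite disj_set2E; apply/eqP; rewrite setDIK.
  pose c : R := N.+1%:R ^- d.+2.
  apply: (@le_trans _ _ ((2 ^+ d * (3 - 2 / N.+1%:R))%:E + (c * (2 * N.+1%:R) ^+ d)%:E)%E).
    apply: leeD => //.
    apply: (@le_trans _ _ (\int[leb]_(x in cube N.+1%:R `\` cube N%:R) (cst c%:E) x)%E).
      apply: ge0_le_integral => //; first exact: measurable_funTS.
      move=> x [_ /cubeP h]; rewrite lee_fin /c lef_pV2 ?posrE ?exprn_gt0//.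
      apply: lerXn2r; rewrite ?nnegrE ?(ltW (e1 _))// -natr1 addrC lerD2l.
      move/existsNP: h => [i /negP]; rewrite -ltNge => h; apply: ltW; apply: lt_le_trans h _.
      exact: coord_le_eucl.
    rewrite integral_cst// EFinM lee_wpmul2l ?lee_fin ?invr_ge0 ?exprn_ge0//.
    rewrite -(leb_cube Hleb)//; apply: le_measure; rewrite ?inE//; solve [exact: measurable_cube | exact: subDsetl].
  rewrite -EFinD lee_fin exprMn /c.
  have n0 : (0 : R) < N.+1%:R by rewrite ltr0n.
  rewrite -[N.+2%:R]natr1; have nn1 : (1 : R) <= N.+1%:R by rewrite ler1n.
  move: (N.+1%:R : R) n0 nn1 => n n0 nn1.
  rewrite (_ : n ^- d.+2 * (2 ^+ d * n ^+ d) = 2 ^+ d * (n^-1 * n^-1)); last first.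
    rewrite -addn2 exprD invfM expr2; have : n ^+ d != 0 by rewrite expf_neq0// gt_eqF.
    have : n != 0 by rewrite gt_eqF.
    by move: (n ^+ d) (2 ^+ d) => A B h1 h2; field; rewrite h1 h2.
  rewrite -mulrDr ler_pM2l ?exprn_gt0//.
  have n1 : n * (n + 1) != 0 by rewrite mulf_neq0// gt_eqF// addr_gt0.
  rewrite -subr_ge0.
  have -> : 3 - 2 / (n + 1) - (3 - 2 / n + n^-1 * n^-1) = (n - 1) / (n * n * (n + 1)).
    by field; move: n1; rewrite mulf_eq0 negb_or => /andP[-> ->].
  apply: divr_ge0; first by rewrite subr_ge0.
  by apply: mulr_ge0; [apply: mulr_ge0; lra|lra].
have nd : nondecreasing_seq (fun N => cube N%:R : set T).
  move=> m n mn; apply/subsetPset => x /cubeP h; apply/cubeP => i; apply: le_trans (h i) _.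
  by rewrite ler_nat.
rewrite -cube_cover.
have := @ge0_nondecreasing_set_cvg_integral _ _ _ (fun N => cube N%:R) f leb nd.
move=> /(_ (fun N => measurable_cube _) (fun N => measurable_funTS mf) (fun N x _ => f0 x)).
move=> /cvg_lim <- //; apply: lime_le; last first.
  apply: nearW => N; apply: le_trans (step N) _; rewrite lee_fin mulrC ler_pM2r ?exprn_gt0//.
  by rewrite gerBl divr_ge0.
apply: ereal_nondecreasing_is_cvgn => m n mn; apply: ge0_subset_integral => //.
- exact: measurable_cube.
- exact: measurable_cube.
- exact: measurable_funTS.
- by apply/subsetPset; exact: nd.
Qed.

End LebesgueMore.

(** For q > 0 and m = min(1, c / q), m (1 + s) <= 1 + c s / q <= exp(c s / q); raising to the power
    q gives C = m^-q. *)
Lemma expR_dominates {R : realType} (c : R) (q : nat) : 0 < c ->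
  exists C, 0 < C /\ forall s, 0 <= s -> (1 + s) ^+ q <= C * expR (c * s).
Proof.
move=> c0; case: q => [|q].
  by exists 1; split => // s s0; rewrite expr0 mul1r -[leLHS]expR0 ler_expR mulr_ge0// ltW.
pose m := Num.min 1 (c / q.+1%:R).
have m0 : 0 < m by rewrite lt_min ltr01 divr_gt0.
exists (m ^- q.+1); split => [|s s0]; first by rewrite invr_gt0 exprn_gt0.
rewrite -ler_pdivrMl ?invr_gt0 ?exprn_gt0// invrK -exprMn.
have -> : c * s = q.+1%:R * (c / q.+1%:R * s).
  by rewrite mulrA mulrCA mulfV ?mulr1// pnatr_eq0.
have m1 : 0 <= m * (1 + s) by rewrite mulr_ge0 ?addr_ge0 ?(ltW m0).
rewrite expRM_natl; apply: lerXn2r; rewrite ?nnegrE ?expR_ge0//.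
apply: le_trans (expR_ge1Dx _); rewrite mulrDr mulr1 lerD//; first by rewrite ge_min lexx.
by rewrite ler_wpM2r// ge_min lexx orbT.
Qed.

(** The constant is chosen before the measure [leb]; all later constants inherit this uniformity. *)
Lemma integral_exp_decay {R : realType} (d : nat) (c : R) (p : nat) : 0 < c ->
  exists C : R, 0 < C /\ forall leb : {measure set (Rd R d) -> \bar R}, is_lebesgue leb ->
    (\int[leb]_x ((1 + eucl x) ^+ p * expR (- (c * eucl x)))%:E <= C%:E)%E.
Proof.
move=> c0; have [C [C0 hC]] := expR_dominates (p + d.+2) c0.
exists (C * (3 * 2 ^+ d)); split => [|leb Hleb]; first by rewrite !mulr_gt0// exprn_gt0.
have me : measurable_fun setT (fun x : Rd R d => eucl x) by exact: measurable_eucl.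
have e1 (x : Rd R d) : 0 < 1 + eucl x by have := eucl_ge0 x; lra.
have mf : measurable_fun setT (fun x : Rd R d => ((1 + eucl x) ^- (d.+2))%:E) by exact: measurable_decay.
apply: (@le_trans _ _ (\int[leb]_x (C%:E * ((1 + eucl x) ^- (d.+2))%:E))%E).
  apply: ge0_le_integral => //.
  - by move=> x _; rewrite lee_fin mulr_ge0 ?expR_ge0 ?exprn_ge0 ?ltW.
  - apply/measurable_EFinP/measurable_funM.
      by apply: measurable_funX; apply: measurable_funD.
    apply: measurableT_comp => //; apply: measurableT_comp => //.
    by apply: measurable_funM.
  - by apply: measurable_funeM.
  - move=> x _; rewrite -EFinM lee_fin expRN ler_pdivrMr ?expR_gt0//.
    rewrite -mulrA [X in _ <= _ * X]mulrC mulrA ler_pdivlMr ?exprn_gt0// -exprD.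
    exact/hC/eucl_ge0.
rewrite ge0_integralZl//; last 2 first.
- by move=> x _; rewrite lee_fin invr_ge0 exprn_ge0// ltW.
- by rewrite lee_fin ltW.
by rewrite EFinM; apply: lee_wpmul2l; [rewrite lee_fin ltW|exact: integral_decay_le].
Qed.

(** * Semidiscrete transport *)

Section FiniteMax.
Context {R : realType} {n : nat}.
Implicit Types F G : 'I_n.+1 -> R.

(** The entry at [ord0] serves as the neutral element of the big maximum; index types have the form
    ['I_n.+1], so the value is always attained. *)
Definition fmax F : R := \big[Num.max/F ord0]_i F i.

Lemma fmax_ge F i : F i <= fmax F.
Proof. by apply: le_bigmax. Qed.

Lemma fmax_le F c : (forall i, F i <= c) -> fmax F <= c.
Proof. by move=> h; apply/bigmax_leP; split. Qed.

Lemma fmax_ex F : exists i, fmax F = F i.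
Proof.
rewrite /fmax; elim/big_ind : _ => [|a b [i ->] [j ->]|i _].
- by exists ord0.
- by have [_|_] := leP (F i) (F j); [exists j|exists i].
- by exists i.
Qed.

Lemma measurable_fmax {dT} {T : measurableType dT} (F : 'I_n.+1 -> T -> R) :
  (forall i, measurable_fun setT (F i)) -> measurable_fun setT (fun x => fmax (fun i => F i x)).
Proof.
move=> mF; rewrite /fmax.
have h (s : seq 'I_n.+1) : measurable_fun setT (fun x => \big[Num.max/F ord0 x]_(i <- s) F i x).
  elim: s => [|i s IH]; first by under eq_fun do rewrite big_nil; exact: mF.
  under eq_fun do rewrite big_cons.
  by apply: measurable_maxr.
exact: h.
Qed.

End FiniteMax.

Section SemiDiscrete.
Context {R : realType} {d : nat} (leb : {measure set (Rd R d) -> \bar R}).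
Hypothesis Hleb : is_lebesgue leb.
Local Notation T := (Rd R d).
Local Notation V := 'rV[R]_d.
Variables (rho : probability T R) (n : nat).
Hypothesis rho_ac : forall A : set T, measurable A -> leb A = 0%E -> rho A = 0%E.
Hypothesis rho_m1 : intg rho (fun x : T => eucl x).
Variables (pt : 'I_n.+1 -> V) (m : 'I_n.+1 -> R).
Hypotheses (pt_inj : injective pt) (m_gt0 : forall j, 0 < m j) (m_sum : \sum_j m j = 1).

(** Kantorovich potential for the cost x.y when the second marginal sits on the atoms [pt j]; [w]
    lists the values of the conjugate potential at the atoms. *)
Definition sdpot (w : 'rV[R]_n.+1) (x : V) : R := fmax (fun j => dotv x (pt j) - w 0 j).
Let A : R := \sum_j eucl (pt j).
Let E1 : R := \int[rho]_x eucl x.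
Let A0 : 0 <= A. Proof. by apply: sumr_ge0 => j _; exact: eucl_ge0. Qed.

Lemma pt_le_sum j : eucl (pt j) <= A.
Proof. by rewrite /A (bigD1 j)//= lerDl; apply: sumr_ge0 => k _; exact: eucl_ge0. Qed.

Lemma dotv_pt_le (x : V) j : `|dotv x (pt j)| <= A * eucl x.
Proof.
apply: le_trans (dotv_abs_le _ _) _; rewrite mulrC ler_wpM2r ?eucl_ge0//.
exact: pt_le_sum.
Qed.

Lemma measurable_sdpot w : measurable_fun setT (fun x : T => sdpot w x).
Proof.
apply: measurable_fmax => j; apply: measurable_funB; last exact: measurable_cst.
by apply: measurable_dotv => //; exact: measurable_cst.
Qed.

Lemma sdpot_abs_le w (x : V) : `|sdpot w x| <= A * eucl x + `|w|.
Proof.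
rewrite /sdpot; have [j ->] := fmax_ex (fun j => dotv x (pt j) - w 0 j).
apply: le_trans (ler_normB _ _) _; apply: lerD; first exact: dotv_pt_le.
by rewrite [leRHS]/Num.norm/= mx_normrE; apply: (le_bigmax _ (fun ij => `|w ij.1 ij.2|) (0, j)).
Qed.

Lemma intg_sdpot w : intg rho (fun x : T => sdpot w x).
Proof.
apply: (@intg_le _ _ _ _ _ (fun x : T => A * eucl x + `|w|)).
- exact: measurable_sdpot.
- exact: sdpot_abs_le.
- by apply: intgD; [exact: intgZ|exact: intg_cst].
Qed.

Lemma sdpot_lip w w' (x : V) : sdpot w x - sdpot w' x <= `|w - w'|.
Proof.
rewrite lerBlDr; apply: fmax_le => j.
have := fmax_ge (fun j => dotv x (pt j) - w' 0 j) j; rewrite -/(sdpot w' x).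
have : `|(w - w') 0 j| <= `|w - w'|.
  by rewrite [leRHS]/Num.norm/= mx_normrE; apply: (le_bigmax _ (fun ij => `|(w - w') ij.1 ij.2|) (0, j)).
rewrite !mxE ler_norml; move: `|w - w'| (dotv _ _) (sdpot _ _) => a b c; lra.
Qed.

(** The dual functional of semidiscrete transport towards the masses [m j]. At a minimizer the cells
    where a given affine piece wins have the prescribed masses. *)
Definition sdfun (w : 'rV[R]_n.+1) : R := \int[rho]_x sdpot w x + \sum_j m j * w 0 j.

Lemma sdfun_lip w w' : sdfun w - sdfun w' <= 2 * `|w - w'|.
Proof.
rewrite /sdfun opprD addrACA -EEB; [|exact: intg_sdpot..].
rewrite mulr2n mulrDl !mul1r; apply: lerD.
  rewrite -[leRHS](EE_cst rho); apply: EE_le => [| |x]; last exact: sdpot_lip.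
    by apply: intgB; exact: intg_sdpot.
  exact: intg_cst.
rewrite -sumrB; have -> : `|w - w'| = \sum_j m j * `|w - w'| by rewrite -mulr_suml m_sum mul1r.
apply: ler_sum => j _; rewrite -mulrBr ler_wpM2l// ?(ltW (m_gt0 j))//.
have : `|(w - w') 0 j| <= `|w - w'|.
  by rewrite [leRHS]/Num.norm/= mx_normrE; apply: (le_bigmax _ (fun ij => `|(w - w') ij.1 ij.2|) (0, j)).
by rewrite !mxE ler_norml => /andP[].
Qed.

Lemma sdfun_continuous : continuous sdfun.
Proof.
move=> w P /(nbhs_ballP (sdfun w)) [e /= e0 eP].
apply/nbhs_ballP; exists (e / 2) => /=; first by rewrite divr_gt0.
move=> w'; rewrite -ball_normE /= => h; apply: eP; rewrite -ball_normE /=.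
have h1 := sdfun_lip w w'; have h2 := sdfun_lip w' w; rewrite [`|w' - w|]distrC in h2.
by move: h h1 h2; rewrite ltr_norml; move: `|w - w'| => a; lra.
Qed.

Lemma sdfun_shift w c : sdfun (w - const_mx c) = sdfun w.
Proof.
rewrite /sdfun; have -> : \int[rho]_x sdpot (w - const_mx c) x = \int[rho]_x (sdpot w x + c).
  apply: eq_Rintegral => x _; apply/eqP; rewrite eq_le; apply/andP; split.
    apply: fmax_le => j; rewrite !mxE opprB addrA.
    have := fmax_ge (fun j => dotv x (pt j) - w 0 j) j; rewrite -/(sdpot w x); lra.
  rewrite -lerBrDr; apply: fmax_le => j.
  have := fmax_ge (fun j => dotv x (pt j) - (w - const_mx c) 0 j) j.
  rewrite -/(sdpot _ _) !mxE; lra.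
rewrite EED; [|exact: intg_sdpot|exact: intg_cst]; rewrite EE_cst.
under [X in _ + X = _]eq_bigr do rewrite !mxE mulrBr.
by rewrite sumrB -mulr_suml m_sum; ring.
Qed.

(** Adding a constant to [w] changes nothing, so the least entry may be taken to be 0. Such a [w]
    with one large entry is worse than [w = 0], which reduces the search to a compact cube. *)
Lemma sdfun_min : exists w, forall w', sdfun w <= sdfun w'.
Proof.
have E10 : 0 <= E1 by apply: EE_ge0 => x; exact: eucl_ge0.
have [jm jmP] : exists j, forall k, m j <= m k.
  have [j hj] := fmax_ex (fun j => - m j); exists j => k.
  by have := fmax_ge (fun j => - m j) k; rewrite hj lerN2.
(* An entry above [W] makes the functional at least - A E1 + (min m) W = A E1 + 1, whereas its value
   at 0 is at most A E1. *)
pose W := (2 * A * E1 + 1) / m jm.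
have W0 : 0 <= W by apply: divr_ge0; [rewrite addr_ge0 ?mulr_ge0|exact: ltW].
pose K := [set w : 'rV[R]_n.+1 | forall i, `[0, W]%classic (w ord0 i)].
have cK : compact K by apply: (@rV_compact _ _ (fun=> `[0, W]%classic)) => _; exact: segment_compact.
have K0 : K !=set0 by exists 0 => i; rewrite /= in_itv/= mxE lexx.
have [w0 _ hw0] := EVT_min_rV K0 cK (continuous_subspaceT sdfun_continuous).
have h0 w : K w -> sdfun w0 <= sdfun w by move=> Kw; apply: hw0; rewrite inE.
exists w0 => w.
have [j0 hj0] := fmax_ex (fun j => - w 0 j).
rewrite -(sdfun_shift w (w 0 j0)); set w' := w - _.
have w'0 j : 0 <= w' 0 j.
  have := fmax_ge (fun j => - w 0 j) j; rewrite hj0 !mxE; lra.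
have w'j0 : w' 0 j0 = 0 by rewrite !mxE subrr.
have [hK|hK] := pselect (forall j, w' 0 j <= W).
  by apply: h0 => j; rewrite /= in_itv/= w'0 hK.
apply: le_trans (h0 0 _) _; first by move=> j; rewrite /= in_itv/= mxE lexx.
have [j1 hj1] : exists j, W < w' 0 j.
  by move/existsNP: hK => [j /negP]; rewrite -ltNge => h; exists j.
have s0 : sdfun 0 <= A * E1.
  rewrite /sdfun big1 ?addr0 => [|j _]; last by rewrite mxE mulr0.
  rewrite -EEZ//; apply: EE_le => [| |x]; [exact: intg_sdpot|exact: intgZ|].
  by apply: le_trans (ler_norm _) _; apply: le_trans (sdpot_abs_le _ _) _; rewrite normr0 addr0.
have s1 : - (A * E1) + m jm * W <= sdfun w'.
  rewrite /sdfun; apply: lerD.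
    rewrite -EEZ// -EEN; last exact: intgZ.
    apply: EE_le => [| |x]; [by apply: intgN; exact: intgZ|exact: intg_sdpot|].
    apply: le_trans (fmax_ge _ j0); rewrite w'j0 subr0.
    by have := dotv_pt_le x j0; rewrite ler_norml => /andP[].
  rewrite (bigD1 j1)//=; apply: (@le_trans _ _ (m j1 * w' 0 j1)).
    by apply: ler_pM => //; [exact: ltW|exact: ltW].
  by rewrite lerDl; apply: sumr_ge0 => j _; rewrite mulr_ge0// ltW.
apply: le_trans s0 (le_trans _ s1).
by rewrite /W mulrCA mulfV ?mulr1 ?gt_eqF//; lra.
Qed.

(* Raising [w j] by [h] costs [m j * h] and gains [h] wherever [j] wins by at least [h]. *)
Lemma sd_win_le w j h : (forall w', sdfun w <= sdfun w') -> 0 < h ->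
  (rho [set x : T | forall k, k != j -> dotv x (pt k) - w ord0 k <= dotv x (pt j) - w ord0 j - h]%R
    <= (m j)%:E)%E.
Proof.
move=> wmin h0; set S := [set x : T | _].
have mS : measurable S.
  rewrite (_ : S = \bigcap_(k in [set k | k != j])
     ([set: T] `&` (fun x : T => dotv x (pt j) - w ord0 j - h - (dotv x (pt k) - w ord0 k)) @^-1` `[0, +oo[%classic)).
    apply: fin_bigcap_measurable => [|k _]; first exact: finite_finset.
    have md (k0 : 'I_n.+1) : measurable_fun setT (fun x : T => dotv x (pt k0) - w ord0 k0).
      apply: measurable_funB; last exact: measurable_cst.
      by apply: measurable_dotv => //; exact: measurable_cst.
    by apply: measurable_funB => //; apply: measurable_funB.
  apply/seteqP; split => x /= hx k kj.
    by split => //; rewrite /= in_itv/= andbT subr_ge0 hx.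
  by have [_] := hx k kj; rewrite /= in_itv/= andbT subr_ge0.
pose w' := w + h *: delta_mx 0 j.
have iS : intg rho (fun x : T => \1_S x) by exact: integrable_indic.
have hS (x : T) : sdpot w' x <= sdpot w x - h * \1_S x.
  apply: fmax_le => k; rewrite !mxE eqxx /= indicE.
  have gek := fmax_ge (fun j => dotv x (pt j) - w 0 j) k; rewrite -/(sdpot w x) in gek.
  have gej := fmax_ge (fun j => dotv x (pt j) - w 0 j) j; rewrite -/(sdpot w x) in gej.
  have [xS|xS] := boolP (x \in S); last by rewrite mulr0 subr0; case: (k == j) => /=; lra.
  have [->|kj] := eqVneq k j; first by rewrite /=; lra.
  by move: xS; rewrite inE => /(_ k kj) /=; lra.
have := wmin w'; rewrite /sdfun -lerBlDl => H.
have {H} : \int[rho]_x (sdpot w x - sdpot w' x) <= m j * h.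
  rewrite EEB; [|exact: intg_sdpot..].
  move: H; have -> : \sum_j0 m j0 * w' 0 j0 = \sum_j0 m j0 * w 0 j0 + m j * h.
    rewrite (eq_bigr (fun k => m k * w 0 k + (if k == j then m j * h else 0))); last first.
      by move=> k _; rewrite !mxE eqxx /= mulrDr; case: eqP => [->|_]; rewrite ?mulr1 ?mulr0.
    by rewrite big_split /= -big_mkcond big_pred1_eq.
  by move: (\sum_(i < n.+1) _) => s; lra.
have : h * \int[rho]_x \1_S x <= \int[rho]_x (sdpot w x - sdpot w' x).
  rewrite -EEZ//; apply: EE_le => [| |x]; first exact: intgZ.
    by apply: intgB; exact: intg_sdpot.
  by have := hS x; lra.
move=> h1 h2; have := le_trans h1 h2; rewrite mulrC ler_pM2r// -lee_fin; apply: le_trans.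
by rewrite -EE_fineK// integral_indic// setIT.
Qed.

(** The set where j wins by a margin h > 0 has mass at most m_j; letting h decrease to 0 covers the
    cell up to ties. Ties lie on hyperplanes, which are null because [rho] is absolutely continuous.
    Both families of masses sum to 1, so every inequality is an equality. *)
Theorem semidiscrete : exists (w : 'rV[R]_n.+1) (ii : T -> 'I_n.+1),
  (forall j, measurable [set x | ii x = j]) /\
  (forall j, rho [set x | ii x = j] = (m j)%:E) /\
  forall (x : T) k, dotv x (pt k) - w 0 k <= dotv x (pt (ii x)) - w 0 (ii x).
Proof.
have [w wmin] := sdfun_min; exists w.
pose F (x : T) j := dotv x (pt j) - w 0 j.
have md (k : 'I_n.+1) : measurable_fun setT (F ^~ k).
  apply: measurable_funB; last exact: measurable_cst.
  by apply: measurable_dotv => //; exact: measurable_cst.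
(* Ties are broken by the smallest index attaining the maximum, which makes the cells measurable. *)
have /choice[ii iiP] : forall x : T, exists j : 'I_n.+1, F x j = sdpot w x /\
    forall k : 'I_n.+1, (k < j)%N -> F x k != sdpot w x.
  move=> x; have [j0 hj0] := fmax_ex (F x).
  have ex : exists i, [exists j : 'I_n.+1, (j == i :> nat) && (F x j == sdpot w x)].
    by exists j0; apply/existsP; exists j0; rewrite eqxx /= -hj0.
  have [i /existsP[j /andP[/eqP ji /eqP jP]] imin] := ex_minnP ex.
  exists j; split => // k kj; apply/negP => /eqP kP.
  have := imin k; rewrite leqNgt -ji kj => /implyP; rewrite implybF => /negP; apply.
  by apply/existsP; exists k; rewrite eqxx kP /=.
have iiE j : [set x | ii x = j] = [set: T] `&` [set x : T | F x j = sdpot w x] `&`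
    \bigcap_(k in [set k : 'I_n.+1 | (k < j)%N]) ([set: T] `&` [set x : T | F x k < sdpot w x]).
  apply/seteqP; split => x /=.
    move=> <-; have [h1 h2] := iiP x; split; first by split.
    move=> k /= kj; split => //; rewrite lt_neqAle h2//=; exact: (fmax_ge (F x)).
  move=> [[_ h1] h2]; have [h3 h4] := iiP x; apply/val_inj; case: (ltngtP (ii x) j) => // lt.
    by have [_] := h2 (ii x) lt; rewrite /= h3 ltxx.
  by have := h4 _ lt; rewrite h1 eqxx.
have mcell j : measurable [set x | ii x = j].
  rewrite iiE; apply: measurableI.
    rewrite (_ : [set x | _] = (fun x => F x j - sdpot w x) @^-1` [set 0]); last first.
      by apply/seteqP; split => x /= => [->|/eqP]; rewrite ?subrr// subr_eq0 => /eqP.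
    by apply: measurable_funB => //; exact: measurable_sdpot.
  apply: fin_bigcap_measurable => [|k _]; first exact: finite_finset.
  rewrite (_ : [set x | _] = (fun x => F x k - sdpot w x) @^-1` `]-oo, 0[%classic); last first.
    by apply/seteqP; split => x /=; rewrite in_itv/= subr_lt0.
  by apply: measurable_funB => //; exact: measurable_sdpot.
exists ii; split => //; split; last first.
  by move=> x k; have [h _] := iiP x; rewrite -/(F x k) -/(F x (ii x)) h; exact: (fmax_ge (F x)).
pose S j h : set T := [set x : T | forall k, k != j -> F x k <= F x j - h].
have mS j h : measurable (S j h).
  rewrite (_ : S j h = \bigcap_(k in [set k | k != j])
     ([set: T] `&` (fun x : T => F x j - h - F x k) @^-1` `[0, +oo[%classic)).
    apply: fin_bigcap_measurable => [|k _]; first exact: finite_finset.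
    by apply: measurable_funB => //; apply: measurable_funB.
  apply/seteqP; split => x /= hx k kj.
    by split => //; rewrite /= in_itv/= andbT subr_ge0 hx.
  by have [_] := hx k kj; rewrite /= in_itv/= andbT subr_ge0.
have Sle j h : 0 < h -> (rho (S j h) <= (m j)%:E)%E by move=> h0; exact: sd_win_le.
pose tie j k : set T := [set x : T | dotv x (pt k - pt j) = w 0 k - w 0 j].
have tie0 j k : k != j -> rho (tie j k) = 0%E.
  move=> kj; apply: rho_ac; first exact: measurable_hyperplane.
  apply: leb_hyperplane => //; rewrite subr_eq0; apply: contra kj => /eqP e.
  by apply/eqP; exact: pt_inj.
pose N j : set T := \bigcup_(k in [set k | k != j]) tie j k.
have mtie j k : measurable (tie j k) by exact: measurable_hyperplane.
have mN j : measurable (N j) by apply: fin_bigcup_measurable => [|k _]; [exact: finite_finset|exact: mtie].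
have N0 j : rho (N j) = 0%E.
  apply: measure_negligible => //.
  rewrite /N (_ : \bigcup_(k in _) _ = \big[setU/set0]_(k < n.+1 | k != j) tie j k); last first.
    by rewrite -bigcup_seq_cond; apply/seteqP; split => x [k /= kj xk]; exists k => //=; rewrite ?mem_index_enum//; case/andP: kj.
  elim/big_ind : _ => [|B C|k kj]; [exact: negligible_set0|exact: negligibleU|].
  by exists (tie j k); split => //; exact: tie0.
have cellsub j : [set x | ii x = j] `<=` (\bigcup_i S j i.+1%:R^-1) `|` N j.
  move=> x /= xj; have [h1 h2] := iiP x; rewrite xj in h1.
  have [[k kj xk]|nt] := pselect (exists2 k, k != j & tie j k x); first by right; exists k.
  left; have lt k : k != j -> F x k < F x j.
    move=> kj; rewrite lt_neqAle h1; apply/andP; split; last exact: (fmax_ge (F x)).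
    apply/negP => /eqP e; apply: nt; exists k => //=.
    by move: e; rewrite /tie /= -h1 /F dotvBr; lra.
  (* [g] is the least margin of j over the other indices. The entry -1 at k = j is a dummy that
     keeps the maximum meaningful when there is only one atom, and makes g at most 1. *)
  have [k0 hk0] := fmax_ex (fun k => if k == j then -1 else - (F x j - F x k)).
  pose g := - fmax (fun k => if k == j then -1 else - (F x j - F x k)).
  have g0 : 0 < g.
    by rewrite /g hk0; case: ifPn => [_|k0j]; rewrite ?opprK// subr_gt0 lt.
  exists (Num.truncn g^-1) => // k kj /=.
  have hr : (Num.truncn g^-1).+1%:R^-1 <= g.
    by rewrite -[leRHS]invrK lef_pV2 ?posrE ?invr_gt0 ?ltr0n// ltW// truncnS_gt.
  have := fmax_ge (fun k => if k == j then -1 else - (F x j - F x k)) k.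
  rewrite (negbTE kj) => h; apply: le_trans (_ : F x j - g <= _); first by rewrite /g; lra.
  by rewrite lerB.
have le_m j : (rho [set x | ii x = j] <= (m j)%:E)%E.
  have nd : nondecreasing_seq (fun i => S j i.+1%:R^-1).
    move=> a b ab; apply/subsetPset => x h k kj; apply: le_trans (h k kj) _; rewrite lerB//.
    by rewrite lef_pV2 ?posrE ?ltr0n// ler_nat ltnS.
  have mUS : measurable (\bigcup_i S j i.+1%:R^-1) by exact: bigcupT_measurable.
  apply: (@le_trans _ _ (rho ((\bigcup_i S j i.+1%:R^-1) `|` N j))).
    by apply: le_measure; rewrite ?inE//; exact: measurableU.
  apply: le_trans (measureU2 _ mUS (mN j)) _; rewrite [X in (_ + X)%E]N0 adde0.
  have cv := nondecreasing_cvg_mu (mu := rho) (fun i => mS j i.+1%:R^-1) mUS nd.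
  have e := cvg_lim (@ereal_hausdorff R) cv.
  apply: (@le_trans _ _ (limn (rho \o (fun i => S j i.+1%:R^-1)))); first by rewrite e.
  apply: lime_le; first by apply/cvg_ex; eexists; exact: cv.
  by apply: nearW => i; apply: Sle; rewrite invr_gt0.
have sum1 : (\sum_j rho [set x | ii x = j] = 1)%E.
  rewrite -measure_bigsetU_ord//; last by move=> a b _ _ [x [/= <- <-]].
  rewrite -(probability_setT rho); congr (rho _).
  by apply/seteqP; split => // x _; rewrite -bigcup_seq; exists (ii x) => //=; exact: mem_index_enum.
have fin j : rho [set x | ii x = j] \is a fin_num by exact: fin_num_measure.
move=> j; apply/eqP; rewrite eq_le le_m /= leNgt; apply/negP => lt.
have : (\sum_j rho [set x | ii x = j] < \sum_j (m j)%:E)%E.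
  rewrite (bigD1 j)//= [ltRHS](bigD1 j)//= lte_leD//; last exact: lee_sum.
  by rewrite sum_fin_num; apply/allP => _ /mapP[k _ ->]; exact: fin.
by rewrite sum1 sumEFin m_sum ltxx.
Qed.

End SemiDiscrete.

(** * Gluing along finite partitions, and quantization of a law *)

Lemma measure_fibers {dT} {T : measurableType dT} {R : realType} (mu : {measure set T -> \bar R})
    n (ii : T -> 'I_n) (A : set T) : (forall j, measurable [set x | ii x = j]) -> measurable A ->
  mu A = (\sum_j mu (A `&` [set x | ii x = j]))%E.
Proof.
move=> mi mA; rewrite -measure_bigsetU_ord//.
- congr (mu _); apply/seteqP; split => x; rewrite -bigcup_seq.
    by move=> Ax; exists (ii x) => //=; exact: mem_index_enum.
  by move=> [j _ []].
- by move=> j; apply: measurableI.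
- by move=> a b _ _ [x [[_ /= <-] [_ /= <-]]].
Qed.

Lemma fin_preimage_measurable {dT} {T : measurableType dT} (I : finType) (ii : T -> I) (P : set I) :
  (forall j, measurable [set x | ii x = j]) -> measurable [set x | P (ii x)].
Proof.
move=> mi; rewrite (_ : [set x | _] = \bigcup_(j in P) [set x | ii x = j]).
  by apply: fin_bigcup_measurable => // ; exact: finite_finset.
by apply/seteqP; split => x /=; [exists (ii x)|move=> [j Pj /= ->]].
Qed.

Section Glue.
Context {d1 d2 : measure_display} {S1 : measurableType d1} {S2 : measurableType d2} {R : realType}.
Variables (g : probability S1 R) (tau : probability S2 R) (n : nat).
Variables (ii : S1 -> 'I_n) (jj : S2 -> 'I_n) (m : 'I_n -> R).
Hypotheses (mii : forall j, measurable [set x | ii x = j]) (mjj : forall j, measurable [set x | jj x = j]).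
Hypotheses (gii : forall j, g [set x | ii x = j] = (m j)%:E) (tjj : forall j, tau [set x | jj x = j] = (m j)%:E).
Hypothesis m_gt0 : forall j, 0 < m j.

Let blk j : set (S1 * S2) := [set x | ii x = j] `*` [set y | jj y = j].
Let kern (z : S1 * S2) : R := \sum_j (m j)^-1 * \1_(blk j) z.
Let mblk j : measurable (blk j). Proof. exact: measurableX. Qed.
Let kern0 z : 0 <= kern z.
Proof. by apply: sumr_ge0 => j _; rewrite mulr_ge0// invr_ge0 ltW. Qed.
Let mkern : measurable_fun setT kern.
Proof.
apply: measurable_sum => j; apply: measurable_funM; first exact: measurable_cst.
exact: measurable_indic.
Qed.
Let P := (g \x tau)%E.

Let int_kern (A : set (S1 * S2)) : measurable A ->
  (\int[P]_(z in A) (kern z)%:E = \sum_j ((m j)^-1)%:E * P (A `&` blk j))%E.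
Proof.
move=> mA; under eq_integral do rewrite /kern -sumEFin.
rewrite ge0_integral_sum//; last 2 first.
- move=> j; apply/measurable_EFinP; apply: measurable_funTS.
  by apply: measurable_funM; [exact: measurable_cst|exact: measurable_indic].
- by move=> j x _; rewrite lee_fin mulr_ge0// invr_ge0 ltW.
apply: eq_bigr => j _; under eq_integral do rewrite EFinM.
rewrite ge0_integralZl//; last 2 first.
- by apply/measurable_EFinP; exact: measurable_indic.
- by rewrite lee_fin invr_ge0 ltW.
by rewrite integral_indic// setIC.
Qed.

Let int_kernX (A : set S1) (B : set S2) : measurable A -> measurable B ->
  (\int[P]_(z in A `*` B) (kern z)%:E =
   \sum_j ((m j)^-1)%:E * (g (A `&` [set x | ii x = j]) * tau (B `&` [set y | jj y = j])))%E.
Proof.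
move=> mA mB; rewrite int_kern; last exact: measurableX.
apply: eq_bigr => j _; congr (_ * _)%E.
rewrite -product_measure1E; [|exact: measurableI..].
by congr (P _); rewrite setXI.
Qed.

(** The density [kern] with respect to the product measure makes the two coordinates independent
    given their common block label. This replaces disintegration along a common marginal: when the
    labels come from a fine partition, the two copies of that marginal differ by at most a block
    diameter. *)
Lemma glue : exists G : probability (S1 * S2)%type R,
  (forall A, measurable A -> G (A `*` setT) = g A) /\
  (forall B, measurable B -> G (setT `*` B) = tau B) /\
  G [set z | ii z.1 = jj z.2] = 1%E.
Proof.
have hA (A : set S1) : measurable A -> (\int[P]_(z in A `*` setT) (kern z)%:E = g A)%E.
  move=> mA; rewrite int_kernX// (measure_fibers g mii mA).
  apply: eq_bigr => j _; rewrite setTI tjj muleCA -EFinM mulVf ?mule1//.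
  by rewrite gt_eqF.
have hB (B : set S2) : measurable B -> (\int[P]_(z in setT `*` B) (kern z)%:E = tau B)%E.
  move=> mB; rewrite int_kernX// (measure_fibers tau mjj mB).
  apply: eq_bigr => j _; rewrite setTI gii muleA -EFinM mulVf ?mul1e//.
  by rewrite gt_eqF.
have [|G GE] := density_probability mkern kern0 (m := P).
  by rewrite -setXTT hA// probability_setT.
exists G; split; first by move=> A mA; rewrite GE ?hA//; exact: measurableX.
split; first by move=> B mB; rewrite GE ?hB//; exact: measurableX.
have e : [set z : S1 * S2 | ii z.1 = jj z.2] = \bigcup_(j in setT) blk j.
  by apply/seteqP; split => [[x y] /= h|[x y] [j _ [/= -> ->]]//]; exists (jj y).
have mD : measurable [set z : S1 * S2 | ii z.1 = jj z.2].
  by rewrite e; apply: fin_bigcup_measurable => [|j _]; [exact: finite_finset|exact: mblk].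
rewrite -[X in G X]setCK probability_setC; last exact: measurableC.
rewrite (_ : G (~` _) = 0%E) ?sube0// GE; last exact: measurableC.
rewrite int_kern; last exact: measurableC.
apply: big1 => j _; rewrite (_ : _ `&` blk j = set0); last first.
  by apply/seteqP; split => // -[x y] [/= h [/= h1 h2]]; apply: h; rewrite h1 h2.
by rewrite (_ : P set0 = 0%E) ?mule0//; exact: (measure0 (g \x tau)%E).
Qed.

End Glue.

Section Quantize.
Context {R : realType} {d : nat}.
Local Notation T := (Rd R d).
Local Notation V := 'rV[R]_d.
Variable N : nat.
Hypothesis N0 : (0 < N)%N.
Local Notation K := (2 * N * N).+1.

(** Cells have mesh 1 / N on [-N, N]. The index [ord_max] is never produced by the grid and collects
    everything outside; its value is N + 1 / N, hence the overflow error of at most 3 |t| + 1 /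
    N. *)
Let code (t : R) : 'I_K.+1 :=
  if `|t| <= N%:R then inord (Num.truncn ((t + N%:R) * N%:R)) else ord_max.
Let value (c : 'I_K.+1) : R := c%:R / N%:R - N%:R.

Let Nr : (0 : R) < N%:R. Proof. by rewrite ltr0n. Qed.

Let code_in (t : R) : `|t| <= N%:R -> (code t = Num.truncn ((t + N%:R) * N%:R) :> nat) /\ (code t < K)%N.
Proof.
move=> h; rewrite /code h; have : (Num.truncn ((t + N%:R) * N%:R) < K)%N.
  rewrite ltnS truncn_le_nat -natr1 !natrM; apply: (@le_lt_trans _ _ (2 * N%:R * N%:R)); last by rewrite ltrDl.
  by rewrite ler_wpM2r ?(ltW Nr)//; move: h; rewrite ler_norml; lra.
by move=> lt; rewrite inordK// ltnW.
Qed.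

Let code_err (t : R) : `|t - value (code t)| <= N%:R^-1 + (if N%:R < `|t| then 3 * `|t| else 0).
Proof.
have [h|h] := leP `|t| N%:R; last first.
  rewrite /code ifF; last by apply/negbTE; rewrite -ltNge.
  rewrite /value /=.
  rewrite -natr1 !natrM mulrDl -[2 * _ * _ / _]mulrA mulfV ?gt_eqF// mulr1 mul1r.
  have n1 : 0 <= N%:R^-1 :> R by rewrite invr_ge0 ltW.
  have t0 := normr_ge0 t; move: h; have := ler_norm t; have := ler_norm (- t); rewrite normrN ler_norml.
  move: Nr; move: (N%:R^-1) n1; move: (N%:R : R) => b a; lra.
have [e _] := code_in h; rewrite /value e addr0.
have p0 : 0 <= (t + N%:R) * N%:R.
  by apply: mulr_ge0; [move: h; rewrite ler_norml; lra|exact: ltW].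
have h1 : (Num.truncn ((t + N%:R) * N%:R))%:R <= (t + N%:R) * N%:R by rewrite truncn_le.
have h2 := truncnS_gt ((t + N%:R) * N%:R).
set q := Num.truncn _ in h1 h2 *.
have -> : t - (q%:R / N%:R - N%:R) = ((t + N%:R) * N%:R - q%:R) / N%:R.
  by field; rewrite gt_eqF.
rewrite ger0_norm; last by apply: divr_ge0; [rewrite subr_ge0|exact: ltW].
rewrite -[leRHS]mul1r ler_wpM2r ?invr_ge0 ?(ltW Nr)//.
by rewrite -natr1 in h2; lra.
Qed.

Let mcode c : measurable [set t : R | code t = c].
Proof.
have mN : measurable [set t : R | `|t| <= N%:R].
  rewrite (_ : [set t | _] = `[- N%:R, N%:R]%classic); first exact: measurable_itv.
  by apply/seteqP; split => t /=; rewrite in_itv/= ler_norml.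
have [->|cm] := eqVneq c ord_max.
  rewrite (_ : [set t | _] = ~` [set t : R | `|t| <= N%:R]); first exact: measurableC.
  apply/seteqP; split => t /=; last by rewrite /code => /negP/negbTE ->.
  move=> h hN; have [_] := code_in hN; rewrite h /=; by rewrite ltnn.
rewrite (_ : [set t | _] = [set t : R | `|t| <= N%:R] `&`
   (([set: R] `&` (fun t => (t + N%:R) * N%:R) @^-1` `[c%:R, c.+1%:R[%classic))).
  apply: measurableI => //.
  have : measurable_fun [set: R] (fun t : R => (t + N%:R) * N%:R).
    by apply: measurable_funM => //; apply: measurable_funD.
  by apply.
apply/seteqP; split => t /=.
  move=> tc; have tN : `|t| <= N%:R.
    by apply: contraT => h; move: tc; rewrite /code (negbTE h) => /esym/eqP; rewrite (negbTE cm).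
  split => //; split => //; have [e _] := code_in tN; rewrite in_itv/= -tc e.
  by rewrite truncn_le ?truncnS_gt// mulr_ge0 ?(ltW Nr)//; move: tN; rewrite ler_norml; lra.
move=> [tN [_]]; rewrite in_itv/= => h; apply/val_inj; rewrite [LHS](code_in tN).1.
apply/eqP; rewrite truncn_eq//; rewrite mulr_ge0 ?(ltW Nr)//; move: tN; rewrite ler_norml; lra.
Qed.

(** Every coordinate is rounded on the grid. The error is uniform inside the ball of radius N and
    linear outside, so it can be made small in L^2 by a third moment even when the law is not
    compactly supported. *)
Lemma quantize (nu : probability T R) : exists n (pt : 'I_n.+1 -> V) (jj : T -> 'I_n.+1),
  injective pt /\ (forall j, measurable [set y | jj y = j]) /\
  (forall j, (0 < nu [set y | jj y = j])%E) /\
  {ae nu, forall y : T, eucl ((y : V) - pt (jj y)) <=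
     d%:R * (N%:R^-1 + (if N%:R < eucl y then 3 * eucl y else 0))}.
Proof.
pose I : finType := {ffun 'I_d -> 'I_K.+1}.
pose jj0 (y : T) : I := [ffun i => code ((y : V) 0 i)].
pose pt0 (c : I) : V := \row_i value (c i).
have mjj0 c : measurable [set y | jj0 y = c].
  rewrite (_ : [set y | _] = \bigcap_(i in [set: 'I_d])
    ([set: T] `&` (fun y : T => (y : V) 0 i) @^-1` [set t | code t = c i])).
    apply: fin_bigcap_measurable => [|i _]; first exact: finite_finset.
    exact: (measurable_coord i measurableT (mcode (c i))).
  apply/seteqP; split => y /=; first by move=> <- i _; split => //=; rewrite ffunE.
  by move=> h; apply/ffunP => i; rewrite ffunE; have [] := h i Logic.I.
pose s := [seq c <- enum I | (0%E < nu [set y | jj0 y = c])%E].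
have ae_s : {ae nu, forall y, jj0 y \in s}.
  suff neg : nu.-negligible (\big[setU/set0]_(c | c \notin s) [set y | jj0 y = c]).
    apply: negligibleS neg; move=> y /= /negP ys; rewrite -bigcup_seq_cond; exists (jj0 y) => //=; rewrite mem_index_enum /=; exact: ys.
  apply: (big_ind (fun B => nu.-negligible B)) => [|B C|c cs]; [exact: negligible_set0|exact: negligibleU|].
  exists [set y | jj0 y = c]; split => //; apply/eqP; rewrite eq_le measure_ge0 andbT leNgt.
  by apply: contra cs => h; rewrite mem_filter h mem_enum.
have [c0 c0s] : exists c, c \in s.
  case: s ae_s => [|c s' _]; last by exists c; rewrite mem_head.
  move=> [B [mB B0 sub]]; have : nu [set: T] = 0%E.
    by apply/eqP; rewrite -measure_le0 -B0; apply: le_measure; rewrite ?inE// => y _; apply: sub.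
  by rewrite probability_setT => /eqP; rewrite eqe oner_eq0.
have szs : (size s).-1.+1 = size s by case: (s) c0s.
have lts (j : 'I_(size s).-1.+1) : (j < size s)%N by rewrite -[X in (_ < X)%N]szs.
have us : uniq s by rewrite filter_uniq// enum_uniq.
pose n := (size s).-1.
pose jj y : 'I_n.+1 := inord (index (jj0 y) s).
pose pt (j : 'I_n.+1) := pt0 (nth c0 s j).
have mjj j : measurable [set y | jj y = j].
  exact: (fin_preimage_measurable [set c | inord (index c s) = j] mjj0).
have jjs y : jj0 y \in s -> nth c0 s (jj y) = jj0 y.
  by move=> ys; rewrite /jj inordK ?nth_index// szs index_mem.
exists n, pt, jj; split.
  move=> j k /rowP h; apply/val_inj; have jl := lts j; have kl := lts k.
  apply/eqP; rewrite -(nth_uniq c0 jl kl us); apply/eqP/ffunP => i.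
  have := h i; rewrite !mxE /value => /addIr /mulIf e; apply/val_inj/eqP; rewrite -(eqr_nat R).
  by apply/eqP/e; rewrite invr_eq0 gt_eqF.
split => //; split.
  move=> j; have jl := lts j.
  have : nth c0 s j \in s by exact: mem_nth.
  rewrite mem_filter => /andP[h _]; apply: lt_le_trans h _; apply: le_measure; rewrite ?inE//.
  by move=> y /= e; rewrite /jj e index_uniq// inord_val.
apply: filterS ae_s => y ys; apply: eucl_le_max => i.
rewrite !mxE jjs// ffunE; apply: le_trans (code_err _) _; rewrite lerD2l.
have := coord_le_eucl y i; have := normr_ge0 ((y : V) 0 i).
by case: ltP => h1; case: ltP => h2; lra.
Qed.

End Quantize.

(** * Maximization of the dual functional *)

(** Tychonoff: the functions stay in a product of compact intervals, and a neighbourhood of a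
    cluster point constrains finitely many values. A cluster point is enough because every
    admissibility condition involves finitely many points. *)
Lemma pointwise_cluster {R : realType} (X : eqType) (F : nat -> X -> R) (B : X -> R) :
  (forall n x, `|F n x| <= B x) ->
  exists f : X -> R, forall N (s : seq X) (e : R), 0 < e ->
    exists n, (N <= n)%N /\ forall x, x \in s -> `|F n x - f x| < e.
Proof.
move=> FB.
have cA : @compact (prod_topology (fun _ : X => R)) [set f | forall x, `[- B x, B x]%classic (f x)].
  apply: (@tychonoff X (fun _ => R) (fun x => `[- B x, B x]%classic)) => x; exact: segment_compact.
have [|f [_ clf]] := cA ((F : nat -> prod_topology (fun _ : X => R)) @ \oo) _.
  by exists 0 => // n _ x; rewrite /= in_itv/= -ler_norml.
exists f => N s e e0.
have nb : nbhs (f : prod_topology (fun _ : X => R)) [set g | forall x, x \in s -> `|g x - f x| < e].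
  elim: s => [|x s IH]; first by apply: (@filterS _ (nbhs (f : prod_topology (fun _ : X => R))) _ setT); [move=> g _ x; rewrite in_nil|exact: filterT].
  have hx : nbhs (f : prod_topology (fun _ : X => R)) [set g | `|g x - f x| < e].
    apply: (@proj_continuous X (fun _ : X => R) x f [set z | `|z - f x| < e]).
    apply/nbhs_ballP; exists e => //= z; rewrite -ball_normE /= distrC.
    exact.
  pose NF := @nbhs_filter (prod_topology (fun _ : X => R)) f.
  have h2 := @filterI _ _ NF _ _ hx IH.
  apply: (@filterS _ _ NF _ _ _ h2) => g [g1 g2] z.
  by rewrite inE => /orP[/eqP->|]; [exact: g1|exact: g2].
have nF : (((F : nat -> prod_topology (fun _ : X => R)) @ \oo)
    [set g | exists n, (N <= n)%N /\ g = F n]).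
  by exists N => // n /= Nn; exists n.
by have [g [[n [Nn ->]] h]] := clf _ _ nF nb; exists n.
Qed.

Section DensePoints.
Context {R : realType} {d : nat}.
Local Notation T := (Rd R d).
Local Notation V := 'rV[R]_d.

(** An enumeration of the rational points; codes that decode to nothing are sent to 0. *)
Definition dpt (n : nat) : V :=
  \row_i ratr (odflt [ffun=> 0] (unpickle n : option {ffun 'I_d -> rat}) i).

Lemma dpt_dense (x : V) (e : R) : 0 < e -> exists n, eucl (x - dpt n) < e.
Proof.
move=> e0; pose r := e / (d.+1)%:R.
have r0 : 0 < r by rewrite divr_gt0// ltr0n.
have h i : exists q : rat, `|x 0 i - ratr q| <= r.
  have /rat_in_itvoo[q] : x 0 i - r < x 0 i + r by lra.
  rewrite in_itv/= => /andP[h1 h2]; exists q; rewrite ler_norml; lra.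
have [q hq] := choice h; exists (pickle [ffun i => q i]).
apply: (@le_lt_trans _ _ (d%:R * r)).
  by apply: eucl_le_max => i; rewrite !mxE pickleK /= ffunE.
rewrite /r mulrA ltr_pdivrMr ?ltr0n// mulrC ltr_pM2l// ltr_nat//.
Qed.

Lemma measurable_sublevel {dS} {S : measurableType dS} (f : S -> R) :
  (forall c, measurable [set x | f x <= c]) -> measurable_fun setT f.
Proof.
move=> h; apply: (measurability _ (RGenOInfty.measurableE R)).
move=> _ [_ [c ->] <-]; rewrite setTI (_ : _ @^-1` _ = ~` [set x | f x <= c]).
  exact: measurableC.
by apply/seteqP; split => x /=; rewrite in_itv/= andbT; rewrite ltNge => /negP.
Qed.

Definition lipschitz (L : R) (f : V -> R) := forall x x', f x - f x' <= L * eucl (x - x').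

Lemma lipschitz_abs L f x x' : lipschitz L f -> `|f x - f x'| <= L * eucl (x - x').
Proof.
move=> h; rewrite ler_norml h andbT; have := h x' x; rewrite eucl_distC; lra.
Qed.

(** By the Lipschitz bound, f x <= c holds exactly when f q - L |x - q| <= c for all q in the dense
    sequence, which writes the sublevel set as a countable intersection of measurable sets. *)
Lemma lipschitz_measurable L f : 0 <= L -> lipschitz L f -> measurable_fun [set: T] f.
Proof.
move=> L0 Lf; apply: measurable_sublevel => c.
rewrite (_ : [set x : T | _] = \bigcap_n [set x : T | f (dpt n) - L * eucl (x - dpt n : V) <= c]).
  apply: bigcapT_measurable => n.
  rewrite (_ : [set x : T | _] = [set: T] `&`
    (fun x : T => f (dpt n) - L * eucl ((x : V) - dpt n)) @^-1` `]-oo, c]%classic); last first.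
    by apply/seteqP; split => x /=; [move=> h; split => //; rewrite in_itv|move=> [_]; rewrite in_itv].
  have : measurable_fun setT (fun x : T => f (dpt n) - L * eucl ((x : V) - dpt n)).
    apply: measurable_funB; first exact: measurable_cst.
    apply: measurable_funM; first exact: measurable_cst.
    by apply: measurable_eucl; apply: measurable_subv => //; exact: measurable_cst.
  by apply => //; exact: measurable_itv.
apply/seteqP; split => x /= h.
  by move=> n _ /=; apply: le_trans h; have := Lf (dpt n) x; rewrite eucl_distC; lra.
rewrite leNgt; apply/negP => cx.
have e0 : 0 < (f x - c) / (2 * L + 1) by rewrite divr_gt0 ?subr_gt0//; lra.
have [n hn] := dpt_dense x e0; have /= := h n Logic.I.
have := Lf x (dpt n); rewrite ltr_pdivlMr in hn; last by lra.
have := eucl_ge0 (x - dpt n); move: hn; move: (eucl _) => a; nra.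
Qed.

Definition convexf (f : V -> R) :=
  forall x x' t, 0 <= t <= 1 -> f (t *: x + (1 - t) *: x') <= t * f x + (1 - t) * f x'.

Lemma lipschitz_eucl : lipschitz 1 (@eucl R d).
Proof. by move=> x x'; rewrite mul1r; exact: eucl_sub_le. Qed.

Lemma convexf_eucl : convexf (@eucl R d).
Proof.
move=> x x' t /andP[t0 t1]; apply: le_trans (eucl_triangle _ _) _.
by rewrite !euclZ !ger0_norm// subr_ge0.
Qed.

Lemma convexf_fmax n (F : 'I_n.+1 -> V -> R) : (forall i, convexf (F i)) ->
  convexf (fun x => fmax (fun i => F i x)).
Proof.
move=> h x x' t t01; apply: fmax_le => i; apply: le_trans (h i x x' t t01) _.
move: t01 => /andP[t0 t1]; apply: lerD; apply: ler_wpM2l; rewrite ?subr_ge0//.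
  exact: (fmax_ge (fun i => F i x)).
exact: (fmax_ge (fun i => F i x')).
Qed.

Lemma lipschitz_fmax L n (F : 'I_n.+1 -> V -> R) : (forall i, lipschitz L (F i)) ->
  lipschitz L (fun x => fmax (fun i => F i x)).
Proof.
move=> h x x'; rewrite lerBlDr; apply: fmax_le => i.
have := fmax_ge (fun i => F i x') i; have := h i x x'; lra.
Qed.

Lemma convexf_affine (p : V) c : convexf (fun x => dotv x p - c).
Proof. by move=> x x' t _; rewrite dotvDl !dotvZl; lra. Qed.

Lemma lipschitz_affine (p : V) c L : eucl p <= L -> lipschitz L (fun x => dotv x p - c).
Proof.
move=> pL x x'; rewrite (_ : _ - _ = dotv (x - x') p); last by rewrite dotvBl; lra.
by apply: le_trans (dotv_le _ _) _; rewrite mulrC ler_wpM2r ?eucl_ge0.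
Qed.

Lemma lipschitzD L L' f g : lipschitz L f -> lipschitz L' g -> lipschitz (L + L') (fun x => f x + g x).
Proof. by move=> hf hg x x'; have := hf x x'; have := hg x x'; lra. Qed.

Lemma convexfD f g : convexf f -> convexf g -> convexf (fun x => f x + g x).
Proof. by move=> hf hg x x' t h; have := hf x x' t h; have := hg x x' t h; lra. Qed.

Lemma convexfZ a f : 0 <= a -> convexf f -> convexf (fun x => a * f x).
Proof. by move=> a0 hf x x' t h; have := ler_wpM2l a0 (hf x x' t h); lra. Qed.

Lemma lipschitzZ a L f : 0 <= a -> lipschitz L f -> lipschitz (a * L) (fun x => a * f x).
Proof. by move=> a0 hf x x'; rewrite -mulrBr -mulrA; exact: ler_wpM2l. Qed.

Lemma lipschitz_le L L' f : L <= L' -> lipschitz L f -> lipschitz L' f.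
Proof. by move=> h hf x x'; apply: le_trans (hf x x') _; rewrite ler_wpM2r ?eucl_ge0. Qed.

End DensePoints.

Lemma intg_ae_le {dT} {T : measurableType dT} {R : realType} (m : {measure set T -> \bar R}) (f g : T -> R) :
  measurable_fun setT f -> intg m g -> {ae m, forall x, `|f x| <= g x} -> intg m f.
Proof.
move=> mf ig h; apply/integrableP; split; first exact/measurable_EFinP.
have mn : measurable_fun setT (fun x => `|f x|) by exact: measurableT_comp.
have mm : measurable_fun setT (fun x => Num.min `|f x| `|g x|).
  by apply: measurable_minr => //; apply: measurableT_comp => //; exact: intg_measurable ig.
have m0 x : 0 <= Num.min `|f x| `|g x| by rewrite le_min !normr_ge0.
have /integrableP[_] : intg m (fun x => Num.min `|f x| `|g x|).
  apply: (@intg_le _ _ _ _ _ (fun x => `|g x|)) => //; last exact: intg_norm.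
  by move=> x; rewrite ger0_norm// ge_min lexx orbT.
congr (_ < _)%E; apply: ae_eq_integral => //.
- by apply/measurable_EFinP; apply: measurableT_comp.
- exact/measurable_EFinP.
- apply: filterS h => x h _ /=; congr (_%:E); rewrite ger0_norm// min_l//.
  by apply: le_trans h _; exact: ler_norm.
Qed.

Lemma intg_ae_bounded {dT} {T : measurableType dT} {R : realType} (P : probability T R) (f : T -> R) (c : R) :
  measurable_fun setT f -> {ae P, forall x, `|f x| <= c} -> intg P f.
Proof. by move=> mf h; apply: intg_ae_le mf (intg_cst P c) h. Qed.

(** * Admissible potentials and their growth *)

Section Target.
Context {R : realType} {d : nat}.
Local Notation T := (Rd R d).
Local Notation V := 'rV[R]_d.

(** The quantitative content of membership in [Kset]: a radius for the support, zero barycenter, and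
    the lower bound on Theta in its homogeneous form. *)
Record target (mu : probability T R) (D th : R) : Prop := Target {
  target_le : {ae mu, forall y : T, eucl y <= D};
  target_c : forall i, \int[mu]_y ((y : V) 0 i) = 0;
  target_th : forall x : V, th * eucl x <= \int[mu]_y `|dotv x y| }.

Variables (mu : probability T R) (D th : R).
Hypothesis Hmu : target mu D th.

Lemma target_eucl : intg mu (fun y : T => eucl y).
Proof.
apply: (intg_ae_bounded (c := D)); first exact: measurable_eucl.
by apply: filterS (target_le Hmu) => y; rewrite ger0_norm ?eucl_ge0.
Qed.

Lemma target_coord i : intg mu (fun y : T => (y : V) 0 i).
Proof.
apply: intg_le target_eucl; first exact: measurable_coord.
by move=> y; exact: coord_le_eucl.
Qed.

Lemma target_dotv (x : V) : intg mu (fun y : T => dotv x y).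
Proof.
apply: (@intg_le _ _ _ _ _ (fun y : T => eucl x * eucl y)).
- by apply: measurable_dotv => //; exact: measurable_cst.
- by move=> y; exact: dotv_abs_le.
- by apply: intgZ; exact: target_eucl.
Qed.

Lemma target_EE (x : V) : \int[mu]_y dotv x y = 0.
Proof.
rewrite /dotv EE_sum => [|i]; last by apply: intgZ; exact: target_coord.
rewrite big1// => i _; rewrite EEZ; last exact: target_coord.
by rewrite (target_c Hmu) mulr0.
Qed.

Variable L : R.
Hypothesis L0 : 0 <= L.

(** The last field says that the Legendre transform of [psi] has nonpositive integral, stated
    through finite maxima of the affine functions below it. These are integrable, and each condition
    involves finitely many values of [psi], so it survives pointwise limits. *)
Record adm (psi : V -> R) : Prop := Adm {
  adm_lip : lipschitz L psi;
  adm_convex : convexf psi;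
  adm_dual : forall n (X : 'I_n.+1 -> V), \int[mu]_y fmax (fun i => dotv (X i) y - psi (X i)) <= 0 }.

Lemma target_fmax n (X : 'I_n.+1 -> V) (c : 'I_n.+1 -> R) :
  intg mu (fun y : T => fmax (fun i => dotv (X i) y - c i)).
Proof.
apply: (@intg_le _ _ _ _ _ (fun y : T => \sum_i (`|dotv (X i) y| + `|c i|))).
- apply: measurable_fmax => i; apply: measurable_funB; last exact: measurable_cst.
  by apply: measurable_dotv => //; exact: measurable_cst.
- move=> y; have [i ->] := fmax_ex (fun i => dotv (X i) y - c i).
  apply: le_trans (ler_normB _ _) _; rewrite [leRHS](bigD1 i)//= lerDl.
  by apply: sumr_ge0 => j _; rewrite addr_ge0.
- apply: intg_sum => i; apply: intgD; last exact: intg_cst.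
  by apply: intg_norm; exact: target_dotv.
Qed.

Lemma adm_ge0 psi x : adm psi -> 0 <= psi x.
Proof.
move=> h; have := adm_dual h (fun _ : 'I_1 => x).
have -> : \int[mu]_y fmax (fun _ : 'I_1 => dotv x y - psi x) = \int[mu]_y (dotv x y - psi x).
  by apply: eq_Rintegral => y _; have [i ->] := fmax_ex (fun _ : 'I_1 => dotv x y - psi x).
rewrite EEB; [|exact: target_dotv|exact: intg_cst].
by rewrite target_EE EE_cst; lra.
Qed.

(** The dual condition is tested with the two points x and x': the maximum of the two affine
    functions dominates half their sum plus half their distance. The linear part integrates to 0 by
    centering, and the absolute value to at least th |x - x'|. *)
Lemma adm_grow psi x x' : adm psi -> th / 2 * eucl (x - x') <= Num.max (psi x) (psi x').
Proof.
move=> h; pose X (i : 'I_2) := if i == ord0 then x else x'.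
have := adm_dual h X.
have le1 : \int[mu]_y (2^-1 * `|dotv (x - x') y| + 2^-1 * dotv (x + x') y - Num.max (psi x) (psi x'))
   <= \int[mu]_y fmax (fun i => dotv (X i) y - psi (X i)).
  apply: EE_le; last first.
  - move=> y; have := fmax_ge (fun i => dotv (X i) y - psi (X i)) ord0.
    have := fmax_ge (fun i => dotv (X i) y - psi (X i)) ord_max; rewrite /X /= dotvBl dotvDl.
    have : psi x <= Num.max (psi x) (psi x') by rewrite le_max lexx.
    have : psi x' <= Num.max (psi x) (psi x') by rewrite le_max lexx orbT.
    move: (Num.max _ _) (fmax _) (dotv x y) (dotv x' y) => p q a b.
    by have [?|?] := leP 0 (a - b); [rewrite ger0_norm//|rewrite ltr0_norm//]; lra.
  - exact: target_fmax.
  - apply: intgB; last exact: intg_cst.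
    apply: intgD; apply: intgZ; last exact: target_dotv.
    by apply: intg_norm; exact: target_dotv.
move=> /(le_trans le1); rewrite EEB; last 2 first.
- apply: intgD; apply: intgZ; last exact: target_dotv.
  by apply: intg_norm; exact: target_dotv.
- exact: intg_cst.
rewrite EED; [|apply: intgZ; apply: intg_norm; exact: target_dotv|apply: intgZ; exact: target_dotv].
rewrite !EEZ; [|exact: target_dotv|apply: intg_norm; exact: target_dotv].
rewrite target_EE EE_cst; have := target_th Hmu (x - x'); lra.
Qed.

(** With x0 minimal up to 1, psi x >= psi x0 - 1 and psi x >= (th / 2) |x - x0| - 1. One third of
    each, together with psi >= 0, gives the coefficients 1/3, th/6 and 2/3. The term psi x0 / 3 is
    kept because it bounds psi x0 from above once the partition function is bounded below. *)
Lemma adm_growth psi : 0 < th -> adm psi ->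
  exists x0, forall x, psi x0 / 3 + th / 6 * eucl (x - x0) - 2 / 3 <= psi x.
Proof.
move=> th0 h; have lb : has_lbound (range psi) by exists 0 => _ [x _ <-]; exact: adm_ge0.
have : has_inf (range psi) by split => //; exists (psi 0), 0.
move=> /(inf_adherent ltr01)[_ [x0 _ <-] hx0]; exists x0 => x.
have h1 : psi x0 - 1 <= psi x.
  have : inf (range psi) <= psi x by apply: ge_inf => //; exists x.
  lra.
have := adm_grow x x0 h; have := adm_ge0 x0 h; have := eucl_ge0 (x - x0).
have := adm_ge0 x h.
by have [_|_] := leP (psi x) (psi x0); move: (eucl _) => e; nra.
Qed.

Lemma adm_shift psi h : adm psi -> adm (fun x => psi (x + h)).
Proof.
case=> l c k; split.
- by move=> x x'; have := l (x + h) (x' + h); rewrite opprD addrACA subrr addr0.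
- move=> x x' t t01; have := c (x + h) (x' + h) t t01.
  rewrite (_ : t *: (x + h) + _ = t *: x + (1 - t) *: x' + h)//.
  by rewrite !scalerDr addrACA -scalerDl addrCA subrr addr0 scale1r.
- move=> n X; apply: le_trans (k n (fun i => X i + h)).
  rewrite -[leRHS]addr0 -[X in _ + X]oppr0 -(target_EE h) -EEB; [|exact: target_fmax|exact: target_dotv].
  apply: EE_le; [exact: target_fmax|by apply: intgB; [exact: target_fmax|exact: target_dotv]|].
  move=> y; apply: fmax_le => i; rewrite lerBrDr.
  have := fmax_ge (fun i => dotv (X i + h) y - psi (X i + h)) i.
  by rewrite dotvDl; lra.
Qed.

(** A reference competitor, which bounds the maximal partition function from below independently of
    [mu]. *)
Lemma adm_norm : D <= L -> adm (fun x => L * eucl x).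
Proof.
move=> DL; split.
- by apply: (@lipschitz_le _ _ (L * 1)); [rewrite mulr1|apply: lipschitzZ => //; exact: lipschitz_eucl].
- by apply: convexfZ => //; exact: convexf_eucl.
- move=> n X; rewrite -[leRHS](EE_cst mu); apply: EE_le_ae; [exact: target_fmax|exact: intg_cst|].
  apply: filterS (target_le Hmu) => y yD; apply: fmax_le => i.
  have := dotv_le (X i) y; have := eucl_ge0 (X i); move: (eucl _) => a; nra.
Qed.

(** Each defining inequality reads finitely many values of the function, so approximation on finite
    sets suffices. *)
Lemma adm_closed psi (F : nat -> V -> R) : (forall n, adm (F n)) ->
  (forall (s : seq V) e, 0 < e -> exists n, forall x, x \in s -> `|F n x - psi x| < e) -> adm psi.
Proof.
move=> aF h; split.
- move=> x x'; apply/ler_addgt0Pr => e e0; have e2 : 0 < e / 2 by lra.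
  have [n hn] := h [:: x; x'] _ e2; have := adm_lip (aF n) x x'.
  have := hn x; have := hn x'; rewrite !inE !eqxx !orbT => /(_ isT) h1 /(_ isT) h2.
  by move: h1 h2; rewrite !ltr_norml; lra.
- move=> x x' t t01; apply/ler_addgt0Pr => e e0; have e2 : 0 < e / 2 by lra.
  have [n hn] := h [:: x; x'; t *: x + (1 - t) *: x'] _ e2; have := adm_convex (aF n) x x' t01.
  have := hn x; have := hn x'; have := hn (t *: x + (1 - t) *: x'); rewrite !inE !eqxx !orbT.
  move=> /(_ isT) h0 /(_ isT) h1 /(_ isT) h2; move: h0 h1 h2; rewrite !ltr_norml.
  move: t01 (F n _) (F n _) (F n _) (psi _) (psi _) (psi _) => /andP[t0 t1] a b c a' b' c'; nra.
- move=> n X; apply/ler_addgt0Pr => e e0.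
  have [m hm] := h [seq X i | i <- enum 'I_n.+1] _ e0.
  rewrite add0r; apply: (@le_trans _ _ (\int[mu]_y (fmax (fun i => dotv (X i) y - F m (X i)) + e))).
    apply: EE_le; [exact: target_fmax|by apply: intgD; [exact: target_fmax|exact: intg_cst]|].
    move=> y; apply: fmax_le => i; have := fmax_ge (fun i => dotv (X i) y - F m (X i)) i.
    have : X i \in [seq X i | i <- enum 'I_n.+1] by rewrite map_f// mem_enum.
    by move=> /hm; rewrite ltr_norml; lra.
  rewrite EED; [|exact: target_fmax|exact: intg_cst].
  by rewrite EE_cst; have := adm_dual (aF m) X; lra.
Qed.

End Target.

Section ShiftReal.
Context {R : realType} {d : nat} (leb : {measure set (Rd R d) -> \bar R}).
Hypothesis Hleb : is_lebesgue leb.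
Local Notation T := (Rd R d).
Local Notation V := 'rV[R]_d.

Lemma measurable_fun_shift (t : V) (f : T -> R) : measurable_fun setT f ->
  measurable_fun setT (fun x : T => f ((x : V) + t : T)).
Proof. by move=> mf; exact: (measurableT_comp mf (measurable_shift t)). Qed.

Lemma intg_shift (t : V) (f : T -> R) : intg leb f -> intg leb (fun x : T => f ((x : V) + t : T)).
Proof.
move=> hf; have mf := intg_measurable hf; move: hf => /integrableP[_ h].
apply/integrableP; split; first by apply/measurable_EFinP; exact: measurable_fun_shift.
rewrite (ge0_integral_shift Hleb t (f := fun x : T => `|(f x)%:E|%E))//.
by apply: measurableT_comp => //; exact/measurable_EFinP.
Qed.

Lemma EE_shift (t : V) (f : T -> R) : measurable_fun setT f ->
  \int[leb]_x f ((x : V) + t : T) = \int[leb]_x f x.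
Proof.
move=> mf; have mE : measurable_fun setT (EFin \o f) by exact/measurable_EFinP.
rewrite /Rintegral integralE [in RHS]integralE; congr (fine (_ - _)).
  transitivity (\int[leb]_x ((EFin \o f)^\+ ((x : V) + t)%R))%E.
  by apply: eq_integral => y _; rewrite ?funeposE ?funenegE.
  by apply: (ge0_integral_shift Hleb t (f := (EFin \o f)^\+%E)) => //; exact: measurable_funepos.
transitivity (\int[leb]_x ((EFin \o f)^\- ((x : V) + t)%R))%E.
  by apply: eq_integral => y _; rewrite ?funeposE ?funenegE.
by apply: (ge0_integral_shift Hleb t (f := (EFin \o f)^\-%E)) => //; exact: measurable_funeneg.
Qed.

Lemma decay_intg (c A : R) p (f : T -> R) : 0 < c -> measurable_fun setT f ->
  (forall x, `|f x| <= A * ((1 + eucl x) ^+ p * expR (- (c * eucl x)))) -> intg leb f.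
Proof.
move=> c0 mf h; apply: intg_le mf h _; apply: intgZ.
have [C [_ /(_ leb Hleb) hC]] := integral_exp_decay d p c0.
apply: intg_fin.
- apply: measurable_funM.
    apply: measurable_funX; apply: measurable_funD; first exact: measurable_cst.
    exact: measurable_eucl.
  apply: measurableT_comp => //; apply: measurableT_comp => //.
  by apply: measurable_funM; [exact: measurable_cst|exact: measurable_eucl].
- by move=> x; rewrite mulr_ge0 ?expR_ge0// exprn_ge0// addr_ge0// eucl_ge0.
- exact: le_lt_trans hC (ltry _).
Qed.

End ShiftReal.

Section Maximizer.
Context {R : realType} {d : nat} (leb : {measure set (Rd R d) -> \bar R}).
Hypothesis Hleb : is_lebesgue leb.
Local Notation T := (Rd R d).
Local Notation V := 'rV[R]_d.
Variables (mu : probability T R) (D th L C6 : R).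
Hypothesis Hmu : target mu D th.
Hypotheses (th0 : 0 < th) (L0 : 0 <= L) (DL : D <= L).
Hypothesis HC6 : (\int[leb]_x (expR (- (th / 6 * eucl x)))%:E <= C6%:E)%E.
Local Notation adm := (adm mu L).

Definition partf (psi : V -> R) : R := \int[leb]_x expR (- psi x).

Let th6 : 0 < th / 6. Proof. by rewrite divr_gt0. Qed.

Lemma adm_measurable psi : adm psi -> measurable_fun [set: T] psi.
Proof. by move=> h; exact: lipschitz_measurable (adm_lip h). Qed.

Lemma measurable_expN (psi : T -> R) : measurable_fun [set: T] psi ->
  measurable_fun [set: T] (fun x => expR (- psi x)).
Proof. by move=> h; apply: measurableT_comp => //; exact: measurableT_comp. Qed.

Lemma adm_lin psi : adm psi -> exists B, forall x, th / 6 * eucl x - B <= psi x.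
Proof.
move=> h; have [x0 hx0] := adm_growth Hmu th0 h.
exists (th / 6 * eucl x0 + 2 / 3 - psi x0 / 3) => x; have := hx0 x.
have := ler_wpM2l (ltW th6) (eucl_sub_le x x0); lra.
Qed.

Lemma lin_moment (c B : R) p (psi : V -> R) : 0 < c -> measurable_fun [set: T] psi ->
  (forall x, c * eucl x - B <= psi x) ->
  forall f : T -> R, measurable_fun setT f -> (exists A, forall x, `|f x| <= A * (1 + eucl x) ^+ p) ->
  intg leb (fun x => f x * expR (- psi x)).
Proof.
move=> c0 mp hB f mf [A hA]; apply: (@decay_intg _ _ _ Hleb c (A * expR B) p) => //.
  by apply: measurable_funM => //; exact: measurable_expN.
move=> x; rewrite normrM (ger0_norm (expR_ge0 _)) -mulrA [expR B * _]mulrCA -expRD mulrA.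
apply: ler_pM => //.
by rewrite ler_expR; have := hB x; lra.
Qed.

Lemma adm_expN psi : adm psi -> intg leb (fun x => expR (- psi x)).
Proof.
move=> h; have [B hB] := adm_lin h.
have := lin_moment (p := 0) th6 (adm_measurable h) hB (f := fun=> 1) (measurable_cst _).
rewrite (_ : (fun x : T => 1 * expR (- psi x)) = fun x : T => expR (- psi x)); last first.
  by apply/funext => x; rewrite mul1r.
by apply; exists 1 => x; rewrite normr1 expr0 mulr1.
Qed.

Lemma intg_decay0 : intg leb (fun x => expR (- (th / 6 * eucl x))).
Proof.
apply: intg_fin; last exact: le_lt_trans HC6 (ltry _).
- apply: (measurable_expN (psi := fun x => th / 6 * eucl x)).
  by apply: measurable_funM; [exact: measurable_cst|exact: measurable_eucl].
- by move=> x; exact: expR_ge0.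
Qed.

Lemma partf_le psi x0 : adm psi ->
  (forall x, psi x0 / 3 + th / 6 * eucl (x - x0) - 2 / 3 <= psi x) ->
  partf psi <= expR (2 / 3 - psi x0 / 3) * C6.
Proof.
move=> h hx0.
have h1 := intgZ (expR (2 / 3 - psi x0 / 3)) (intg_shift Hleb (- x0) intg_decay0).
apply: (@le_trans _ _ (\int[leb]_x (expR (2 / 3 - psi x0 / 3) * expR (- (th / 6 * eucl ((x : V) - x0)))))).
  apply: EE_le => //; first exact: adm_expN.
  by move=> x; rewrite -expRD ler_expR; have := hx0 x; lra.
rewrite EEZ; last exact: (intg_shift Hleb (- x0) intg_decay0).
rewrite ler_wpM2l ?expR_ge0//.
rewrite (EE_shift Hleb (- x0) (f := fun x : T => expR (- (th / 6 * eucl (x : V))))); last first.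
  exact: intg_measurable intg_decay0.
by rewrite -lee_fin -EE_fineK//; exact: intg_decay0.
Qed.

Lemma partf_norm_ge : 2 ^+ d * expR (- (L * d%:R)) <= partf (fun x => L * eucl x).
Proof.
have a := adm_norm Hmu L0 DL.
rewrite -lee_fin -EE_fineK; last exact: adm_expN.
have mc := measurable_cube (R := R) (d := d) 1.
apply: (@le_trans _ _ (\int[leb]_x (expR (- (L * d%:R)) * \1_(cube 1 : set T) x)%:E)%E).
  rewrite (eq_integral (fun x : T => ((expR (- (L * d%:R)))%:E * (\1_(cube 1 : set T) x)%:E)%E)) => [|x _]; last first.
    by rewrite EFinM.
  rewrite ge0_integralZl//.
  - by rewrite integral_indic// setIT (leb_cube Hleb)// mulr1 EFinM muleC.
  - exact/measurable_EFinP/measurable_indic.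
apply: ge0_le_integral => //.
- apply/measurable_EFinP; apply: measurable_funM; first exact: measurable_cst.
  exact: measurable_indic.
- by apply/measurable_EFinP; apply: intg_measurable; exact: adm_expN.
- move=> x _; rewrite lee_fin indicE; have [|_] := boolP (x \in _); last by rewrite mulr0 expR_ge0.
  rewrite inE => /cubeP hx; rewrite mulr1 ler_expR lerN2 ler_wpM2l//.
  by rewrite -[leRHS]mulr1; exact: eucl_le_max.
Qed.

Lemma partf_shift psi h : adm psi -> partf (fun x => psi (x + h)) = partf psi.
Proof.
move=> a; apply: (EE_shift Hleb h (f := fun x : T => expR (- psi (x : V)))).
exact: intg_measurable (adm_expN a).
Qed.

Lemma partf_cvg (psi : V -> R) (F : nat -> V -> R) (B : R) : (forall n, adm (F n)) -> adm psi ->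
  (forall n x, th / 6 * eucl x - B <= F n x) ->
  (forall x (e : R), 0 < e -> exists N, forall n, (N <= n)%N -> `|F n x - psi x| < e) ->
  forall c, (forall e, 0 < e -> exists N, forall n, (N <= n)%N -> c - e <= partf (F n)) -> c <= partf psi.
Proof.
move=> aF ap hB hF c hc.
have [] := @dominated_convergence _ T R leb setT measurableT
  (fun n x => (expR (- F n x))%:E) (fun x => (expR (- psi x))%:E)
  (fun x => (expR B * expR (- (th / 6 * eucl x)))%:E).
- by move=> n; apply/measurable_EFinP; exact: intg_measurable (adm_expN (aF n)).
- by apply/measurable_EFinP; exact: intg_measurable (adm_expN ap).
- apply: aeW => x _.
  apply/fine_cvgP; split; first by exists 0%N.
  have h : (fun n => F n x) @ \oo --> psi x.
    apply/cvgrPdist_lt => e e0; have [N hN] := hF x e e0.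
    by exists N => // n /= Nn; rewrite distrC; exact: hN.
  apply: (@cvg_comp _ _ _ (fun n => - F n x) expR _ (nbhs (- psi x))); last exact: continuous_expR.
  exact: cvgN.
- exact: (intgZ (expR B) intg_decay0).
- apply: aeW => x n _; rewrite /= lee_fin ger0_norm ?expR_ge0// -expRD ler_expR.
  by have := hB n x; lra.
move=> _ _ cv; apply/ler_addgt0Pr => e e0; rewrite -lerBlDr -lee_fin.
rewrite -(EE_fineK (adm_expN ap)); have [N hN] := hc e e0.
rewrite -(cvg_lim (@ereal_hausdorff R) cv).
apply: lime_ge; first by apply/cvg_ex; eexists; exact: cv.
exists N => // n /= Nn; rewrite (EE_fineK (adm_expN (aF n))) lee_fin; exact: hN.
Qed.

Theorem maximizer : exists psi, adm psi /\ forall psi', adm psi' -> partf psi' <= partf psi.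
Proof.
have L4 : 0 < 4 * L + 4 by rewrite ltr_wpDl// mulr_ge0.
have C60 : 0 <= C6.
  rewrite -lee_fin; apply: le_trans HC6; apply: integral_ge0 => x _; by rewrite lee_fin expR_ge0.
pose S := [set partf psi | psi in [set psi | adm psi]].
have p0 := partf_norm_ge.
have Sne : S !=set0 by exists (partf (fun x => L * eucl x)), (fun x => L * eucl x) => //; exact: (adm_norm Hmu L0 DL).
have Sub : has_ubound S.
  exists (expR 1 * C6) => _ [psi /= a <-]; have [x0 hx0] := adm_growth Hmu th0 a.
  apply: le_trans (partf_le a hx0) _; rewrite ler_wpM2r// ler_expR.
  by have := adm_ge0 Hmu x0 a; lra.
have sS : has_sup S by split.
pose W := sup S.
have W0 : 0 < W.
  apply: (@lt_le_trans _ _ (2 ^+ d * expR (- (L * d%:R)))).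
    by rewrite mulr_gt0 ?expR_gt0// exprn_gt0.
  by apply: le_trans p0 _; apply: ub_le_sup => //; exists (fun x => L * eucl x) => //; exact: (adm_norm Hmu L0 DL).
have seqn n : exists psi, adm psi /\ W - W / 2 / n.+1%:R <= partf psi /\
    forall x, psi 0 / 3 + th / 6 * eucl x - 2 / 3 <= psi x.
  (* The half ensures that every term of the maximizing sequence has partition function at least W /
     2; the translation puts its near-minimum at the origin, so that the linear lower bounds are
     uniform. *)
  have e0 : 0 < W / 2 / n.+1%:R by rewrite !divr_gt0// ltr0n.
  have [_ [psi /= a <-] h] := sup_adherent e0 sS; have [x0 hx0] := adm_growth Hmu th0 a.
  exists (fun x => psi (x + x0)); split; first exact: (adm_shift Hmu).
  rewrite partf_shift//; split; first exact: ltW.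
  by move=> x; rewrite add0r; have := hx0 (x + x0); rewrite addrK.
have [F hF] := choice seqn.
have aF n : adm (F n) := (hF n).1.
(* From W / 2 <= partf (F n) <= exp(2/3 - F n 0 / 3) C6, solved for F n 0. *)
pose B0 := 3 * (2 / 3 - ln (W / 2 / C6)).
have C6p : 0 < C6.
  rewrite lt_neqAle C60 andbT; apply/eqP => C6e; have [psi [a [h hx]]] := seqn 0.
  have := partf_le (x0 := 0) a; rewrite -C6e mulr0 => /(_ _)/wrap[].
    by move=> x; rewrite subr0; exact: hx.
  by move: h; rewrite divr1; lra.
have F0 n : F n 0 <= B0.
  have [a [h hx]] := hF n.
  have h1 : W / 2 <= partf (F n).
    apply: le_trans h; have : W / 2 / n.+1%:R <= W / 2.
      by rewrite ler_pdivrMr ?ltr0n// ler_peMr ?divr_ge0 ?(ltW W0)// ler1n.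
    by move=> h2; rewrite lerBrDr [leRHS]splitr lerD2l.
  have := partf_le (x0 := 0) a; move=> /(_ _)/wrap[].
    by move=> x; rewrite subr0; exact: hx.
  move=> h2; have := le_trans h1 h2; rewrite -ler_pdivrMr// -[X in X <= _]lnK ?posrE ?divr_gt0//.
  by rewrite ler_expR /B0; lra.
have FB n x : `|F n x| <= B0 + L * eucl x.
  rewrite ger0_norm; last exact: (adm_ge0 Hmu).
  by have := adm_lip (aF n) x 0; rewrite subr0; have := F0 n; lra.
have [psi hpsi] := pointwise_cluster FB.
have ap : adm psi.
  apply: (adm_closed Hmu aF) => s e e0; have [n [_ h]] := hpsi 0 s e e0; by exists n.
(* Index k is matched with a term that is 1 / (k + 1)-close to the limit on the first k + 1 dense
   points. The common Lipschitz constant turns this into convergence at every point, hence dominated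
   convergence applies. *)
have sub k : exists n, (k <= n)%N /\ forall x, x \in [seq dpt (R := R) (d := d) i | i <- iota 0 k.+1] ->
    `|F n x - psi x| < k.+1%:R^-1.
  by apply: hpsi; rewrite invr_gt0 ltr0n.
have [kk hkk] := choice sub.
exists psi; split; first exact: ap.
move=> psi' a'.
apply: (@le_trans _ _ W); first by apply: ub_le_sup => //; exists psi'.
apply: (@partf_cvg psi (fun k => F (kk k)) (2 / 3)) => //.
- move=> n x; have [_ [_ h]] := hF (kk n); apply: le_trans (h x).
  by have := adm_ge0 Hmu 0 (aF (kk n)); lra.
- move=> x e e0.
  have q0 : 0 < e / (4 * L + 4) by rewrite divr_gt0.
  have [i hi] := dpt_dense x q0; rewrite ltr_pdivlMr// in hi.
  pose N := maxn i (Num.truncn (2 / e)).+1; exists N => n Nn.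
  have [_ /(_ (dpt i))] := hkk n; rewrite map_f => [/(_ isT) h1|]; last first.
    by rewrite mem_iota /= add0n ltnS (leq_trans (leq_maxl _ _) Nn).
  have h2 : n.+1%:R^-1 < e / 2.
    have : 2 / e < n.+1%:R.
      apply: lt_le_trans (truncnS_gt _) _; rewrite ler_nat.
      by apply: leq_trans (leq_maxr _ _) (leq_trans Nn _).
    rewrite ltr_pdivrMr// => h2; rewrite -[ltLHS]mul1r ltr_pdivrMr ?ltr0n//; lra.
  have h3 := lipschitz_abs x (dpt i) (adm_lip (aF (kk n))).
  have h4 := lipschitz_abs x (dpt i) (adm_lip ap).
  have := eucl_ge0 (x - dpt i); move: hi h1 h2 h3 h4; rewrite !ltr_norml !ler_norml.
  move: (eucl _) (n.+1%:R^-1) (F _ _) (F _ _) (psi _) (psi _) => r q c1 c2 c3 c4; lra.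
- move=> e e0; exists (Num.truncn (W / 2 / e)).+1 => n Nn.
  have [_ [h _]] := hF (kk n); apply: le_trans h; rewrite lerD2l lerN2.
  rewrite ler_pdivrMr ?ltr0n// [leRHS]mulrC -ler_pdivrMr//; apply: ltW; apply: lt_le_trans (truncnS_gt _) _.
  by rewrite ler_nat (leq_trans Nn)// (leq_trans (hkk n).1).
Qed.

End Maximizer.

(** * Random variables with prescribed laws *)

Section HasLaw.
Context {R : realType}.

(** Couplings are carried by variables on arbitrary probability spaces, so a space can be enlarged
    by gluing while the variables already present keep their joint law. *)
Record haslaw {dS dT} {S : measurableType dS} {T : measurableType dT}
    (P : probability S R) (X : S -> T) (rho : probability T R) : Prop := HasLaw {
  law_mfun : measurable_fun setT X;
  law_preim : forall A, measurable A -> P (X @^-1` A) = rho A }.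

Context {dS dT dU : measure_display} {S : measurableType dS} {T : measurableType dT} {U : measurableType dU}.

Lemma haslaw_comp (P : probability S R) (X : S -> T) (Q : probability T R) (Y : T -> U) (rho : probability U R) :
  haslaw P X Q -> haslaw Q Y rho -> haslaw P (Y \o X) rho.
Proof.
move=> [mX lX] [mY lY]; split; first exact: measurableT_comp.
move=> A mA; rewrite comp_preimage lX ?lY//; rewrite -[X in measurable X]setTI; exact: mY.
Qed.

Lemma haslaw_push (P : probability S R) (X : S -> T) : measurable_fun setT X ->
  exists Q : probability T R, haslaw P X Q.
Proof.
move=> mX.
pose m A := P (X @^-1` A).
have m0 : m set0 = 0%E by rewrite /m preimage_set0 measure0.
have mge A : (0 <= m A)%E by exact: measure_ge0.
have ms : semi_sigma_additive m.
  move=> F mF tF mU; rewrite /m preimage_bigcup; apply: measure_semi_sigma_additive.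
  - by move=> n; rewrite -[X in measurable X]setTI; exact: mX.
  - by apply/trivIsetP => i j _ _ ij; rewrite -preimage_setI; move/trivIsetP : tF => ->//; rewrite preimage_set0.
  - by rewrite -preimage_bigcup -[X in measurable X]setTI; exact: mX.
pose Pm : {measure set T -> \bar R} := HB.pack m (isMeasure.Build _ _ _ m m0 mge ms).
have k1 : Pm setT = 1%E by rewrite /Pm /= /m preimage_setT probability_setT.
pose PP : probability T R := HB.pack m (Measure.class Pm) (Measure_isProbability.Build _ _ _ Pm k1).
by exists PP; split.
Qed.

Lemma haslaw_ae (P : probability S R) (X : S -> T) (rho : probability T R) (Q : T -> Prop) : haslaw P X rho ->
  {ae rho, forall x, Q x} -> {ae P, forall s, Q (X s)}.
Proof.
move=> [mX lX] [N [mN N0 sub]]; exists (X @^-1` N); split.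
- by rewrite -[X in measurable X]setTI; exact: mX.
- by rewrite lX.
- by move=> s h; apply: sub.
Qed.

Lemma haslaw_intg (P : probability S R) (X : S -> T) (rho : probability T R) (f : T -> R) : haslaw P X rho ->
  intg rho f -> intg P (fun s => f (X s)).
Proof. by move=> [mX lX] h; apply/(law_intg mX lX (f := f)) => //; exact: intg_measurable h. Qed.

Lemma haslaw_EE (P : probability S R) (X : S -> T) (rho : probability T R) (f : T -> R) : haslaw P X rho ->
  measurable_fun setT f -> \int[P]_s f (X s) = \int[rho]_x f x.
Proof. by move=> [mX lX] h; exact: law_EE. Qed.

End HasLaw.

Lemma fin_preimage2_measurable {d1 d2} {S1 : measurableType d1} {S2 : measurableType d2} n
  (ii : S1 -> 'I_n) (jj : S2 -> 'I_n) :
  (forall j, measurable [set x | ii x = j]) -> (forall j, measurable [set y | jj y = j]) ->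
  measurable [set z : S1 * S2 | ii z.1 = jj z.2].
Proof.
move=> mi mj.
rewrite (_ : [set z | _] = \bigcup_(j in setT) ([set x | ii x = j] `*` [set y | jj y = j])).
  by apply: fin_bigcup_measurable => [|j _]; [exact: finite_finset|exact: measurableX].
by apply/seteqP; split => [[x y] /= h|[x y] [j _ [/= -> ->]]//]; exists (jj y).
Qed.

Lemma measurable_fin_comp {dT} {T : measurableType dT} {R : realType} n (jj : T -> 'I_n) (F : 'I_n -> R) :
  (forall j, measurable [set y | jj y = j]) -> measurable_fun setT (fun y => F (jj y)).
Proof.
move=> mj _ Y mY; rewrite setTI.
exact: (fin_preimage_measurable [set j | Y (F j)] mj).
Qed.

Section GlueLaw.
Context {d1 d2 : measure_display} {S1 : measurableType d1} {S2 : measurableType d2} {R : realType}.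
Variables (g : probability S1 R) (tau : probability S2 R) (n : nat).
Variables (ii : S1 -> 'I_n) (jj : S2 -> 'I_n) (m : 'I_n -> R).
Hypotheses (mii : forall j, measurable [set x | ii x = j]) (mjj : forall j, measurable [set x | jj x = j]).
Hypotheses (gii : forall j, g [set x | ii x = j] = (m j)%:E) (tjj : forall j, tau [set x | jj x = j] = (m j)%:E).
Hypothesis m_gt0 : forall j, 0 < m j.

Lemma glue_law : exists G : probability (S1 * S2)%type R,
  [/\ haslaw G fst g, haslaw G snd tau & {ae G, forall z, ii z.1 = jj z.2}].
Proof.
have [G [G1 [G2 G3]]] := glue mii mjj gii tjj m_gt0; exists G; split.
- by split => // A mA; rewrite -G1//; congr (G _); apply/seteqP; split => z //= [].
- by split => // A mA; rewrite -G2//; congr (G _); apply/seteqP; split => z //= [].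
- by apply: (ae_prob1 _ G3); exact: fin_preimage2_measurable.
Qed.

End GlueLaw.

(** Gluing along the partition with a single block. *)
Lemma product_law {d1 d2} {S1 : measurableType d1} {S2 : measurableType d2} {R : realType}
  (g : probability S1 R) (tau : probability S2 R) :
  exists G : probability (S1 * S2)%type R, haslaw G fst g /\ haslaw G snd tau.
Proof.
have [||||j|G [h1 h2 _]] := @glue_law _ _ S1 S2 R g tau 1 (fun=> ord0) (fun=> ord0) (fun=> 1).
- by move=> j; rewrite (_ : [set _ | _] = setT)//; apply/seteqP; split => // x _ /=; rewrite (ord1 j).
- by move=> j; rewrite (_ : [set _ | _] = setT)//; apply/seteqP; split => // x _ /=; rewrite (ord1 j).
- move=> j; rewrite -(probability_setT g); congr (g _); apply/seteqP; split => // x _ /=; by rewrite (ord1 j).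
- move=> j; rewrite -(probability_setT tau); congr (tau _); apply/seteqP; split => // x _ /=; by rewrite (ord1 j).
- exact: ltr01.
by exists G.
Qed.

Lemma ae_meets {dT} {T : measurableType dT} {R : realType} (mu : {measure set T -> \bar R})
  (A : set T) (Q : T -> Prop) : measurable A -> (0 < mu A)%E -> {ae mu, forall y, Q y} -> exists y, A y /\ Q y.
Proof.
move=> mA A0 [N [mN N0 sub]]; apply: contrapT => h.
have : (mu A <= mu N)%E.
  apply: le_measure; rewrite ?inE// => y Ay; apply: sub => Qy; apply: h; by exists y.
by rewrite N0 leNgt A0.
Qed.

(** Monotone convergence with a real-valued limit: the bounded integrals force the limit to be
    finite almost everywhere, and [fine] replaces it by a real function. *)
Lemma increasing_dominated {dT} {T : measurableType dT} {R : realType} (m : {measure set T -> \bar R})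
  (h : nat -> T -> R) (B : R) : (forall n, intg m (h n)) -> (forall n x, 0 <= h n x) ->
  (forall x, {homo h ^~ x : i j / (i <= j)%N >-> i <= j}) -> (forall n, \int[m]_x h n x <= B) ->
  exists H : T -> R, [/\ intg m H, \int[m]_x H x <= B & {ae m, forall x n, h n x <= H x}].
Proof.
move=> ih h0 hh hB.
pose HE x := limn (fun n => (h n x)%:E).
have cvg x : cvgn (fun n => (h n x)%:E).
  by apply: ereal_nondecreasing_is_cvgn => i j ij; rewrite lee_fin; exact: hh.
have mHE : measurable_fun setT HE.
  by apply: (emeasurable_fun_cvg (fun n x => (h n x)%:E)) => [n|x _];
    [apply/measurable_EFinP; exact: intg_measurable (ih n)|exact: cvg].
have HE0 x : (0 <= HE x)%E by apply: lime_ge => //; apply: nearW => n; rewrite lee_fin.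
have hHE x n : ((h n x)%:E <= HE x)%E.
  apply: lime_ge => //; exists n => // k /= nk; rewrite lee_fin; exact: hh.
have iHE : (\int[m]_x HE x <= B%:E)%E.
  rewrite /HE monotone_convergence//; last 3 first.
  - by move=> n; apply/measurable_EFinP; exact: intg_measurable (ih n).
  - by move=> n x _; rewrite lee_fin.
  - by move=> x _ i j ij; rewrite lee_fin; exact: hh.
  apply: lime_le.
    apply: ereal_nondecreasing_is_cvgn => i j ij; apply: ge0_le_integral => //.
    - by move=> x _; rewrite lee_fin.
    - by apply/measurable_EFinP; exact: intg_measurable (ih i).
    - by apply/measurable_EFinP; exact: intg_measurable (ih j).
    - by move=> x _; rewrite lee_fin; exact: hh.
  by apply: nearW => n; rewrite EE_fineK// lee_fin.
exists (fun x => fine (HE x)).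
have mf : measurable_fun setT (fun x => fine (HE x)) by exact: measurableT_comp.
have f0 x : 0 <= fine (HE x) by exact: fine_ge0.
have [] := @EE_lee _ _ _ m _ B mf f0.
  apply: le_trans iHE; apply: ge0_le_integral => //.
  - by move=> x _; rewrite lee_fin.
  - exact/measurable_EFinP.
  - move=> x _; move: (HE0 x); case: (HE x) => //= r; by rewrite leey.
move=> i1 i2; split => //.
have : m.-integrable setT HE.
  apply/integrableP; split => //; apply: le_lt_trans (ltry B).
  by under eq_integral do rewrite gee0_abs//.
move=> /(integrable_ae measurableT); apply: filterS => x /(_ Logic.I) fx n.
by rewrite -lee_fin fineK.
Qed.

(** Only the smaller function is assumed integrable; this is needed for the entropy integrand. *)
Lemma lee_integral_intg {dT} {T : measurableType dT} {R : realType} (m : {measure set T -> \bar R})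
  (h k : T -> R) : intg m h -> measurable_fun setT k -> (forall x, h x <= k x) ->
  ((\int[m]_x h x)%:E <= \int[m]_x (k x)%:E)%E.
Proof.
move=> ih mk hk; rewrite -EE_fineK// integralE [leRHS]integralE.
have mkE : measurable_fun setT (EFin \o k) by exact/measurable_EFinP.
have mhE : measurable_fun setT (EFin \o h) by apply/measurable_EFinP; exact: intg_measurable ih.
apply: leeB.
  apply: ge0_le_integral => //; [exact: measurable_funepos|exact: measurable_funepos|].
  by move=> x _; rewrite !funeposE /= ge_max !le_max lexx orbT andbT lee_fin hk.
apply: ge0_le_integral => //; [exact: measurable_funeneg|exact: measurable_funeneg|].
by move=> x _; rewrite !funenegE /= ge_max !le_max lexx orbT andbT lee_fin lerN2 hk.
Qed.

(** * Gibbs measures minimize the energy *)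

Section DualAndNearOptimal.
Context {R : realType} {d : nat} (leb : {measure set (Rd R d) -> \bar R}).
Hypothesis Hleb : is_lebesgue leb.
Local Notation T := (Rd R d).
Local Notation V := 'rV[R]_d.
Variables (mu : probability T R) (D th : R).
Hypothesis Hmu : target mu D th.
Hypothesis D0 : 0 <= D.
Local Notation L := (D + 1).
Local Notation adm := (adm mu L).

Let L0 : 0 <= L. Proof. by rewrite addr_ge0. Qed.

Lemma dual_dense (psi : V -> R) (y : V) c : lipschitz L psi ->
  (forall n, dotv (dpt n) y - psi (dpt n) <= c) -> forall x, dotv x y - psi x <= c.
Proof.
move=> lp h x; apply/ler_addgt0Pr => e e0.
have E0 := eucl_ge0 y.
have K0 : 0 < L + eucl y + 1 by move: L0; lra.
have q0 : 0 < e / (L + eucl y + 1) by rewrite divr_gt0.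
have [n hn] := dpt_dense x q0; rewrite ltr_pdivlMr// in hn.
have h1 := h n; have h2 := lp (dpt n) x; have h3 := dotv_le (x - dpt n) y.
rewrite dotvBl in h3; rewrite eucl_distC in h2; have r0 := eucl_ge0 (x - dpt n).
move: hn h1 h2 h3 r0 L0 E0; move: (eucl _) (eucl y) (dotv _ _) (dotv _ _) (psi _) (psi _) (D + 1) => r q a b a' b' l; nra.
Qed.

(** [phi] is the increasing limit of the maxima over the first n dense points, a version of the
    Legendre transform. Admissibility bounds their integrals by 0, so the limit is finite almost
    everywhere; the Lipschitz bound extends the inequality from dense points to all x. *)
Lemma dual_potential psi : adm psi -> exists phi : T -> R,
  [/\ intg mu phi, \int[mu]_y phi y <= 0 & {ae mu, forall y : T, forall x : V, dotv x y <= psi x + phi y}].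
Proof.
move=> ap; pose ph n (y : T) := fmax (fun i : 'I_n.+1 => dotv (dpt i) y - psi (dpt i)).
have iph n : intg mu (ph n) := target_fmax Hmu (fun i : 'I_n.+1 => dpt i) (fun i => psi (dpt i)).
have phle i j y : (i <= j)%N -> ph i y <= ph j y.
  move=> ij; apply: fmax_le => k; rewrite -ltnS in ij.
  exact: (fmax_ge (fun i : 'I_j.+1 => dotv (dpt i) y - psi (dpt i)) (widen_ord ij k)).
have hE n : \int[mu]_y ph n y <= 0 by exact: (adm_dual ap).
have [||||H [iH EH aH]] := @increasing_dominated _ T R mu (fun n y => ph n y - ph 0 y) (- \int[mu]_y ph 0 y).
- by move=> n; exact: intgB.
- by move=> n x; rewrite subr_ge0; exact: phle.
- by move=> x i j ij; rewrite lerD2r; exact: phle.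
- by move=> n; rewrite EEB//; have := hE n; lra.
exists (fun y => H y + ph 0 y); split; first exact: intgD.
  by rewrite EED//; lra.
apply: filterS aH => y h x; have : dotv x y - psi x <= H y + ph 0 y; last by lra.
apply: dual_dense; first exact: adm_lip ap.
move=> n; apply: (@le_trans _ _ (ph n y)); last by rewrite -lerBlDr; exact: h.
exact: (fmax_ge (fun i : 'I_n.+1 => dotv (dpt i) y - psi (dpt i)) ord_max).
Qed.

Lemma intg_dotv {dS} {S : measurableType dS} (P : probability S R) (X M : S -> T) (rho : probability T R) :
  haslaw P X rho -> haslaw P M mu -> intg rho (fun x : T => eucl x) -> intg P (fun s => dotv (X s) (M s)).
Proof.
move=> hX hM i1; apply: (@intg_ae_le _ _ _ _ _ (fun s => D * eucl (X s))).
- by apply: measurable_dotv; [exact: law_mfun hX|exact: law_mfun hM].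
- by apply: intgZ; exact: (haslaw_intg (f := fun x : T => eucl x) hX).
- apply: filterS (haslaw_ae hM (target_le Hmu)) => s h.
  by apply: le_trans (dotv_abs_le _ _) _; rewrite mulrC ler_wpM2r// eucl_ge0.
Qed.

Lemma quantize_target eta : 0 < eta -> exists n (pt : 'I_n.+1 -> V) (jj : T -> 'I_n.+1),
  [/\ injective pt, forall j, measurable [set y | jj y = j], forall j, (0 < mu [set y | jj y = j])%E &
  {ae mu, forall y : T, eucl ((y : V) - pt (jj y)) <= eta /\ eucl y <= D}].
Proof.
move=> eta0.
pose N := (Num.truncn (D + d%:R / eta)).+1.
have N0 : (0 < N)%N by [].
have hN : D + d%:R / eta < N%:R by exact: truncnS_gt.
have dn0 : (0 : R) <= d%:R by [].
have q0 : 0 <= d%:R / eta by rewrite divr_ge0// ltW.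
have DN : D < N%:R by lra.
have dN : d%:R * N%:R^-1 <= eta.
  rewrite ler_pdivrMr ?ltr0n// [leRHS]mulrC -ler_pdivrMr//; apply: le_trans (ltW hN); by rewrite lerDr.
have [n [pt [jj [ptinj [mjj [jj0 hjj]]]]]] := quantize N0 mu.
have ajj : {ae mu, forall y : T, eucl ((y : V) - pt (jj y)) <= eta /\ eucl y <= D}.
  apply: filterS2 hjj (target_le Hmu) => y h1 h2; split=> //; move: h1.
  by rewrite ifF ?addr0; [move=> /le_trans; exact|apply/negbTE; rewrite -leNgt; lra].
by exists n, pt, jj.
Qed.

Section NearOptimal.
Variable rho : probability T R.
Hypothesis rho_ac : forall A : set T, measurable A -> leb A = 0%E -> rho A = 0%E.
Hypothesis rho_m1 : intg rho (fun x : T => eucl x).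

(** [mu] is quantized, the semidiscrete plan is glued to [mu] through the labels, and its potential
    is corrected by eta |x| and by the mean [c] of the weights. The correction eta |x| absorbs the
    displacement of [mu] onto the atoms and makes the potential exactly admissible. *)
Lemma near_optimal e : 0 < e -> exists (g : probability (T * T)%type R) (psi : V -> R),
  [/\ haslaw g fst rho, haslaw g snd mu, adm psi &
   \int[rho]_x psi x - e <= \int[g]_z dotv z.1 z.2].
Proof.
have lin (a p v x E b q : R) : a <= p - v -> p - x * E <= q -> a + x * E + b - 2 * x * E - b + v <= q.
  by move=> *; lra.
move=> e0; pose E1 := \int[rho]_x eucl x.
have E10 : 0 <= E1 by apply: EE_ge0 => x; exact: eucl_ge0.
(* The loss in the transport cost is 2 eta E|x|, hence the second term. The slopes are at most D +
   eta and the correction adds eta, so eta <= 1/2 keeps the Lipschitz constant below D + 1. *)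
pose eta := Num.min (2^-1) (e / (2 * (E1 + 1))).
have F0 : 0 < 2 * (E1 + 1) by rewrite mulr_gt0// ltr_wpDl.
have eta0 : 0 < eta by rewrite lt_min invr_gt0 ltr0n divr_gt0.
have eta2 : eta <= 2^-1 by rewrite ge_min lexx.
have etaE : 2 * eta * E1 <= e.
  have : eta <= e / (2 * (E1 + 1)) by rewrite ge_min lexx orbT.
  have aux (a b : R) : 0 < b -> b * (2 * (a + 1)) <= e -> 2 * b * a <= e by lra.
  by rewrite ler_pdivlMr//; exact: aux.
have [n [pt [jj [ptinj mjj jj0 ajj]]]] := quantize_target eta0.
pose m j := fine (mu [set y | jj y = j]).
have mE j : mu [set y | jj y = j] = (m j)%:E by rewrite /m fineK// fin_num_measure.
have m0 j : 0 < m j by rewrite -lte_fin -mE.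
have m1 : \sum_j m j = 1.
  apply: EFin_inj; rewrite -sumEFin -(probability_setT mu) (measure_fibers mu mjj measurableT).
  by apply: eq_bigr => j _; rewrite -mE; congr (mu _); rewrite setTI.
have [w [ii [mii [rii hii]]]] := semidiscrete Hleb rho_ac rho_m1 ptinj m0 m1.
have [G [G1 G2 G3]] := glue_law mii mjj rii mE m0.
pose W (y : T) := w 0 (jj y).
have iW : intg mu W.
  apply: (@intg_bounded _ _ _ _ _ (\sum_j `|w 0 j|)); first exact: (measurable_fin_comp (w 0) mjj).
  by move=> y; rewrite (bigD1 (jj y))//= lerDl sumr_ge0.
pose c := \int[mu]_y W y.
pose psi (x : V) := sdpot pt w x + eta * eucl x + c.
have ptD j : eucl (pt j) <= D + eta.
  have [y [/= <- [h1 h2]]] := ae_meets (mjj j) (jj0 j) ajj.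
  have := eucl_sub_le (pt (jj y)) y; rewrite eucl_distC; lra.
have lpsi : lipschitz L psi.
  apply: (@lipschitz_le _ _ ((D + eta) + eta * 1 + 0)); first by lra.
  apply: lipschitzD; last by move=> x x'; rewrite subrr mul0r.
  apply: lipschitzD; last by apply: lipschitzZ; [exact: ltW|exact: lipschitz_eucl].
  apply: (lipschitz_fmax (F := fun j x => dotv x (pt j) - w 0 j)) => j.
  exact: lipschitz_affine.
have cpsi : convexf psi.
  apply: convexfD; last by move=> x x' t _; lra.
  apply: convexfD; last by apply: convexfZ; [exact: ltW|exact: convexf_eucl].
  by apply: (convexf_fmax (F := fun j x => dotv x (pt j) - w 0 j)) => j; exact: convexf_affine.
have key (x y : V) j : eucl (y - pt j) <= eta -> dotv x y <= dotv x (pt j) + eta * eucl x.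
  move=> h; have := dotv_le x (y - pt j); rewrite dotvBr; have := eucl_ge0 x.
  move: (eucl x) (eucl _) h => a b; nra.
have key' (x y : V) j : eucl (y - pt j) <= eta -> dotv x (pt j) - eta * eucl x <= dotv x y.
  move=> h; have := dotv_le (- x) (y - pt j); rewrite dotvBr !dotvNl euclN; have := eucl_ge0 x.
  move: (eucl x) (eucl _) h => a b; nra.
exists G, psi; split => //.
  split => // k X; apply: (@le_trans _ _ (\int[mu]_y (W y - c))); last first.
    by rewrite EEB//; [rewrite EE_cst subrr|exact: intg_cst].
  apply: EE_le_ae; [exact: (target_fmax Hmu)|by apply: intgB => //; exact: intg_cst|].
  apply: filterS ajj => y [h _]; apply: fmax_le => i.
  have := key (X i) y _ h; have := fmax_ge (fun j => dotv (X i) (pt j) - w 0 j) (jj y).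
  by rewrite /psi /W -/(sdpot pt w (X i)); lra.
have isd : intg rho (fun x : T => sdpot pt w x) by exact: intg_sdpot.
have ipsi : intg rho (fun x : T => psi x).
  by apply: intgD; [apply: intgD => //; exact: intgZ|exact: intg_cst].
have iG1 := haslaw_intg G1 isd; have iGp := haslaw_intg G1 ipsi.
have iGe := haslaw_intg G1 rho_m1; have iGW := haslaw_intg G2 iW.
apply: (@le_trans _ _ (\int[G]_z (psi z.1 - 2 * eta * eucl z.1 - c + W z.2))).
  rewrite EED//; last by apply: intgB; [apply: intgB => //; exact: intgZ|exact: intg_cst].
  rewrite (haslaw_EE G2 (intg_measurable iW)) -/c EEB; [|by apply: intgB => //; exact: intgZ|exact: intg_cst].
  rewrite EE_cst subrK EEB//; last exact: intgZ.
  rewrite EEZ// (haslaw_EE (f := fun x : T => psi x) G1 (intg_measurable ipsi)).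
  by rewrite (haslaw_EE (f := fun x : T => eucl x) G1 (intg_measurable rho_m1)) -/E1 lerB.
apply: EE_le_ae.
- by apply: intgD => //; apply: intgB; [apply: intgB => //; exact: intgZ|exact: intg_cst].
- exact: (intg_dotv G1 G2).
- apply: filterS2 G3 (haslaw_ae G2 ajj) => z hz [h _].
  have := key' z.1 z.2 _ h; rewrite /W /psi -hz.
  have : sdpot pt w z.1 <= dotv (z.1 : V) (pt (ii z.1)) - w 0 (ii z.1) by apply: fmax_le => j; exact: hii.
  exact: lin.
Qed.

End NearOptimal.

End DualAndNearOptimal.

Lemma coupling_law {R : realType} {d : nat} (rho mu : probability (Rd R d) R)
    (g : probability (Rd R d * Rd R d)%type R) :
  coupling rho mu g <-> haslaw g fst rho /\ haslaw g snd mu.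
Proof.
split=> [h|[[_ h1] [_ h2]] A mA].
  split; split => // A mA; [rewrite -(h A mA).1|rewrite -(h A mA).2];
    by congr (g _); apply/seteqP; split => z //= [].
by split; [rewrite -h1//|rewrite -h2//]; congr (g _); apply/seteqP; split => z //= [].
Qed.

(** Convex duality for t log t, obtained from ln t <= t - 1 at t = exp(-(p + c)) / f. *)
Lemma entropy_ge_gibbs {R : realType} (f p c : R) : 0 <= f -> 
  - (f * (p + c)) + f - expR (- (p + c)) <= f * ln f.
Proof.
rewrite le_eqVlt => /predU1P[<-|f0]; first by rewrite !mul0r oppr0 add0r sub0r oppr_le0 expR_ge0.
have q0 : 0 < expR (- (p + c)) / f by rewrite divr_gt0 ?expR_gt0.
have := @le_ln1Dx R (expR (- (p + c)) / f - 1).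
rewrite addrCA subrr addr0 lnM ?posrE ?expR_gt0 ?invr_gt0// expRK lnV ?posrE//.
move=> /(_ _)/wrap[]; first by lra.
move=> h; have := ler_wpM2l (ltW f0) h; rewrite !mulrBr mulrA [f * expR _]mulrC mulfK ?gt_eqF//.
by move: (ln f) (expR _) => a b; lra.
Qed.

Section Nice.
Context {R : realType} {d : nat}.
Local Notation T := (Rd R d).
Local Notation V := 'rV[R]_d.

(** All that is retained of a Gibbs measure: two-sided linear bounds on its potential, centering,
    the dual inequality, and plans optimal up to any slack. The constants are uniform over the class
    of targets. *)
Record nice (leb : {measure set T -> \bar R}) (mu rho : probability T R) (Psi : V -> R) (phi : T -> R)
    (L c C : R) : Prop := Nice {
  nice_dens : forall A : set T, measurable A -> rho A = (\int[leb]_(x in A) (expR (- Psi x))%:E)%E;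
  nice_lip : lipschitz L Psi;
  nice_conv : convexf Psi;
  nice_lo : forall x, c * eucl x - C <= Psi x;
  nice_up : forall x, Psi x <= C + L * eucl x;
  nice_ctr : forall i, \int[rho]_x ((x : V) 0 i) = 0;
  nice_phi : intg mu phi;
  nice_dual : {ae mu, forall y : T, forall x : V, dotv x y <= Psi x + phi y};
  nice_opt : forall e, 0 < e -> exists g : probability (T * T)%type R,
    [/\ haslaw g fst rho, haslaw g snd mu &
      \int[rho]_x Psi x + \int[mu]_y phi y - e <= \int[g]_z dotv z.1 z.2] }.

Variables (leb : {measure set T -> \bar R}) (mu : probability T R) (D th : R).
Hypotheses (Hleb : is_lebesgue leb) (Hmu : target mu D th) (th0 : 0 < th) (D0 : 0 <= D).
Local Notation L := (D + 1).
Local Notation adm := (adm mu L).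

Let L0 : 0 <= L. Proof. by rewrite addr_ge0. Qed.

Section GibbsMinimizer.
Variables (psi0 : V -> R) (phi : T -> R) (rho : probability T R).
Hypotheses (a0 : adm psi0) (mx : forall psi, adm psi -> partf leb psi <= partf leb psi0).
Hypothesis Z0 : 0 < partf leb psi0.
Hypotheses (iphi : intg mu phi) (phi0 : \int[mu]_y phi y <= 0).
Hypothesis dphi : {ae mu, forall y : T, forall x : V, dotv x y <= psi0 x + phi y}.
Local Notation Z := (partf leb psi0).
Let Psi (x : V) := psi0 x + ln Z.
Hypothesis rhoE : forall A : set T, measurable A -> rho A = (\int[leb]_(x in A) (expR (- Psi x))%:E)%E.

Lemma lipschitz_intg (f : V -> R) (l : R) (rho' : probability T R) : 0 <= l -> lipschitz l f ->
  intg rho' (fun x : T => eucl x) -> intg rho' (fun x : T => f x).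
Proof.
move=> l0 lf i1; apply: (@intg_le _ _ _ _ _ (fun x : T => `|f 0| + l * eucl x)).
- exact: lipschitz_measurable lf.
- move=> x; have := lipschitz_abs x 0 lf; rewrite subr0.
  by have := ler_normD (f x - f 0) (f 0); rewrite subrK; lra.
- by apply: intgD; [exact: intg_cst|exact: intgZ].
Qed.

(** Any admissible [psi] can be used, not only the maximizer: exp(-psi) / Z has mass at most 1
    because Z is maximal, and the entropy relative to it is bounded below by one minus that mass. *)
Lemma entropy_ge (rho' : probability T R) psi : adm psi -> intg rho' (fun x : T => eucl x) ->
  ((- (\int[rho']_x psi x + ln Z))%:E <= entropy leb rho')%E.
Proof.
move=> ap i1; apply: le_ereal_inf_tmp => _ [f [mf [f0 rf]] <-].
have ip := lipschitz_intg L0 (adm_lip ap) i1.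
have mp : measurable_fun [set: T] psi := intg_measurable ip.
have ipZ : intg rho' (fun x : T => psi x + ln Z) by apply: intgD => //; exact: intg_cst.
have ie := adm_expN Hleb Hmu th0 L0 ap.
have i2 : intg leb (fun x : T => f x * (psi x + ln Z)).
  have := (integrable_density mf f0 rf (f := fun x : T => psi x + ln Z) (intg_measurable ipZ)).1 ipZ.
  by congr (_.-integrable _ _); apply/funext => x /=; rewrite mulrC.
have i3 : intg leb f.
  have := (integrable_density mf f0 rf (f := fun x : T => 1) (measurable_cst _)).1 (intg_cst rho' 1).
  by congr (_.-integrable _ _); apply/funext => x /=; rewrite mul1r.
have eE x : expR (- (psi x + ln Z)) = expR (- psi x) * Z^-1.
  by rewrite opprD expRD -[X in _ * X]invrK -expRN opprK lnK ?posrE.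
have i4 : intg leb (fun x : T => expR (- (psi x + ln Z))).
  by rewrite (_ : (fun x : T => _) = fun x : T => expR (- psi x) * Z^-1); [exact: intgZr|apply/funext].
have i5 : intg leb (fun x : T => - (f x * (psi x + ln Z)) + f x - expR (- (psi x + ln Z))).
  by apply: intgB => //; apply: intgD => //; exact: intgN.
apply: (@le_trans _ _ (\int[leb]_x (- (f x * (psi x + ln Z)) + f x - expR (- (psi x + ln Z))))%:E).
  rewrite lee_fin EEB//; last by apply: intgD => //; exact: intgN.
  rewrite EED//; last exact: intgN.
  rewrite EEN//.
  have -> : \int[leb]_x (f x * (psi x + ln Z)) = \int[rho']_x psi x + ln Z.
    transitivity (\int[leb]_x ((psi x + ln Z) * f x)); first by apply: eq_Rintegral => x _; rewrite mulrC.
    rewrite -(Rintegral_density mf f0 rf (intg_measurable ipZ)) EED//; [by rewrite EE_cst|exact: intg_cst].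
  have -> : \int[leb]_x f x = 1.
    transitivity (\int[leb]_x (1 * f x)); first by apply: eq_Rintegral => x _; rewrite mul1r.
    by rewrite -(Rintegral_density mf f0 rf (measurable_cst _)) EE_cst.
  have : \int[leb]_x expR (- (psi x + ln Z)) <= 1.
    rewrite (eq_Rintegral _ (g := fun x : T => expR (- psi x) * Z^-1)) => [|x _]; last exact: eE.
    by rewrite EEZr// ler_pdivrMr// mul1r; exact: mx.
  lra.
apply: lee_integral_intg => //.
  apply: measurable_funM => //; apply: measurableT_comp => //; exact: measurable_ln.
by move=> x; exact: entropy_ge_gibbs.
Qed.

(** A near-optimal admissible [psi] appears with opposite signs in the entropy bound and in the
    transport bound and cancels, leaving - ln Z. If the measure has no density, the entropy is
    infinite while the transport term stays above a finite value. *)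
Lemma Efun_ge rho' : finite_first_moment rho' -> ((- ln Z)%:E <= Efun leb mu rho')%E.
Proof.
move=> fm; have i1 : intg rho' (fun x : T => eucl x).
  by apply: intg_fin => //; [exact: measurable_eucl|move=> x; exact: eucl_ge0].
have [h|h] := pselect (exists f, density_of leb rho' f); last first.
  rewrite /Efun /entropy (_ : density_of leb rho' = set0) ?image_set0 ?ereal_inf0; last first.
    by apply/seteqP; split => // f df; apply: h; exists f.
  have [G [G1 G2]] := product_law rho' mu.
  have : ((\int[G]_z dotv z.1 z.2)%:E <= Tcost rho' mu)%E.
    apply: ereal_sup_ubound; exists G; first by apply/coupling_law.
    by rewrite EE_fineK//; exact: (intg_dotv Hmu G1 G2 i1).
  by case: (Tcost _ _) => [r||]// _; rewrite leey.
have [f [mf [f0 rf]]] := h.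
have ac (A : set T) : measurable A -> leb A = 0%E -> rho' A = 0%E.
  move=> mA A0; rewrite rf// null_set_integral//.
  by apply: measurable_funTS; exact/measurable_EFinP.
apply/lee_addgt0Pr => e e0; have [G [psi [G1 G2 ap hG]]] := near_optimal Hleb Hmu D0 ac i1 e0.
rewrite -leeBlDr// -EFinB.
have -> : - ln Z - e = - (\int[rho']_x psi x + ln Z) + (\int[rho']_x psi x - e) by lra.
rewrite EFinD; apply: leeD; first exact: entropy_ge.
apply: (@le_trans _ _ (\int[G]_z dotv z.1 z.2)%:E); first by rewrite lee_fin.
apply: ereal_sup_ubound; exists G; first by apply/coupling_law.
by rewrite EE_fineK//; exact: (intg_dotv Hmu G1 G2 i1).
Qed.

Hypothesis rho_m1 : intg rho (fun x : T => eucl x).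

Let ip0 : intg rho (fun x : T => psi0 x). Proof. exact: lipschitz_intg L0 (adm_lip a0) rho_m1. Qed.

Let mPsi : measurable_fun [set: T] (fun x : T => expR (- Psi x)).
Proof.
apply: (measurable_expN (psi := fun x : T => Psi x)); apply: measurable_funD; last exact: measurable_cst.
exact: intg_measurable ip0.
Qed.

Lemma dual_bound {dS} {S : measurableType dS} (P : probability S R) (X M : S -> T) :
  haslaw P X rho -> haslaw P M mu -> \int[P]_s dotv (X s) (M s) <= \int[rho]_x psi0 x + \int[mu]_y phi y.
Proof.
move=> hX hM; rewrite -(haslaw_EE (f := fun x : T => psi0 x) hX (intg_measurable ip0)).
rewrite -(haslaw_EE hM (intg_measurable iphi)) -EED; [|exact: haslaw_intg hX ip0|exact: haslaw_intg hM iphi].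
apply: EE_le_ae.
- exact: (intg_dotv Hmu hX hM).
- by apply: intgD; [exact: haslaw_intg hX ip0|exact: haslaw_intg hM iphi].
- by apply: filterS (haslaw_ae hM dphi) => s; exact.
Qed.

Lemma Efun_le : (Efun leb mu rho <= (- ln Z)%:E)%E.
Proof.
have -> : - ln Z = - (\int[rho]_x psi0 x + ln Z) + \int[rho]_x psi0 x by lra.
rewrite EFinD; apply: leeD.
  apply: ge_ereal_inf; eexists; first by exists (fun x : T => expR (- Psi x)).
  have iP : intg rho (fun x : T => - Psi x) by apply: intgN; apply: intgD => //; exact: intg_cst.
  have i2 : intg leb (fun x : T => - Psi x * expR (- Psi x)).
    exact: ((integrable_density mPsi (fun x => expR_ge0 _) rhoE (intg_measurable iP)).1 iP).
  rewrite (eq_integral (fun x : T => (- Psi x * expR (- Psi x))%:E)) => [|x _]; last by rewrite expRK mulrC.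
  rewrite EE_fineK// -(Rintegral_density mPsi (fun x => expR_ge0 _) rhoE (intg_measurable iP)).
  by rewrite EEN ?EED ?EE_cst//; [exact: intg_cst|apply: intgD => //; exact: intg_cst].
apply: ge_ereal_sup => _ [g /coupling_law[g1 g2] <-].
rewrite EE_fineK; last exact: (intg_dotv Hmu g1 g2 rho_m1).
by rewrite lee_fin; apply: le_trans (dual_bound g1 g2) _; have := phi0; lra.
Qed.

Lemma Mset_gibbs : Mset leb mu rho.
Proof.
split; last by move=> rho' /Efun_ge; exact: le_trans Efun_le.
by rewrite /finite_first_moment EE_fineK// ltry.
Qed.

(** The potential supplied with the near-optimal plan may differ from [psi0], but its [rho]-integral
    is not smaller: 1 + (psi0 - psi) <= exp(psi0 - psi), whose [rho]-mean is partf psi / Z <= 1. *)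
Lemma gibbs_near_opt e : 0 < e -> exists g : probability (T * T)%type R,
  [/\ haslaw g fst rho, haslaw g snd mu &
    \int[rho]_x Psi x + \int[mu]_y (phi y - ln Z) - e <= \int[g]_z dotv z.1 z.2].
Proof.
move=> e0.
have ac (A : set T) : measurable A -> leb A = 0%E -> rho A = 0%E.
  move=> mA A0; rewrite rhoE// null_set_integral//.
  by apply: measurable_funTS; exact/measurable_EFinP.
have [G [psi [G1 G2 ap hG]]] := near_optimal Hleb Hmu D0 ac rho_m1 e0.
exists G; split => //; apply: le_trans hG; rewrite [X in _ + X - _]EEB//; last exact: intg_cst.
rewrite EE_cst [X in X + _ - _]EED//; last exact: intg_cst.
rewrite EE_cst.
have ip := lipschitz_intg L0 (adm_lip ap) rho_m1.
suff : \int[rho]_x psi0 x <= \int[rho]_x psi x by have := phi0; lra.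
have ie := adm_expN Hleb Hmu th0 L0 ap.
have eE x : expR (psi0 x - psi x) * expR (- Psi x) = expR (- psi x) * Z^-1.
  rewrite -expRD /Psi (_ : psi0 x - psi x - _ = - psi x + - ln Z); last by lra.
  by rewrite expRD -[X in _ * X]invrK -expRN opprK lnK ?posrE.
have mq : measurable_fun [set: T] (fun x : T => expR (psi0 x - psi x)).
  by apply: measurableT_comp => //; apply: measurable_funB; [exact: intg_measurable ip0|exact: intg_measurable ip].
have iq : intg rho (fun x : T => expR (psi0 x - psi x)).
  apply/(integrable_density mPsi (fun x => expR_ge0 _) rhoE mq).
  rewrite (_ : (fun x : T => _ * _) = fun x : T => expR (- psi x) * Z^-1); last by apply/funext => x; exact: eE.
  exact: intgZr.
have : \int[rho]_x (1 + (psi0 x - psi x)) <= \int[rho]_x expR (psi0 x - psi x).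
  apply: EE_le => //; last by move=> x; exact: expR_ge1Dx.
  by apply: intgD; [exact: intg_cst|exact: intgB].
rewrite EED; [|exact: intg_cst|exact: intgB].
rewrite EE_cst EEB// (Rintegral_density mPsi (fun x => expR_ge0 _) rhoE mq).
rewrite (eq_Rintegral _ (g := fun x : T => expR (- psi x) * Z^-1)) => [|x _]; last exact: eE.
rewrite EEZr//.
have : \int[leb]_x expR (- psi x) * Z^-1 <= 1 by rewrite ler_pdivrMr// mul1r; exact: mx.
lra.
Qed.

End GibbsMinimizer.

(** Admissibility and the partition function are invariant under translation, so the maximizer can
    be moved to have its Gibbs barycenter at the origin. *)
Lemma centred_maximizer C6 : (\int[leb]_x (expR (- (th / 6 * eucl x)))%:E <= C6%:E)%E ->
  exists psi, [/\ adm psi, forall psi', adm psi' -> partf leb psi' <= partf leb psi,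
    2 ^+ d * expR (- (L * d%:R)) <= partf leb psi &
    forall i, \int[leb]_x ((x : V) 0 i * expR (- psi x)) = 0].
Proof.
move=> HC6; have DL : D <= L by rewrite lerDl.
have [psi [ap mx]] := maximizer Hleb Hmu th0 L0 DL HC6.
have Z1 := le_trans (partf_norm_ge Hleb Hmu th0 L0 DL) (mx _ (adm_norm Hmu L0 DL)).
have Z0 : 0 < partf leb psi by apply: lt_le_trans Z1; rewrite mulr_gt0 ?expR_gt0// exprn_gt0.
have ie := adm_expN Hleb Hmu th0 L0 ap.
have th6 : 0 < th / 6 by rewrite divr_gt0.
have ix i : intg leb (fun x : T => (x : V) 0 i * expR (- psi x)).
  have [B hB] := adm_lin Hmu th0 ap.
  apply: (lin_moment Hleb (p := 1) th6 (adm_measurable L0 ap) hB (measurable_coord i)).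
  by exists 1 => x; rewrite expr1 mul1r; have := coord_le_eucl x i; lra.
pose h : V := \row_i ((\int[leb]_x ((x : V) 0 i * expR (- psi x))) / partf leb psi).
exists (fun x => psi (x + h)); split; first exact: (adm_shift Hmu).
- by rewrite (partf_shift Hleb Hmu th0 L0).
- by rewrite (partf_shift Hleb Hmu th0 L0).
move=> i; pose f (x : T) := ((x : V) 0 i - h 0 i) * expR (- psi x).
transitivity (\int[leb]_x f ((x : V) + h : T)).
  by apply: eq_Rintegral => x _; rewrite /f mxE addrK.
have fE x : f x = (x : V) 0 i * expR (- psi x) - h 0 i * expR (- psi x) by rewrite /f mulrBl.
rewrite (EE_shift Hleb); last first.
  rewrite (_ : f = fun x : T => (x : V) 0 i * expR (- psi x) - h 0 i * expR (- psi x)); last exact/funext.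
  exact: intg_measurable (intgB (ix i) (intgZ _ ie)).
rewrite (eq_Rintegral _ (fun x _ => fE x)) EEB//; last exact: intgZ.
by rewrite EEZ// mxE -/(partf leb psi) divfK ?subrr// gt_eqF.
Qed.

End Nice.

Theorem nice_exists (R : realType) (d : nat) (D th : R) : 0 < th -> 0 <= D ->
  exists C, forall (leb : {measure set (Rd R d) -> \bar R}) (mu : probability (Rd R d) R),
    is_lebesgue leb -> target mu D th -> exists rho Psi phi,
    nice leb mu rho Psi phi (D + 1) (th / 6) C /\ Mset leb mu rho.
Proof.
move=> th0 D0; have L0 : 0 <= D + 1 by rewrite addr_ge0.
have th6 : 0 < th / 6 by rewrite divr_gt0.
have [C6 [C60 hC6]] := integral_exp_decay d 1 th6.
(* [v0] bounds the partition function from below through the competitor (D + 1) |x| on the unit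
   cube; [C6] governs the upper bounds. *)
pose v0 : R := 2 ^+ d * expR (- ((D + 1) * d%:R)).
have v00 : 0 < v0 by rewrite mulr_gt0 ?expR_gt0// exprn_gt0.
(* Radius for the near-minimum x0: since the Gibbs barycenter is 0, each coordinate of x0 times Z is
   at most the integral of |x - x0| exp(- psi), hence at most exp(2/3) C6, and Z >= v0. *)
pose r0 := d%:R * (expR (2 / 3) * C6 / v0).
have r00 : 0 <= r0 by rewrite mulr_ge0// divr_ge0 ?(ltW v00)// mulr_ge0 ?(ltW C60)// expR_ge0.
pose B0 := 3 * (2 / 3 - ln (v0 / C6)).
pose lZ := `|ln v0| + `|2 / 3 + ln C6|.
pose C := `|B0| + (D + 1) * r0 + th / 6 * r0 + 2 / 3 + lZ.
exists C => leb mu Hleb Hmu.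
have mdec : measurable_fun setT (fun x : Rd R d => (1 + eucl x) ^+ 1 * expR (- (th / 6 * eucl x))).
  apply: measurable_funM.
    apply: measurable_funX; apply: measurable_funD; first exact: measurable_cst.
    exact: measurable_eucl.
  apply: (measurable_expN (psi := fun x => th / 6 * eucl x)).
  by apply: measurable_funM; [exact: measurable_cst|exact: measurable_eucl].
have dec0 (x : Rd R d) : 0 <= (1 + eucl x) ^+ 1 * expR (- (th / 6 * eucl x)).
  by rewrite mulr_ge0 ?expR_ge0// expr1 addr_ge0// eucl_ge0.
have [idec Edec] := EE_lee mdec dec0 (hC6 leb Hleb).
have HC6 : (\int[leb]_x (expR (- (th / 6 * eucl x)))%:E <= C6%:E)%E.
  apply: le_trans (hC6 leb Hleb); apply: ge0_le_integral => //.
  - apply/measurable_EFinP; apply: (measurable_expN (psi := fun x => th / 6 * eucl x)).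
    by apply: measurable_funM; [exact: measurable_cst|exact: measurable_eucl].
  - exact/measurable_EFinP.
  - by move=> x _; rewrite lee_fin ler_peMl ?expR_ge0// expr1 lerDl eucl_ge0.
have [psi [ap mx Zv ctr]] := centred_maximizer Hleb Hmu th0 D0 HC6.
have [x0 hx0] := adm_growth Hmu th0 ap.
have Zu := partf_le Hleb Hmu th0 L0 HC6 ap hx0.
have ie := adm_expN Hleb Hmu th0 L0 ap.
set Z := partf leb psi in Zv Zu; have Z0 : 0 < Z by exact: lt_le_trans v00 Zv.
have p0 := adm_ge0 Hmu x0 ap.
have mpsi := adm_measurable L0 ap.
have x0B : psi x0 <= B0.
  have := le_trans Zv Zu; rewrite -/v0 -ler_pdivrMr// -[X in X <= _]lnK ?posrE ?divr_gt0//.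
  by rewrite ler_expR /B0; lra.
have x0r : eucl x0 <= r0.
  apply: eucl_le_max => i; rewrite ler_pdivlMr//.
  have ix : intg leb (fun x : Rd R d => (x : 'rV[R]_d) 0 i * expR (- psi x)).
    have [B hB] := adm_lin Hmu th0 ap.
    apply: (lin_moment Hleb (p := 1) th6 mpsi hB (measurable_coord i)).
    by exists 1 => x; rewrite expr1 mul1r; have := coord_le_eucl x i; clear; lra.
  apply: (@le_trans _ _ (`|x0 0 i| * Z)); first by rewrite ler_wpM2l.
  have -> : `|x0 0 i| * Z = `|\int[leb]_x ((x : 'rV[R]_d) 0 i * expR (- psi x) - x0 0 i * expR (- psi x))|.
    by rewrite EEB//; [rewrite ctr sub0r normrN EEZ// normrM [`|\int[_]_x _|]gtr0_norm|exact: intgZ].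
  apply: le_trans (EE_abs (intgB ix (intgZ _ ie))) _.
  pose dc (x : Rd R d) := (1 + eucl x) ^+ 1 * expR (- (th / 6 * eucl x)).
  have is0 := intg_shift Hleb (- x0) idec.
  apply: (@le_trans _ _ (\int[leb]_x (expR (2 / 3) * dc ((x : 'rV[R]_d) - x0 : Rd R d)))).
    apply: EE_le; [by apply: intg_norm; apply: intgB => //; exact: intgZ|exact: intgZ|].
    move=> x; rewrite -mulrBl normrM (ger0_norm (expR_ge0 _)) /dc mulrCA -expRD.
    apply: ler_pM => //.
      rewrite expr1; have := coord_le_eucl (x - x0) i; rewrite !mxE.
      by have := eucl_ge0 (x - x0); lra.
    by rewrite ler_expR; have := hx0 x; have := p0; lra.
  rewrite EEZ; last exact: is0.
  apply: ler_wpM2l; first exact: expR_ge0.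
  by rewrite (EE_shift Hleb (- x0) mdec); exact: Edec.
have lnZ : `|ln Z| <= lZ.
  have h1 : ln v0 <= ln Z by rewrite ler_ln ?posrE.
  have h2 : ln Z <= 2 / 3 + ln C6.
    rewrite -ler_expR expRD !lnK ?posrE//; apply: le_trans Zu _.
    by rewrite ler_wpM2r ?(ltW C60)// ler_expR; lra.
  rewrite ler_norml /lZ; have := ler_norm (- ln v0); rewrite normrN.
  have := ler_norm (2 / 3 + ln C6); have := normr_ge0 (ln v0); have := normr_ge0 (2 / 3 + ln C6).
  by move: `|ln v0| `|_ + _| => a b; lra.
have lZ1 := ler_norm (ln Z); have lZ2 := ler_norm (- ln Z); rewrite normrN in lZ2.
pose Psi x := psi x + ln Z.
have mPsi : measurable_fun setT (fun x : Rd R d => expR (- Psi x)).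
  apply: (measurable_expN (psi := fun x => Psi x)); apply: measurable_funD => //; exact: measurable_cst.
have eE x : expR (- Psi x) = expR (- psi x) * Z^-1.
  by rewrite /Psi opprD expRD -[X in _ * X]invrK -expRN opprK lnK ?posrE.
have [|rho rhoE] := density_probability mPsi (fun x => expR_ge0 _) (m := leb).
  have i1 : intg leb (fun x : Rd R d => expR (- psi x) * Z^-1) by exact: intgZr.
  rewrite (eq_integral (fun x : Rd R d => (expR (- psi x) * Z^-1)%:E)) => [|x _]; last by rewrite eE.
  by rewrite EE_fineK// EEZr// mulfV// gt_eqF.
have Plo x : th / 6 * eucl x - C <= Psi x.
  have h1 := hx0 x; have h2 := ler_wpM2l (ltW th6) (eucl_sub_le x x0).
  have h3 := ler_wpM2l (ltW th6) x0r; have h4 : 0 <= (D + 1) * r0 by rewrite mulr_ge0.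
  have h5 := normr_ge0 B0; rewrite /C /Psi; rewrite mulrBr in h2.
  by move: p0 lnZ lZ2 h1 h2 h3 h4 h5; move: `|ln Z| `|B0| (_ * r0) (_ * r0) (_ * eucl x0) => a b p q s; clear; lra.
have rho1 : intg rho (fun x : Rd R d => eucl x).
  apply/(integrable_density mPsi (fun x => expR_ge0 _) rhoE (measurable_eucl _)) => //.
  apply: (lin_moment Hleb (p := 1) th6 _ Plo (measurable_eucl _)) => //.
    by apply: measurable_funD => //; exact: measurable_cst.
  by exists 1 => x; rewrite expr1 mul1r ger0_norm ?eucl_ge0// lerDr.
have [phi [iphi phi0 dphi]] := dual_potential Hmu D0 ap.
exists rho, Psi, (fun y => phi y - ln Z); split; last exact: (Mset_gibbs Hleb Hmu th0 D0 ap mx Z0 iphi phi0 dphi rhoE rho1).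
split => //.
- by move=> x x'; have := adm_lip ap x x'; rewrite /Psi; clear; lra.
- by apply: convexfD; [exact: adm_convex ap|move=> x x' t _; clear; lra].
- move=> x; have h1 := adm_lip ap x x0; have h2 := ler_wpM2l L0 (euclB_le x x0).
  have h3 := ler_wpM2l L0 x0r; have h4 := ler_norm B0; have h5 : 0 <= th / 6 * r0 by rewrite mulr_ge0// ltW.
  rewrite mulrDr in h2; rewrite /C /Psi.
  by move: x0B lnZ lZ1 h1 h2 h3 h4 h5; move: `|ln Z| `|B0| (_ * r0) (_ * r0) (_ * eucl x0) => a b p q s; clear; lra.
- move=> i; rewrite (Rintegral_density mPsi (fun x => expR_ge0 _) rhoE (measurable_coord i)).
  have ix : intg leb (fun x : Rd R d => (x : 'rV[R]_d) 0 i * expR (- psi x)).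
    have [B hB] := adm_lin Hmu th0 ap.
    apply: (lin_moment Hleb (p := 1) th6 mpsi hB (measurable_coord i)).
    by exists 1 => x; rewrite expr1 mul1r; have := coord_le_eucl x i; clear; lra.
  rewrite (eq_Rintegral _ (g := fun x : Rd R d => (x : 'rV[R]_d) 0 i * expR (- psi x) * Z^-1)) => [|x _]; last first.
    by rewrite eE mulrA.
  by rewrite EEZr// ctr mul0r.
- by apply: intgB => //; exact: intg_cst.
- by apply: filterS dphi => y h x; rewrite /Psi; have := h x; clear; lra.
- move=> e e0; exact: (gibbs_near_opt Hleb Hmu th0 D0 ap mx Z0 iphi phi0 rhoE rho1 e0).
Qed.

(** * Score, virial and energy estimates *)

(** From exp(r) <= 1 / (1 - r) and (1 + r + 2 r^2) (1 - r) = 1 + r^2 (1 - 2 r) >= 1. *)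
Lemma expR_le_quad {R : realType} (r : R) : r <= 2^-1 -> expR r <= 1 + r + 2 * r ^+ 2.
Proof.
move=> r2; have e0 := expR_gt0 r; have := expR_ge1Dx (- r); rewrite expRN => h.
have r1 : 0 < 1 - r by lra.
have : expR r * (1 - r) <= 1 by rewrite mulrC -ler_pdivlMr// div1r.
have : 1 <= (1 + r + 2 * r ^+ 2) * (1 - r).
  by rewrite (_ : _ * _ = 1 + r ^+ 2 * (1 - 2 * r)); [rewrite lerDl mulr_ge0 ?sqr_ge0//; lra|ring].
by move=> h1 h2; rewrite -(ler_pM2r r1); exact: le_trans h2 h1.
Qed.

Section NiceTheory.
Context {R : realType} {d : nat} (leb : {measure set (Rd R d) -> \bar R}).
Hypothesis Hleb : is_lebesgue leb.
Local Notation T := (Rd R d).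
Local Notation V := 'rV[R]_d.
Variables (mu rho : probability T R) (Psi : V -> R) (phi : T -> R) (D th L c C : R).
Hypotheses (Hmu : target mu D th) (D0 : 0 <= D) (L0 : 0 < L) (c0 : 0 < c).
Hypothesis N : nice leb mu rho Psi phi L c C.

(** Density of a translate of [rho] with respect to [rho]: a function evaluated at x - tau has the
    same [rho]-mean as the function times [ratio tau]. *)
Definition ratio (tau x : V) : R := expR (Psi x - Psi (x + tau)).
Local Notation J := (\int[rho]_x Psi x + \int[mu]_y phi y).

Lemma nice_mPsi : measurable_fun [set: T] Psi.
Proof. by apply: lipschitz_measurable (nice_lip N); exact: ltW. Qed.

Lemma nice_mk : measurable_fun [set: T] (fun x : T => expR (- Psi x)).
Proof. by apply: (measurable_expN (psi := fun x : T => Psi x)); exact: nice_mPsi. Qed.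

Lemma nice_moment p (f : T -> R) A : measurable_fun setT f ->
  (forall x, `|f x| <= A * (1 + eucl x) ^+ p) -> intg rho f.
Proof.
move=> mf hA; apply/(integrable_density nice_mk (fun x => expR_ge0 _) (nice_dens N) mf).
by apply: (lin_moment Hleb c0 nice_mPsi (nice_lo N) mf); exists A.
Qed.

Lemma nice_pow p : intg rho (fun x : T => eucl x ^+ p).
Proof.
apply: (@nice_moment p _ 1); first by apply: measurable_funX; exact: measurable_eucl.
move=> x; rewrite mul1r ger0_norm ?exprn_ge0 ?eucl_ge0//.
by apply: lerXn2r; rewrite ?nnegrE ?addr_ge0 ?eucl_ge0// lerDr.
Qed.

Lemma nice_eucl : intg rho (fun x : T => eucl x).
Proof. exact: (nice_pow 1). Qed.

Lemma nice_coord i : intg rho (fun x : T => (x : V) 0 i).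
Proof. by apply: intg_le nice_eucl; [exact: measurable_coord|move=> x; exact: coord_le_eucl]. Qed.

Lemma nice_iPsi : intg rho (fun x : T => Psi x).
Proof. exact: lipschitz_intg (ltW L0) (nice_lip N) nice_eucl. Qed.

Lemma nice_ac (A : set T) : measurable A -> leb A = 0%E -> rho A = 0%E.
Proof.
move=> mA A0; rewrite (nice_dens N)// null_set_integral//.
by apply: measurable_funTS; apply/measurable_EFinP; exact: nice_mk.
Qed.

Lemma measurable_ratio tau : measurable_fun [set: T] (fun x : T => ratio tau x).
Proof.
rewrite /ratio; apply: measurableT_comp => //; apply: measurable_funB; first exact: nice_mPsi.
by apply: (@measurable_fun_shift _ _ tau (fun x : T => Psi x)); exact: nice_mPsi.
Qed.

Lemma nice_shift (tau : V) (f : T -> R) : measurable_fun setT f ->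
  \int[rho]_x f ((x : V) + tau : T) = \int[rho]_x (f x * ratio (- tau) x).
Proof.
move=> mf.
rewrite (Rintegral_density nice_mk (fun x => expR_ge0 _) (nice_dens N)); last exact: measurable_fun_shift.
rewrite (Rintegral_density nice_mk (fun x => expR_ge0 _) (nice_dens N)); last first.
  by apply: measurable_funM => //; exact: measurable_ratio.
pose g (x : T) := f x * expR (- Psi ((x : V) - tau)).
transitivity (\int[leb]_x g ((x : V) + tau : T)).
  by apply: eq_Rintegral => x _; rewrite /g addrK.
rewrite (EE_shift Hleb); last first.
  apply: measurable_funM => //.
  by apply: (@measurable_fun_shift _ _ (- tau) (fun x : T => expR (- Psi x))); exact: nice_mk.
by apply: eq_Rintegral => x _; rewrite /g /ratio -mulrA -expRD; congr (_ * expR _); lra.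
Qed.

Lemma ratio_near1 tau x : L * eucl tau <= 2^-1 -> `|ratio tau x - 1| <= 2 * (L * eucl tau).
Proof.
move=> h; have h1 := lipschitz_abs x (x + tau) (nice_lip N).
rewrite opprD addrA subrr sub0r euclN in h1; rewrite /ratio.
move: h1; set r := Psi x - _ => h1.
have r2 : r <= 2^-1 by apply: le_trans h; apply: le_trans h1; exact: ler_norm.
have := expR_le_quad r2; have := expR_ge1Dx r.
have e0 := eucl_ge0 tau; move: h h1; move: (L * eucl tau) => q; rewrite expr2 !ler_norml; move: (expR r) => e; nra.
Qed.

Lemma ratio_le2 tau x : L * eucl tau <= 2^-1 -> ratio tau x <= 2.
Proof. by move=> h; have := ratio_near1 x h; rewrite ler_norml; lra. Qed.

Lemma ratio_ge0 tau x : 0 <= ratio tau x. Proof. exact: expR_ge0. Qed.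

Lemma ratio_mean tau : \int[rho]_x ratio tau x = 1.
Proof.
have := nice_shift (- tau) (f := fun=> 1) (measurable_cst _); rewrite EE_cst opprK => ->.
by apply: eq_Rintegral => x _; rewrite mul1r.
Qed.

Section Joint.
Context {dS : measure_display} {S : measurableType dS} (P : probability S R) (X M : S -> T).
Hypotheses (hX : haslaw P X rho) (hM : haslaw P M mu).

Lemma nice_idot : intg P (fun s => dotv (X s) (M s)).
Proof. exact: (intg_dotv Hmu hX hM nice_eucl). Qed.

Lemma nice_dual_bound : \int[P]_s dotv (X s) (M s) <= J.
Proof.
rewrite -(haslaw_EE (f := fun x : T => Psi x) hX nice_mPsi) -(haslaw_EE hM (intg_measurable (nice_phi N))).
have i1 := haslaw_intg hX nice_iPsi; have i2 := haslaw_intg hM (nice_phi N).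
rewrite -EED//; apply: EE_le_ae; [exact: nice_idot|exact: intgD|].
by apply: filterS (haslaw_ae hM (nice_dual N)) => s; exact.
Qed.

Variable sl : R.
Hypothesis near_opt : J - sl <= \int[P]_s dotv (X s) (M s).
Let Z (tau : V) s := ratio tau (X s) - 1 + dotv tau (M s).

Let iratio tau : L * eucl tau <= 2^-1 -> intg P (fun s => ratio tau (X s)).
Proof.
move=> h; apply: (@intg_bounded _ _ _ _ _ 2).
  exact: (measurableT_comp (measurable_ratio tau) (law_mfun hX)).
by move=> s; rewrite ger0_norm ?ratio_ge0//; exact: ratio_le2.
Qed.

Let iZ tau : L * eucl tau <= 2^-1 -> intg P (Z tau).
Proof.
move=> h; apply: intgD; first by apply: intgB; [exact: iratio|exact: intg_cst].
exact: (haslaw_intg hM (target_dotv Hmu tau)).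
Qed.

(** Finite-difference form of grad Psi(X) = M. The dual inequality at X + tau bounds Z from above by
    the slack plus 2 (L |tau|)^2, and Z has mean zero since translation preserves mass and [mu] is
    centered. A centered variable with such an upper bound B satisfies E|Z| <= 2 E B. *)
Lemma score tau : L * eucl tau <= 2^-1 ->
  \int[P]_s `|Z tau s| <= 2 * (sl + 2 * (L * eucl tau) ^+ 2).
Proof.
move=> h; pose Sl s := Psi (X s) + phi (M s) - dotv (X s) (M s).
have i1 := haslaw_intg hX nice_iPsi; have i2 := haslaw_intg hM (nice_phi N).
have iSl : intg P Sl by apply: intgB; [exact: intgD|exact: nice_idot].
have ESl : \int[P]_s Sl s <= sl.
  rewrite EEB; [|exact: intgD|exact: nice_idot].
  rewrite EED// (haslaw_EE (f := fun x : T => Psi x) hX nice_mPsi) (haslaw_EE hM (intg_measurable (nice_phi N))).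
  by have := near_opt; lra.
have EZ : \int[P]_s Z tau s = 0.
  rewrite EED; [|by apply: intgB; [exact: iratio|exact: intg_cst]|exact: (haslaw_intg hM (target_dotv Hmu tau))].
  rewrite EEB; [|exact: iratio|exact: intg_cst].
  rewrite EE_cst (haslaw_EE (f := fun x : T => ratio tau x) hX (measurable_ratio tau)) ratio_mean.
  rewrite (haslaw_EE hM (intg_measurable (target_dotv Hmu tau))) (target_EE Hmu); lra.
pose B s := 2 * (Sl s + 2 * (L * eucl tau) ^+ 2).
have iB : intg P B by apply: intgZ; apply: intgD => //; exact: intg_cst.
apply: (@le_trans _ _ (\int[P]_s (B s - Z tau s))).
  apply: EE_le_ae; [by apply: intg_norm; exact: iZ|by apply: intgB => //; exact: iZ|].
  apply: filterS (haslaw_ae hM (nice_dual N)) => s hs.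
  have S0 : 0 <= Sl s by have := hs (X s); rewrite /Sl; lra.
  have h1 := lipschitz_abs (X s) (X s + tau) (nice_lip N).
  rewrite opprD addrA subrr sub0r euclN in h1.
  have r2 : Psi (X s) - Psi (X s + tau) <= 2^-1.
    by apply: le_trans h; apply: le_trans h1; exact: ler_norm.
  have h2 := expR_le_quad r2; have := hs (X s + tau); rewrite dotvDl => h3.
  have h4 : (Psi (X s) - Psi (X s + tau)) ^+ 2 <= (L * eucl tau) ^+ 2.
    rewrite -[leLHS]real_normK ?num_real//; apply: lerXn2r => //; rewrite nnegrE//.
    by apply: le_trans h1.
  have zB : Z tau s <= Sl s + 2 * (L * eucl tau) ^+ 2.
    rewrite /Z /ratio /Sl; move: h2 h3 h4; move: (expR _) (_ ^+ 2) (_ ^+ 2) => p q q'; lra.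
  have q0 : 0 <= (L * eucl tau) ^+ 2 by exact: sqr_ge0.
  rewrite /B; have [z0|z0] := leP 0 (Z tau s); [rewrite ger0_norm//|rewrite ltr0_norm//]; lra.
rewrite EEB//; last exact: iZ.
rewrite EZ subr0 EEZ; last by apply: intgD => //; exact: intg_cst.
rewrite EED//; last exact: intg_cst.
by rewrite EE_cst; lra.
Qed.

(** An unbounded weight is cut at level A through |W| <= A + W^2 / A. The first part multiplies the
    second-order L^1 bound on Z, the second only the pointwise bound |Z| <= (2 L + D) |tau|. *)
Lemma score_weighted tau (W : S -> R) A : L * eucl tau <= 2^-1 -> 0 < A ->
  measurable_fun setT W -> intg P (fun s => W s ^+ 2) ->
  intg P (fun s => W s * Z tau s) /\
  `|\int[P]_s (W s * Z tau s)| <= A * (2 * (sl + 2 * (L * eucl tau) ^+ 2)) +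
    (2 * L + D) * eucl tau * (\int[P]_s W s ^+ 2) / A.
Proof.
move=> h A0 mW iW; have e0 := eucl_ge0 tau.
pose K := (2 * L + D) * eucl tau.
have K0 : 0 <= K by rewrite mulr_ge0// addr_ge0// mulr_ge0// ltW.
have Zb : {ae P, forall s, `|Z tau s| <= K}.
  apply: filterS (haslaw_ae hM (target_le Hmu)) => s hs.
  have h1 := ratio_near1 (X s) h; have h2 := dotv_abs_le tau (M s).
  have h3 := ler_wpM2l e0 hs; have := ler_normD (ratio tau (X s) - 1) (dotv tau (M s)).
  by rewrite -/(Z tau s) /K mulrDl; move: h1 h2 h3; move: `|_ - 1| `|dotv _ _| `|Z _ _| => p q z; lra.
have ib : intg P (fun s => A * `|Z tau s| + K / A * W s ^+ 2).
  by apply: intgD; apply: intgZ => //; apply: intg_norm; exact: iZ.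
have le1 : {ae P, forall s, `|W s * Z tau s| <= A * `|Z tau s| + K / A * W s ^+ 2}.
  apply: filterS Zb => s hs; rewrite normrM.
  have w1 : `|W s| <= A + W s ^+ 2 / A.
    rewrite -[W s ^+ 2]real_normK ?num_real// -(ler_pM2r A0) mulrDl divfK ?gt_eqF//.
    have := normr_ge0 (W s); move: `|W s| => w; nra.
  have z0 := normr_ge0 (Z tau s).
  have : `|W s| * `|Z tau s| <= (A + W s ^+ 2 / A) * `|Z tau s| by exact: ler_wpM2r.
  have : W s ^+ 2 / A * `|Z tau s| <= W s ^+ 2 / A * K.
    by apply: ler_wpM2l => //; rewrite divr_ge0 ?sqr_ge0// ltW.
  rewrite mulrDl (_ : K / A * W s ^+ 2 = W s ^+ 2 / A * K); last by rewrite mulrC mulrA mulrAC.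
  by move=> h1 h2; apply: le_trans h2 _; rewrite lerD2l.
have iWZ : intg P (fun s => W s * Z tau s).
  by apply: intg_ae_le _ ib le1; apply: measurable_funM => //; exact: intg_measurable (iZ h).
split => //; apply: le_trans (EE_abs iWZ) _.
apply: le_trans (EE_le_ae (intg_norm iWZ) ib le1) _.
rewrite EED; [|by apply: intgZ; apply: intg_norm; exact: iZ|exact: intgZ].
rewrite !EEZ//; last by apply: intg_norm; exact: iZ.
apply: lerD; first by apply: ler_wpM2l; [exact: ltW|exact: score].
by rewrite mulrAC.
Qed.

End Joint.
End NiceTheory.

Section Energy.
Context {R : realType} {d : nat} (leb : {measure set (Rd R d) -> \bar R}).
Hypothesis Hleb : is_lebesgue leb.
Local Notation T := (Rd R d).
Local Notation V := 'rV[R]_d.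
Variables (mu rho : probability T R) (Psi : V -> R) (phi : T -> R) (D th L c C : R).
Hypotheses (Hmu : target mu D th) (D0 : 0 <= D) (L0 : 0 < L) (c0 : 0 < c).
Hypothesis N : nice leb mu rho Psi phi L c C.
Local Notation J := (\int[rho]_x Psi x + \int[mu]_y phi y).

Let mratio := measurable_ratio L0 N.
Let ipow := nice_pow Hleb L0 c0 N.
Let ieucl := nice_eucl Hleb L0 c0 N.
Let icoord := nice_coord Hleb L0 c0 N.

(** Integration by parts, discretely: the score along t e_i is tested against X_i. Translating [rho]
    by t e_i moves the mean of X_i by t, which produces the 1 for each coordinate. *)
Lemma virial_le A t : 0 < A -> 0 < t -> L * t <= 2^-1 ->
  J <= d%:R * (1 + (2 * A * (1 + 2 * L ^+ 2) * t + (2 * L + D) * (\int[rho]_x eucl x ^+ 2) / A)) + t ^+ 2.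
Proof.
move=> A0 t0 Lt; have t20 : 0 < t ^+ 2 by rewrite exprn_gt0.
have [g [g1 g2 hg]] := nice_opt N t20.
set m2 := \int[rho]_x eucl x ^+ 2.
have LD : 0 <= 2 * L + D by rewrite addr_ge0// mulr_ge0// ltW.
have ixm i : intg g (fun z : T * T => (z.1 : V) 0 i * (z.2 : V) 0 i).
  apply: (@intg_ae_le _ _ _ _ _ (fun z : T * T => D * eucl z.1)).
  - by apply: measurable_funM; apply: measurable_coord_comp.
  - by apply: intgZ; exact: haslaw_intg g1 ieucl.
  - apply: filterS (haslaw_ae g2 (target_le Hmu)) => z hz; rewrite normrM mulrC.
    apply: ler_pM => //; last exact: coord_le_eucl.
    by apply: le_trans hz; exact: coord_le_eucl.
have key i : \int[g]_z ((z.1 : V) 0 i * (z.2 : V) 0 i) <=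
    1 + (2 * A * (1 + 2 * L ^+ 2) * t + (2 * L + D) * m2 / A).
  pose tau : V := t *: delta_mx 0 i.
  have taut : eucl tau = t.
    by rewrite euclZ (gtr0_norm t0) /eucl dotv_delta mxE !eqxx sqrtr1 mulr1.
  have Ltau : L * eucl tau <= 2^-1 by rewrite taut.
  have i2 : intg g (fun z : T * T => (z.1 : V) 0 i ^+ 2).
    apply: (@intg_le _ _ _ _ _ (fun z : T * T => eucl z.1 ^+ 2)).
    - by apply: measurable_funX; exact: measurable_coord_comp.
    - by move=> z; rewrite normrX; apply: lerXn2r; rewrite ?nnegrE ?eucl_ge0//; exact: coord_le_eucl.
    - exact: haslaw_intg g1 (ipow 2).
  have m2i : \int[g]_z (z.1 : V) 0 i ^+ 2 <= m2.
    rewrite /m2 -(haslaw_EE g1 (intg_measurable (ipow 2))); apply: EE_le => //; first exact: haslaw_intg g1 (ipow 2).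
    move=> z; rewrite -[leLHS]real_normK ?num_real//; apply: lerXn2r; rewrite ?nnegrE ?eucl_ge0//.
    exact: coord_le_eucl.
  have mW : measurable_fun setT (fun z : T * T => (z.1 : V) 0 i) by exact: measurable_coord_comp.
  have [iWZ hWZ] := score_weighted Hleb Hmu D0 L0 c0 N g1 g2 hg Ltau A0 mW i2.
  have ir : intg g (fun z : T * T => (z.1 : V) 0 i * ratio Psi tau z.1).
    apply: (@intg_le _ _ _ _ _ (fun z : T * T => 2 * eucl z.1)).
    - by apply: measurable_funM => //; exact: (measurableT_comp (mratio tau) (law_mfun g1)).
    - move=> z; rewrite normrM mulrC; apply: ler_pM => //; last exact: coord_le_eucl.
      by rewrite ger0_norm ?ratio_ge0//; exact: (ratio_le2 N).
    - by apply: intgZ; exact: haslaw_intg g1 ieucl.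
  have ic := haslaw_intg g1 (icoord i).
  have EWZ : \int[g]_z ((z.1 : V) 0 i * (ratio Psi tau z.1 - 1 + dotv tau z.2)) =
     - t + t * \int[g]_z ((z.1 : V) 0 i * (z.2 : V) 0 i).
    rewrite (eq_Rintegral _ (g := fun z : T * T => (z.1 : V) 0 i * ratio Psi tau z.1 - (z.1 : V) 0 i +
       t * ((z.1 : V) 0 i * (z.2 : V) 0 i))) => [|z _]; last first.
      by rewrite dotvZl dotvC dotv_delta; ring.
    rewrite EED; [|exact: intgB|by apply: intgZ; exact: ixm].
    rewrite EEB// EEZ; last exact: ixm.
    rewrite (haslaw_EE (f := fun x : T => (x : V) 0 i) g1 (measurable_coord i)) (nice_ctr N) subr0.
    congr (_ + _).
    rewrite (haslaw_EE (f := fun x : T => (x : V) 0 i * ratio Psi tau x) g1); last first.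
      by apply: measurable_funM => //; exact: measurable_coord.
    have := nice_shift Hleb L0 N (- tau) (measurable_coord i); rewrite opprK => <-.
    rewrite (eq_Rintegral _ (g := fun x : T => (x : V) 0 i - t)) => [|x _]; last by rewrite !mxE !eqxx mulr1.
    by rewrite EEB//; [rewrite (nice_ctr N) EE_cst sub0r|exact: intg_cst].
  have h1 : - t + t * \int[g]_z ((z.1 : V) 0 i * (z.2 : V) 0 i) <=
    A * (2 * (t ^+ 2 + 2 * (L * t) ^+ 2)) + (2 * L + D) * t * m2 / A.
    rewrite -EWZ; apply: le_trans (ler_norm _) _; apply: le_trans hWZ _; rewrite taut lerD2l.
    rewrite ler_pM2r ?invr_gt0//; apply: ler_wpM2l => //; by rewrite mulr_ge0// ltW.
  rewrite -(ler_pM2l t0) mulrDr mulr1; move: h1.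
  rewrite (_ : t * (_ + _) = A * (2 * (t ^+ 2 + 2 * (L * t) ^+ 2)) + (2 * L + D) * t * m2 / A); last by ring.
  by rewrite [- t + _]addrC lerBlDl.
have : \int[g]_z dotv z.1 z.2 <= d%:R * (1 + (2 * A * (1 + 2 * L ^+ 2) * t + (2 * L + D) * m2 / A)).
  rewrite /dotv EE_sum//; apply: le_trans (ler_sum _ (fun i _ => key i)) _.
  by rewrite sumr_const card_ord [leRHS]mulr_natl.
by move: hg; move: (d%:R * _) => q; lra.
Qed.

(** The errors vanish when A is sent to infinity and t to 0, in this order. *)
Lemma virial : J <= d%:R.
Proof.
rewrite leNgt; apply/negP => Jd; pose dl := J - d%:R; have dl0 : 0 < dl by rewrite subr_gt0.
set m2 := \int[rho]_x eucl x ^+ 2.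
have m20 : 0 <= m2 by apply: EE_ge0 => x; rewrite exprn_ge0// eucl_ge0.
pose K := d%:R * ((2 * L + D) * m2).
have K0 : 0 <= K by rewrite mulr_ge0// mulr_ge0// addr_ge0// mulr_ge0// ltW.
pose A := 4 * K / dl + 1.
have A0 : 0 < A by rewrite ltr_wpDl// divr_ge0 ?(ltW dl0)// mulr_ge0.
have KA : K / A <= dl / 4.
  rewrite ler_pdivrMr// /A mulrDr mulr1 (_ : dl / 4 * _ = K); last by field; rewrite gt_eqF.
  by rewrite lerDl divr_ge0// ltW.
pose B := 1 + d%:R * (2 * A * (1 + 2 * L ^+ 2)).
have B0 : 0 < B by rewrite ltr_pwDl// mulr_ge0// mulr_ge0 ?mulr_ge0 ?(ltW A0)// addr_ge0// mulr_ge0// sqr_ge0.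
pose t := Num.min 1 (Num.min ((2 * L)^-1) (dl / (4 * B))).
have t0 : 0 < t by rewrite !lt_min ltr01 invr_gt0 mulr_gt0//= divr_gt0// mulr_gt0.
have t1 : t <= 1 by rewrite ge_min lexx.
have tL : L * t <= 2^-1.
  rewrite mulrC -ler_pdivlMr// -invfM; rewrite !ge_min; apply/orP; right; by rewrite [2 * L]mulrC lexx.
have tB : t * B <= dl / 4.
  have : t <= dl / (4 * B) by rewrite !ge_min lexx !orbT.
  by rewrite ler_pdivlMr ?mulr_gt0//; lra.
have := virial_le A0 t0 tL; rewrite -/m2 mulrDr mulr1 mulrDr => h.
have e1 : d%:R * (2 * A * (1 + 2 * L ^+ 2) * t) = B * t - t by rewrite /B; ring.
have e2 : d%:R * ((2 * L + D) * m2 / A) = K / A by rewrite /K; ring.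
rewrite e1 e2 in h; have t2 : t ^+ 2 <= t by rewrite expr2 ler_piMl// ltW.
have : dl <= dl / 2 by rewrite {1}/dl; move: h KA tB t2; rewrite [B * t]mulrC; move: (K / A) (t * B) (t ^+ 2) => p q w; lra.
by lra.
Qed.

Section Joint.
Context {dS : measure_display} {S : measurableType dS} (P : probability S R) (X M Y : S -> T).
Hypotheses (hX : haslaw P X rho) (hM : haslaw P M mu) (mY : measurable_fun setT Y).
Variables (sl sg : R) (u v : V -> R) (Au : R).
Hypothesis near_opt : J - sl <= \int[P]_s dotv (X s) (M s).
Hypothesis iY2 : intg P (fun s => eucl (Y s) ^+ 2).
Local Notation m2 := (\int[P]_s eucl (Y s) ^+ 2).
Hypotheses (mu_ : measurable_fun [set: T] u) (uA : forall x, `|u x| <= Au * (1 + eucl x) ^+ 2).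
Hypothesis fen : forall x y, dotv x y <= u x + v y.
Local Notation sigma s := (u (X s) + v (Y s) - dotv (X s) (Y s)).
Hypotheses (isg : intg P (fun s => sigma s)) (Esg : \int[P]_s sigma s <= sg).

Let iY : intg P (fun s => eucl (Y s)).
Proof.
apply: (@intg_le _ _ _ _ _ (fun s => 1 + eucl (Y s) ^+ 2)); first exact: measurable_eucl.
  by move=> s; rewrite ger0_norm ?eucl_ge0//; move: (eucl_ge0 (Y s)); move: (eucl _) => e; nra.
by apply: intgD => //; exact: intg_cst.
Qed.

Let ibY b : intg P (fun s => dotv b (Y s)).
Proof.
apply: (@intg_le _ _ _ _ _ (fun s => eucl b * eucl (Y s))); last exact: intgZ.
  by apply: measurable_dotv => //; exact: measurable_cst.
by move=> s; exact: dotv_abs_le.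
Qed.

Let iQ b : intg P (fun s => dotv b (Y s) * dotv b (M s)) /\
  `|\int[P]_s (dotv b (Y s) * dotv b (M s))| <= eucl b ^+ 2 * (D * (1 + m2)).
Proof.
have ia : {ae P, forall s, `|dotv b (Y s) * dotv b (M s)| <= eucl b ^+ 2 * (D * (1 + eucl (Y s) ^+ 2))}.
  apply: filterS (haslaw_ae hM (target_le Hmu)) => s hs; rewrite normrM.
  have h1 := dotv_abs_le b (Y s); have h2 := dotv_abs_le b (M s).
  have b0 := eucl_ge0 b; have y0 := eucl_ge0 (Y s).
  apply: (@le_trans _ _ ((eucl b * eucl (Y s)) * (eucl b * D))).
    by apply: ler_pM => //; apply: le_trans h2 _; exact: ler_wpM2l.
  rewrite (_ : _ * _ * _ = eucl b ^+ 2 * (D * eucl (Y s))); last by ring.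
  apply: ler_wpM2l; first exact: sqr_ge0.
  by apply: ler_wpM2l => //; move: (eucl (Y s)) y0 => e; nra.
have ib : intg P (fun s => eucl b ^+ 2 * (D * (1 + eucl (Y s) ^+ 2))).
  by apply: intgZ; apply: intgZ; apply: intgD => //; exact: intg_cst.
have i1 : intg P (fun s => dotv b (Y s) * dotv b (M s)).
  apply: intg_ae_le _ ib ia; apply: measurable_funM.
    by apply: measurable_dotv => //; exact: measurable_cst.
  by apply: measurable_dotv; [exact: measurable_cst|exact: law_mfun hM].
split => //; apply: le_trans (EE_abs i1) _; apply: le_trans (EE_le_ae (intg_norm i1) ib ia) _.
rewrite EEZ; last by apply: intgZ; apply: intgD => //; exact: intg_cst.
rewrite EEZ; last by apply: intgD => //; exact: intg_cst.
by rewrite EED//; [rewrite EE_cst|exact: intg_cst].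
Qed.

Let iu (b : V) : intg rho (fun x : T => u (x + b)).
Proof.
apply: (nice_moment Hleb L0 c0 N (p := 2) (A := `|Au| * (1 + eucl b) ^+ 2)).
  exact: (@measurable_fun_shift _ _ b (fun x : T => u x)).
move=> x; apply: le_trans (uA _) _; rewrite -mulrA -exprMn.
apply: (@le_trans _ _ (`|Au| * (1 + eucl (x + b)) ^+ 2)).
  by apply: ler_wpM2r; [exact: sqr_ge0|exact: ler_norm].
apply: ler_wpM2l => //; have x0 := eucl_ge0 x; have b0 := eucl_ge0 b.
have := eucl_triangle x b; have := eucl_ge0 (x + b).
move: (eucl x) (eucl b) (eucl _) x0 b0 => p q r p0 q0 r0 h; apply: lerXn2r; rewrite ?nnegrE; nra.
Qed.

Definition energy_err (b : V) A := A * (2 * (sl + 2 * (L * eucl b) ^+ 2)) + (2 * L + D) * eucl b ^+ 3 * m2 / A.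

(** Fenchel at x - h b gives u(X) - u(X - h b) <= h b.Y + sigma. Integrating against the translated
    density inserts the factor [ratio], which the score replaces by 1 + t b.M; as [ratio] is at most
    2, the slack sigma is at most doubled. *)
Lemma energy_step (b : V) (A h t : R) : 0 < A -> 0 <= h -> 0 <= t <= 1 -> L * eucl b <= 2^-1 ->
  \int[rho]_x u ((x : V) + t *: b) - \int[rho]_x u ((x : V) + (t - h) *: b) <=
   h * (\int[P]_s dotv b (Y s) + t * \int[P]_s (dotv b (Y s) * dotv b (M s)) + energy_err b A) + 2 * sg.
Proof.
move=> A0 h0 /andP[t0 t1] Lb.
pose f (x : T) := u x - u ((x : V) - h *: b).
pose tau := - (t *: b).
have b0 := eucl_ge0 b.
have etau : eucl tau <= eucl b by rewrite euclN euclZ ger0_norm// ler_piMl.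
have Ltau : L * eucl tau <= 2^-1 by apply: le_trans Lb; apply: ler_wpM2l => //; exact: ltW.
have mf : measurable_fun setT f.
  by apply: measurable_funB => //; exact: (@measurable_fun_shift _ _ (- (h *: b)) (fun x : T => u x)).
have e1 : \int[rho]_x u ((x : V) + t *: b) - \int[rho]_x u ((x : V) + (t - h) *: b) =
    \int[P]_s (f (X s) * ratio Psi tau (X s)).
  rewrite -EEB; [|exact: iu..].
  rewrite (haslaw_EE (f := fun x : T => f x * ratio Psi tau x) hX); last first.
    by apply: measurable_funM => //; exact: mratio.
  rewrite -(nice_shift Hleb L0 N (t *: b) mf); apply: eq_Rintegral => x _.
  by rewrite /f scalerBl addrA.
have irt (F : S -> R) : intg P F -> intg P (fun s => F s * ratio Psi tau (X s)).
  move=> iF; apply: (@intg_le _ _ _ _ _ (fun s => `|F s| * 2)).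
  - apply: measurable_funM; first exact: intg_measurable iF.
    exact: (measurableT_comp (mratio tau) (law_mfun hX)).
  - move=> s; rewrite normrM; apply: ler_wpM2l => //.
    by rewrite ger0_norm ?ratio_ge0//; exact: (ratio_le2 N).
  - by apply: intgZr; exact: intg_norm.
have if_ : intg P (fun s => f (X s)).
  apply: (haslaw_intg (f := f) hX); apply: intgB; last first.
    exact: (iu (- (h *: b))).
  by have := iu 0; congr (intg _ _); apply/funext => x; rewrite addr0.
have sg0 s : 0 <= sigma s by rewrite subr_ge0; exact: fen.
rewrite e1; apply: (@le_trans _ _ (\int[P]_s (h * (dotv b (Y s) * ratio Psi tau (X s)) + 2 * sigma s))).
  apply: EE_le; [exact: irt|by apply: intgD; apply: intgZ => //; exact: irt|].
  move=> s; have r0 := ratio_ge0 Psi tau (X s); have r2 := ratio_le2 N (X s) Ltau.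
  have := sg0 s; have : f (X s) <= h * dotv b (Y s) + sigma s.
    by have := fen (X s - h *: b) (Y s); rewrite dotvBl dotvZl /f; lra.
  move: (sigma s) (ratio _ _ _) r0 r2 (f _) (dotv b _) => w r r0 r2 g q hg w0.
  have h1 := ler_wpM2r r0 hg; have h2 := ler_wpM2l w0 r2; rewrite mulrDl in h1; lra.
rewrite EED; [|by apply: intgZ; exact: irt|exact: intgZ].
rewrite !EEZ//; last exact: irt.
apply: lerD; last by rewrite ler_pM2l.
apply: ler_wpM2l => //.
have mW : measurable_fun setT (fun s => dotv b (Y s)) := intg_measurable (ibY b).
have w2 s : dotv b (Y s) ^+ 2 <= eucl b ^+ 2 * eucl (Y s) ^+ 2.
  rewrite -exprMn -[leLHS]real_normK ?num_real//; apply: lerXn2r; rewrite ?nnegrE ?mulr_ge0 ?eucl_ge0//.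
  exact: dotv_abs_le.
have iW2 : intg P (fun s => dotv b (Y s) ^+ 2).
  apply: (@intg_le _ _ _ _ _ (fun s => eucl b ^+ 2 * eucl (Y s) ^+ 2)); last exact: intgZ.
    exact: measurable_funX.
  by move=> s; rewrite ger0_norm ?sqr_ge0.
have EW2 : \int[P]_s dotv b (Y s) ^+ 2 <= eucl b ^+ 2 * m2.
  by rewrite -EEZ//; apply: EE_le => //; exact: intgZ.
have [iWZ hWZ] := score_weighted Hleb Hmu D0 L0 c0 N hX hM near_opt Ltau A0 mW iW2.
have [iq _] := iQ b.
have -> : \int[P]_s (dotv b (Y s) * ratio Psi tau (X s)) =
   \int[P]_s dotv b (Y s) + t * \int[P]_s (dotv b (Y s) * dotv b (M s)) +
   \int[P]_s (dotv b (Y s) * (ratio Psi tau (X s) - 1 + dotv tau (M s))).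
  rewrite -EEZ// -EED//; last exact: intgZ.
  rewrite -EED//; last by apply: intgD => //; exact: intgZ.
  by apply: eq_Rintegral => s _; rewrite /tau dotvNl dotvZl; ring.
rewrite lerD2l; apply: le_trans (ler_norm _) _; apply: le_trans hWZ _; rewrite /energy_err.
have LD : 0 <= 2 * L + D by rewrite addr_ge0// mulr_ge0// ltW.
have tau0 := eucl_ge0 tau.
apply: lerD.
  apply: ler_wpM2l; first exact: ltW.
  rewrite ler_pM2l// lerD2l ler_pM2l//; apply: lerXn2r; rewrite ?nnegrE ?mulr_ge0 ?(ltW L0)//.
  by rewrite ler_pM2l.
rewrite ler_pM2r ?invr_gt0// -!mulrA; apply: ler_wpM2l => //.
apply: (@le_trans _ _ (eucl b * (eucl b ^+ 2 * m2))); last by rewrite expr2 -!mulrA.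
by apply: ler_pM => //; apply: EE_ge0 => s; exact: sqr_ge0.
Qed.

(** The steps telescope along the segment. The Riemann sum of t over k + 1 intervals gives (1 + 1 /
    (k + 1)) / 2 in place of 1/2, and the slack is paid k + 1 times. *)
Lemma half_energy (b : V) (A : R) k : 0 < A -> L * eucl b <= 2^-1 ->
  \int[rho]_x u ((x : V) + b) - \int[rho]_x u x <= \int[P]_s dotv b (Y s) +
    2^-1 * (1 + k.+1%:R^-1) * \int[P]_s (dotv b (Y s) * dotv b (M s)) + energy_err b A + 2 * k.+1%:R * sg.
Proof.
move=> A0 Lb; pose h : R := k.+1%:R^-1.
have k0 : (0 : R) < k.+1%:R by rewrite ltr0n.
have h0 : 0 <= h by rewrite invr_ge0 ltW.
have hk : h * k.+1%:R = 1 by rewrite mulVf// gt_eqF.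
pose a l := \int[rho]_x u ((x : V) + (l%:R * h) *: b).
set B := \int[P]_s dotv b (Y s); set Q := \int[P]_s (_ * _).
have st l : (l < k.+1)%N -> a l.+1 - a l <= h * (B + (l.+1%:R * h) * Q + energy_err b A) + 2 * sg.
  move=> lk; have t01 : 0 <= l.+1%:R * h <= 1.
    apply/andP; split; first exact: mulr_ge0.
    by rewrite -[leRHS]hk [leRHS]mulrC ler_wpM2r// ler_nat.
  have := energy_step A0 h0 t01 Lb.
  by rewrite (_ : l.+1%:R * h - h = l%:R * h)//; rewrite -natr1 mulrDl mul1r addrK.
have -> : \int[rho]_x u ((x : V) + b) = a k.+1.
  by rewrite /a mulrC hk; apply: eq_Rintegral => x _; rewrite scale1r.
have -> : \int[rho]_x u x = a 0%N.
  by rewrite /a mul0r; apply: eq_Rintegral => x _; rewrite scale0r addr0.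
rewrite -(telescope_sumr a (leq0n k.+1)) big_mkord.
apply: (@le_trans _ _ (\sum_(l < k.+1) (h * (B + (l.+1%:R * h) * Q + energy_err b A) + 2 * sg))).
  by apply: ler_sum => l _; exact: st.
have -> n : \sum_(l < n) (h * (B + (l.+1%:R * h) * Q + energy_err b A) + 2 * sg) =
    n%:R * (h * B + h * energy_err b A + 2 * sg) + 2^-1 * (n%:R * (n%:R + 1)) * h ^+ 2 * Q.
  elim: n => [|n IH]; first by rewrite big_ord0 !mul0r mulr0 !mul0r addr0.
  by rewrite big_ord_recr /= IH -!natr1; move: (n%:R : R) (energy_err b A) => z w; field.
rewrite le_eqVlt; apply/orP; left; apply/eqP.
rewrite -/h; move: hk; move: (k.+1%:R : R) (energy_err b A) => z w hk.
transitivity ((h * z) * B + 2^-1 * (h * z) * (h * z + h) * Q + (h * z) * w + 2 * z * sg); first by ring.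
by rewrite hk; ring.
Qed.

(** Adding the half bounds for b and - b cancels the first-order term E b.Y and doubles the
    quadratic one. *)
Lemma energy_bound (b : V) (A : R) k : 0 < A -> L * eucl b <= 2^-1 ->
  \int[rho]_x (u ((x : V) + b) + u ((x : V) - b) - 2 * u x) <=
    \int[P]_s (dotv b (Y s) * dotv b (M s)) + eucl b ^+ 2 * (D * (1 + m2)) * k.+1%:R^-1 +
    2 * energy_err b A + 4 * k.+1%:R * sg.
Proof.
move=> A0 Lb; have h1 := half_energy k A0 Lb.
have := @half_energy (- b) A k A0; rewrite euclN => /(_ Lb).
have -> : \int[P]_s (dotv (- b) (Y s) * dotv (- b) (M s)) = \int[P]_s (dotv b (Y s) * dotv b (M s)).
  by apply: eq_Rintegral => s _; rewrite !dotvNl mulrNN.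
have -> : \int[P]_s dotv (- b) (Y s) = - \int[P]_s dotv b (Y s).
  by rewrite -EEN//; apply: eq_Rintegral => s _; rewrite dotvNl.
have -> : energy_err (- b) A = energy_err b A by rewrite /energy_err euclN.
have i0 : intg rho (fun x : T => u x).
  by have := iu 0; congr (intg _ _); apply/funext => x; rewrite addr0.
move=> h2; rewrite EEB; [|by apply: intgD; exact: iu|exact: intgZ].
rewrite EED; [|exact: iu..].
rewrite EEZ//; have [_ hQ] := iQ b.
set Q := \int[P]_s (_ * _) in h1 h2 hQ *.
have : Q * k.+1%:R^-1 <= eucl b ^+ 2 * (D * (1 + m2)) * k.+1%:R^-1.
  by apply: ler_wpM2r; [rewrite invr_ge0|apply: le_trans hQ; exact: ler_norm].
move: h1 h2; move: (energy_err b A) (k.+1%:R : R) => w kk; move: (kk^-1) => i.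
move: (eucl b ^+ 2 * _ * i) => z h1 h2 h3; lra.
Qed.

End Joint.
End Energy.

Lemma young_scaled {R : realType} (w p q : R) : 0 < w -> p * q <= w / 2 * p ^+ 2 + (2 * w)^-1 * q ^+ 2.
Proof.
move=> w0; rewrite -subr_ge0.
have -> : w / 2 * p ^+ 2 + (2 * w)^-1 * q ^+ 2 - p * q = (2 * w)^-1 * (w * p - q) ^+ 2.
  by field; rewrite gt_eqF.
by rewrite mulr_ge0 ?sqr_ge0// invr_ge0 mulr_ge0// ltW.
Qed.

Lemma eucl_dist_mid {R : realType} {d : nat} (x y z : 'rV[R]_d) e :
  eucl (x - z) <= e -> eucl (y - z) <= e -> eucl (x - y) <= 2 * e.
Proof.
move=> h1 h2; rewrite mulr2n mulrDl mul1r; apply: le_trans (lerD h1 h2).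
by rewrite [eucl (y - z)]eucl_distC; apply: le_trans (eucl_triangle _ _); rewrite addrA subrK.
Qed.

Section EnergySmall.
Context {R : realType} {d : nat} (leb : {measure set (Rd R d) -> \bar R}).
Hypothesis Hleb : is_lebesgue leb.
Local Notation T := (Rd R d).
Local Notation V := 'rV[R]_d.
Variables (mu rho : probability T R) (Psi : V -> R) (phi : T -> R) (D th L c C : R).
Hypotheses (Hmu : target mu D th) (D0 : 0 <= D) (L0 : 0 < L) (c0 : 0 < c).
Hypothesis N : nice leb mu rho Psi phi L c C.
Local Notation J := (\int[rho]_x Psi x + \int[mu]_y phi y).

(** Quantified over all probability spaces, because the plans to which it is applied live on
    different glued spaces, while the admissible slack must be fixed before the potentials are
    chosen. *)
Definition energy_at (m2 dl R0 r s : R) : Prop :=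
  forall {dS : measure_display} {S : measurableType dS} (P : probability S R) (X M Y : S -> T)
    (u v : V -> R) (Au : R), haslaw P X rho -> haslaw P M mu -> measurable_fun setT Y ->
  J - s <= \int[P]_s dotv (X s) (M s) ->
  intg P (fun s => eucl (Y s) ^+ 2) -> \int[P]_s eucl (Y s) ^+ 2 <= m2 ->
  measurable_fun [set: T] u -> (forall x, `|u x| <= Au * (1 + eucl x) ^+ 2) ->
  (forall x y, dotv x y <= u x + v y) ->
  intg P (fun s => u (X s) + v (Y s) - dotv (X s) (Y s)) ->
  \int[P]_s (u (X s) + v (Y s) - dotv (X s) (Y s)) <= s ->
  forall b, eucl b <= R0 * r ->
  \int[rho]_x (u ((x : V) + b) + u ((x : V) - b) - 2 * u x) <=
    \int[P]_s (dotv b (Y s) * dotv b (M s)) + dl * r ^+ 2.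

Lemma energy_at_le (m2 dl R0 r s s' : R) : s' <= s -> energy_at m2 dl R0 r s -> energy_at m2 dl R0 r s'.
Proof.
move=> ss h dS S P X M Y u v Au hX hM mY no iY EY mu_ uA fen isg Esg.
by apply: (h _ _ _ _ _ _ _ _ _ hX hM mY _ iY EY mu_ uA fen isg (le_trans Esg ss)); apply: le_trans no; rewrite lerD2l lerN2.
Qed.

(** With b of length at most R0 r, the weight b.Y has size r, so the cut is taken at r A1. The
    number of intervals contributes 1/4 of dl r^2, the two parts of the score error 1/4 each, and
    the terms carrying the slack the last 1/4. *)
Lemma energy (m2 dl R0 : R) : 0 <= m2 -> 0 < dl -> 0 < R0 -> exists r0, 0 < r0 /\
  forall r, 0 < r <= r0 -> exists s, 0 < s /\ energy_at m2 dl R0 r s.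
Proof.
move=> m20 dl0 R00.
have LD : 0 <= 2 * L + D by rewrite addr_ge0// mulr_ge0// ltW.
pose K1 := 8 * (2 * L + D) * R0 ^+ 3 * m2.
have K10 : 0 <= K1.
  by apply: mulr_ge0 => //; apply: mulr_ge0; [exact: mulr_ge0|apply: exprn_ge0; exact: ltW].
pose A1 := K1 / dl + 1.
have A10 : 0 < A1 by rewrite ltr_wpDl// divr_ge0// ltW.
have A1K : K1 <= dl * A1 by rewrite /A1 mulrDr mulr1 mulrC divfK ?gt_eqF// lerDl ltW.
pose Q1 := R0 ^+ 2 * (D * (1 + m2)).
have Q10 : 0 <= Q1 by rewrite mulr_ge0 ?sqr_ge0// mulr_ge0// addr_ge0.
pose k := Num.truncn (4 * Q1 / dl).
have kQ : 4 * Q1 <= dl * k.+1%:R by rewrite [leRHS]mulrC -ler_pdivrMr//; apply: ltW; exact: truncnS_gt.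
pose r0 := Num.min ((2 * L * R0)^-1) (dl / (32 * (A1 * L ^+ 2 * R0 ^+ 2))).
have B0 : 0 < A1 * L ^+ 2 * R0 ^+ 2 by rewrite !mulr_gt0 ?exprn_gt0.
have r00 : 0 < r0.
  rewrite lt_min; apply/andP; split; first by rewrite invr_gt0 !mulr_gt0.
  by apply: divr_gt0 => //; rewrite mulr_gt0.
exists r0; split => // r /andP[rr0 rr].
have rL : L * (R0 * r) <= 2^-1.
  have : r <= (2 * L * R0)^-1 by apply: le_trans rr _; rewrite ge_min lexx.
  rewrite -[X in _ <= X -> _]mul1r ler_pdivlMr ?mulr_gt0//; lra.
have rB : 32 * (A1 * L ^+ 2 * R0 ^+ 2) * r <= dl.
  have : r <= dl / (32 * (A1 * L ^+ 2 * R0 ^+ 2)) by apply: le_trans rr _; rewrite ge_min lexx orbT.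
  rewrite ler_pdivlMr ?mulr_gt0//; lra.
have kk0 : (0 : R) < k.+1%:R by rewrite ltr0n.
(* [S0] collects the factors in front of the slack s; the choice s S0 = dl r^2 is possible only once
   r is known. *)
pose S0 := 16 * (r * A1 + k.+1%:R).
have S00 : 0 < S0 by rewrite mulr_gt0// addr_gt0// mulr_gt0.
exists (dl * r ^+ 2 / S0); split; first by rewrite divr_gt0// mulr_gt0// exprn_gt0.
set s := dl * r ^+ 2 / S0.
have sS : s * S0 = dl * r ^+ 2 by rewrite /s divfK// gt_eqF.
have s0 : 0 < s by rewrite divr_gt0// mulr_gt0// exprn_gt0.
move=> dS S P X M Y u v Au hX hM mY no iY2 EY2 mu_ uA fen isg Esg b bR.
have b0 := eucl_ge0 b.
have Lb : L * eucl b <= 2^-1 by apply: le_trans rL; rewrite ler_pM2l.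
have rA0 : 0 < r * A1 by rewrite mulr_gt0.
apply: le_trans (energy_bound Hleb Hmu D0 L0 c0 N hX hM mY no iY2 mu_ uA fen isg Esg k rA0 Lb) _.
rewrite -!addrA lerD2l /energy_err.
set m2' := \int[P]_s _ in EY2 *.
have m2'0 : 0 <= m2' by apply: EE_ge0 => z; exact: sqr_ge0.
have t1 : eucl b ^+ 2 * (D * (1 + m2')) * k.+1%:R^-1 <= dl * r ^+ 2 / 4.
  rewrite ler_pdivrMr//.
  apply: (@le_trans _ _ ((R0 * r) ^+ 2 * (D * (1 + m2)))).
    apply: ler_pM; rewrite ?sqr_ge0 ?mulr_ge0 ?addr_ge0//.
      by apply: lerXn2r; rewrite ?nnegrE// mulr_ge0 ?(ltW R00) ?(ltW rr0).
    by apply: ler_wpM2l => //; rewrite lerD2l.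
  rewrite exprMn (_ : _ * _ * _ = r ^+ 2 * Q1); last by rewrite /Q1; ring.
  have := ler_wpM2l (sqr_ge0 r) kQ; move: (k.+1%:R : R) (r ^+ 2) => p q; lra.
have LR : (L * eucl b) ^+ 2 <= L ^+ 2 * R0 ^+ 2 * r ^+ 2.
  rewrite -!exprMn; apply: lerXn2r; rewrite ?nnegrE ?mulr_ge0 ?(ltW L0) ?(ltW R00) ?(ltW rr0)//.
  by rewrite -mulrA ler_pM2l.
have t2 : r * A1 * (2 * (2 * (L * eucl b) ^+ 2)) <= dl * r ^+ 2 / 8.
  apply: (@le_trans _ _ (r * A1 * (2 * (2 * (L ^+ 2 * R0 ^+ 2 * r ^+ 2))))).
    by rewrite ler_pM2l// !ler_pM2l.
  have := ler_wpM2r (sqr_ge0 r) rB.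
  rewrite (_ : _ * r * r ^+ 2 = 8 * (r * A1 * (2 * (2 * (L ^+ 2 * R0 ^+ 2 * r ^+ 2))))); last by ring.
  by move: (r * A1 * _) (dl * _) => p q; lra.
have t3 : (2 * L + D) * eucl b ^+ 3 * m2' / (r * A1) <= dl * r ^+ 2 / 8.
  rewrite ler_pdivrMr//.
  apply: (@le_trans _ _ ((2 * L + D) * (R0 * r) ^+ 3 * m2)).
    apply: ler_pM; rewrite ?mulr_ge0 ?exprn_ge0//.
    apply: ler_wpM2l => //; apply: lerXn2r; rewrite ?nnegrE// mulr_ge0 ?(ltW R00) ?(ltW rr0)//.
  have := ler_wpM2l (exprn_ge0 3 (ltW rr0)) A1K; rewrite /K1.
  rewrite (_ : r ^+ 3 * (8 * (2 * L + D) * R0 ^+ 3 * m2) = 8 * ((2 * L + D) * (R0 * r) ^+ 3 * m2)); last by ring.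
  rewrite (_ : r ^+ 3 * (dl * A1) = 8 * (dl * r ^+ 2 / 8 * (r * A1))); last by field.
  by rewrite ler_pM2l.
move: sS t1 t2 t3; rewrite /S0.
move: (k.+1%:R : R) kk0 (_ * _^-1) => kk kk0 p; move: (_ / (r * A1)) => q sS t1 t2 t3.
move: sS t1 t2 t3; move: (dl * r ^+ 2) => z sS t1 t2 t3.
have e1 : r * A1 * (2 * (s + 2 * (L * eucl b) ^+ 2)) = 2 * (r * A1 * s) + r * A1 * (2 * (2 * (L * eucl b) ^+ 2)) by ring.
rewrite e1; move: t2; move: (r * A1 * (2 * (2 * _))) => w t2.
have e2 : z = 16 * (r * A1 * s) + 16 * (kk * s) by rewrite -sS; ring.
have s1 : 0 <= r * A1 * s by rewrite mulr_ge0 ?(ltW rA0) ?(ltW s0).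
rewrite (_ : 4 * kk * s = 4 * (kk * s)); last by ring.
move: e2 s1; move: (r * A1 * s) (kk * s) => y y'; lra.
Qed.

(** A common slack for finitely many scales: the least of those found separately. *)
Lemma energy_seq (m2 dl R0 : R) : 0 <= m2 -> 0 < dl -> 0 < R0 -> exists r0, 0 < r0 /\
  forall rs : seq R, (forall r, r \in rs -> 0 < r <= r0) ->
  exists s, 0 < s /\ forall r, r \in rs -> energy_at m2 dl R0 r s.
Proof.
move=> m20 dl0 R00; have [r0 [r00 hr]] := energy m20 dl0 R00; exists r0; split => //.
elim=> [_|r rs IH h]; first by exists 1; split => // r; rewrite in_nil.
have [|s [s0 hs]] := IH; first by move=> r' r's; apply: h; rewrite inE r's orbT.
have [|s' [s'0 hs']] := hr r; first by apply: h; rewrite mem_head.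
exists (Num.min s s'); split; first by rewrite lt_min s0.
move=> r'; rewrite inE => /orP[/eqP->|/hs]; first by apply: energy_at_le hs'; rewrite ge_min lexx orbT.
by apply: energy_at_le; rewrite ge_min lexx.
Qed.

(* The two couplings are glued along a fine partition of the common marginal [mu]. *)
Lemma cross_bound (nu : probability T R) (D' th' w : R) 
    {dh : measure_display} {Sh : measurableType dh} (h : probability Sh R) (A B : Sh -> T)
    {dS : measure_display} {S : measurableType dS} (P : probability S R) (X M : S -> T) :
  target nu D' th' -> haslaw h A mu -> haslaw h B nu -> 0 < w ->
  intg h (fun z => eucl ((A z : V) - B z) ^+ 2) -> \int[h]_z eucl ((A z : V) - B z) ^+ 2 <= w ^+ 2 ->
  haslaw P X rho -> haslaw P M nu ->
  \int[P]_s dotv (X s) (M s) <= d%:R + w / 2 * (1 + \int[rho]_x eucl x ^+ 2).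
Proof.
have lin1 (xm xk xn p q r1 r2 r3 : R) : xn - xk <= p -> xm - xn <= q -> p <= r1 + r2 -> q <= r3 ->
    xm <= xk + r1 + r2 + r3 by move=> *; lra.
have lin2 (j a b k f e : R) : j <= d%:R -> a <= f -> k <= e -> j + b + a + k <= d%:R + (f + b) + e.
  by move=> *; lra.
move=> Hnu h1 h2 w0 ih Eh hX hM; apply/ler_addgt0Pr => e e0.
have ie := nice_eucl Hleb L0 c0 N; have ip := nice_pow Hleb L0 c0 N 2.
have E0 : 0 <= \int[rho]_x eucl x by apply: EE_ge0 => x; exact: eucl_ge0.
have [E Ee] : exists E, E = \int[rho]_x eucl x by eexists.
have [m2 me] : exists m2, m2 = \int[rho]_x eucl x ^+ 2 by eexists.
rewrite -Ee in E0; rewrite -me.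
pose eta := e / (2 * E + 1).
have F0 : 0 < 2 * E + 1 by rewrite ltr_wpDl// mulr_ge0.
have eta0 : 0 < eta by rewrite divr_gt0.
have etaE : 2 * eta * E <= e.
  have : eta * (2 * E + 1) = e by rewrite /eta divfK// gt_eqF.
  by move: eta0; clearbody eta; move=> ?; lra.
clearbody eta.
(* The sign of the radius is not given; enlarging it to its absolute value keeps the target
   property. *)
have D'0 : 0 <= `|D'| by [].
have Hnu' : target nu `|D'| th'.
  case: Hnu => a b c'; split => //; apply: filterS a => y /le_trans; apply; exact: ler_norm.
have [n [pt [jj [_ mjj jj0 ajj]]]] := quantize_target Hnu' D'0 eta0.
pose m j := fine (nu [set y | jj y = j]).
have mE j : nu [set y | jj y = j] = (m j)%:E by rewrite /m fineK// fin_num_measure.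
have m0 j : 0 < m j by rewrite -lte_fin -mE.
have mP j : measurable [set s | jj (M s) = j].
  by rewrite -[X in measurable X]setTI; exact: (law_mfun hM measurableT (mjj j)).
have EP j : P [set s | jj (M s) = j] = (m j)%:E by rewrite -mE -(law_preim hM).
have mh j : measurable [set z | jj (B z) = j].
  by rewrite -[X in measurable X]setTI; exact: (law_mfun h2 measurableT (mjj j)).
have Eh' j : h [set z | jj (B z) = j] = (m j)%:E by rewrite -mE -(law_preim h2).
have [G [G1 G2 G3]] := glue_law mP mh EP Eh' m0.
have gX : haslaw G (fun z : S * Sh => X z.1) rho := haslaw_comp G1 hX.
have gM : haslaw G (fun z : S * Sh => M z.1) nu := haslaw_comp G1 hM.
have gN : haslaw G (fun z : S * Sh => B z.2) nu := haslaw_comp G2 h2.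
have gK : haslaw G (fun z : S * Sh => A z.2) mu := haslaw_comp G2 h1.
have iK := nice_idot Hleb Hmu L0 c0 N gX gK.
have JK := le_trans (nice_dual_bound Hleb Hmu L0 c0 N gX gK) (virial Hleb Hmu D0 L0 c0 N).
have iM := intg_dotv Hnu hX hM ie.
have iGM := intg_dotv Hnu gX gM ie.
have mdiff : measurable_fun setT (fun z => eucl ((A z : V) - B z) ^+ 2) := intg_measurable ih.
have iKN := haslaw_intg G2 ih.
have iX2 := haslaw_intg gX ip; have iX1 := haslaw_intg gX ie.
(* X.M is split into X.A, X.(B - A) and X.(M - B). The virial bound controls the first, Young with
   weight w the second, and the diameter of the blocks the third. *)
pose F (z : S * Sh) := dotv (X z.1) (A z.2) + w / 2 * eucl (X z.1) ^+ 2 +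
  (2 * w)^-1 * eucl ((A z.2 : V) - B z.2) ^+ 2 + 2 * eta * eucl (X z.1).
have i1 : intg G (fun z => dotv (X z.1) (A z.2) + w / 2 * eucl (X z.1) ^+ 2) by apply: intgD => //; exact: intgZ.
have i2 : intg G (fun z => dotv (X z.1) (A z.2) + w / 2 * eucl (X z.1) ^+ 2 +
   (2 * w)^-1 * eucl ((A z.2 : V) - B z.2) ^+ 2) by apply: intgD => //; exact: intgZ.
have iF : intg G F by apply: intgD => //; exact: intgZ.
rewrite -(haslaw_EE (f := fun s => dotv (X s) (M s)) G1 (intg_measurable iM)).
apply: (@le_trans _ _ (\int[G]_z F z)).
  apply: EE_le_ae => //.
  apply: filterS3 G3 (haslaw_ae gM ajj) (haslaw_ae gN ajj) => z e1 [hm _] [hn _].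
  have x0 := eucl_ge0 (X z.1).
  have k1 := dotv_le (X z.1) ((B z.2 : V) - A z.2).
  have k2 := dotv_le (X z.1) ((M z.1 : V) - B z.2).
  have k3 : eucl ((M z.1 : V) - B z.2) <= 2 * eta.
    by rewrite e1 in hm; exact: eucl_dist_mid hm hn.
  have k4 : eucl (X z.1) * eucl ((B z.2 : V) - A z.2) <=
      w / 2 * eucl (X z.1) ^+ 2 + (2 * w)^-1 * eucl ((A z.2 : V) - B z.2) ^+ 2.
    rewrite [eucl ((B z.2 : V) - _)]eucl_distC; exact: young_scaled.
  have k5 := ler_wpM2l x0 k3.
  rewrite dotvBr in k1; rewrite dotvBr in k2; rewrite /F.
  rewrite [eucl (X z.1) * (2 * eta)]mulrC in k5; exact: lin1 k1 k2 k4 k5.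
rewrite EED//; last exact: intgZ.
rewrite EED//; last exact: intgZ.
rewrite EED//; last exact: intgZ.
rewrite !EEZ//.
rewrite (haslaw_EE (f := fun x : T => eucl x ^+ 2) gX (intg_measurable ip)) -me.
rewrite (haslaw_EE (f := fun x : T => eucl x) gX (intg_measurable ie)) -Ee.
rewrite (haslaw_EE G2 mdiff).
have : (2 * w)^-1 * \int[h]_z eucl ((A z : V) - B z) ^+ 2 <= w / 2.
  rewrite mulrC ler_pdivrMr ?mulr_gt0//; apply: le_trans Eh _.
  by rewrite le_eqVlt; apply/orP; left; apply/eqP; field.
move=> hh; rewrite mulrDr mulr1; exact: lin2 JK hh etaE.
Qed.

End EnergySmall.

(** * Transport potentials and their second differences *)

Lemma young_eps {R : realType} (eps p q : R) : 0 < eps -> p * q <= eps * p ^+ 2 + (4 * eps)^-1 * q ^+ 2.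
Proof.
move=> e0; have e20 : 0 < 2 * eps by rewrite mulr_gt0.
apply: le_trans (young_scaled p q e20) _; rewrite le_eqVlt; apply/orP; left; apply/eqP.
by field; rewrite gt_eqF.
Qed.

(* Convexity together with the existence of approximate subgradients, so that Jensen's inequality is immediate. *)
Definition subconvex {R : realType} {d : nat} (u : 'rV[R]_d -> R) :=
  forall x e, 0 < e -> exists p, forall x', u x + dotv p (x' - x) - e <= u x'.

Lemma subconvex_convexf {R : realType} {d : nat} (u : 'rV[R]_d -> R) : subconvex u -> convexf u.
Proof.
move=> su x x' t /andP[t0 t1]; apply/ler_addgt0Pr => e e0.
have [p hp] := su (t *: x + (1 - t) *: x') e e0.
have h1 := ler_wpM2l t0 (hp x).
have t1' : 0 <= 1 - t by rewrite subr_ge0.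
have h2 := ler_wpM2l t1' (hp x'); move: h1 h2.
rewrite !dotvBr !dotvDr !dotvZr; move: (u _) (u _) (u _) (dotv _ _) (dotv _ _) => a b c f g; lra.
Qed.

Section Potentials.
Context {R : realType} {d : nat} (leb : {measure set (Rd R d) -> \bar R}).
Hypothesis Hleb : is_lebesgue leb.
Local Notation T := (Rd R d).
Local Notation V := 'rV[R]_d.

Section Construct.
Variables (n : nat) (pt : 'I_n.+1 -> V) (w : 'rV[R]_n.+1) (eps : R).
Hypothesis eps0 : 0 < eps.

(** The quadratic term makes the Legendre transform finite with quadratic growth at a cost
    proportional to eps. *)
Definition primal_pot (x : V) : R := sdpot pt w x + eps * eucl x ^+ 2.
(** The supremum runs over the dense sequence only, so measurability is immediate; [fenchel_young]
    recovers the inequality at all points by continuity of [primal_pot]. *)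
Definition dual_pot (y : V) : R := sup [set dotv (dpt k) y - primal_pot (dpt k) | k in [set: nat]].
Local Notation u := primal_pot.
Local Notation v := dual_pot.
Local Notation A := (\sum_j eucl (pt j)).

Let A0 : 0 <= A. Proof. by apply: sumr_ge0 => j _; exact: eucl_ge0. Qed.

Let gap_le x y : dotv x y - u x <= `|w| + (4 * eps)^-1 * (eucl y + A) ^+ 2.
Proof.
have := dotv_le x y; have := sdpot_abs_le pt w x.
have := young_eps (eucl x) (eucl y + A) eps0.
rewrite /u mulrDr ler_norml [A * _]mulrC; move: (_^-1 * _) (eps * _) (eucl x * A) (eucl x * eucl y) => a b c f; lra.
Qed.

Let gap_ub (y : V) : has_ubound [set dotv (dpt k) y - u (dpt k) | k in [set: nat]].
Proof. by exists (`|w| + (4 * eps)^-1 * (eucl y + A) ^+ 2) => _ [k _ <-]; exact: gap_le. Qed.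

Lemma dual_pot_ge k y : dotv (dpt k) y - u (dpt k) <= v y.
Proof. by apply: ub_le_sup; [exact: gap_ub|exists k]. Qed.

Lemma dual_pot_le y c : (forall x, dotv x y - u x <= c) -> v y <= c.
Proof. by move=> h; apply: ge_sup; [exists (dotv (dpt 0) y - u (dpt 0)), 0%N|move=> _ [k _ <-]]. Qed.

Lemma primal_pot_near x x' : u x' - u x <= eucl (x - x') * (A + eps * (2 * eucl x + eucl (x - x'))).
Proof.
have l1 : lipschitz A (sdpot pt w).
  apply: (lipschitz_fmax (F := fun j x => dotv x (pt j) - w 0 j)) => j.
  by apply: lipschitz_affine; exact: pt_le_sum.
have := l1 x' x; rewrite eucl_distC => h1.
have h2 : eucl x' <= eucl x + eucl (x - x').
  by rewrite eucl_distC; have := eucl_sub_le x' x; lra.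
have x0 := eucl_ge0 x; have x'0 := eucl_ge0 x'; have r0 := eucl_ge0 (x - x').
have h3 : eucl x' ^+ 2 - eucl x ^+ 2 <= eucl (x - x') * (2 * eucl x + eucl (x - x')).
  move: h2 x0 x'0 r0; move: (eucl x) (eucl x') (eucl _) => a b r h2 a0 b0 r0; nra.
rewrite (_ : u x' - u x = (sdpot pt w x' - sdpot pt w x) + eps * (eucl x' ^+ 2 - eucl x ^+ 2)); last first.
  by rewrite /u mulrBr opprD addrACA.
rewrite [leRHS]mulrDr; apply: lerD; first by rewrite mulrC.
by rewrite mulrCA ler_pM2l.
Qed.

Lemma fenchel_young x y : dotv x y <= u x + v y.
Proof.
rewrite -lerBlDl; apply/ler_addgt0Pr => e e0.
have x0 := eucl_ge0 x; have y0 := eucl_ge0 y.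
pose K := A + eucl y + eps * (2 * eucl x + 1) + 1.
have K0 : 0 < K by rewrite ltr_wpDl// !addr_ge0// mulr_ge0 ?(ltW eps0)// addr_ge0// mulr_ge0.
have q0 : 0 < Num.min 1 (e / K) by rewrite lt_min ltr01 divr_gt0.
have [k] := dpt_dense x q0; rewrite lt_min => /andP[r1 rK]; rewrite ltr_pdivlMr// in rK.
have h1 := primal_pot_near x (dpt k); have h2 := dual_pot_ge k y.
have h3 := dotv_le (x - dpt k) y; rewrite dotvBl in h3; have r0 := eucl_ge0 (x - dpt k).
move: h1 h2 h3 r0 r1 rK; rewrite /K.
move: (eucl (x - _)) (eucl x) (eucl y) x0 y0 A A0 (u _) (u _) (v _) (dotv _ _) (dotv _ _) => r a b a0 b0 B B0 u1 u2 v1 p q h1 h2 h3 r0 r1 rK.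
have h4 : eps * r <= eps by rewrite ger_pMr// ltW.
have h5 : r * (eps * r) <= r * eps by apply: ler_wpM2l.
rewrite !mulrDr !mulr1 in h1 rK; rewrite [r * (_ * (2 * a))]mulrCA in h1 rK; lra.
Qed.

Lemma primal_pot_subconvex : subconvex u.
Proof.
move=> x e e0; have [j hj] := fmax_ex (fun j => dotv x (pt j) - w 0 j).
exists (pt j + (2 * eps) *: x) => x'.
have h1 := fmax_ge (fun j => dotv x' (pt j) - w 0 j) j.
rewrite /u /sdpot hj dotvDl !dotvBr !dotvZl [dotv (pt j) x]dotvC [dotv (pt j) x']dotvC !eucl_sqr.
have := ler_wpM2l (ltW eps0) (dotvv_ge0 (x' - x)); rewrite mulr0 dotvBl !dotvBr [dotv x x']dotvC.
move: h1; move: (fmax _) (dotv x' x) (dotv x x) (dotv x' x') (dotv _ _) (dotv _ _) (w 0 j) => *; lra.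
Qed.

Lemma dual_pot_subconvex : subconvex v.
Proof.
move=> y e e0.
have hs : has_sup [set dotv (dpt k) y - u (dpt k) | k in [set: nat]].
  by split; [exists (dotv (dpt 0) y - u (dpt 0)), 0%N|exact: gap_ub].
have [_ [k _ <-] hk] := sup_adherent e0 hs.
exists (dpt k) => y'; rewrite dotvBr; have := dual_pot_ge k y'; move: hk; rewrite -/(v y).
move: (v y) (v y') (u _) (dotv _ _) (dotv _ _) => *; lra.
Qed.

Lemma measurable_primal_pot : measurable_fun [set: T] u.
Proof.
apply: measurable_funD; first exact: measurable_sdpot.
by apply: measurable_funM; [exact: measurable_cst|apply: measurable_funX; exact: measurable_eucl].
Qed.

Lemma measurable_dual_pot : measurable_fun [set: T] v.
Proof.
apply: measurable_sublevel => c.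
rewrite (_ : [set y : T | _] = \bigcap_k [set y : T | dotv (dpt k) y - u (dpt k) <= c]).
  apply: bigcapT_measurable => k.
  rewrite (_ : [set y : T | _] = [set: T] `&` (fun y : T => dotv (dpt k) y - u (dpt k)) @^-1` `]-oo, c]%classic); last first.
    by apply/seteqP; split => x /=; [move=> h; split => //; rewrite in_itv|move=> [_]; rewrite in_itv].
  have : measurable_fun setT (fun y : T => dotv (dpt k) y - u (dpt k)).
    apply: measurable_funB; last exact: measurable_cst.
    by apply: measurable_dotv => //; exact: measurable_cst.
  by apply => //; exact: measurable_itv.
apply/seteqP; split => y /= h; first by move=> k _ /=; apply: le_trans h; exact: dual_pot_ge.
by apply: ge_sup; [exists (dotv (dpt 0) y - u (dpt 0)), 0%N|move=> _ [k _ <-]; exact: h].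
Qed.

Lemma primal_pot_growth : exists K, 0 <= K /\ forall x, `|u x| <= K * (1 + eucl x) ^+ 2.
Proof.
exists (A + `|w| + eps); split; first by rewrite !addr_ge0// ltW.
move=> x; have x0 := eucl_ge0 x; have w0 := normr_ge0 w.
apply: le_trans (ler_normD _ _) _.
rewrite [`|eps * _|]ger0_norm; last by rewrite mulr_ge0 ?sqr_ge0// ltW.
apply: le_trans (lerD (sdpot_abs_le pt w x) (lexx _)) _.
move: eps0 A A0 `|w| w0 (eucl x) x0 => e0 B B0 W W0 a a0.
rewrite -subr_ge0 (_ : _ - _ = B * (1 + a + a ^+ 2) + W * (2 * a + a ^+ 2) + eps * (1 + 2 * a)); last by ring.
by rewrite !addr_ge0 ?mulr_ge0 ?addr_ge0 ?sqr_ge0 ?mulr_ge0// ltW.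
Qed.

Lemma dual_pot_growth : exists K, 0 <= K /\ forall y, `|v y| <= K * (1 + eucl y) ^+ 2.
Proof.
have lin (b a c p q r t u' : R) : b - a <= c -> - b <= p -> a <= t -> p <= q -> t <= r -> 0 <= u' -> - (u' + (q + r)) <= c.
  by move=> *; lra.
pose x0 := dpt 0 : V; have a0 := eucl_ge0 x0.
pose K1 := `|w| + (4 * eps)^-1 * (1 + A) ^+ 2.
have i0 : 0 <= (4 * eps)^-1 by rewrite invr_ge0 mulr_ge0// ltW.
have K10 : 0 <= K1 by rewrite addr_ge0// mulr_ge0 ?sqr_ge0.
pose K2 := eucl x0 + `|u x0|; have K20 : 0 <= K2 by rewrite addr_ge0.
exists (K1 + K2); split; first exact: addr_ge0.
move=> y; have y0 := eucl_ge0 y.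
have s1 : 1 <= (1 + eucl y) ^+ 2 by rewrite exprn_ege1// lerDl.
have s0 : 0 <= (1 + eucl y) ^+ 2 by exact: sqr_ge0.
rewrite ler_norml; apply/andP; split.
  have h := dual_pot_ge 0 y; have h1 := dotv_le (- x0) y; rewrite dotvNl euclN in h1.
  have h2 := ler_norm (u x0).
  have h3 : eucl x0 * eucl y <= eucl x0 * (1 + eucl y) ^+ 2.
    by apply: ler_wpM2l => //; move: (eucl y) y0 => b b0; nra.
  have h4 : `|u x0| <= `|u x0| * (1 + eucl y) ^+ 2 by rewrite ler_peMr.
  have h5 : 0 <= K1 * (1 + eucl y) ^+ 2 by rewrite mulr_ge0.
  have h6 : K2 * (1 + eucl y) ^+ 2 = eucl x0 * (1 + eucl y) ^+ 2 + `|u x0| * (1 + eucl y) ^+ 2 by rewrite /K2 mulrDl.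
  rewrite [(K1 + K2) * _]mulrDl h6; move: h h1 h2 h3 h4 h5; rewrite -/x0.
  exact: lin.
apply: le_trans (dual_pot_le (gap_le^~ y)) _.
rewrite [leRHS]mulrDl; apply: ler_wpDr; first by rewrite mulr_ge0.
rewrite /K1 [leRHS]mulrDl; apply: lerD; first by rewrite ler_peMr.
rewrite -mulrA; apply: ler_wpM2l => //; rewrite -exprMn; apply: lerXn2r; rewrite ?nnegrE.
- exact: addr_ge0.
- by rewrite mulr_ge0 ?addr_ge0.
- rewrite mulrDl mul1r mulrDr mulr1; have : 0 <= A * eucl y by exact: mulr_ge0.
  by move: (A * eucl y) A (eucl y) => p q r; lra.
Qed.

Lemma dual_pot_cell y j : v y <= w 0 j + (4 * eps)^-1 * eucl (y - pt j) ^+ 2.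
Proof.
apply: dual_pot_le => x.
have := young_eps (eucl x) (eucl (y - pt j)) eps0.
have := dotv_le x (y - pt j); rewrite dotvBr /u.
have := fmax_ge (fun j => dotv x (pt j) - w 0 j) j; rewrite -/(sdpot pt w x).
move: (_^-1 * _) (eps * _) (eucl x * _) (dotv _ _) (dotv _ _) (sdpot _ _ _) => a b c e f g; lra.
Qed.

(** If x lies in the cell of atom j, then x.y differs from x.(pt j) by at most |x| |y - pt j|, and
    Young with weight eps controls this product by the quadratic term of the potential. *)
Lemma slack_cell x y j : sdpot pt w x <= dotv x (pt j) - w 0 j ->
  u x + v y - dotv x y <= 2 * eps * eucl x ^+ 2 + (2 * eps)^-1 * eucl (y - pt j) ^+ 2.
Proof.
move=> h; have := young_eps (eucl x) (eucl (y - pt j)) eps0.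
have := dotv_le (- x) (y - pt j); rewrite dotvNl dotvBr euclN; have := dual_pot_cell y j.
have -> : (2 * eps)^-1 * eucl (y - pt j) ^+ 2 = 2 * ((4 * eps)^-1 * eucl (y - pt j) ^+ 2).
  by field; rewrite gt_eqF.
rewrite /u -mulrA; move: h; move: (_^-1 * _) (eps * _) (eucl x * _) (dotv _ _) (dotv _ _) (sdpot _ _ _) (v y) => a b c e f g k; lra.
Qed.

End Construct.

Variables rho0 rho1 : probability T R.
Hypothesis ac0 : forall A : set T, measurable A -> leb A = 0%E -> rho0 A = 0%E.
Hypotheses (i0 : forall p, intg rho0 (fun x : T => eucl x ^+ p)) (i1 : forall p, intg rho1 (fun x : T => eucl x ^+ p)).

Theorem potentials e : 0 < e -> exists (u v : V -> R) (K : R),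
  [/\ subconvex u, measurable_fun [set: T] u & forall x, `|u x| <= K * (1 + eucl x) ^+ 2] /\
  [/\ subconvex v, measurable_fun [set: T] v & forall y, `|v y| <= K * (1 + eucl y) ^+ 2] /\
  [/\ forall x y, dotv x y <= u x + v y,
    forall {dS : measure_display} {S : measurableType dS} (P : probability S R) (X : S -> T), haslaw P X rho0 ->
      exists G : probability (S * T)%type R, [/\ haslaw G fst P, haslaw G snd rho1 &
        intg G (fun z => u (X z.1) + v z.2 - dotv (X z.1) z.2) /\
        \int[G]_z (u (X z.1) + v z.2 - dotv (X z.1) z.2) <= e] &
    forall {dS : measure_display} {S : measurableType dS} (P : probability S R) (Y : S -> T), haslaw P Y rho1 ->
      exists G : probability (S * T)%type R, [/\ haslaw G fst P, haslaw G snd rho0 &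
        intg G (fun z => u z.2 + v (Y z.1) - dotv z.2 (Y z.1)) /\
        \int[G]_z (u z.2 + v (Y z.1) - dotv z.2 (Y z.1)) <= e]].
Proof.
move=> e0.
pose m0 := \int[rho0]_x eucl x ^+ 2; pose m3 := \int[rho1]_x eucl x ^+ 3.
have m00 : 0 <= m0 by apply: EE_ge0 => x; exact: sqr_ge0.
have m30 : 0 <= m3 by apply: EE_ge0 => x; rewrite exprn_ge0// eucl_ge0.
pose eps := e / (4 * (m0 + 1)).
have F0 : 0 < 4 * (m0 + 1) by rewrite mulr_gt0// ltr_wpDl.
have eps0 : 0 < eps by rewrite divr_gt0.
have e20 : 0 < 2 * eps by rewrite mulr_gt0.
have epsE : 2 * eps * m0 <= e / 2.
  have : eps * (4 * (m0 + 1)) = e by rewrite /eps divfK// gt_eqF.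
  by move: eps0; clearbody eps m0; lra.
(* [eps] is fixed by the second moment of [rho0]; the mesh is then taken fine enough for the squared
   error to be below e eps, compensating (2 eps)^-1. Outside radius N, |y|^2 is exchanged for |y|^3
   / N, hence the third moment. *)
pose B := 2 * d%:R ^+ 2 + 18 * d%:R ^+ 2 * m3.
have B0 : 0 <= B by rewrite addr_ge0 ?mulr_ge0 ?sqr_ge0// ?mulr_ge0 ?sqr_ge0.
pose N := (Num.truncn (B / (e * eps))).+1.
have N0 : (0 < N)%N by [].
have Nr : (0 : R) < N%:R by rewrite ltr0n.
have ee0 : 0 < e * eps by rewrite mulr_gt0.
have BN : B / N%:R <= e * eps.
  by rewrite ler_pdivrMr// [leRHS]mulrC -ler_pdivrMr//; apply: ltW; exact: truncnS_gt.
have [n [pt [jj [ptinj [mjj [jj0 hjj]]]]]] := quantize N0 rho1.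
pose m j := fine (rho1 [set y | jj y = j]).
have mE j : rho1 [set y | jj y = j] = (m j)%:E by rewrite /m fineK// fin_num_measure.
have mp j : 0 < m j by rewrite -lte_fin -mE.
have m1 : \sum_j m j = 1.
  apply: EFin_inj; rewrite -sumEFin -(probability_setT rho1) (measure_fibers rho1 mjj measurableT).
  by apply: eq_bigr => j _; rewrite -mE; congr (rho1 _); rewrite setTI.
have [w [ii [mii [rii hii]]]] := semidiscrete Hleb ac0 (i0 1) ptinj mp m1.
pose q (y : T) := eucl ((y : V) - pt (jj y)) ^+ 2.
have mq : measurable_fun setT q.
  apply: measurable_funX; apply: measurable_eucl; apply: measurable_subv => //.
  by apply: measurable_fun_Rd => i; exact: (measurable_fin_comp (fun j => pt j 0 i) mjj).
have aq : {ae rho1, forall y : T, `|q y| <= (2 * d%:R ^+ 2 + 18 * d%:R ^+ 2 * eucl y ^+ 3) / N%:R}.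
  apply: filterS hjj => y h; rewrite ger0_norm ?sqr_ge0// /q.
  have y0 := eucl_ge0 y; have q0 := eucl_ge0 ((y : V) - pt (jj y)).
  apply: (@le_trans _ _ ((d%:R * (N%:R^-1 + (if N%:R < eucl y then 3 * eucl y else 0))) ^+ 2)).
    by apply: lerXn2r; rewrite ?nnegrE//; apply: le_trans h.
  rewrite exprMn ler_pdivlMr//.
  have Ni : 0 < N%:R^-1 :> R by rewrite invr_gt0.
  have N1 : N%:R^-1 * N%:R = 1 :> R by rewrite mulVf// gt_eqF.
  have N2 : N%:R^-1 <= 1 :> R by rewrite invf_le1// ler1n.
  have d2 : 0 <= d%:R ^+ 2 :> R by exact: sqr_ge0.
  rewrite (_ : 2 * _ + _ = d%:R ^+ 2 * (2 + 18 * eucl y ^+ 3)); last by ring.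
  rewrite -mulrA; apply: ler_wpM2l => //.
  case: ifPn => [Ny|_].
    apply: (@le_trans _ _ ((2 * N%:R^-1 ^+ 2 + 18 * eucl y ^+ 2) * N%:R)).
      apply: ler_wpM2r; first exact: ltW.
      rewrite -subr_ge0 (_ : _ - _ = (N%:R^-1 - 3 * eucl y) ^+ 2) ?sqr_ge0//; ring.
    rewrite mulrDl; apply: lerD.
      by rewrite -mulrA expr2 -mulrA N1 mulr1 ler_piMr.
    rewrite -mulrA ler_pM2l// [eucl y ^+ 3]exprSr; apply: ler_wpM2l; first exact: sqr_ge0.
    exact: ltW.
  rewrite addr0 expr2 -mulrA N1 mulr1; apply: le_trans N2 _.
  by have y3 := exprn_ge0 3 y0; apply: (@le_trans _ _ 2); [rewrite ler1n|rewrite lerDl mulr_ge0].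
have iqb : intg rho1 (fun y : T => (2 * d%:R ^+ 2 + 18 * d%:R ^+ 2 * eucl y ^+ 3) / N%:R).
  by apply: intgZr; apply: intgD; [exact: intg_cst|apply: intgZ; exact: i1].
have iq : intg rho1 q by exact: intg_ae_le mq iqb aq.
have Eq : \int[rho1]_y q y <= e * eps.
  apply: le_trans BN; apply: (@le_trans _ _ (\int[rho1]_y ((2 * d%:R ^+ 2 + 18 * d%:R ^+ 2 * eucl y ^+ 3) / N%:R))).
    by apply: EE_le_ae => //; apply: filterS aq => y; apply: le_trans; exact: ler_norm.
  rewrite EEZr; last by apply: intgD; [exact: intg_cst|apply: intgZ; exact: i1].
  by rewrite EED; [rewrite EE_cst EEZ//; exact: i1|exact: intg_cst|apply: intgZ; exact: i1].
have [K1 [K10 hK1]] := primal_pot_growth pt w eps0; have [K2 [K20 hK2]] := dual_pot_growth pt w eps0.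
pose u := primal_pot pt w eps; pose v := dual_pot pt w eps.
have mu_ : measurable_fun [set: T] u := measurable_primal_pot pt w eps.
have mv : measurable_fun [set: T] v := measurable_dual_pot pt w eps0.
have core (dO : measure_display) (Om : measurableType dO) (Q : probability Om R) (X Y : Om -> T) :
    haslaw Q X rho0 -> haslaw Q Y rho1 -> {ae Q, forall o, ii (X o) = jj (Y o)} ->
    intg Q (fun o => u (X o) + v (Y o) - dotv (X o) (Y o)) /\
    \int[Q]_o (u (X o) + v (Y o) - dotv (X o) (Y o)) <= e.
  move=> hX hY ae_.
  have ib : intg Q (fun o => 2 * eps * eucl (X o) ^+ 2 + (2 * eps)^-1 * q (Y o)).
    by apply: intgD; apply: intgZ; [exact: (haslaw_intg (f := fun x : T => eucl x ^+ 2) hX (i0 2))|exact: haslaw_intg hY iq].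
  have le_ : {ae Q, forall o, u (X o) + v (Y o) - dotv (X o) (Y o) <= 2 * eps * eucl (X o) ^+ 2 + (2 * eps)^-1 * q (Y o)}.
    apply: filterS ae_ => o h; rewrite /q -h; apply: slack_cell => //.
    by apply: fmax_le => k; exact: hii.
  have g0 o : 0 <= u (X o) + v (Y o) - dotv (X o) (Y o) by rewrite subr_ge0; exact: fenchel_young.
  have is_ : intg Q (fun o => u (X o) + v (Y o) - dotv (X o) (Y o)).
    apply: intg_ae_le _ ib _; last by apply: filterS le_ => o; rewrite ger0_norm.
    apply: measurable_funB; last by apply: measurable_dotv; [exact: law_mfun hX|exact: law_mfun hY].
    apply: measurable_funD; first exact: (measurableT_comp mu_ (law_mfun hX)).
    exact: (measurableT_comp mv (law_mfun hY)).
  split => //; apply: le_trans (EE_le_ae is_ ib le_) _.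
  have i2 := haslaw_intg (f := fun x : T => eucl x ^+ 2) hX (i0 2); have i3 := haslaw_intg hY iq.
  rewrite EED; [|exact: intgZ|exact: intgZ]. rewrite !EEZ//.
  rewrite (haslaw_EE (f := fun x : T => eucl x ^+ 2) hX (intg_measurable (i0 2))) -/m0.
  rewrite (haslaw_EE hY mq) [e]splitr; apply: lerD => //.
  rewrite mulrC ler_pdivrMr//; apply: le_trans Eq _.
  by rewrite (_ : e / 2 * _ = e * eps)//; field.
exists u, v, (K1 + K2); split.
  split => //; first exact: primal_pot_subconvex.
  by move=> x; apply: le_trans (hK1 x) _; rewrite ler_wpM2r ?sqr_ge0// lerDl.
split.
  split => //; first exact: dual_pot_subconvex.
  by move=> x; apply: le_trans (hK2 x) _; rewrite ler_wpM2r ?sqr_ge0// lerDr.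
split; first exact: fenchel_young.
  move=> dS S P X hX.
  have mP j : measurable [set s | ii (X s) = j].
    by rewrite -[X in measurable X]setTI; exact: (law_mfun hX measurableT (mii j)).
  have EP j : P [set s | ii (X s) = j] = (m j)%:E by rewrite -rii -(law_preim hX).
  have [G [G1 G2 G3]] := glue_law mP mjj EP mE mp.
  exists G; split => //; apply: core => //; exact: haslaw_comp G1 hX.
move=> dS S P Y hY.
have mP j : measurable [set s | jj (Y s) = j].
  by rewrite -[X in measurable X]setTI; exact: (law_mfun hY measurableT (mjj j)).
have EP j : P [set s | jj (Y s) = j] = (m j)%:E by rewrite -mE -(law_preim hY).
have [G [G1 G2 G3]] := glue_law mP mii EP rii mp.
exists G; split => //; apply: (core _ _ G snd (fun z => Y z.1)) => //; first exact: haslaw_comp G1 hY.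
by apply: filterS G3 => z ->.
Qed.

End Potentials.

Definition second_diff {R : realType} {d : nat} (u : 'rV[R]_d -> R) (b x : 'rV[R]_d) : R :=
  u (x + b) + u (x - b) - 2 * u x.

Lemma seq_lower_bound {R : realType} (rs : seq R) (F : R -> R) : (forall r, r \in rs -> 0 < F r) ->
  exists q, 0 < q /\ forall r, r \in rs -> q <= F r.
Proof.
elim: rs => [_|r rs IH h]; first by exists 1; split => // r; rewrite in_nil.
have [|q [q0 hq]] := IH; first by move=> r' r's; apply: h; rewrite inE r's orbT.
exists (Num.min q (F r)); split; first by rewrite lt_min q0 h// mem_head.
move=> r'; rewrite inE => /orP[/eqP->|/hq]; first by rewrite ge_min lexx orbT.
by apply: le_trans; rewrite ge_min lexx.
Qed.

Section SecondDifference.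
Context {R : realType} {d : nat} (leb : {measure set (Rd R d) -> \bar R}).
Hypothesis Hleb : is_lebesgue leb.
Local Notation T := (Rd R d).
Local Notation V := 'rV[R]_d.

Lemma intg_quad {dS : measure_display} {S : measurableType dS} (P : probability S R) (Y M : S -> T)
    (rho mu : probability T R) (D th : R) (b b' : V) : target mu D th -> 0 <= D ->
  intg rho (fun x : T => eucl x) -> haslaw P Y rho -> haslaw P M mu ->
  intg P (fun s => dotv (Y s) b * dotv b' (M s)).
Proof.
move=> Hmu D0 i1 hY hM; apply: (@intg_ae_le _ _ _ _ _ (fun s => (eucl b * eucl b' * D) * eucl (Y s))).
- apply: measurable_funM; apply: measurable_dotv => //.
  + exact: law_mfun hY.
  + exact: law_mfun hM.
- by apply: intgZ; exact: (haslaw_intg (f := fun x : T => eucl x) hY i1).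
- apply: filterS (haslaw_ae hM (target_le Hmu)) => s hs; rewrite normrM.
  have h1 := dotv_abs_le (Y s) b; have h2 := le_trans (dotv_abs_le b' (M s)) (ler_wpM2l (eucl_ge0 b') hs).
  rewrite (_ : _ * _ * D * _ = (eucl (Y s) * eucl b) * (eucl b' * D)); last by ring.
  by apply: ler_pM.
Qed.

Lemma intg_growth (rho mu : probability T R) Psi phi L c C (u : V -> R) K (b : V) : 0 < L -> 0 < c ->
  nice leb mu rho Psi phi L c C -> measurable_fun [set: T] u -> (forall x, `|u x| <= K * (1 + eucl x) ^+ 2) ->
  intg rho (fun x : T => u (x + b)).
Proof.
move=> L0 c0 N mu_ uA.
apply: (nice_moment Hleb L0 c0 N (p := 2) (A := `|K| * (1 + eucl b) ^+ 2)).
  exact: (@measurable_fun_shift _ _ b (fun x : T => u x)).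
move=> x; apply: le_trans (uA _) _; rewrite -mulrA -exprMn.
apply: (@le_trans _ _ (`|K| * (1 + eucl (x + b)) ^+ 2)).
  by apply: ler_wpM2r; [exact: sqr_ge0|exact: ler_norm].
apply: ler_wpM2l => //; have x0 := eucl_ge0 x; have b0 := eucl_ge0 b.
have := eucl_triangle x b; have := eucl_ge0 (x + b).
move: (eucl x) (eucl b) (eucl _) x0 b0 => p q r p0 q0 r0 h; apply: lerXn2r; rewrite ?nnegrE; nra.
Qed.

Variables (mu nu rho0 rho1 : probability T R) (Psi0 Psi1 : V -> R) (phi0 phi1 : T -> R) (D th L c C : R).
Hypotheses (Hmu : target mu D th) (Hnu : target nu D th) (D0 : 0 <= D) (L0 : 0 < L) (c0 : 0 < c).
Hypotheses (N0 : nice leb mu rho0 Psi0 phi0 L c C) (N1 : nice leb nu rho1 Psi1 phi1 L c C).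
Context {dh : measure_display} {Sh : measurableType dh} (h : probability Sh R) (A B : Sh -> T) (w m2 : R).
Hypotheses (hA : haslaw h A mu) (hB : haslaw h B nu) (w0 : 0 < w).
Hypothesis ih : intg h (fun z => eucl ((A z : V) - B z) ^+ 2).
Hypothesis Eh : \int[h]_z eucl ((A z : V) - B z) ^+ 2 <= w ^+ 2.
Hypotheses (m20 : \int[rho0]_x eucl x ^+ 2 <= m2) (m21 : \int[rho1]_x eucl x ^+ 2 <= m2).

Definition frame_vec (a : V) (i j : 'I_d) : V := a 0 i *: delta_mx 0 j - a 0 j *: delta_mx 0 i.

Lemma eucl_frame_vec (a : V) i j : eucl (frame_vec a i j) <= 2 * eucl a.
Proof.
have e (k : 'I_d) : eucl (delta_mx 0 k : V) = 1 by rewrite /eucl dotv_delta mxE !eqxx sqrtr1.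
apply: le_trans (euclB_le _ _) _; rewrite !euclZ !e !mulr1.
by have := coord_le_eucl a i; have := coord_le_eucl a j; lra.
Qed.

(** Tightness of the frame turns a weighted sum of directional products into the full inner product,
    the only quantity that the virial bound controls. *)
Lemma quad_frame {dS : measure_display} {S : measurableType dS} (P : probability S R) (Y M : S -> T)
    (rho mu' : probability T R) (a : V) : target mu' D th -> intg rho (fun x : T => eucl x) ->
  haslaw P Y rho -> haslaw P M mu' ->
  \int[P]_s (dotv a (Y s) * dotv a (M s)) +
    2^-1 * \sum_i \sum_j \int[P]_s (dotv (frame_vec a i j) (Y s) * dotv (frame_vec a i j) (M s)) =
  dotv a a * \int[P]_s dotv (Y s) (M s).
Proof.
move=> Hm i1 hY hM.
have iq b : intg P (fun s => dotv b (Y s) * dotv b (M s)).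
  have := intg_quad b b Hm D0 i1 hY hM.
  by congr (intg _ _); apply/funext => s; rewrite [dotv (Y s) b]dotvC.
have -> : \sum_i \sum_j \int[P]_s (dotv (frame_vec a i j) (Y s) * dotv (frame_vec a i j) (M s)) =
    \int[P]_s \sum_i \sum_j (dotv (frame_vec a i j) (Y s) * dotv (frame_vec a i j) (M s)).
  rewrite EE_sum; first by apply: eq_bigr => i _; rewrite EE_sum.
  by move=> i; exact: intg_sum.
have iS : intg P (fun s => \sum_i \sum_j (dotv (frame_vec a i j) (Y s) * dotv (frame_vec a i j) (M s))).
  by apply: intg_sum => i; exact: intg_sum.
rewrite -(EEZ (2^-1) iS) -EED//; last exact: intgZ.
rewrite -(EEZ _ (intg_dotv Hm hY hM i1)).
apply: eq_Rintegral => s _; rewrite -lagrange_frame [dotv a (Y s)]dotvC; congr (_ + _ * _).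
by apply: eq_bigr => i _; apply: eq_bigr => j _; rewrite dotvC.
Qed.

(** The frame argument. Upper bounds hold along [a] and along every frame vector; their weighted sum
    is controlled by the cross bounds. Subtracting the Fenchel lower bounds along the frame vectors
    leaves the bound along [a]. *)
Theorem second_difference_bound (R0 dl : R) : 0 < dl -> 0 < R0 -> exists r0, 0 < r0 /\
  forall rs : seq R, (forall r, r \in rs -> 0 < r <= r0) -> forall e, 0 < e ->
  exists (u v : V -> R) (K : R) (g : probability (T * T)%type R),
  [/\ subconvex u, measurable_fun [set: T] u & forall x, `|u x| <= K * (1 + eucl x) ^+ 2] /\
  [/\ subconvex v, measurable_fun [set: T] v & forall y, `|v y| <= K * (1 + eucl y) ^+ 2] /\
  [/\ haslaw g fst rho0, haslaw g snd rho1,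
      intg g (fun z => u z.1 + v z.2 - dotv z.1 z.2) & \int[g]_z (u z.1 + v z.2 - dotv z.1 z.2) <= e] /\
  (forall x y, dotv x y <= u x + v y) /\
  forall r, r \in rs -> forall a, eucl a <= R0 ->
    \int[rho0]_x second_diff u (r *: a) x + \int[rho1]_y second_diff v (r *: a) y <=
      r ^+ 2 * (2 * dotv a a * (1 + w / 2 * (1 + m2)) + dl).
Proof.
have lin4 (p s t q u1 u2 u0 v1 v2 v0 : R) : p + s + (t + q) <= u1 + v1 -> p - s - (t - q) <= u2 + v2 ->
    2 * q - 2 * (u0 + v0 - p) <= u1 + u2 - 2 * u0 + (v1 + v2 - 2 * v0) by move=> *; lra.
have lin5 (b0 b1 q0 q1 z : R) : b0 <= q0 + z -> b1 <= q1 + z -> b0 + b1 <= q0 + q1 + 2 * z by move=> *; lra.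
have fin (r2 aa dd e' dl' l bua bva qua qva SB SQu SQv SF Mu Mv k : R) : 0 <= r2 -> 0 <= aa -> 0 <= dd ->
    e' <= dl' * r2 -> dl' * (2 + 2 * dd) = l -> bua <= r2 * qua + dl' * r2 -> bva <= r2 * qva + dl' * r2 ->
    SB <= r2 * SQu + r2 * SQv + dd * (2 * (dl' * r2)) -> 2 * r2 * SF - dd * (2 * e') <= SB ->
    aa + 2^-1 * SF = d%:R * aa -> qua + 2^-1 * SQu = aa * Mu -> qva + 2^-1 * SQv = aa * Mv ->
    Mu <= d%:R + k -> Mv <= d%:R + k -> bua + bva <= r2 * (2 * aa * (1 + k) + l).
  move=> r0 a0 d0 he <- hu hv h1 h2 hf fu fv mu' mv'.
  have j1 := ler_wpM2l (mulr_ge0 r0 a0) mu'; have j2 := ler_wpM2l (mulr_ge0 r0 a0) mv'.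
  have j3 := ler_wpM2l d0 he.
  have k1 : r2 * qua + r2 * (2^-1 * SQu) = r2 * aa * Mu by rewrite -mulrDr fu mulrA.
  have k2 : r2 * qva + r2 * (2^-1 * SQv) = r2 * aa * Mv by rewrite -mulrDr fv mulrA.
  have k3 : r2 * aa + r2 * (2^-1 * SF) = r2 * aa * d%:R by rewrite -mulrDr hf; ring.
  move: (d%:R : R) j1 j2 k3 => dr *; lra.
move=> dl0 R00.
have p0 := nice_pow Hleb L0 c0 N0; have p1 := nice_pow Hleb L0 c0 N1.
have m2_ge0 : 0 <= m2 by apply: le_trans m20; apply: EE_ge0 => x; exact: sqr_ge0.
pose dd : R := d%:R ^+ 2.
have dd0 : 0 <= dd by exact: sqr_ge0.
pose dl' := dl / (2 + 2 * dd).
have F0 : 0 < 2 + 2 * dd by rewrite ltr_pwDl// mulr_ge0.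
have dl'0 : 0 < dl' by rewrite divr_gt0.
have dlE : dl' * (2 + 2 * dd) = dl by rewrite /dl' divfK// gt_eqF.
have R20 : 0 < 2 * R0 by rewrite mulr_gt0.
have [ra [ra0 hra]] := energy_seq Hleb Hmu D0 L0 c0 N0 m2_ge0 dl'0 R20.
have [rb [rb0 hrb]] := energy_seq Hleb Hnu D0 L0 c0 N1 m2_ge0 dl'0 R20.
exists (Num.min ra rb); split; first by rewrite lt_min ra0.
move=> rs hrs e e0.
have [|sa [sa0 hsa]] := hra rs.
  by move=> r /hrs; rewrite le_min => /andP[-> /andP[]].
have [|sb [sb0 hsb]] := hrb rs.
  by move=> r /hrs; rewrite le_min => /andP[-> /andP[]].
(* The slack must also be below dl' r^2 at every listed scale, because each of the d^2 lower bounds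
   loses twice the slack. *)
have [|q [q0 hq]] := @seq_lower_bound R rs (fun r => dl' * r ^+ 2).
  by move=> r /hrs /andP[r0 _]; rewrite mulr_gt0// exprn_gt0.
pose e' := Num.min (Num.min e q) (Num.min sa sb).
have e'0 : 0 < e' by rewrite !lt_min e0 q0 sa0.
have e'e : e' <= e by rewrite !ge_min lexx.
have e'q : e' <= q by rewrite !ge_min lexx orbT.
have e'a : e' <= sa by rewrite !ge_min lexx !orbT.
have e'b : e' <= sb by rewrite !ge_min lexx !orbT.
have [u [v [K [[cu mu_ gu] [[cv mv gv] [fen hG0 hG1]]]]]] := potentials Hleb (nice_ac L0 N0) p0 p1 e'0.
have [g0 [g01 g02 og0]] := nice_opt N0 sa0.
have [g1 [g11 g12 og1]] := nice_opt N1 sb0.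
have [G [G1 G2 [iG EG]]] := hG0 _ _ g0 fst g01.
have [H [H1 H2 [iH EH]]] := hG1 _ _ g1 fst g11.
have GX : haslaw G (fun z => z.1.1) rho0 := haslaw_comp G1 g01.
have GM : haslaw G (fun z => z.1.2) mu := haslaw_comp G1 g02.
have HY : haslaw H (fun z => z.1.1) rho1 := haslaw_comp H1 g11.
have HM : haslaw H (fun z => z.1.2) nu := haslaw_comp H1 g12.
have mfst : measurable_fun setT (fun z : T * T * T => (z.1.1, z.2) : T * T).
  by apply/measurable_fun_pairP; split; [exact: (law_mfun GX)|exact: (law_mfun G2)].
have [g gG] := haslaw_push G mfst.
have g1' : haslaw g fst rho0.
  by split => // P mP; rewrite -(law_preim gG) -?(law_preim GX)// -[X in measurable X]setTI; exact: measurable_fst.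
have g2' : haslaw g snd rho1.
  by split => // P mP; rewrite -(law_preim gG) -?(law_preim G2)// -[X in measurable X]setTI; exact: measurable_snd.
have msig : measurable_fun setT (fun z : T * T => u z.1 + v z.2 - dotv z.1 z.2).
  apply: measurable_funB; last exact: measurable_dotv.
  by apply: measurable_funD; [exact: (measurableT_comp mu_ measurable_fst)|exact: (measurableT_comp mv measurable_snd)].
have isig : intg g (fun z => u z.1 + v z.2 - dotv z.1 z.2).
  by apply/(law_intg (law_mfun gG) (law_preim gG) msig).
have Esig : \int[g]_z (u z.1 + v z.2 - dotv z.1 z.2) <= e' by rewrite -(haslaw_EE gG msig).
exists u, v, K, g; split => //; split => //; split; first by split => //; exact: le_trans Esig e'e.
split => // r rrs a aR.
have /andP[r0 _] := hrs r rrs; have a0 := eucl_ge0 a; have r20 : 0 <= r ^+ 2 by exact: sqr_ge0.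
have iu b : intg rho0 (fun x : T => u (x + b)) := intg_growth b L0 c0 N0 mu_ gu.
have iv b : intg rho1 (fun x : T => v (x + b)) := intg_growth b L0 c0 N1 mv gv.
have iu0 : intg rho0 (fun x : T => u x) by have := iu 0; congr (intg _ _); apply/funext => x; rewrite addr0.
have iv0 : intg rho1 (fun x : T => v x) by have := iv 0; congr (intg _ _); apply/funext => x; rewrite addr0.
have isu b : intg rho0 (fun x : T => second_diff u b x).
  by apply: intgB; [apply: intgD; exact: iu|exact: intgZ].
have isv b : intg rho1 (fun x : T => second_diff v b x).
  by apply: intgB; [apply: intgD; exact: iv|exact: intgZ].
pose Bu b := \int[rho0]_x second_diff u b x; pose Bv b := \int[rho1]_x second_diff v b x.
pose Qu b := \int[G]_z (dotv b z.2 * dotv b z.1.2); pose Qv b := \int[H]_z (dotv b z.2 * dotv b z.1.2).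
have ie0 := nice_eucl Hleb L0 c0 N0; have ie1 := nice_eucl Hleb L0 c0 N1.
have qz (dS : measure_display) (S : measurableType dS) (P : probability S R) (Y M : S -> T) (rho mu' : probability T R) b :
    target mu' D th -> intg rho (fun x : T => eucl x) -> haslaw P Y rho -> haslaw P M mu' ->
    \int[P]_s (dotv (r *: b) (Y s) * dotv (r *: b) (M s)) = r ^+ 2 * \int[P]_s (dotv b (Y s) * dotv b (M s)).
  move=> Hm i1 hY hM'; rewrite -EEZ.
    by apply: eq_Rintegral => s _; rewrite !dotvZl expr2 mulrACA.
  have := intg_quad b b Hm D0 i1 hY hM'; congr (intg _ _); apply/funext => s; by rewrite dotvC.
have bu b : eucl b <= 2 * R0 -> Bu (r *: b) <= r ^+ 2 * Qu b + dl' * r ^+ 2.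
  move=> bR; rewrite /Qu -(qz _ _ G (fun z => z.2) (fun z => z.1.2) rho1 mu b Hmu ie1 G2 GM).
  apply: (hsa r rrs _ _ G (fun z => z.1.1) (fun z => z.1.2) (fun z => z.2) u v K) => //.
  - exact: law_mfun G2.
  - by rewrite (haslaw_EE (f := fun z : T * T => dotv z.1 z.2) G1)//; exact: measurable_dotv.
  - exact: (haslaw_intg (f := fun x : T => eucl x ^+ 2) G2 (p1 2)).
  - by rewrite (haslaw_EE (f := fun x : T => eucl x ^+ 2) G2 (intg_measurable (p1 2))).
  - exact: le_trans EG e'a.
  - by rewrite euclZ gtr0_norm// mulrC ler_pM2r.
have bv b : eucl b <= 2 * R0 -> Bv (r *: b) <= r ^+ 2 * Qv b + dl' * r ^+ 2.
  move=> bR; rewrite /Qv -(qz _ _ H (fun z => z.2) (fun z => z.1.2) rho0 nu b Hnu ie0 H2 HM).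
  have eqs z : v z.1.1 + u z.2 - dotv z.1.1 z.2 = u z.2 + v z.1.1 - dotv z.2 z.1.1 by rewrite addrC dotvC [v _ + _]addrC [RHS]addrC.
  apply: (hsb r rrs _ _ H (fun z => z.1.1) (fun z => z.1.2) (fun z => z.2) v u K) => //.
  - exact: law_mfun H2.
  - by rewrite (haslaw_EE (f := fun z : T * T => dotv z.1 z.2) H1)//; exact: measurable_dotv.
  - exact: (haslaw_intg (f := fun x : T => eucl x ^+ 2) H2 (p0 2)).
  - by rewrite (haslaw_EE (f := fun x : T => eucl x ^+ 2) H2 (intg_measurable (p0 2))).
  - by move=> x y; rewrite dotvC addrC.
  - by move: iH; congr (intg _ _); apply/funext => z; rewrite eqs.
  - apply: le_trans (le_trans EH e'b); rewrite le_eqVlt; apply/orP; left; apply/eqP.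
    by apply: eq_Rintegral => z _; rewrite eqs.
  - by rewrite euclZ gtr0_norm// mulrC ler_pM2r.
(* Fenchel at the pairs (x + r b, y + r b) and (x - r b, y - r b): the mixed terms cancel and 2 r^2
   |b|^2 remains, minus twice the slack at (x, y). *)
have fl b : 2 * (r ^+ 2 * dotv b b) - 2 * e' <= Bu (r *: b) + Bv (r *: b).
  rewrite /Bu /Bv -(haslaw_EE (f := fun x : T => second_diff u (r *: b) x) g1' (intg_measurable (isu _))).
  rewrite -(haslaw_EE (f := fun x : T => second_diff v (r *: b) x) g2' (intg_measurable (isv _))).
  have j1 := haslaw_intg (f := fun x : T => second_diff u (r *: b) x) g1' (isu _).
  have j2 := haslaw_intg (f := fun x : T => second_diff v (r *: b) x) g2' (isv _).
  rewrite -EED//; apply: (@le_trans _ _ (\int[g]_z (2 * (r ^+ 2 * dotv b b) - 2 * (u z.1 + v z.2 - dotv z.1 z.2)))).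
    rewrite EEB; [|exact: intg_cst|exact: intgZ].
    by rewrite EE_cst EEZ// lerD2l lerN2 ler_pM2l.
  apply: EE_le; [by apply: intgB; [exact: intg_cst|exact: intgZ]|exact: intgD|].
  move=> z; have f1 := fen (z.1 + r *: b) (z.2 + r *: b); have f2 := fen (z.1 - r *: b) (z.2 - r *: b).
  rewrite dotvBl !dotvBr in f2; rewrite dotvDl !dotvDr in f1.
  move: f1 f2; rewrite !dotvZl !dotvZr [dotv b z.2]dotvC expr2 -mulrA /second_diff.
  exact: lin4.
(* Here the variable of law [rho1] is paired with one of law [mu], not with its own target [nu];
   this is where the distance w between the targets enters. *)
have cu_ : \int[G]_z dotv z.2 z.1.2 <= d%:R + w / 2 * (1 + m2).
  have ih' : intg h (fun z => eucl ((B z : V) - A z) ^+ 2).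
    by move: ih; congr (intg _ _); apply/funext => z; rewrite eucl_distC.
  have Eh' : \int[h]_z eucl ((B z : V) - A z) ^+ 2 <= w ^+ 2.
    by apply: le_trans Eh; rewrite le_eqVlt; apply/orP; left; apply/eqP; apply: eq_Rintegral => z _; rewrite eucl_distC.
  apply: le_trans (cross_bound Hleb Hnu D0 L0 c0 N1 Hmu hB hA w0 ih' Eh' G2 GM) _.
  by rewrite lerD2l ler_pM2l ?divr_gt0// lerD2l.
have cv_ : \int[H]_z dotv z.2 z.1.2 <= d%:R + w / 2 * (1 + m2).
  apply: le_trans (cross_bound Hleb Hmu D0 L0 c0 N0 Hnu hA hB w0 ih Eh H2 HM) _.
  by rewrite lerD2l ler_pM2l ?divr_gt0// lerD2l.
have fu := quad_frame a Hmu ie1 G2 GM; have fv := quad_frame a Hnu ie0 H2 HM.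
rewrite -/(Qu a) in fu; rewrite -/(Qv a) in fv.
have aR2 : eucl a <= 2 * R0 by rewrite mulr2n mulrDl mul1r; apply: le_trans aR _; rewrite lerDl ltW.
have fR i j : eucl (frame_vec a i j) <= 2 * R0 by apply: le_trans (eucl_frame_vec a i j) _; rewrite ler_pM2l.
have sumc (x : R) : \sum_(i < d) \sum_(j < d) x = dd * x.
  by rewrite !sumr_const !card_ord -mulrnA -[x *+ _]mulr_natl natrM -expr2.
have su : \sum_i \sum_j (Bu (r *: frame_vec a i j) + Bv (r *: frame_vec a i j)) <=
   r ^+ 2 * \sum_i \sum_j Qu (frame_vec a i j) + r ^+ 2 * \sum_i \sum_j Qv (frame_vec a i j) + dd * (2 * (dl' * r ^+ 2)).
  rewrite -sumc !mulr_sumr -!big_split /=; apply: ler_sum => i _.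
  rewrite !mulr_sumr -!big_split /=; apply: ler_sum => j _.
  exact: lin5 (bu _ (fR i j)) (bv _ (fR i j)).
have sl_ : 2 * r ^+ 2 * (\sum_i \sum_j dotv (frame_vec a i j) (frame_vec a i j)) - dd * (2 * e') <=
   \sum_i \sum_j (Bu (r *: frame_vec a i j) + Bv (r *: frame_vec a i j)).
  rewrite -sumc mulr_sumr -sumrB; apply: ler_sum => i _.
  rewrite mulr_sumr -sumrB; apply: ler_sum => j _.
  by apply: le_trans (fl _); rewrite mulrA.
have nf := lagrange_frame_norm a.
exact: (fin _ _ _ _ _ _ _ _ _ _ _ _ _ _ _ _ _ r20 (dotvv_ge0 a) dd0 (le_trans e'q (hq r rrs)) dlE (bu a aR2) (bv a aR2) su sl_ nf fu fv cu_ cv_).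
Qed.

End SecondDifference.

Lemma second_diff_ge0 {R : realType} {d : nat} (u : 'rV[R]_d -> R) b x : convexf u -> 0 <= second_diff u b x.
Proof.
move=> cu; have h2 : 0 <= (2^-1 : R) <= 1 by rewrite invr_ge0 ler0n invf_le1// ler1n.
have := cu (x + b) (x - b) _ h2.
rewrite (_ : _ + _ *: _ = x); last first.
  rewrite (_ : 1 - 2^-1 = 2^-1 :> R); last by field.
  by rewrite -scalerDr addrCA addrK -mulr2n -[x *+ 2]scaler_nat scalerA mulVf// scale1r.
by rewrite /second_diff; lra.
Qed.

(** Index 1 is the coarse scale and index 0 the fine one. Since a is close to 2 q - b at each scale,
    the two mixed Fenchel inequalities compare b1 - q with i^2 (b0 - q) from both sides. The term
    (lam + i - 2) q is the loss due to unequal steps and is of second order in lam - 1. *)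
Lemma scale_step {R : realType} (lam i q e a0 a1 b0 b1 : R) : 1 <= lam -> i * lam = 1 -> 0 <= i ->
  2 * q - e <= i * a0 + lam * b1 -> 2 * q - e <= lam * a1 + i * b0 -> 0 <= q -> 0 <= e ->
  `|b1 - q| <= i ^+ 2 * `|b0 - q| + `|a0 + b0 - 2 * q| + `|a1 + b1 - 2 * q| + (lam + i - 2) * q + e.
Proof.
move=> l1 il i0 h1 h2 q0 e0.
have i1 : i <= 1 by rewrite -il ler_peMr.
have k0 : 0 <= lam + i - 2.
  rewrite -(pmulr_rge0 _ (lt_le_trans ltr01 l1)).
  rewrite (_ : lam * _ = (lam - 1) ^+ 2 + (i * lam - 1)); last by ring.
  by rewrite il subrr addr0 sqr_ge0.
have kq : 0 <= (lam + i - 2) * q by rewrite mulr_ge0.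
have s0 := ler_norm (a0 + b0 - 2 * q); have s1 := ler_norm (a1 + b1 - 2 * q).
have g0 : - (i ^+ 2 * `|b0 - q|) <= i ^+ 2 * (b0 - q) <= i ^+ 2 * `|b0 - q|.
  by rewrite -mulrN !ler_wpM2l ?sqr_ge0// ?ler_norm// lerNl -normrN ler_norm.
have n0 := normr_ge0 (a0 + b0 - 2 * q); have n1 := normr_ge0 (a1 + b1 - 2 * q).
have j1 := ler_wpM2l i0 h1; have j2 := ler_wpM2l i0 h2.
have w1 : i * (lam * b1) = b1 by rewrite mulrA il mul1r.
have w2 : i * (lam * a1) = a1 by rewrite mulrA il mul1r.
have w7 : i * (2 * q - e) = 2 * (i * q) - i * e by ring.
rewrite w7 mulrDr w1 in j1; rewrite w7 mulrDr w2 in j2.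
have w3 : i * ((lam + i - 2) * q) <= (lam + i - 2) * q by rewrite ler_piMl.
have w4 : i * ((lam + i - 2) * q) = q + i ^+ 2 * q - 2 * (i * q).
  by rewrite (_ : _ * _ = (i * lam) * q + i ^+ 2 * q - 2 * (i * q)); [rewrite il mul1r|ring].
have w5 : i * e <= e by rewrite ler_piMl.
have w6 : i ^+ 2 * (a0 + b0 - 2 * q) <= `|a0 + b0 - 2 * q|.
  apply: (@le_trans _ _ (i ^+ 2 * `|a0 + b0 - 2 * q|)); first by rewrite ler_wpM2l ?sqr_ge0.
  by rewrite ler_piMl// expr_le1.
have w8 : i * (i * a0) = i ^+ 2 * a0 by ring.
have w9 : i * (i * b0) = i ^+ 2 * b0 by ring.
rewrite w8 in j1; rewrite w9 in j2.
move: g0 w6; rewrite !mulrBr mulrDr => /andP[g0 g0'] w6.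
move: g0 g0' w3 w4 w5 w6 j1 j2 s0 s1 n0 n1 kq e0.
move=> *.
rewrite ler_norml; apply/andP; split; lra.
Qed.

Lemma contraction_iter {R : realType} (b : nat -> R) (y E : R) n : 0 <= y < 1 -> 0 <= E ->
  (forall k, (k < n)%N -> b k <= y * b k.+1 + E) -> b 0%N <= y ^+ n * b n + E / (1 - y).
Proof.
move=> /andP[y0 y1] E0; have y1' : 0 < 1 - y by rewrite subr_gt0.
elim: n b => [|n IH] b h; first by rewrite expr0 mul1r lerDl divr_ge0// ltW.
have h1 := IH (fun k => b k.+1) (fun k kn => h k.+1 kn); have h0 := h 0%N isT.
apply: le_trans h0 _; apply: (@le_trans _ _ (y * (y ^+ n * b n.+1 + E / (1 - y)) + E)).
  by rewrite lerD2r ler_wpM2l.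
rewrite mulrDr mulrA -exprS -addrA lerD2l.
by rewrite le_eqVlt; apply/orP; left; apply/eqP; field; rewrite gt_eqF.
Qed.

(** * Contraction of second differences across geometric scales *)

Section Hessian.
Context {R : realType} {d : nat} (leb : {measure set (Rd R d) -> \bar R}).
Hypothesis Hleb : is_lebesgue leb.
Local Notation T := (Rd R d).
Local Notation V := 'rV[R]_d.
Variables (mu nu rho0 rho1 : probability T R) (Psi0 Psi1 : V -> R) (phi0 phi1 : T -> R) (D th L c C : R).
Hypotheses (Hmu : target mu D th) (Hnu : target nu D th) (D0 : 0 <= D) (L0 : 0 < L) (c0 : 0 < c).
Hypotheses (N0 : nice leb mu rho0 Psi0 phi0 L c C) (N1 : nice leb nu rho1 Psi1 phi1 L c C).
Context {dh : measure_display} {Sh : measurableType dh} (h : probability Sh R) (A B : Sh -> T) (w m2 : R).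
Hypotheses (hA : haslaw h A mu) (hB : haslaw h B nu) (w0 : 0 < w).
Hypothesis ih : intg h (fun z => eucl ((A z : V) - B z) ^+ 2).
Hypothesis Eh : \int[h]_z eucl ((A z : V) - B z) ^+ 2 <= w ^+ 2.
Hypotheses (m20 : \int[rho0]_x eucl x ^+ 2 <= m2) (m21 : \int[rho1]_x eucl x ^+ 2 <= m2).

(* Contracting from the smallest to the largest of the geometric scales. *)
Lemma scales_contract (u v : V -> R) (K : R) (g : probability (T * T)%type R) (r : nat -> R) (lam q eta es : R)
    (a : V) (n : nat) :
  convexf u -> measurable_fun [set: T] u -> (forall x, `|u x| <= K * (1 + eucl x) ^+ 2) ->
  convexf v -> measurable_fun [set: T] v -> (forall x, `|v x| <= K * (1 + eucl x) ^+ 2) ->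
  haslaw g fst rho0 -> haslaw g snd rho1 -> intg g (fun z => u z.1 + v z.2 - dotv z.1 z.2) ->
  (forall x y, dotv x y <= u x + v y) ->
  1 < lam -> lam <= 2 -> (forall k, 0 < r k) -> (forall k, r k = lam * r k.+1) -> q = dotv a a -> 0 <= eta -> 0 <= es ->
  (forall k, (k <= n)%N -> 2 * \int[g]_z (u z.1 + v z.2 - dotv z.1 z.2) <= es * (r k * r k)) ->
  (forall k, (k <= n)%N -> 2 * \int[g]_z (u z.1 + v z.2 - dotv z.1 z.2) <= es * (r k * r k.+1)) ->
  (forall k, (k <= n)%N -> \int[rho0]_x second_diff u (r k *: a) x + \int[rho1]_y second_diff v (r k *: a) y <=
     r k ^+ 2 * (2 * q + eta)) ->
  \int[rho1]_y `|(r 0%N) ^- 2 * second_diff v (r 0%N *: a) y - q| <=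
     lam ^- 2 ^+ n * (3 * q + eta) + (2 * (eta + 2 * es) + (lam - 1) ^+ 2 * q + es) / (1 - lam ^- 2) /\
  \int[rho0]_x `|(r 0%N) ^- 2 * second_diff u (r 0%N *: a) x - q| <=
     lam ^- 2 ^+ n * (3 * q + eta) + (2 * (eta + 2 * es) + (lam - 1) ^+ 2 * q + es) / (1 - lam ^- 2) + (eta + 2 * es).
Proof.
have lin5 (a1 b1 c1 f1 x y z : R) : a1 <= x -> b1 <= x -> c1 <= y -> f1 <= z ->
    a1 + (b1 + (c1 + f1)) <= 2 * x + (y + z) by move=> *; lra.
have lin1 (a0 b0 q' e' : R) : 2 * q' - e' <= a0 + b0 -> 0 <= e' -> `|a0 + b0 - 2 * q'| <= a0 + b0 - 2 * q' + 2 * e'.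
  by move=> *; rewrite ler_norml; apply/andP; split; lra.
have lin4 (p s t q1 u1 u2 u3 v1 v2 v3 : R) : p + s + (t + q1) <= u1 + v1 -> p - s - (t - q1) <= u2 + v2 ->
    2 * q1 - 2 * (u3 + v3 - p) <= u1 + u2 - 2 * u3 + (v1 + v2 - 2 * v3) by move=> *; lra.
move=> cu mu_ gu cv mv gv g1 g2 isg fen l1 l2 r0 rS qE eta0 es0 hs hs' hE.
have q0 : 0 <= q by rewrite qE dotvv_ge0.
have iu b : intg rho0 (fun x : T => u (x + b)) := intg_growth Hleb b L0 c0 N0 mu_ gu.
have iv b : intg rho1 (fun x : T => v (x + b)) := intg_growth Hleb b L0 c0 N1 mv gv.
have iu0 : intg rho0 (fun x : T => u x) by have := iu 0; congr (intg _ _); apply/funext => x; rewrite addr0.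
have iv0 : intg rho1 (fun x : T => v x) by have := iv 0; congr (intg _ _); apply/funext => x; rewrite addr0.
have isu b : intg rho0 (fun x : T => second_diff u b x).
  by apply: intgB; [apply: intgD; exact: iu|exact: intgZ].
have isv b : intg rho1 (fun x : T => second_diff v b x).
  by apply: intgB; [apply: intgD; exact: iv|exact: intgZ].
(* Second differences divided by the squared step, so that the expected value at every scale is q =
   |a|^2. *)
pose al k (x : T) := r k ^- 2 * second_diff u (r k *: a) x.
pose be k (y : T) := r k ^- 2 * second_diff v (r k *: a) y.
have ial k : intg rho0 (al k) by exact: intgZ.
have ibe k : intg rho1 (be k) by exact: intgZ.
have r2 k : 0 < r k ^- 2 by rewrite invr_gt0 exprn_gt0.
have al0 k x : 0 <= al k x by rewrite mulr_ge0 ?second_diff_ge0// ltW.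
have be0 k x : 0 <= be k x by rewrite mulr_ge0 ?second_diff_ge0// ltW.
have jal k := haslaw_intg g1 (ial k); have jbe k := haslaw_intg g2 (ibe k).
pose sg (z : T * T) := u z.1 + v z.2 - dotv z.1 z.2.
have sg0 z : 0 <= sg z by rewrite subr_ge0.
have fl k k' z : 2 * (r k * r k' * q) - 2 * sg z <= r k ^+ 2 * al k z.1 + r k' ^+ 2 * be k' z.2.
  rewrite /al /be !mulVKf ?expf_neq0 ?gt_eqF// qE.
  have f1 := fen (z.1 + r k *: a) (z.2 + r k' *: a); have f2 := fen (z.1 - r k *: a) (z.2 - r k' *: a).
  rewrite dotvBl !dotvBr in f2; rewrite dotvDl !dotvDr in f1.
  move: f1 f2; rewrite !dotvZl !dotvZr [dotv a z.2]dotvC -mulrA /second_diff /sg.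
  exact: lin4.
have lam0 : 0 < lam by rewrite (lt_trans ltr01).
have il : lam^-1 * lam = 1 by rewrite mulVf// gt_eqF.
have i0 : 0 <= lam^-1 by rewrite invr_ge0 ltW.
pose es_ k k' z := 2 * sg z / (r k * r k').
have rr k k' : 0 < r k * r k' by rewrite mulr_gt0.
have es_0 k k' z : 0 <= es_ k k' z by rewrite divr_ge0 ?mulr_ge0// ltW.
have ies k k' : intg g (es_ k k') by apply: intgZr; exact: intgZ.
have Ees k : (k <= n)%N -> \int[g]_z es_ k k z <= es.
  by move=> kn; rewrite EEZr ?EEZ//; [rewrite ler_pdivrMr//; exact: hs|exact: intgZ].
have Ees' k : (k <= n)%N -> \int[g]_z es_ k k.+1 z <= es.
  by move=> kn; rewrite EEZr ?EEZ//; [rewrite ler_pdivrMr//; exact: hs'|exact: intgZ].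
have f00 k z : 2 * q - es_ k k z <= al k z.1 + be k z.2.
  rewrite -(ler_pM2l (rr k k)) mulrBr mulrDr -!expr2 /es_ -expr2 [_ ^+ 2 * (_ / _)]mulrC divfK ?expf_neq0 ?gt_eqF//.
  by have := fl k k z; rewrite -expr2 mulrCA.
have f01 k z : 2 * q - es_ k k.+1 z <= lam * al k z.1 + lam^-1 * be k.+1 z.2.
  rewrite -(ler_pM2l (rr k k.+1)) mulrBr mulrDr /es_ [_ * _ * (2 * _ / _)]mulrC divfK ?mulf_neq0 ?gt_eqF//.
  have -> : r k * r k.+1 * (lam * al k z.1) = r k ^+ 2 * al k z.1 by rewrite [r k ^+ 2]expr2 {3}(rS k); ring.
  have -> : r k * r k.+1 * (lam^-1 * be k.+1 z.2) = r k.+1 ^+ 2 * be k.+1 z.2.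
    by rewrite rS; field; rewrite gt_eqF.
  by have := fl k k.+1 z; rewrite [2 * (_ * q)]mulrCA.
have f10 k z : 2 * q - es_ k k.+1 z <= lam^-1 * al k.+1 z.1 + lam * be k z.2.
  rewrite -(ler_pM2l (rr k k.+1)) mulrBr mulrDr /es_ [_ * _ * (2 * _ / _)]mulrC divfK ?mulf_neq0 ?gt_eqF//.
  have -> : r k * r k.+1 * (lam * be k z.2) = r k ^+ 2 * be k z.2 by rewrite [r k ^+ 2]expr2 {3}(rS k); ring.
  have -> : r k * r k.+1 * (lam^-1 * al k.+1 z.1) = r k.+1 ^+ 2 * al k.+1 z.1.
    by rewrite rS; field; rewrite gt_eqF.
  by have := fl k.+1 k z; rewrite [2 * (_ * q)]mulrCA [r k.+1 * r k]mulrC.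
pose s k z := `|al k z.1 + be k z.2 - 2 * q|.
have isk k : intg g (s k) by apply: intg_norm; apply: intgB; [exact: intgD|exact: intg_cst].
(* An almost nonnegative function has L^1 norm close to its mean: Fenchel with equal steps bounds al
   + be - 2 q below by minus the slack, and [hE] bounds the mean above. *)
have Es k : (k <= n)%N -> \int[g]_z s k z <= eta + 2 * es.
  move=> kn; apply: (@le_trans _ _ (\int[g]_z (al k z.1 + be k z.2 - 2 * q + 2 * es_ k k z))).
    apply: EE_le => //; first by apply: intgD; [apply: intgB; [exact: intgD|exact: intg_cst]|exact: intgZ].
    by move=> z; apply: lin1.
  rewrite EED; [|by apply: intgB; [exact: intgD|exact: intg_cst]|exact: intgZ].
  rewrite EEZ//; apply: lerD; last by rewrite ler_pM2l// Ees.
  rewrite EEB; [|exact: intgD|exact: intg_cst].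
  rewrite EE_cst EED// (haslaw_EE g1 (intg_measurable (ial k))) (haslaw_EE g2 (intg_measurable (ibe k))).
  rewrite !EEZ// -mulrDr lerBlDl mulrC ler_pdivrMr ?exprn_gt0// [leRHS]mulrC; exact: hE.
pose b k := \int[rho1]_y `|be k y - q|.
have ibq k : intg rho1 (fun y => `|be k y - q|) by apply: intg_norm; apply: intgB => //; exact: intg_cst.
have jbq k := haslaw_intg g2 (ibq k).
have bE k : b k = \int[g]_z `|be k z.2 - q| by rewrite (haslaw_EE g2 (intg_measurable (ibq k))).
have kl : lam + lam^-1 - 2 <= (lam - 1) ^+ 2.
  have -> : lam + lam^-1 - 2 = lam^-1 * (lam - 1) ^+ 2 by field; rewrite gt_eqF.
  by rewrite ler_piMl ?sqr_ge0// invf_le1// ltW.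
pose Err := 2 * (eta + 2 * es) + (lam - 1) ^+ 2 * q + es.
have Err0 : 0 <= Err.
  apply: addr_ge0 => //; apply: addr_ge0; last by rewrite mulr_ge0 ?sqr_ge0.
  by apply: mulr_ge0 => //; apply: addr_ge0 => //; exact: mulr_ge0.
have step k : (k < n)%N -> b k <= lam ^- 2 * b k.+1 + Err.
  move=> kn; rewrite !bE.
  apply: (@le_trans _ _ (\int[g]_z (lam ^- 2 * `|be k.+1 z.2 - q| + s k.+1 z + s k z + (lam + lam^-1 - 2) * q + es_ k k.+1 z))).
    apply: EE_le => //.
      apply: intgD => //; apply: intgD; last exact: intg_cst.
      by apply: intgD => //; apply: intgD => //; exact: intgZ.
    by move=> z; rewrite -exprVn; apply: (scale_step (ltW l1) il i0 (f10 k z) (f01 k z) q0).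
  rewrite EED//; last first.
    apply: intgD; last exact: intg_cst.
    by apply: intgD => //; apply: intgD => //; exact: intgZ.
  rewrite EED; [|by apply: intgD => //; apply: intgD => //; exact: intgZ|exact: intg_cst].
  rewrite EED//; last by apply: intgD => //; exact: intgZ.
  rewrite EED//; last exact: intgZ.
  rewrite (EEZ _ (jbq k.+1)) EE_cst /Err -!addrA lerD2l.
  have e1 := Es _ kn; have e2 := Es _ (ltnW kn); have e3 := Ees' _ (ltnW kn).
  have e4 := ler_wpM2r q0 kl.
  by rewrite -addrA in e4; exact: lin5 e1 e2 e4 e3.
have y01 : 0 <= lam ^- 2 < 1.
  rewrite invr_ge0 exprn_ge0 ?(ltW lam0)//=.
  by rewrite invf_lt1 ?exprn_gt0// exprn_egt1.
have b0 := contraction_iter y01 Err0 step.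
(* At the finest scale only nonnegativity and the mean are used; this crude bound is damped by
   lam^-2 to the power n. *)
have bn : b n <= 3 * q + eta.
  rewrite bE; apply: (@le_trans _ _ (\int[g]_z (al n z.1 + be n z.2 + q))).
    apply: EE_le => //; first by apply: intgD; [exact: intgD|exact: intg_cst].
    move=> z; apply: le_trans (ler_normB _ _) _; rewrite !ger0_norm// lerD2r lerDr.
    exact: al0.
  rewrite EED; [|exact: intgD|exact: intg_cst].
  rewrite EE_cst EED// (haslaw_EE g1 (intg_measurable (ial n))) (haslaw_EE g2 (intg_measurable (ibe n))).
  rewrite (_ : 3 * q + eta = (2 * q + eta) + q); last by ring.
  rewrite lerD2r !EEZ// -mulrDr mulrC ler_pdivrMr ?exprn_gt0// [leRHS]mulrC; exact: hE.
have fin : b 0%N <= lam ^- 2 ^+ n * (3 * q + eta) + Err / (1 - lam ^- 2).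
  apply: le_trans b0 _; rewrite lerD2r; apply: ler_wpM2l => //.
  by rewrite exprn_ge0//; case/andP: y01.
split => //.
have jaq : intg rho0 (fun x => `|al 0%N x - q|) by apply: intg_norm; apply: intgB => //; exact: intg_cst.
rewrite -(haslaw_EE (f := fun x => `|al 0%N x - q|) g1 (intg_measurable jaq)).
apply: (@le_trans _ _ (\int[g]_z (`|be 0%N z.2 - q| + s 0%N z))).
  apply: EE_le => //; [exact: haslaw_intg g1 jaq|exact: intgD|].
  move=> z; rewrite /s (_ : al 0%N z.1 - q = (al 0%N z.1 + be 0%N z.2 - 2 * q) - (be 0%N z.2 - q)); last by ring.
  by apply: le_trans (ler_normB _ _) _; rewrite addrC.
by rewrite EED// -bE; apply: lerD => //; exact: Es.
Qed.

End Hessian.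

Lemma bernoulli_ineq {R : realType} (t : R) n : 0 <= t -> 1 + n%:R * t <= (1 + t) ^+ n.
Proof.
move=> t0; elim: n => [|n IH]; first by rewrite mul0r addr0 expr0.
have t1 : 0 <= 1 + t by rewrite addr_ge0.
rewrite exprS; apply: le_trans (ler_wpM2l t1 IH); rewrite -natr1.
have : 0 <= n%:R * t * t by rewrite !mulr_ge0.
move: (n%:R : R) => k; lra.
Qed.

(** Dividing by 1 - (1 + t)^-2 >= t / 2 costs 1 / t. The loss t^2 q becomes O(t q), and w <= t^2
    gives eta / t <= q t (1 + m2) + dl / 24. The total is 5 t q + 6 eta / t + 12 es / t, hence the
    coefficient 11 + 6 m2. *)
Lemma contraction_bound {R : realType} (t q eta es dl m2 w yN y : R) : 0 < t -> t <= 1 -> 0 <= q -> 0 <= m2 ->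
  w <= t ^+ 2 -> 0 < dl -> eta = q * w * (1 + m2) + dl * t / 24 -> 0 <= eta -> es = dl * t / 48 ->
  yN <= t -> t / 2 <= 1 - y ->
  yN * (3 * q + eta) + (2 * (eta + 2 * es) + t ^+ 2 * q + es) / (1 - y) + (eta + 2 * es) <=
  (11 + 6 * m2) * t * q + dl.
Proof.
move=> t0 t1 q0 m0 wt dl0 etaE eta0 esE yt ty.
have es0 : 0 <= es by rewrite esE divr_ge0// mulr_ge0 ?ltW.
have t2 : 0 < t / 2 by rewrite divr_gt0.
have E0 : 0 <= 2 * (eta + 2 * es) + t ^+ 2 * q + es.
  apply: addr_ge0 => //; apply: addr_ge0; last by rewrite mulr_ge0 ?sqr_ge0.
  by apply: mulr_ge0 => //; apply: addr_ge0 => //; exact: mulr_ge0.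
have a1 : yN * (3 * q + eta) <= t * (3 * q + eta) by rewrite ler_wpM2r// addr_ge0// mulr_ge0.
have a2 : (2 * (eta + 2 * es) + t ^+ 2 * q + es) / (1 - y) <= (2 * (eta + 2 * es) + t ^+ 2 * q + es) / (t / 2).
  by rewrite ler_wpM2l// lef_pV2// posrE// (lt_le_trans t2).
have a3 : (2 * (eta + 2 * es) + t ^+ 2 * q + es) / (t / 2) = 4 * (eta / t) + 10 * (es / t) + 2 * (t * q).
  by field; rewrite gt_eqF.
have b1 : eta / t <= q * t * (1 + m2) + dl / 24.
  rewrite ler_pdivrMr// etaE mulrDl (_ : dl / 24 * t = dl * t / 24); last by ring.
  rewrite lerD2r (_ : q * t * (1 + m2) * t = q * t ^+ 2 * (1 + m2)); last by ring.
  by rewrite ler_wpM2r ?addr_ge0// ler_wpM2l.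
have b2 : es / t = dl / 48 by rewrite esE; field; rewrite gt_eqF.
have b3 : eta <= eta / t by rewrite ler_pdivlMr// ler_piMr.
have b4 : t * eta <= eta / t by apply: le_trans b3; rewrite ler_piMl.
have b5 : es <= es / t by rewrite ler_pdivlMr// ler_piMr.
rewrite [t * _]mulrDr in a1; move: a1 a2 b1 b2 b3 b4 b5; rewrite a3.
move: (eta / t) (es / t) (t * eta) (yN * _) (_ / (1 - y)) => e1 e2 e3 e4 e5; move=> *; lra.
Qed.

Section HessianClose.
Context {R : realType} {d : nat} (leb : {measure set (Rd R d) -> \bar R}).
Hypothesis Hleb : is_lebesgue leb.
Local Notation T := (Rd R d).
Local Notation V := 'rV[R]_d.
Variables (mu nu rho0 rho1 : probability T R) (Psi0 Psi1 : V -> R) (phi0 phi1 : T -> R) (D th L c C : R).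
Hypotheses (Hmu : target mu D th) (Hnu : target nu D th) (D0 : 0 <= D) (L0 : 0 < L) (c0 : 0 < c).
Hypotheses (N0 : nice leb mu rho0 Psi0 phi0 L c C) (N1 : nice leb nu rho1 Psi1 phi1 L c C).
Context {dh : measure_display} {Sh : measurableType dh} (h : probability Sh R) (A B : Sh -> T) (w m2 : R).
Hypotheses (hA : haslaw h A mu) (hB : haslaw h B nu) (w0 : 0 < w).
Hypothesis ih : intg h (fun z => eucl ((A z : V) - B z) ^+ 2).
Hypothesis Eh : \int[h]_z eucl ((A z : V) - B z) ^+ 2 <= w ^+ 2.
Hypotheses (m20 : \int[rho0]_x eucl x ^+ 2 <= m2) (m21 : \int[rho1]_x eucl x ^+ 2 <= m2).

(** The largest scale is 1 / n, with n as large as wanted, because it becomes the mesh of the later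
    interpolation; the ratio 1 + t of successive scales carries the final precision. *)
Theorem hessian_close (t R0 dl : R) (n0 : nat) : 0 < t -> t <= 1 -> w <= t ^+ 2 -> 0 < R0 -> 0 < dl ->
  exists (n : nat) (u v : V -> R) (K : R) (g : probability (T * T)%type R),
  [/\ subconvex u, measurable_fun [set: T] u & forall x, `|u x| <= K * (1 + eucl x) ^+ 2] /\
  [/\ subconvex v, measurable_fun [set: T] v & forall y, `|v y| <= K * (1 + eucl y) ^+ 2] /\
  [/\ haslaw g fst rho0, haslaw g snd rho1,
      intg g (fun z => u z.1 + v z.2 - dotv z.1 z.2) & \int[g]_z (u z.1 + v z.2 - dotv z.1 z.2) <= dl] /\
  (forall x y, dotv x y <= u x + v y) /\ (n0 <= n)%N /\ (0 < n)%N /\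
  forall a, eucl a <= R0 ->
    \int[rho0]_x `|n%:R ^+ 2 * second_diff u (n%:R^-1 *: a) x - dotv a a| <= (11 + 6 * m2) * t * dotv a a + dl /\
    \int[rho1]_x `|n%:R ^+ 2 * second_diff v (n%:R^-1 *: a) x - dotv a a| <= (11 + 6 * m2) * t * dotv a a + dl.
Proof.
move=> t0 t1 wt R00 dl0.
have m2_ge0 : 0 <= m2 by apply: le_trans m20; apply: EE_ge0 => x; exact: sqr_ge0.
have dt0 : 0 < dl * t / 24 by rewrite divr_gt0// mulr_gt0.
have [r0 [r00 hr]] := second_difference_bound Hleb Hmu Hnu D0 L0 c0 N0 N1 hA hB w0 ih Eh m20 m21 dt0 R00.
pose n := (maxn n0 (Num.truncn r0^-1)).+1.
have n0' : (0 : R) < n%:R by rewrite ltr0n.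
have nr : n%:R^-1 <= r0.
  rewrite -[r0]invrK lef_pV2 ?posrE ?invr_gt0//; apply: ltW; apply: lt_le_trans (truncnS_gt _) _.
  by rewrite ler_nat ltnS leq_maxr.
have lam1 : 1 < 1 + t by rewrite ltrDl.
have lam0 : 0 < 1 + t by rewrite (lt_trans ltr01).
have lam2 : 1 + t <= 2 by rewrite [leRHS](_ : 2 = 1 + 1)// lerD2l.
pose r (k : nat) := (1 + t) ^- k / n%:R.
have rp k : 0 < r k by rewrite divr_gt0// invr_gt0 exprn_gt0.
have rS k : r k = (1 + t) * r k.+1.
  by rewrite /r exprS invfM !mulrA mulfV ?gt_eqF// mul1r.
have rdec k : r k.+1 <= r k by rewrite (rS k) ler_peMl ?(ltW (rp _))// ltW.
have rmono k l : (k <= l)%N -> r l <= r k.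
  by elim: l => [|l IH]; [rewrite leqn0 => /eqP->|rewrite leq_eqVlt => /predU1P[->//|/IH]; apply: le_trans].
have r0n : r 0%N = n%:R^-1 by rewrite /r expr0 invr1 mul1r.
(* Bernoulli gives (1 + t)^N >= N t >= 1 / t, so after N scales the crude bound is damped by at most
   t. *)
pose N := (Num.truncn (t ^- 2)).+1.
have yN : (1 + t) ^- 2 ^+ N <= t.
  rewrite exprVn -exprM mulnC exprM -exprVn.
  have h1 : (1 + t) ^- N <= t.
    rewrite -[t in leRHS]invrK lef_pV2 ?posrE ?invr_gt0 ?exprn_gt0//.
    apply: le_trans (bernoulli_ineq N (ltW t0)).
    have : t ^- 2 <= N%:R by apply: ltW; exact: truncnS_gt.
    move=> /(ler_wpM2r (ltW t0)); rewrite expr2 invfM -mulrA mulVf ?gt_eqF// mulr1 => /le_trans; apply.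
    by rewrite lerDr.
  rewrite expr2; apply: le_trans h1; rewrite ler_piMl ?invr_ge0 ?exprn_ge0 ?(ltW lam0)//.
  by rewrite invf_le1 ?exprn_gt0// exprn_ege1// ltW.
have ty : t / 2 <= 1 - (1 + t) ^- 2.
  rewrite lerBrDr -lerBrDl; rewrite -[leLHS]mul1r ler_pdivrMr ?exprn_gt0//.
  rewrite -subr_ge0 (_ : _ - _ = 2^-1 * t * (3 - t ^+ 2)); last by field.
  by rewrite !mulr_ge0 ?invr_ge0 ?(ltW t0)// subr_ge0; apply: (@le_trans _ _ 1); [rewrite expr_le1// ltW|rewrite ler1n].
pose es := dl * t / 48.
have es0 : 0 < es by rewrite divr_gt0// mulr_gt0.
(* The slack is measured against the square of the smallest step in use, r_(N+1). *)
pose e := Num.min dl (es * r N.+1 ^+ 2 / 2).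
have e0 : 0 < e by rewrite lt_min dl0 divr_gt0// mulr_gt0// exprn_gt0.
have [|u [v [K [g [[cu mu_ gu] [[cv mv gv] [[g1 g2 isg Esg] [fen hE]]]]]]]] := hr [seq r k | k <- iota 0 N.+1] _ e e0.
  by move=> _ /mapP[k _ ->]; rewrite rp/=; apply: le_trans nr; rewrite -r0n; exact: rmono.
exists n, u, v, K, g; split => //; split => //; split.
  by split => //; apply: le_trans Esg _; rewrite ge_min lexx.
split => //; split; first by rewrite ltnW// ltnS leq_maxl.
split => // a aR.
have q0 : 0 <= dotv a a := dotvv_ge0 a.
pose eta := dotv a a * w * (1 + m2) + dl * t / 24.
have eta0 : 0 <= eta by rewrite addr_ge0 ?(ltW dt0)// !mulr_ge0 ?addr_ge0// ltW.
have Esg' : 2 * \int[g]_z (u z.1 + v z.2 - dotv z.1 z.2) <= es * r N.+1 ^+ 2.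
  rewrite -ler_pdivlMl// mulrC; apply: le_trans Esg _; by rewrite ge_min lexx orbT.
have rr k l : (k <= N.+1)%N -> (l <= N.+1)%N -> 2 * \int[g]_z (u z.1 + v z.2 - dotv z.1 z.2) <= es * (r k * r l).
  move=> kN lN; apply: le_trans Esg' _; rewrite ler_pM2l// expr2.
  by apply: ler_pM; rewrite ?(ltW (rp _))// rmono.
have [|||h1 h2] := @scales_contract R d leb Hleb mu nu rho0 rho1 Psi0 Psi1 phi0 phi1 L c C L0 c0 N0 N1 u v K g r (1 + t)
  (dotv a a) eta es a N (subconvex_convexf cu) mu_ gu (subconvex_convexf cv) mv gv g1 g2 isg fen lam1 lam2 rp rS erefl eta0 (ltW es0).
- by move=> k kN; apply: rr; exact: leqW.
- by move=> k kN; apply: rr => //; exact: leqW.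
- move=> k kN; have : r k \in [seq r k | k <- iota 0 N.+1] by rewrite map_f// mem_iota.
  move=> /hE/(_ a aR)/le_trans; apply; rewrite ler_pM2l ?exprn_gt0//.
  by rewrite le_eqVlt; apply/orP; left; apply/eqP; rewrite /eta; field.
have cb := contraction_bound t0 t1 q0 m2_ge0 wt dl0 (erefl eta) eta0 (erefl es) yN ty.
have tE : 1 + t - 1 = t by rewrite addrAC subrr add0r.
have nn : (n%:R^-1) ^- 2 = n%:R ^+ 2 :> R by rewrite exprVn invrK.
rewrite tE r0n nn in h1 h2; split; first exact: le_trans h2 cb.
by apply: le_trans h1 _; apply: le_trans cb; rewrite lerDl addr_ge0// mulr_ge0 ?(ltW es0).
Qed.

End HessianClose.

(** * Interpolation from the uniform law on a cube *)

Section ProductExpectation.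
Context {d1 d2 : measure_display} {S1 : measurableType d1} {S2 : measurableType d2} {R : realType}.
Variables (P1 : probability S1 R) (P2 : probability S2 R).
Local Notation PP := ((P1 \x P2)%E : probability (S1 * S2)%type R).

Lemma prod_haslaw : haslaw PP fst P1 /\ haslaw PP snd P2.
Proof.
split; split => // A mA.
- rewrite (_ : fst @^-1` A = A `*` setT); last by apply/seteqP; split => x /=; [|case].
  by rewrite [LHS]product_measure1E//= probability_setT mule1.
- rewrite (_ : snd @^-1` A = setT `*` A); last by apply/seteqP; split => x /=; [|case].
  by rewrite [LHS]product_measure1E//= probability_setT mul1e.
Qed.

(** Fubini as an inequality between expectations: comparison on every section suffices, which plays
    the role of conditional Jensen. *)
Lemma prod_EE_ge (f : S1 * S2 -> R) (g : S1 -> R) : intg PP f -> intg P1 g ->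
  (forall x, intg P2 (fun y => f (x, y)) /\ g x <= \int[P2]_y f (x, y)) ->
  \int[P1]_x g x <= \int[PP]_z f z.
Proof.
move=> if_ ig h; rewrite -lee_fin -!EE_fineK//.
have := integral12_prod_meas1 if_; rewrite -[X in _ = X -> _]/(\int[PP]_z (f z)%:E)%E => <-.
have [/integrableP[mg _] iF] := (ig, integrable_fubini_F if_).
apply: le_integral => //= x _.
by rewrite /fubini_F EE_fineK ?lee_fin; [case: (h x)|case: (h x)].
Qed.

Lemma prod_EE_ge2 (f : S1 * S2 -> R) (g : S2 -> R) : intg PP f -> intg P2 g ->
  (forall y, intg P1 (fun x => f (x, y)) /\ g y <= \int[P1]_x f (x, y)) ->
  \int[P2]_y g y <= \int[PP]_z f z.
Proof.
move=> if_ ig h; rewrite -lee_fin -!EE_fineK//.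
have := integral21_prod_meas1 if_; rewrite -[X in _ = X -> _]/(\int[PP]_z (f z)%:E)%E => <-.
have mf : measurable_fun setT (EFin \o f) by exact: measurable_int if_.
have iG : P2.-integrable setT (fubini_G P1 (EFin \o f)).
  apply/integrableP; split; first exact: (measurable_fubini_G if_).
  apply: le_lt_trans ((integrable21ltyP _ _ mf).1 if_); apply: ge0_le_integral => //.
  - by apply: measurableT_comp => //; exact: (measurable_fubini_G if_).
  - apply: (@measurable_fun_fubini_tonelli_G _ _ _ _ _ P1 (abse \o (EFin \o f))).
      exact: measurableT_comp.
    by move=> x; exact: abse_ge0.
  - move=> y _; apply: le_abse_integral => //; apply: measurableT_comp => //; exact: measurable_pair2.
apply: le_integral => //= y _.
by rewrite /fubini_G EE_fineK ?lee_fin; [case: (h y)|case: (h y)].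
Qed.

Lemma prod_EE (f : S1 * S2 -> R) (g : S1 -> R) : intg PP f -> intg P1 g ->
  (forall x, intg P2 (fun y => f (x, y)) /\ \int[P2]_y f (x, y) = g x) ->
  \int[PP]_z f z = \int[P1]_x g x.
Proof.
move=> if_ ig h; apply/eqP; rewrite eq_le; apply/andP; split; last first.
  by apply: prod_EE_ge => // x; have [h1 ->] := h x.
rewrite -lerN2 -!EEN//; apply: prod_EE_ge; [exact: intgN|exact: intgN|].
by move=> x; have [h1 h2] := h x; split; [exact: intgN|rewrite EEN// h2].
Qed.

End ProductExpectation.

Section DensityTransport.
Context {R : realType} {d : nat} (leb : {measure set (Rd R d) -> \bar R}).
Hypothesis Hleb : is_lebesgue leb.
Local Notation T := (Rd R d).
Local Notation V := 'rV[R]_d.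

(** [leb] is an arbitrary measure with the right values on boxes, so its sigma-finite structure is
    packed on the spot for Tonelli. *)
Lemma leb_tonelli (f : T * T -> \bar R) : measurable_fun setT f -> (forall z, 0 <= f z)%E ->
  (\int[leb]_x \int[leb]_y f (x, y) = \int[leb]_y \int[leb]_x f (x, y))%E /\
  measurable_fun setT (fun y => \int[leb]_x f (x, y))%E.
Proof.
case: leb Hleb => P c Hl mf f0; pose Pm : {measure set T -> \bar R} := Measure.Pack c.
pose m : {sigma_finite_measure set T -> \bar R} :=
  HB.pack P c (Measure_isSigmaFinite.Build _ _ _ Pm (leb_sigma_finite Hl)).
split; first exact: (@fubini_tonelli _ _ T T R m m f mf f0).
exact: (@measurable_fun_fubini_tonelli_G _ _ T T R m f mf f0).
Qed.

(** In the variables (intermediate point y, displacement a) the pair of independent points has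
    density k(y - s a) p(y + (1 - s) a). The change of variables has Jacobian one and consists of
    two translations exchanged by Tonelli. A bound by Cp f(y) then replaces the law of the
    intermediate point by [rho], with a ranging over Lebesgue measure. *)
Lemma density_transport (zz Q rho : probability T R) (k p f : T -> R) (Cp s : R) (h : T * T -> R) :
  measurable_fun setT k -> (forall x, 0 <= k x) -> measurable_fun setT p -> (forall x, 0 <= p x) ->
  measurable_fun setT f -> (forall x, 0 <= f x) ->
  (forall A, measurable A -> zz A = (\int[leb]_(x in A) (k x)%:E)%E) ->
  (forall A, measurable A -> Q A = (\int[leb]_(x in A) (p x)%:E)%E) ->
  (forall A, measurable A -> rho A = (\int[leb]_(x in A) (f x)%:E)%E) ->
  measurable_fun setT h -> (forall z, 0 <= h z) -> 0 <= Cp ->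
  (forall y a : V, k (y - s *: a) * p (y + (1 - s) *: a) <= Cp * f y) ->
  (\int[(zz \x Q)%E]_z (h ((z.1 : V) + s *: ((z.2 : V) - z.1), (z.2 : V) - z.1))%:E <=
   Cp%:E * \int[leb]_a \int[rho]_y (h (y, a))%:E)%E.
Proof.
move=> mk k0 mp p0 mf f0 zzE QE rhoE mh h0 Cp0 hC.
have m1 : measurable_fun setT (fst : T * T -> T) := measurable_fst.
have m2 : measurable_fun setT (snd : T * T -> T) := measurable_snd.
have mcs (c : R) : measurable_fun setT (fun _ : T * T => c) := measurable_cst c.
pose H (z : T * T) := (h ((z.1 : V) + s *: ((z.2 : V) - z.1) : T, (z.2 : V) - z.1 : T))%:E.
have mH : measurable_fun setT H.
  apply/measurable_EFinP; apply: measurableT_comp => //; apply/measurable_fun_pairP; split => /=.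
    by apply: measurable_addv => //; apply: measurable_scalev => //; exact: measurable_subv.
  exact: measurable_subv.
have H0 z : (0 <= H z)%E by rewrite lee_fin.
rewrite (@fubini_tonelli1 _ _ _ _ _ zz Q H mH H0).
have mF := @measurable_fun_fubini_tonelli_F _ _ _ _ _ Q H mH H0.
have F0 x : (0 <= fubini_F Q H x)%E by apply: integral_ge0 => y _; exact: H0.
rewrite (ge0_integral_density mk k0 zzE mF F0).
pose f2 (z : T * T) := (h ((z.1 : V) + s *: (z.2 : V) : T, z.2) * p ((z.2 : V) + (z.1 : V) : T) * k z.1)%:E.
have mf2 : measurable_fun setT f2.
  apply/measurable_EFinP; apply: measurable_funM; last exact: measurableT_comp.
  apply: measurable_funM.
    apply: measurableT_comp => //; apply/measurable_fun_pairP; split => //=.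
    by apply: measurable_addv => //; exact: measurable_scalev.
  by apply: (measurableT_comp mp); exact: measurable_addv.
have f20 z : (0 <= f2 z)%E by rewrite lee_fin !mulr_ge0.
have sec1 x : measurable_fun setT (fun a : T => f2 (x, a)) by apply: measurableT_comp => //; exact: measurable_pair1.
have sec2 a : measurable_fun setT (fun x : T => f2 (x, a)) by apply: measurableT_comp => //; exact: measurable_pair2.
have -> : (\int[leb]_x (fubini_F Q H x * (k x)%:E) = \int[leb]_x \int[leb]_a f2 (x, a))%E.
  apply: eq_integral => x _; rewrite /fubini_F.
  have mHx : measurable_fun setT (fun y => H (x, y)) by apply: measurableT_comp => //; exact: measurable_pair1.
  rewrite (ge0_integral_density mp p0 QE mHx (fun y => H0 (x, y))).
  rewrite -[X in (X * _)%E](ge0_integral_shift Hleb x); first last.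
  - by move=> y; rewrite mule_ge0// lee_fin.
  - by apply: emeasurable_funM => //; exact/measurable_EFinP.
  have mpx : measurable_fun setT (fun a : T => p ((a : V) + x)) by apply: measurable_fun_shift.
  rewrite -ge0_integralZr//; first last.
  - by rewrite lee_fin.
  - by move=> a _; rewrite mule_ge0// ?lee_fin.
  - apply: emeasurable_funM; last exact/measurable_EFinP.
    exact: (measurableT_comp mHx (measurable_shift (x : V))).
  by apply: eq_integral => a _; rewrite /H /f2 /= addrK -!EFinM.
have [-> mG] := leb_tonelli mf2 f20.
have mh1 : measurable_fun setT (fun z : T * T => (h z)%:E) by exact/measurable_EFinP.
have h10 z : (0 <= (h z)%:E)%E by rewrite lee_fin.
have mR := @measurable_fun_fubini_tonelli_G _ _ _ _ _ rho _ mh1 h10.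
rewrite -ge0_integralZl//; last by move=> a _; apply: integral_ge0 => y _.
apply: ge0_le_integral => //.
- by move=> a _; apply: integral_ge0 => y _.
- by apply: emeasurable_funM => //; exact: measurable_cst.
move=> a _.
have mha : measurable_fun setT (fun y : T => (h (y, a))%:E) by apply: (measurableT_comp mh1); exact: measurable_pair2.
rewrite (ge0_integral_density mf f0 rhoE mha (fun y => h10 (y, a))).
rewrite -[leLHS](ge0_integral_shift Hleb (- (s *: (a : V))))//.
rewrite -ge0_integralZl//; first last.
- by move=> y _; rewrite mule_ge0// lee_fin.
- by apply: emeasurable_funM => //; exact/measurable_EFinP.
apply: ge0_le_integral => //.
- exact: (measurableT_comp (sec2 a) (measurable_shift (- (s *: (a : V))))).
- by apply: emeasurable_funM; [exact: measurable_cst|apply: emeasurable_funM => //; exact/measurable_EFinP].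
move=> y _; rewrite /f2 /= -!EFinM lee_fin subrK [leRHS]mulrCA -mulrA; apply: ler_wpM2l => //.
by rewrite mulrC; have := hC y a; rewrite scalerBl scale1r addrCA [a + _]addrC.
Qed.

End DensityTransport.

Section CubeLaw.
Context {R : realType} {d : nat} (leb : {measure set (Rd R d) -> \bar R}).
Hypothesis Hleb : is_lebesgue leb.
Local Notation T := (Rd R d).
Local Notation V := 'rV[R]_d.

(** Density of the uniform law on the cube [-1, 1]^d. *)
Definition kappa (x : T) : R := 2 ^- d * \1_(cube 1 : set T) x.

Lemma kappa_ge0 x : 0 <= kappa x.
Proof. by rewrite mulr_ge0// invr_ge0 exprn_ge0. Qed.

Lemma measurable_kappa : measurable_fun setT kappa.
Proof. by apply: measurable_funM; [exact: measurable_cst|apply: measurable_indic; exact: measurable_cube]. Qed.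

Lemma kappa_le1 x : kappa x <= 1.
Proof.
rewrite /kappa indicE; case: (_ \in _); rewrite ?mulr0// mulr1 invf_le1 ?exprn_gt0//.
by rewrite exprn_ege1// ler1n.
Qed.

Lemma eucl_cube (x : V) : cube 1 x -> eucl x <= d%:R.
Proof. by move=> /cubeP h; rewrite -[leRHS]mulr1; exact: eucl_le_max. Qed.

Lemma kappa_out (x : V) : d%:R < eucl x -> kappa x = 0.
Proof.
move=> h; rewrite /kappa indicE memNset ?mulr0// => /eucl_cube.
by rewrite leNgt h.
Qed.

Definition cube_law (zz : probability T R) := forall A, measurable A -> zz A = (\int[leb]_(x in A) (kappa x)%:E)%E.

Lemma cube_law_exists : exists zz, cube_law zz.
Proof.
apply: density_probability; [exact: measurable_kappa|exact: kappa_ge0|].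
under eq_integral do rewrite EFinM.
rewrite ge0_integralZl//; last by apply/measurable_EFinP; apply: measurable_indic; exact: measurable_cube.
rewrite integral_indic//; last exact: measurable_cube.
by rewrite setIT leb_cube// -EFinM mulr1 mulVf// expf_neq0.
Qed.

Section Facts.
Variable zz : probability T R.
Hypothesis Hzz : cube_law zz.

Lemma cube_law_le : {ae zz, forall z : T, eucl z <= d%:R}.
Proof.
exists (~` (cube 1 : set T)); split; first by apply: measurableC; exact: measurable_cube.
  rewrite Hzz; last by apply: measurableC; exact: measurable_cube.
  apply: integral0_eq => x /= hx; by rewrite /kappa indicE memNset ?mulr0.
by move=> z /= h hz; apply: h; exact: eucl_cube.
Qed.

Lemma cube_law_pow p : intg zz (fun z : T => eucl z ^+ p) /\ \int[zz]_z eucl z ^+ p <= d%:R ^+ p.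
Proof.
have h : {ae zz, forall z : T, `|eucl z ^+ p| <= d%:R ^+ p}.
  apply: filterS cube_law_le => z hz; rewrite ger0_norm ?exprn_ge0 ?eucl_ge0//.
  by apply: lerXn2r; rewrite ?nnegrE ?eucl_ge0.
have i : intg zz (fun z : T => eucl z ^+ p).
  by apply: intg_ae_bounded h; apply: measurable_funX; exact: measurable_eucl.
split => //; rewrite -(EE_cst zz (d%:R ^+ p)); apply: EE_le_ae => //; first exact: intg_cst.
by apply: filterS h => z; apply: le_trans; exact: ler_norm.
Qed.

Lemma cube_law_opp : haslaw zz (fun z : T => - (z : V) : T) zz.
Proof.
have mo : measurable_fun setT (fun z : T => - (z : V) : T) by apply: measurable_oppv; exact: measurable_id.
split => // A mA; rewrite !Hzz//; last by rewrite -[X in measurable X]setTI; exact: mo.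
rewrite integral_mkcond [RHS]integral_mkcond -[RHS](ge0_integral_opp Hleb); first last.
- by move=> x; rewrite patchE; case: ifP => // _; rewrite lee_fin kappa_ge0.
- by apply/(measurable_restrictT _ mA)/measurable_funTS/measurable_EFinP; exact: measurable_kappa.
apply: eq_integral => x _; rewrite !patchE.
have -> : (x \in [eta -%R] @^-1` A) = ((- (x : V) : T) \in A) by apply/idP/idP; rewrite !inE.
case: ifP => // _; congr EFin; rewrite /kappa; congr (_ * _); rewrite !indicE; congr (_%:R); congr nat_of_bool.
by apply/idP/idP; rewrite !inE => /cubeP h; apply/cubeP => i; have := h i; rewrite mxE normrN.
Qed.

Lemma cube_law_coord i : intg zz (fun z : T => (z : V) 0 i) /\ \int[zz]_z (z : V) 0 i = 0.
Proof.
have ic : intg zz (fun z : T => (z : V) 0 i).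
  apply: intg_le (cube_law_pow 1).1; [exact: measurable_coord|].
  by move=> x; exact: coord_le_eucl.
split => //; have := haslaw_EE cube_law_opp (intg_measurable ic).
rewrite (_ : \int[zz]_s (- (s : V)) 0 i = - \int[zz]_z (z : V) 0 i); last first.
  by rewrite -EEN//; congr (Rintegral _ _ _); apply/funext => s; rewrite mxE.
move: (\int[zz]_z _) => m; lra.
Qed.

End Facts.
End CubeLaw.

Lemma interp_frame {R : realType} {d : nat} (y a : 'rV[R]_d) s :
  y = s *: (y + (1 - s) *: a) + (1 - s) *: (y - s *: a).
Proof. by apply/rowP => i; rewrite !mxE; ring. Qed.

Definition displace {R : realType} {d : nat} (s : R) (z : Rd R d * Rd R d) : Rd R d * Rd R d :=
  ((z.1 : 'rV[R]_d) + s *: ((z.2 : 'rV[R]_d) - z.1), (z.2 : 'rV[R]_d) - z.1).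

Lemma measurable_displace {R : realType} {d : nat} (s : R) : measurable_fun setT (@displace R d s).
Proof.
have m1 : measurable_fun setT (fst : Rd R d * Rd R d -> Rd R d) := measurable_fst.
have m2 : measurable_fun setT (snd : Rd R d * Rd R d -> Rd R d) := measurable_snd.
have md := measurable_subv m2 m1.
apply/measurable_fun_pairP; split => //=.
by apply: measurable_addv => //; apply: measurable_scalev => //; exact: measurable_cst.
Qed.

Section Displacement.
Context {R : realType} {d : nat} (leb : {measure set (Rd R d) -> \bar R}).
Hypothesis Hleb : is_lebesgue leb.
Local Notation T := (Rd R d).
Local Notation V := 'rV[R]_d.
Variables (mu rho : probability T R) (Psi : V -> R) (phi : T -> R) (L c C : R).
Hypotheses (L0 : 0 < L) (c0 : 0 < c) (N : nice leb mu rho Psi phi L c C).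
Variable zz : probability T R.
Hypothesis Hzz : cube_law leb zz.

Definition interp_cst : R := expR (2 * `|C| + L * d%:R).

Let up (z : V) : eucl z <= d%:R -> Psi z <= `|C| + L * d%:R.
Proof.
move=> h; apply: le_trans (nice_up N z) _; apply: lerD; first exact: ler_norm.
by rewrite ler_pM2l.
Qed.

Let lo (x : V) : - `|C| <= Psi x.
Proof.
apply: le_trans (nice_lo N x); have := ler_norm C; have : 0 <= c * eucl x by rewrite mulr_ge0 ?eucl_ge0// ltW.
by lra.
Qed.

(** Convexity gives Psi y <= Psi x + (1 - s) (Psi z - Psi x) with z in the cube. There Psi is at
    most |C| + L d, and everywhere it is at least - |C|, so passing from x to y costs a bounded
    factor. *)
Lemma interp_gibbs s (y a : V) : 0 <= s <= 1 ->
  kappa (y - s *: a) * expR (- Psi (y + (1 - s) *: a)) <= interp_cst * expR (- Psi y).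
Proof.
have lin (s' v x p z CC Ld : R) : 0 <= s' <= 1 -> v <= s' * x + (1 - s') * z -> - CC <= x -> z <= CC + Ld -> 0 <= Ld ->
    0 <= CC -> (1 - s') * (z - x) <= (1 - s') * (2 * CC + Ld) -> (1 - s') * (2 * CC + Ld) <= 2 * CC + Ld -> - x <= 2 * CC + Ld + - v.
  by move=> *; lra.
move=> s01; set z := y - _; set x := y + _.
have [h|h] := ltP d%:R (eucl z); first by rewrite kappa_out// mul0r mulr_ge0 ?expR_ge0.
apply: (@le_trans _ _ (expR (- Psi x))); first by rewrite ler_piMl ?expR_ge0// kappa_le1.
rewrite /interp_cst -expRD ler_expR.
have := nice_conv N x z s01; rewrite -interp_frame => hc.
have Ld : 0 <= L * d%:R by rewrite mulr_ge0// ltW.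
have B0 : 0 <= 2 * `|C| + L * d%:R by rewrite addr_ge0// mulr_ge0.
have [s0 s1] := andP s01; have s1' : 0 <= 1 - s by rewrite subr_ge0.
have zx : Psi z - Psi x <= 2 * `|C| + L * d%:R by have := up h; have := lo x; lra.
apply: (lin _ _ _ 0 _ _ _ s01 hc (lo x) (up h) Ld (normr_ge0 _)); first by rewrite ler_wpM2l.
by rewrite ler_piMl// gerBl.
Qed.

(** Both endpoints lie in the cube, so y lies in the ball of radius d, where the Gibbs density is
    bounded below. *)
Lemma interp_cube s (y a : V) : 0 <= s <= 1 ->
  kappa (y - s *: a) * kappa (y + (1 - s) *: a) <= interp_cst * expR (- Psi y).
Proof.
move=> s01; set z := y - _; set x := y + _.
have r0 : 0 <= interp_cst * expR (- Psi y) by rewrite mulr_ge0 ?expR_ge0.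
have [h|h] := ltP d%:R (eucl z); first by rewrite kappa_out// mul0r.
have [h'|h'] := ltP d%:R (eucl x); first by rewrite (kappa_out h') mulr0.
apply: (@le_trans _ _ 1); first by rewrite mulr_ile1 ?kappa_ge0 ?kappa_le1.
have [s0 s1] := andP s01; have s1' : 0 <= 1 - s by rewrite subr_ge0.
have hy : eucl y <= d%:R.
  rewrite [y](interp_frame _ a s) -/z -/x; apply: le_trans (eucl_triangle _ _) _.
  rewrite !euclZ !ger0_norm//; have := ler_wpM2l s0 h'; have := ler_wpM2l s1' h.
  move: (eucl z) (eucl x) (d%:R : R) => *; lra.
rewrite /interp_cst -expRD -[leLHS]expR0 ler_expR; have := up hy; have := normr_ge0 C; lra.
Qed.

(** Since [h] vanishes for displacements beyond R0, the integral over a costs the volume (2 R0)^d of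
    a cube. This volume factor forces the truncation of the segments. *)
Lemma displacement_bound (Q : probability T R) (p : T -> R) (h : T * T -> R) (R0 B s : R) :
  measurable_fun setT p -> (forall x, 0 <= p x) ->
  (forall A, measurable A -> Q A = (\int[leb]_(x in A) (p x)%:E)%E) ->
  (forall y a : V, kappa (y - s *: a) * p (y + (1 - s) *: a) <= interp_cst * expR (- Psi y)) ->
  measurable_fun setT h -> (forall z, 0 <= h z) -> 0 <= R0 -> 0 <= B ->
  (forall z, R0 < eucl (z.2 : V) -> h z = 0) ->
  (forall a : T, eucl (a : V) <= R0 -> intg rho (fun y => h (y, a)) /\ \int[rho]_y h (y, a) <= B) ->
  intg (zz \x Q)%E (fun z => h (displace s z)) /\
  \int[(zz \x Q)%E]_z h (displace s z) <= interp_cst * (B * (2 * R0) ^+ d).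
Proof.
move=> mp p0 QE hC mh h0 R00 B0 hout hin.
apply: EE_lee => [|z|]; last 2 first.
- exact: h0.
- have f0 (x : T) : 0 <= expR (- Psi x) by exact: expR_ge0.
  have dt := density_transport Hleb (@measurable_kappa R d) (@kappa_ge0 R d) mp p0 (nice_mk L0 N) f0
    Hzz QE (nice_dens N) mh h0 (expR_ge0 _) hC.
  apply: le_trans dt _.
  rewrite EFinM; apply: lee_wpmul2l; first by rewrite lee_fin expR_ge0.
  apply: (@le_trans _ _ (\int[leb]_a (B * \1_(cube R0 : set T) a)%:E)%E).
    apply: ge0_le_integral => //.
    + by move=> a _; apply: integral_ge0 => y _; rewrite lee_fin.
    + apply: (@measurable_fun_fubini_tonelli_G _ _ _ _ _ rho (EFin \o h)) => //; exact/measurable_EFinP.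
    + apply/measurable_EFinP; apply: measurable_funM; first exact: measurable_cst.
      by apply: measurable_indic; exact: measurable_cube.
    move=> a _; have [ha|ha] := ltP R0 (eucl (a : V)).
      rewrite integral0_eq; first by rewrite lee_fin mulr_ge0.
      by move=> y _; rewrite hout.
    have [i1 i2] := hin a ha.
    rewrite EE_fineK// lee_fin indicE mem_set ?mulr1//; apply/cubeP => i.
    exact: le_trans (coord_le_eucl _ _) ha.
  under eq_integral do rewrite EFinM.
  rewrite ge0_integralZl//; last by apply/measurable_EFinP; apply: measurable_indic; exact: measurable_cube.
  by rewrite integral_indic ?setIT ?leb_cube//; exact: measurable_cube.
exact: (measurableT_comp mh (measurable_displace s)).
Qed.

End Displacement.

(** Discrete Taylor formula with the increment at 0 as first-order term. *)
Lemma second_sum_lower {R : realType} (G : nat -> R) (m : R) n :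
  (forall i, (0 < i)%N -> (i < n)%N -> m <= G i.+1 + G i.-1 - 2 * G i) ->
  n%:R * (G 1%N - G 0%N) + n%:R * (n%:R - 1) / 2 * m <= G n - G 0%N.
Proof.
move=> h; have inc k : (k < n)%N -> G 1%N - G 0%N + k%:R * m <= G k.+1 - G k.
  elim: k => [|k IH] kn; first by rewrite mul0r addr0.
  have := IH (ltnW kn); have := h k.+1 isT kn; rewrite -[k.+1%:R]natr1 /=.
  move: (k%:R : R) (G 1%N) (G 0%N) (G _) (G _) (G _) => *; lra.
suff H : forall k, (k <= n)%N -> k%:R * (G 1%N - G 0%N) + k%:R * (k%:R - 1) / 2 * m <= G k - G 0%N by exact: H.
elim => [|k IH] kn; first by rewrite !mul0r subrr addr0.
have := IH (ltnW kn); have := inc k kn; rewrite -[k.+1%:R]natr1.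
move: (k%:R : R) (G 1%N) (G 0%N) (G _) (G _) => *; lra.
Qed.

Lemma second_sum_upper {R : realType} (G : nat -> R) (M : R) n :
  (forall i, (0 < i)%N -> (i <= n)%N -> G i.+1 + G i.-1 - 2 * G i <= M) ->
  (G n.+1 - G n) - (G 1%N - G 0%N) <= n%:R * M.
Proof.
elim: n => [|n IH] h; first by rewrite subrr mul0r.
have := IH (fun i i0 i1 => h i i0 (leqW i1)); have := h n.+1 isT (leqnn _); rewrite -[n.+1%:R]natr1 /=.
move: (n%:R : R) (G 1%N) (G 0%N) (G _) (G _) (G _) => *; lra.
Qed.

Section QuadraticGrowth.
Context {R : realType} {d : nat}.
Local Notation T := (Rd R d).
Local Notation V := 'rV[R]_d.
Variables (u : V -> R) (K : R).
Hypotheses (mu_ : measurable_fun [set: T] u) (uA : forall x, `|u x| <= K * (1 + eucl x) ^+ 2).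

Lemma intg_quad_growth {dS : measure_display} {S : measurableType dS} (P : probability S R) (W : S -> T) :
  measurable_fun setT W -> intg P (fun s => eucl (W s) ^+ 2) -> intg P (fun s => u (W s)).
Proof.
move=> mW iW; apply: (@intg_le _ _ _ _ _ (fun s => `|K| * (2 + 2 * eucl (W s) ^+ 2))).
- exact: (measurableT_comp mu_ mW).
- move=> s; apply: le_trans (uA _) _; apply: (@le_trans _ _ (`|K| * (1 + eucl (W s)) ^+ 2)).
    by apply: ler_wpM2r; [exact: sqr_ge0|exact: ler_norm].
  apply: ler_wpM2l => //; rewrite -subr_ge0 (_ : _ - _ = (1 - eucl (W s)) ^+ 2) ?sqr_ge0//; ring.
- by apply: intgZ; apply: intgD; [exact: intg_cst|exact: intgZ].
Qed.

Lemma eucl_comb_sqr (a b : R) (x z : V) : eucl (a *: z + b *: x) ^+ 2 <= 2 * a ^+ 2 * eucl z ^+ 2 + 2 * b ^+ 2 * eucl x ^+ 2.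
Proof.
rewrite !eucl_sqr dotvDl !dotvDr !dotvZl !dotvZr -subr_ge0.
have := dotvv_ge0 (a *: z - b *: x); rewrite dotvBl !dotvBr !dotvZl !dotvZr.
move: (dotv z z) (dotv z x) (dotv x z) (dotv x x) => p q r t h; nra.
Qed.

Lemma intg_comb_sqr {dS : measure_display} {S : measurableType dS} (P : probability S R) (Z X : S -> T) (a b : R) :
  measurable_fun setT Z -> measurable_fun setT X -> intg P (fun s => eucl (Z s) ^+ 2) -> intg P (fun s => eucl (X s) ^+ 2) ->
  measurable_fun setT (fun s => a *: (Z s : V) + b *: (X s : V) : T) /\
  intg P (fun s => eucl (a *: (Z s : V) + b *: (X s : V)) ^+ 2).
Proof.
move=> mZ mX iZ iX.
have m : measurable_fun setT (fun s => a *: (Z s : V) + b *: (X s : V) : T).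
  by apply: measurable_addv; apply: measurable_scalev => //; exact: measurable_cst.
split => //; apply: (@intg_le _ _ _ _ _ (fun s => 2 * a ^+ 2 * eucl (Z s) ^+ 2 + 2 * b ^+ 2 * eucl (X s) ^+ 2)).
- by apply: measurable_funX; exact: measurable_eucl.
- by move=> s; rewrite ger0_norm ?sqr_ge0//; exact: eucl_comb_sqr.
- by apply: intgD; exact: intgZ.
Qed.

Lemma EE_dotv_centered (Q : probability T R) :
  (forall i, intg Q (fun x : T => (x : V) 0 i) /\ \int[Q]_x (x : V) 0 i = 0) ->
  forall z : V, intg Q (fun x : T => dotv z x) /\ \int[Q]_x dotv z x = 0.
Proof.
move=> h z; split.
  by apply: intg_sum => i; apply: intgZ; case: (h i).
rewrite /dotv EE_sum; last by move=> i; apply: intgZ; case: (h i).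
by apply: big1 => i _; rewrite EEZ; [case: (h i) => _ ->; rewrite mulr0|case: (h i)].
Qed.

Hypothesis su : subconvex u.

(** Integrating the approximate affine minorant at y against a centered law removes its linear
    part. *)
Lemma jensen_shift (Q : probability T R) (y : V) (b : R) : intg Q (fun x : T => eucl x ^+ 2) ->
  (forall i, intg Q (fun x : T => (x : V) 0 i) /\ \int[Q]_x (x : V) 0 i = 0) ->
  intg Q (fun x : T => u (y + b *: (x : V))) /\ u y <= \int[Q]_x u (y + b *: (x : V)).
Proof.
move=> i2 ctr.
have mi : measurable_fun setT (fun x : T => x) by exact: measurable_id.
have mc : measurable_fun setT (fun _ : T => (y : T)) by exact: measurable_cst.
have [mW iW] := intg_comb_sqr 1 b mc mi (intg_cst Q _) i2.
have iu : intg Q (fun x : T => u (y + b *: (x : V))).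
  by have := intg_quad_growth mW iW; congr (intg _ _); apply/funext => x; rewrite scale1r.
split => //; apply/ler_addgt0Pr => e e0; have [p hp] := su y e0.
have [ip Ep] := EE_dotv_centered ctr p.
have -> : u y = \int[Q]_x (u y + b * dotv p x).
  by rewrite EED; [rewrite EE_cst EEZ// Ep mulr0 addr0|exact: intg_cst|exact: intgZ].
rewrite -(EE_cst Q e) -EED//; last exact: intg_cst.
apply: EE_le.
- by apply: intgD; [exact: intg_cst|exact: intgZ].
- by apply: intgD => //; exact: intg_cst.
- by move=> x; have := hp (y + b *: (x : V)); rewrite [y + _]addrC addrK dotvZr lerBlDr.
Qed.

End QuadraticGrowth.

(** * Mean of a potential along segments from the cube *)

Section Interpolation.
Context {R : realType} {d : nat} (leb : {measure set (Rd R d) -> \bar R}).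
Hypothesis Hleb : is_lebesgue leb.
Local Notation T := (Rd R d).
Local Notation V := 'rV[R]_d.
Variables (mu rho : probability T R) (Psi : V -> R) (phi : T -> R) (L c C : R).
Hypotheses (L0 : 0 < L) (c0 : 0 < c) (N : nice leb mu rho Psi phi L c C).
Variable zz : probability T R.
Hypothesis Hzz : cube_law leb zz.
Variables (u : V -> R) (K : R).
Hypotheses (su : subconvex u) (mu_ : measurable_fun [set: T] u) (uA : forall x, `|u x| <= K * (1 + eucl x) ^+ 2).
Variables (n : nat) (R0 B : R).
Hypotheses (n0 : (0 < n)%N) (R00 : 0 <= R0) (B0 : 0 <= B).
Hypothesis hB : forall a : V, eucl a <= R0 ->
  \int[rho]_x `|n%:R ^+ 2 * second_diff u (n%:R^-1 *: a) x - dotv a a| <= B.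

Local Notation eta := (@interp_cst R d L C * (B * (2 * R0) ^+ d)).

Section Law.
Variables (Q : probability T R) (p : T -> R).
Hypotheses (mp : measurable_fun setT p) (p0 : forall x, 0 <= p x).
Hypothesis QE : forall A, measurable A -> Q A = (\int[leb]_(x in A) (p x)%:E)%E.
Hypothesis interp : forall s (y a : V), 0 <= s <= 1 ->
  kappa (y - s *: a) * p (y + (1 - s) *: a) <= @interp_cst R d L C * expR (- Psi y).
Hypothesis Q2 : intg Q (fun x : T => eucl x ^+ 2).

Local Notation P := ((zz \x Q)%E : probability (T * T)%type R).

Definition interp_mean (s : R) : R := \int[P]_z u (displace s z).1.
Definition spread2 : R := \int[P]_z eucl (displace 0 z).2 ^+ 2.
Definition far2 (z : T * T) : R := if eucl (displace 0 z).2 <= R0 then 0 else eucl (displace 0 z).2 ^+ 2.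
Let near_err (z : T * T) : R :=
  if eucl (z.2 : V) <= R0 then `|n%:R ^+ 2 * second_diff u (n%:R^-1 *: (z.2 : V)) z.1 - dotv z.2 z.2| else 0.

Let i1 : intg P (fun z => eucl (z.1 : V) ^+ 2).
Proof. exact: (haslaw_intg (f := fun x : T => eucl x ^+ 2) (prod_haslaw zz Q).1 (cube_law_pow Hzz 2).1). Qed.

Let i2 : intg P (fun z => eucl (z.2 : V) ^+ 2).
Proof. exact: (haslaw_intg (f := fun x : T => eucl x ^+ 2) (prod_haslaw zz Q).2 Q2). Qed.

Lemma intg_comb a b : intg P (fun z => u (a *: (z.1 : V) + b *: (z.2 : V))).
Proof.
have [mW iW] := intg_comb_sqr a b measurable_fst measurable_snd i1 i2.
exact: (intg_quad_growth mu_ uA mW iW).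
Qed.

Lemma displace_comb s (z : T * T) : (displace s z).1 = (1 - s) *: (z.1 : V) + s *: (z.2 : V) :> V.
Proof. by rewrite /displace /=; apply/rowP => i; rewrite !mxE; ring. Qed.

Lemma intg_interp s : intg P (fun z => u (displace s z).1).
Proof. by have := intg_comb (1 - s) s; congr (intg _ _); apply/funext => z; rewrite displace_comb. Qed.

Lemma intg_spread : intg P (fun z => eucl (displace 0 z).2 ^+ 2).
Proof.
have [_] := intg_comb_sqr (- 1) 1 measurable_fst measurable_snd i1 i2; congr (intg _ _); apply/funext => z.
by rewrite scaleN1r scale1r addrC.
Qed.

Lemma intg_far2 : intg P far2.
Proof.
apply: intg_le intg_spread.
  apply: measurable_fun_ifT => //.
    apply: measurable_fun_ler => //; apply: measurable_eucl.
    exact: (measurableT_comp measurable_snd (measurable_displace 0)).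
  exact: intg_measurable intg_spread.
by move=> z; rewrite /far2; case: ifP => _; rewrite ?normr0 ?sqr_ge0// ger0_norm ?sqr_ge0.
Qed.

Lemma interp_second s : interp_mean (s + n%:R^-1) + interp_mean (s - n%:R^-1) - 2 * interp_mean s =
  \int[P]_z second_diff u (n%:R^-1 *: (displace s z).2) (displace s z).1 /\
  intg P (fun z => second_diff u (n%:R^-1 *: (displace s z).2) (displace s z).1).
Proof.
have ii := intg_interp.
have E : (fun z => second_diff u (n%:R^-1 *: (displace s z).2) (displace s z).1) =
    (fun z => u (displace (s + n%:R^-1) z).1 + u (displace (s - n%:R^-1) z).1 - 2 * u (displace s z).1).
  apply/funext => z; rewrite /second_diff; congr (u _ + u _ - _); rewrite /displace /=.
    by rewrite scalerDl addrA.
  by rewrite scalerBl addrA.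
rewrite E; split; last by apply: intgB; [exact: intgD|exact: intgZ].
rewrite EEB; [|exact: intgD|exact: intgZ].
by rewrite EED// EEZ.
Qed.

Let measurable_near : measurable_fun setT near_err.
Proof.
have m1 : measurable_fun setT (fst : T * T -> T) := measurable_fst.
have m2 : measurable_fun setT (snd : T * T -> T) := measurable_snd.
have mb : measurable_fun setT (fun z : T * T => n%:R^-1 *: (z.2 : V) : T).
  by apply: measurable_scalev => //; exact: measurable_cst.
apply: measurable_fun_ifT => //; first by apply: measurable_fun_ler => //; exact: measurable_eucl.
apply: measurableT_comp => //; apply: measurable_funB; last exact: measurable_dotv.
apply: measurable_funM => //; apply: measurable_funB; last first.
  by apply: measurable_funM => //; exact: (measurableT_comp mu_ m1).
apply: measurable_funD.
- exact: (measurableT_comp mu_ (measurable_addv m1 mb)).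
- exact: (measurableT_comp mu_ (measurable_subv m1 mb)).
Qed.

Let near_bound s : 0 <= s <= 1 -> intg P (fun z => near_err (displace s z)) /\
  \int[P]_z near_err (displace s z) <= eta.
Proof.
move=> s01; apply: (displacement_bound Hleb L0 N Hzz mp p0 QE (fun y a => interp y a s01) measurable_near) => //.
- by move=> z; rewrite /near_err; case: ifP.
- by move=> z h; rewrite /near_err leNgt h.
move=> a aR; rewrite /near_err /= aR; split; last exact: hB.
have ig b := intg_growth Hleb b L0 c0 N mu_ uA.
apply: intg_norm; apply: intgB; last exact: intg_cst.
apply: intgZ; apply: intgB; last by apply: intgZ; have := ig 0; congr (intg _ _); apply/funext => x; rewrite addr0.
by apply: intgD; exact: ig.
Qed.

Let n2 : 0 < n%:R ^+ 2 :> R. Proof. by rewrite exprn_gt0// ltr0n. Qed.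

(** On long segments the second difference is only known to be nonnegative, by convexity, so the
    contribution |X - Z|^2 is given up there. *)
Lemma interp_lower s : 0 <= s <= 1 -> spread2 - \int[P]_z far2 z - eta <=
  n%:R ^+ 2 * (interp_mean (s + n%:R^-1) + interp_mean (s - n%:R^-1) - 2 * interp_mean s).
Proof.
move=> s01; have [-> isd] := interp_second s; have [ie Ee] := near_bound s01.
apply: (@le_trans _ _ (spread2 - \int[P]_z far2 z - \int[P]_z near_err (displace s z))); first by rewrite lerB.
rewrite -EEB; [|exact: intg_spread|exact: intg_far2].
have isf := intgB intg_spread intg_far2.
rewrite -EEB// -EEZ//; apply: EE_le; [exact: intgB|exact: intgZ|] => z.
rewrite /far2 /near_err (_ : (displace 0 z).2 = (displace s z).2)//.
set sd := second_diff _ _ _; have sd0 : 0 <= sd by exact: second_diff_ge0 (subconvex_convexf su).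
case: ifP => _; last by rewrite subrr sub0r oppr0 mulr_ge0// ltW.
rewrite subr0 eucl_sqr; move: (n%:R ^+ 2 * sd) (dotv _ _) => r q.
by have := ler_norm (- (r - q)); rewrite normrN; lra.
Qed.

(** Without a displacement bound nothing controls long segments from above; the estimate is
    therefore applied to two points of the cube. *)
Lemma interp_upper s : 0 <= s <= 1 -> {ae P, forall z, eucl (displace 0 z).2 <= R0} ->
  n%:R ^+ 2 * (interp_mean (s + n%:R^-1) + interp_mean (s - n%:R^-1) - 2 * interp_mean s) <= spread2 + eta.
Proof.
move=> s01 ab; have [-> isd] := interp_second s; have [ie Ee] := near_bound s01.
apply: (@le_trans _ _ (spread2 + \int[P]_z near_err (displace s z))); last by rewrite lerD2l.
rewrite -EED//; last exact: intg_spread.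
rewrite -EEZ//; apply: EE_le_ae; [exact: intgZ|by apply: intgD => //; exact: intg_spread|].
apply: filterS ab => z zR; rewrite /near_err (_ : (displace s z).2 = (displace 0 z).2)// zR eucl_sqr.
by have := ler_norm (n%:R ^+ 2 * second_diff u (n%:R^-1 *: (displace 0 z).2) (displace s z).1 -
  dotv (displace 0 z).2 (displace 0 z).2); rewrite lerBlDl.
Qed.

Hypothesis Qc : forall i, intg Q (fun x : T => (x : V) 0 i) /\ \int[Q]_x (x : V) 0 i = 0.

Lemma spread2E : spread2 = \int[zz]_z eucl z ^+ 2 + \int[Q]_x eucl x ^+ 2.
Proof.
have [l1 l2] := prod_haslaw zz Q.
have me : measurable_fun [set: T] (fun x : T => eucl x ^+ 2) by apply: measurable_funX; exact: measurable_eucl.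
have e1 : \int[P]_z eucl (z.1 : V) ^+ 2 = \int[zz]_x eucl (x : V) ^+ 2 := haslaw_EE l1 me.
have e2 : \int[P]_z eucl (z.2 : V) ^+ 2 = \int[Q]_x eucl (x : V) ^+ 2 := haslaw_EE l2 me.
have idot : intg P (fun z => dotv z.1 z.2).
  apply: (@intg_le _ _ _ _ _ (fun z : T * T => eucl (z.1 : V) ^+ 2 + eucl (z.2 : V) ^+ 2)).
  - by apply: measurable_dotv; [exact: measurable_fst|exact: measurable_snd].
  - move=> z; apply: le_trans (dotv_abs_le _ _) _; rewrite -subr_ge0.
    have := sqr_ge0 (eucl (z.1 : V) - eucl (z.2 : V)); have := sqr_ge0 (eucl (z.1 : V) + eucl (z.2 : V)).
    by rewrite sqrrB sqrrD; move: (_ * _) (_ ^+ 2) (_ ^+ 2) => *; lra.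
  - exact: intgD.
have E0 : \int[P]_z dotv z.1 z.2 = 0.
  rewrite (@prod_EE _ _ _ _ _ zz Q _ (fun=> 0)) ?EE_cst//; first exact: intg_cst.
  by move=> x; exact: EE_dotv_centered.
have -> : spread2 = \int[P]_z (eucl (z.1 : V) ^+ 2 + eucl (z.2 : V) ^+ 2 - 2 * dotv z.1 z.2).
  congr (Rintegral _ _ _); apply/funext => z; rewrite !eucl_sqr /displace /= dotvBl !dotvBr [dotv z.2 z.1]dotvC.
  by move: (dotv _ _) (dotv _ _) (dotv _ _) => *; ring.
by rewrite EEB; [rewrite EEZ// E0 mulr0 subr0 EED// e1 e2|exact: intgD|exact: intgZ].
Qed.

Lemma interp_jensen a b : \int[zz]_z u (a *: (z : V)) <= \int[P]_z u (a *: (z.1 : V) + b *: (z.2 : V)).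
Proof.
have mi : measurable_fun setT (fun x : T => x) by exact: measurable_id.
have [mW iW] := intg_comb_sqr a 0 mi mi (cube_law_pow Hzz 2).1 (cube_law_pow Hzz 2).1.
apply: prod_EE_ge; first exact: intg_comb.
- by have := intg_quad_growth mu_ uA mW iW; congr (intg _ _); apply/funext => z; rewrite scale0r addr0.
- by move=> z; exact: (jensen_shift mu_ uA su (a *: (z : V)) b Q2 Qc).
Qed.

Lemma interp_jensen2 a b : (forall i, intg zz (fun x : T => (x : V) 0 i) /\ \int[zz]_x (x : V) 0 i = 0) ->
  \int[Q]_x u (b *: (x : V)) <= \int[P]_z u (a *: (z.1 : V) + b *: (z.2 : V)).
Proof.
move=> zc; have mi : measurable_fun setT (fun x : T => x) by exact: measurable_id.
have [mW iW] := intg_comb_sqr b 0 mi mi Q2 Q2.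
apply: prod_EE_ge2; first exact: intg_comb.
- by have := intg_quad_growth mu_ uA mW iW; congr (intg _ _); apply/funext => z; rewrite scale0r addr0.
- move=> x; have := jensen_shift mu_ uA su (b *: (x : V)) a (cube_law_pow Hzz 2).1 zc.
  by under eq_fun do rewrite addrC.
Qed.

Lemma interp_mean0 : interp_mean 0 = \int[zz]_z u z.
Proof.
rewrite /interp_mean -(haslaw_EE (prod_haslaw zz Q).1 mu_); congr (Rintegral _ _ _); apply/funext => z.
by rewrite /displace /= scale0r addr0.
Qed.

Lemma interp_mean1 : interp_mean 1 = \int[Q]_x u x.
Proof.
rewrite /interp_mean -(haslaw_EE (prod_haslaw zz Q).2 mu_); congr (Rintegral _ _ _); apply/funext => z.
by rewrite /displace /= scale1r addrC subrK.
Qed.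

Lemma interp_meanE s : interp_mean s = \int[P]_z u ((1 - s) *: (z.1 : V) + s *: (z.2 : V)).
Proof. by congr (Rintegral _ _ _); apply/funext => z; rewrite displace_comb. Qed.

End Law.
Hypothesis dR0 : 2 * d%:R <= R0.

(** Summing second differences from Z to X leaves the increment at Z, of which no derivative is
    controlled. Jensen and convexity bound it below by minus n times the mean of u((1 + 1/n) Z) -
    u(Z). That quantity is bounded by the same second-difference estimate applied to two independent
    points of the cube. *)
Theorem poincare_gap : \int[zz]_z u z - (\int[zz]_z eucl z ^+ 2) / 2 -
    ((\int[(zz \x rho)%E]_z far2 z) / 2 + eta + (\int[rho]_x eucl x ^+ 2 + 3 * \int[zz]_z eucl z ^+ 2) / (2 * n%:R)) <=
  \int[rho]_x u x - (\int[rho]_x eucl x ^+ 2) / 2.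
Proof.
(* Notation: k = n, i = 1/n; U, Um, Up are the means of u(Z), u((1 - i) Z), u((1 + i) Z); X is the
   mean under rho, A the first interpolated mean; q and r are second moments, t the tail and e the
   transported error. *)
have arith (k i U X A Um Up q r t e : R) : 0 < k -> k * i = 1 -> 0 <= t ->
    k * (A - U) + k * (k - 1) / 2 * (i ^+ 2 * (q + r - t - e)) <= X - U -> Um <= A -> 0 <= Um + Up - 2 * U ->
    Up - U - (U - Up) <= (k + 1) * (i ^+ 2 * (q + q + e)) ->
    U - q / 2 - (t / 2 + e + (r + 3 * q) / (2 * k)) <= X - r / 2.
  move=> k0 ki t0 h1 h2 h3 h4.
  have i0 : 0 <= i by rewrite -(pmulr_rge0 _ k0) ki.
  have e1 : k * (k - 1) / 2 * (i ^+ 2 * (q + r - t - e)) = (1 - i) / 2 * (q + r - t - e).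
    rewrite (_ : k * (k - 1) / 2 * (i ^+ 2 * (q + r - t - e)) = (k * i) * (k * i - i) / 2 * (q + r - t - e)); last by field.
    by rewrite ki mul1r.
  have e2 : k * ((k + 1) * (i ^+ 2 * (q + q + e))) = (1 + i) * (q + q + e).
    rewrite (_ : _ * _ = (k * i) * (k * i + i) * (q + q + e)); last by ring.
    by rewrite ki mul1r.
  have h4' := ler_wpM2l (ltW k0) h4; rewrite e2 in h4'; rewrite e1 in h1.
  have h2' := ler_wpM2l (ltW k0) h2; have h3' := mulr_ge0 (ltW k0) h3.
  have -> : (r + 3 * q) / (2 * k) = (r + 3 * q) / 2 * i.
    by rewrite invfM mulrA; congr (_ * _); rewrite -[k^-1]mulr1 -ki mulKf// gt_eqF.
  have it : 0 <= i * t by rewrite mulr_ge0.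
  move: h1 h2' h3' h4' it; move: {h2 h3 h4 e1 e2}(i * t) (i * q) => *; nra.
have nR : (0 : R) < n%:R by rewrite ltr0n.
have ni : n%:R * n%:R^-1 = 1 :> R by rewrite mulfV// gt_eqF.
have n2 : 0 < n%:R ^+ 2 :> R by rewrite exprn_gt0.
have rc i : intg rho (fun x : T => (x : V) 0 i) /\ \int[rho]_x (x : V) 0 i = 0.
  by split; [exact: nice_coord N i|exact: nice_ctr N i].
have zc i := cube_law_coord Hleb Hzz i.
have z2 := (cube_law_pow Hzz 2).1; have r2 := nice_pow Hleb L0 c0 N 2.
have mk := nice_mk L0 N.
have ig : forall s (y a : V), 0 <= s <= 1 ->
    kappa (y - s *: a) * expR (- Psi (y + (1 - s) *: a)) <= @interp_cst R d L C * expR (- Psi y).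
  by move=> s y a s01; exact: (interp_gibbs L0 c0 N y a s01).
have ic : forall s (y a : V), 0 <= s <= 1 ->
    kappa (y - s *: a) * kappa (y + (1 - s) *: a) <= @interp_cst R d L C * expR (- Psi y).
  by move=> s y a s01; exact: (interp_cube L0 N y a s01).
have lo (s : R) (s01 : 0 <= s <= 1) := interp_lower mk (fun=> expR_ge0 _) (nice_dens N) ig r2 s01.
have ab : {ae (zz \x zz)%E, forall z : T * T, eucl (displace 0 z).2 <= R0}.
  have [l1 l2] := prod_haslaw zz zz.
  have a1 := haslaw_ae l1 (cube_law_le Hzz); have a2 := haslaw_ae l2 (cube_law_le Hzz).
  apply: filterS2 a1 a2 => z h1 h2; apply: le_trans dR0; apply: le_trans (euclB_le _ _) _.
  by rewrite mulr_natl mulr2n addrC lerD.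
have up (s : R) (s01 : 0 <= s <= 1) := interp_upper (@measurable_kappa R d) (@kappa_ge0 R d) Hzz ic z2 s01 ab.
have spz := spread2E z2 zc; have spr := spread2E r2 rc.
have n_le i : (i <= n)%N -> 0 <= (i%:R / n%:R : R) <= 1.
  by move=> i_n; rewrite divr_ge0//= ler_pdivrMr// mul1r ler_nat.
apply: (arith n%:R n%:R^-1 _ _ (interp_mean rho n%:R^-1) (\int[zz]_z u ((1 - n%:R^-1) *: (z : V)))
  (\int[zz]_z u ((1 + n%:R^-1) *: (z : V)))) => //.
- by apply: EE_ge0 => z; rewrite /far2; case: ifP => // _; exact: sqr_ge0.
- rewrite -(interp_mean0 rho) -(interp_mean1 rho).
  have := @second_sum_lower R (fun i => interp_mean rho (i%:R / n%:R)) (n%:R ^- 2 * (\int[zz]_z eucl z ^+ 2 +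
    \int[rho]_x eucl x ^+ 2 - \int[(zz \x rho)%E]_z far2 z - eta)) n.
  rewrite mul1r mul0r mulfV ?gt_eqF// exprVn; apply => i i0 i_n.
  rewrite ler_pdivrMl//; have := lo _ (n_le i (ltnW i_n)); rewrite spr; case: i i0 i_n => // i _ _ /=.
  have -> : i.+2%:R / n%:R = i.+1%:R / n%:R + n%:R^-1 :> R by rewrite -[i.+2%:R]natr1 mulrDl mul1r.
  by have -> : i%:R / n%:R = i.+1%:R / n%:R - n%:R^-1 :> R by rewrite -[i.+1%:R]natr1 mulrDl mul1r addrK.
- rewrite interp_meanE; exact: interp_jensen.
- have mi : measurable_fun setT (fun x : T => x) by exact: measurable_id.
  have iz a : intg zz (fun z : T => u (a *: (z : V))).
    have [mW iW] := intg_comb_sqr a 0 mi mi z2 z2.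
    by have := intg_quad_growth mu_ uA mW iW; congr (intg _ _); apply/funext => z; rewrite scale0r addr0.
  have i1 : intg zz (fun z : T => u z) by have := iz 1; congr (intg _ _); apply/funext => z; rewrite scale1r.
  rewrite -EEZ// -EED// -EEB//; [|exact: intgD|exact: intgZ].
  apply: EE_ge0 => z; rewrite scalerBl scalerDl scale1r [u (_ - _) + _]addrC.
  exact: (second_diff_ge0 _ _ (subconvex_convexf su)).
(* The index is shifted by one: for two cube points the segment is prolonged from -1/n to 1 + 1/n.
   By Jensen both prolonged means are at least the mean of u((1 + 1/n) Z), and the means at 0 and 1
   agree. *)
- have H := @second_sum_upper R (fun i => interp_mean zz ((i%:R - 1) / n%:R)) (n%:R ^- 2 * (\int[zz]_z eucl z ^+ 2 +
    \int[zz]_z eucl z ^+ 2 + eta)) n.+1.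
  rewrite natr1 exprVn; apply: le_trans (H _).
    rewrite subrr mul0r -[n.+2%:R]natr1 addrK -[n.+1%:R]natr1 addrK mulrDl mulfV ?gt_eqF// mul1r sub0r mulN1r.
    rewrite !interp_mean0 !interp_mean1; apply: lerB.
      apply: lerB => //; rewrite interp_meanE; exact: interp_jensen2.
    apply: lerB => //; rewrite interp_meanE opprK; exact: interp_jensen.
  move=> [//|i] _ i_n; rewrite ler_pdivlMl//=; have := up _ (n_le i i_n); rewrite spz.
  have -> : (i.+2%:R - 1) / n%:R = i%:R / n%:R + n%:R^-1 :> R by rewrite -[i.+2%:R]natr1 addrK -[i.+1%:R]natr1 mulrDl mul1r.
  have -> : (i.+1%:R - 1) / n%:R = i%:R / n%:R :> R by rewrite -[i.+1%:R]natr1 addrK.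
  by rewrite mulrBl mul1r.
Qed.

End Interpolation.

(** * Stability *)

Lemma moment_bound {R : realType} (d : nat) (L c C : R) (p : nat) : 0 < L -> 0 < c ->
  exists M, 0 <= M /\ forall (leb : {measure set (Rd R d) -> \bar R}) mu rho Psi phi, is_lebesgue leb ->
    nice leb mu rho Psi phi L c C -> \int[rho]_x eucl x ^+ p <= M.
Proof.
move=> L0 c0; have [C1 [C10 hC1]] := integral_exp_decay d p c0.
exists (expR C * C1); split; first by rewrite mulr_ge0 ?expR_ge0// ltW.
move=> leb mu rho Psi phi Hleb N.
have me : measurable_fun setT (fun x : Rd R d => eucl x) by exact: measurable_eucl.
have mep : measurable_fun setT (fun x : Rd R d => eucl x ^+ p) by exact: measurable_funX.
have e0 (x : Rd R d) : 0 <= eucl x ^+ p by rewrite exprn_ge0// eucl_ge0.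
have [] // := @EE_lee _ _ R rho (fun x : Rd R d => eucl x ^+ p) (expR C * C1) mep e0.
have mk := nice_mk L0 N.
rewrite (ge0_integral_density mk (fun=> expR_ge0 _) (nice_dens N)); first last.
- by move=> x; rewrite lee_fin.
- exact/measurable_EFinP.
have md : measurable_fun setT (fun x : Rd R d => (1 + eucl x) ^+ p * expR (- (c * eucl x))).
  apply: measurable_funM; first by apply: measurable_funX; apply: measurable_funD => //; exact: measurable_cst.
  by apply: (measurable_expN (psi := fun x => c * eucl x)); apply: measurable_funM => //; exact: measurable_cst.
apply: (@le_trans _ _ (\int[leb]_x ((expR C)%:E * ((1 + eucl x) ^+ p * expR (- (c * eucl x)))%:E))%E); last first.
  rewrite ge0_integralZl//.
  - by rewrite EFinM; apply: lee_wpmul2l; [rewrite lee_fin expR_ge0|exact: hC1].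
  - exact/measurable_EFinP.
  - by move=> x _; rewrite lee_fin mulr_ge0 ?expR_ge0// exprn_ge0// addr_ge0// eucl_ge0.
apply: ge0_le_integral => //.
- by move=> x _; rewrite -EFinM lee_fin mulr_ge0 ?expR_ge0.
- by apply: emeasurable_funM; exact/measurable_EFinP.
- by apply: emeasurable_funM; [exact: measurable_cst|exact/measurable_EFinP].
move=> x _; rewrite -!EFinM lee_fin mulrCA -expRD; apply: ler_pM; rewrite ?expR_ge0//.
  by apply: lerXn2r; rewrite ?nnegrE ?addr_ge0 ?eucl_ge0// lerDr.
by rewrite ler_expR; have := nice_lo N x; lra.
Qed.

(** Beyond R0, |X - Z|^2 is at most R0^-q |X - Z|^(q + 2), and |X - Z| is at most twice the larger
    of |X| and d. *)
Lemma far2_moment {R : realType} {d : nat} (leb : {measure set (Rd R d) -> \bar R}) (zz rho : probability (Rd R d) R)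
    (R0 M : R) (q : nat) : is_lebesgue leb -> cube_law leb zz -> 0 < R0 ->
  (forall p, intg rho (fun x : Rd R d => eucl x ^+ p)) -> \int[rho]_x eucl x ^+ (q + 2) <= M ->
  \int[(zz \x rho)%E]_z far2 R0 z <= R0 ^- q * (2 ^+ (q + 2) * (M + d%:R ^+ (q + 2))).
Proof.
move=> Hleb Hzz R00 ip hM.
have [l1 l2] := prod_haslaw zz rho.
have iq := haslaw_intg (f := fun x : Rd R d => eucl x ^+ (q + 2)) l2 (ip _).
have k0 : 0 <= R0 ^- q by rewrite invr_ge0 exprn_ge0// ltW.
have k1 : 0 <= 2 ^+ (q + 2) :> R by rewrite exprn_ge0.
have ib : intg (zz \x rho)%E (fun z => R0 ^- q * (2 ^+ (q + 2) * (eucl (z.2 : 'rV[R]_d) ^+ (q + 2) + d%:R ^+ (q + 2)))).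
  by apply: intgZ; apply: intgZ; apply: intgD => //; exact: intg_cst.
apply: (@le_trans _ _ (\int[(zz \x rho)%E]_z (R0 ^- q * (2 ^+ (q + 2) * (eucl (z.2 : 'rV[R]_d) ^+ (q + 2) + d%:R ^+ (q + 2)))))); last first.
  have is_ : intg (zz \x rho)%E (fun z => eucl (z.2 : 'rV[R]_d) ^+ (q + 2) + d%:R ^+ (q + 2)).
    by apply: intgD => //; exact: intg_cst.
  rewrite EEZ; last exact: intgZ.
  rewrite EEZ// EED//; last exact: intg_cst.
  rewrite EE_cst (haslaw_EE (f := fun x : Rd R d => eucl x ^+ (q + 2)) l2 (intg_measurable (ip _))).
  by rewrite ler_wpM2l// ler_wpM2l// lerD2r.
apply: EE_le_ae => //; first exact: (intg_far2 Hzz R0 (ip 2)).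
apply: filterS (haslaw_ae l1 (cube_law_le Hzz)) => z zd.
have x0 := eucl_ge0 (z.2 : 'rV[R]_d).
rewrite /far2; case: ifPn => [_|]; first by rewrite !mulr_ge0// addr_ge0// exprn_ge0.
rewrite -ltNge => aR; set a := eucl _ in aR *.
have a0 : 0 <= a by exact: eucl_ge0.
have h1 : a ^+ 2 <= R0 ^- q * a ^+ (q + 2).
  rewrite ler_pdivlMl ?exprn_gt0// exprD ler_wpM2r ?sqr_ge0//.
  by apply: lerXn2r; rewrite ?nnegrE// ltW.
apply: le_trans h1 _; rewrite ler_wpM2l//.
have h2 : a <= eucl (z.2 : 'rV[R]_d) + d%:R.
  apply: le_trans (euclB_le _ _) _; exact: lerD.
have [m [m0 hm hm1]] : exists m, [/\ 0 <= m, a <= 2 * m & m ^+ (q + 2) <= eucl (z.2 : 'rV[R]_d) ^+ (q + 2) + d%:R ^+ (q + 2)].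
  have [h|h] := leP (eucl (z.2 : 'rV[R]_d)) d%:R.
    by exists d%:R; split; [exact: ler0n|by move: h h2; clear; lra|rewrite lerDr exprn_ge0].
  by exists (eucl (z.2 : 'rV[R]_d)); split; [|by move: h h2; clear; lra|rewrite lerDl exprn_ge0].
apply: (@le_trans _ _ ((2 * m) ^+ (q + 2))).
  by apply: lerXn2r; rewrite ?nnegrE// mulr_ge0.
by rewrite exprMn ler_wpM2l.
Qed.

Lemma W2sq_le_coupling {R : realType} {d : nat} (a b : probability (Rd R d) R) (g : probability (Rd R d * Rd R d)%type R) r :
  haslaw g fst a -> haslaw g snd b -> intg g (fun z => eucl ((z.1 : 'rV[R]_d) - z.2) ^+ 2) ->
  \int[g]_z eucl ((z.1 : 'rV[R]_d) - z.2) ^+ 2 <= r -> (W2sq a b <= r%:E)%E.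
Proof.
move=> h1 h2 ig hr; apply: le_trans (_ : ((\int[g]_z eucl ((z.1 : 'rV[R]_d) - z.2) ^+ 2)%:E <= _)%E); last by rewrite lee_fin.
by rewrite -EE_fineK//; apply: ereal_inf_lbound; exists g => //; exact/coupling_law.
Qed.

Lemma W2_le {R : realType} {d : nat} (a b : probability (Rd R d) R) r : 0 <= r ->
  (W2sq a b <= (r ^+ 2)%:E)%E -> (W2 a b <= r%:E)%E.
Proof.
rewrite /W2; case: (W2sq a b) => [x| |] r0 //; rewrite !lee_fin => h.
by rewrite -(ger0_norm r0) -sqrtr_sqr ler_wsqrtr.
Qed.

Lemma W2sq_ge0 {R : realType} {d : nat} (a b : probability (Rd R d) R) : (0 <= W2sq a b)%E.
Proof.
apply: le_ereal_inf_tmp => _ [g _ <-]; apply: integral_ge0 => z _; by rewrite lee_fin sqr_ge0.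
Qed.

Lemma intg_dist2 {R : realType} {d : nat} (a b : probability (Rd R d) R) (g : probability (Rd R d * Rd R d)%type R) :
  haslaw g fst a -> haslaw g snd b -> intg a (fun x : Rd R d => eucl x ^+ 2) -> intg b (fun x : Rd R d => eucl x ^+ 2) ->
  intg g (fun z => eucl ((z.1 : 'rV[R]_d) - z.2) ^+ 2) /\
  \int[g]_z eucl ((z.1 : 'rV[R]_d) - z.2) ^+ 2 <= 2 * \int[a]_x eucl x ^+ 2 + 2 * \int[b]_x eucl x ^+ 2.
Proof.
move=> h1 h2 ia ib.
have ja := haslaw_intg (f := fun x : Rd R d => eucl x ^+ 2) h1 ia.
have jb := haslaw_intg (f := fun x : Rd R d => eucl x ^+ 2) h2 ib.
have le z : eucl ((z.1 : 'rV[R]_d) - z.2) ^+ 2 <= 2 * eucl (z.1 : 'rV[R]_d) ^+ 2 + 2 * eucl (z.2 : 'rV[R]_d) ^+ 2.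
  have := eucl_comb_sqr 1 (- 1) (z.2 : 'rV[R]_d) (z.1 : 'rV[R]_d).
  by rewrite scale1r scaleN1r sqrrN !expr1n !mulr1.
have id : intg g (fun z => eucl ((z.1 : 'rV[R]_d) - z.2) ^+ 2).
  apply: (@intg_le _ _ _ _ _ (fun z : Rd R d * Rd R d => 2 * eucl (z.1 : 'rV[R]_d) ^+ 2 + 2 * eucl (z.2 : 'rV[R]_d) ^+ 2)).
  - apply: measurable_funX; apply: measurable_eucl; exact: measurable_subv (measurable_fst) (measurable_snd).
  - by move=> z; rewrite ger0_norm ?sqr_ge0.
  - by apply: intgD; exact: intgZ.
split => //; rewrite -(haslaw_EE (f := fun x : Rd R d => eucl x ^+ 2) h1 (intg_measurable ia)).
rewrite -(haslaw_EE (f := fun x : Rd R d => eucl x ^+ 2) h2 (intg_measurable ib)).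
by rewrite -EEZ// -[X in _ + X]EEZ// -EED; [apply: EE_le => //; apply: intgD; exact: intgZ|exact: intgZ..].
Qed.

Lemma W2sq_product {R : realType} {d : nat} (a b : probability (Rd R d) R) :
  intg a (fun x : Rd R d => eucl x ^+ 2) -> intg b (fun x : Rd R d => eucl x ^+ 2) ->
  (W2sq a b <= (2 * \int[a]_x eucl x ^+ 2 + 2 * \int[b]_x eucl x ^+ 2)%:E)%E.
Proof.
move=> ia ib; have [g [g1 g2]] := product_law a b.
by have [i h] := intg_dist2 g1 g2 ia ib; exact: W2sq_le_coupling g1 g2 i h.
Qed.

(* The radius R0 and the time step t = s^3 are chosen so that the tail R0^-(2d+4), the transported error
   R0^d (t R0^2) and t are all of order s^2. *)
Lemma scale_choice {R : realType} (d : nat) (s : R) : 0 < s -> s <= 1 ->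
  exists R0, [/\ 2 * d%:R <= R0, 1 <= R0, R0 ^- (2 * (d + 2)) <= s ^+ 2 &
    s ^+ 3 * R0 ^+ 2 * (2 * R0) ^+ d = 2 ^+ d * (2 * d%:R + 1) ^+ (d + 2) * s ^+ 2].
Proof.
move=> s0 s1; pose b := s `^ (d + 2)%:R^-1; have b0 : 0 < b by exact: powR_gt0.
have be : b ^+ (d + 2) = s.
  by rewrite -powR_mulrn ?(ltW b0)// -powRrM mulVf ?powRr1// ?(ltW s0)// pnatr_eq0 addn2.
have b1 : b <= 1.
  rewrite leNgt; apply/negP => b1; have : 1 < b ^+ (d + 2) by rewrite exprn_egt1// addn2.
  by rewrite be ltNge s1.
pose r : R := 2 * d%:R + 1; have r1 : 1 <= r by rewrite lerDr mulr_ge0.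
have r0 : 0 < r by apply: lt_le_trans r1.
exists (r / b); split.
- rewrite ler_pdivlMr//; apply: (@le_trans _ _ (2 * d%:R)); first by rewrite ler_piMr// mulr_ge0.
  by rewrite lerDl.
- by rewrite ler_pdivlMr// mul1r; apply: le_trans b1 r1.
- rewrite expr_div_n invf_div mulnC exprM be ler_pdivrMr ?exprn_gt0//.
  by rewrite ler_peMr ?sqr_ge0// exprn_ege1.
- have e : (r / b) ^+ (d + 2) = r ^+ (d + 2) / s by rewrite expr_div_n be.
  rewrite [(2 * _) ^+ d]exprMn -mulrA [_ ^+ 2 * (_ * _)]mulrCA -exprD [(2 + d)%N]addnC e.
  rewrite -/r; move: (r ^+ _) (2 ^+ d) => x y; field; exact: lt0r_neq0.
Qed.

(** Parametrized by s with w = s^6, so that t = s^3 satisfies w <= t^2 and no root is taken. The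
    squared distance is E|X|^2 + E|Y|^2 - 2 E X.Y, where X.Y equals u + v minus the slack. *)
Theorem stability_small {R : realType} (d : nat) (D th L c C : R) : 0 <= D -> 0 < L -> 0 < c ->
  exists K, 0 <= K /\ forall (leb : {measure set (Rd R d) -> \bar R}) (mu nu rho0 rho1 : probability (Rd R d) R) Psi0 Psi1 phi0 phi1,
    is_lebesgue leb -> target mu D th -> target nu D th ->
    nice leb mu rho0 Psi0 phi0 L c C -> nice leb nu rho1 Psi1 phi1 L c C ->
    forall s, 0 < s -> s <= 1 -> (W2sq mu nu < ((s ^+ 6) ^+ 2)%:E)%E -> (W2sq rho0 rho1 <= (K * s ^+ 2)%:E)%E.
Proof.
move=> D0 L0 c0.
pose q := (2 * (d + 2))%N.
have [m2 [m20 hm2]] := @moment_bound R d L c C 2 L0 c0.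
have [Mq [Mq0 hMq]] := @moment_bound R d L c C (q + 2) L0 c0.
pose tl : R := 2 ^+ (q + 2) * (Mq + d%:R ^+ (q + 2)).
pose hs : R := @interp_cst R d L C * ((12 + 6 * m2) * (2 ^+ d * (2 * d%:R + 1) ^+ (d + 2))).
have tl0 : 0 <= tl by rewrite mulr_ge0 ?exprn_ge0// addr_ge0// exprn_ge0.
have m12 : 0 <= 12 + 6 * m2 by rewrite addr_ge0// mulr_ge0.
have r0 : 0 <= 2 ^+ d * (2 * d%:R + 1) ^+ (d + 2) :> R by rewrite mulr_ge0// exprn_ge0// addr_ge0// mulr_ge0.
have hs0 : 0 <= hs by rewrite mulr_ge0 ?expR_ge0// mulr_ge0.
pose Ke := tl / 2 + hs + (m2 + 3 * d%:R ^+ 2) / 2.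
have Ke0 : 0 <= Ke by rewrite !addr_ge0// ?divr_ge0// addr_ge0// mulr_ge0// sqr_ge0.
have lin (q0 q1 eu ev eS us vs z e : R) : us - z / 2 - e <= eu - q0 / 2 -> vs - z / 2 - e <= ev - q1 / 2 ->
    z <= us + vs -> q0 + q1 - 2 * (eu + ev - eS) <= 4 * e + 2 * eS by move=> *; lra.
exists (4 * Ke + 2); split; first by rewrite addr_ge0// mulr_ge0.
move=> leb mu nu rho0 rho1 Psi0 Psi1 phi0 phi1 Hleb Hmu Hnu N0 N1 s s0 s1 /ereal_inf_lt[_ [h /coupling_law[hA hB]] <-] hw.
have mdist : measurable_fun setT (fun z : Rd R d * Rd R d => eucl ((z.1 : 'rV[R]_d) - z.2) ^+ 2).
  apply: measurable_funX; apply: measurable_eucl; exact: measurable_subv (measurable_fst) (measurable_snd).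
have [ih Eh] := EE_lee mdist (fun z => sqr_ge0 _) (ltW hw).
have [R0 [dR0 R01 Rq Rd2]] := scale_choice d s0 s1.
have R00 : 0 < R0 by apply: lt_le_trans R01.
have t0 : 0 < s ^+ 3 by rewrite exprn_gt0.
have t1 : s ^+ 3 <= 1 by rewrite exprn_ile1// ltW.
have wt : s ^+ 6 <= (s ^+ 3) ^+ 2 by rewrite -exprM.
have w0 : 0 < s ^+ 6 by rewrite exprn_gt0.
have m2a := hm2 _ _ _ _ _ Hleb N0; have m2b := hm2 _ _ _ _ _ Hleb N1.
(* The time step and the tolerance are both s^3, and n exceeds s^-2 so that the 1/n terms of the
   interpolation are of order s^2. *)
have [n [u [v [K [g [[su mu_ gu] [[sv mv gv] [[g1 g2 isg Esg] [fen [nn [n0 hE]]]]]]]]]]] :=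
  hessian_close Hleb Hmu Hnu D0 L0 c0 N0 N1 hA hB w0 ih Eh m2a m2b (Num.truncn (s ^- 2)).+1 t0 t1 wt R00 t0.
have [zz Hzz] := cube_law_exists Hleb.
(* The coefficient 12 is 11 plus one for the tolerance s^3, which is at most s^3 R0^2 since R0 >=
   1. *)
pose B := (12 + 6 * m2) * (s ^+ 3 * R0 ^+ 2).
have B0 : 0 <= B by rewrite mulr_ge0// mulr_ge0 ?sqr_ge0// ltW.
have Bge (a : 'rV[R]_d) : eucl a <= R0 -> (11 + 6 * m2) * s ^+ 3 * dotv a a + s ^+ 3 <= B.
  move=> aR; have h1 : dotv a a <= R0 ^+ 2 by rewrite -eucl_sqr; apply: lerXn2r; rewrite ?nnegrE ?eucl_ge0// ltW.
  have h2 : (11 + 6 * m2) * s ^+ 3 * dotv a a <= (11 + 6 * m2) * s ^+ 3 * R0 ^+ 2.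
    by rewrite ler_wpM2l// mulr_ge0 ?addr_ge0 ?mulr_ge0// ltW.
  have h3 : s ^+ 3 <= s ^+ 3 * R0 ^+ 2 by rewrite ler_peMr ?(ltW t0)// exprn_ege1.
  rewrite /B; move: h2 h3; rewrite -!mulrA; move: (_ * R0 ^+ 2) (s ^+ 3); clear => x y; lra.
have etaE : @interp_cst R d L C * (B * (2 * R0) ^+ d) = hs * s ^+ 2.
  rewrite /B -[X in _ * X]mulrA Rd2 /hs.
  move: (interp_cst _ _) (2 ^+ d) (_ ^+ (d + 2)) => x y z; ring.
have s20 : 0 < s ^+ 2 by rewrite exprn_gt0.
have nR : (0 : R) < n%:R by rewrite ltr0n.
have ni : n%:R^-1 <= s ^+ 2.
  rewrite -[s ^+ 2]invrK lef_pV2 ?posrE ?invr_gt0//; apply: ltW.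
  by apply: lt_le_trans (truncnS_gt _) _; rewrite ler_nat.
have KeE : Ke * s ^+ 2 = tl / 2 * s ^+ 2 + hs * s ^+ 2 + (m2 + 3 * d%:R ^+ 2) / 2 * s ^+ 2.
  by rewrite /Ke -!mulrDl.
have z2 := (cube_law_pow Hzz 2).2.
have gap (mu' rho' : probability (Rd R d) R) Psi' phi' (f : 'rV[R]_d -> R) :
    nice leb mu' rho' Psi' phi' L c C -> subconvex f -> measurable_fun [set: Rd R d] f ->
    (forall x, `|f x| <= K * (1 + eucl x) ^+ 2) ->
    (forall a, eucl a <= R0 -> \int[rho']_x `|n%:R ^+ 2 * second_diff f (n%:R^-1 *: a) x - dotv a a| <= B) ->
    \int[zz]_z f z - (\int[zz]_z eucl z ^+ 2) / 2 - Ke * s ^+ 2 <= \int[rho']_x f x - (\int[rho']_x eucl x ^+ 2) / 2.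
  move=> N' sf mf gf hf.
  apply: le_trans (poincare_gap Hleb L0 c0 N' Hzz sf mf gf n0 (ltW R00) B0 hf dR0).
  rewrite lerB// etaE KeE; apply: lerD; first apply: lerD => //.
    rewrite mulrAC ler_pM2r// mulrC.
    apply: le_trans (far2_moment (q := q) Hleb Hzz R00 (nice_pow Hleb L0 c0 N') (hMq _ _ _ _ _ Hleb N')) _.
    by rewrite ler_wpM2r.
  rewrite invfM mulrA; apply: ler_pM.
  - by rewrite divr_ge0// addr_ge0 ?mulr_ge0//; apply: EE_ge0 => x; exact: sqr_ge0.
  - by rewrite invr_ge0 ltW.
  - by rewrite ler_pM2r// lerD// ?ler_pM2l//; exact: hm2 Hleb N'.
  - exact: ni.
have gapu := gap _ _ _ _ u N0 su mu_ gu (fun a aR => le_trans (hE a aR).1 (Bge a aR)).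
have gapv := gap _ _ _ _ v N1 sv mv gv (fun a aR => le_trans (hE a aR).2 (Bge a aR)).
have p0 := nice_pow Hleb L0 c0 N0 2; have p1 := nice_pow Hleb L0 c0 N1 2.
have mid : measurable_fun setT (fun x : Rd R d => x) by exact: measurable_id.
have iu := intg_quad_growth mu_ gu mid p0; have iv := intg_quad_growth mv gv mid p1.
have zi := (cube_law_pow Hzz 2).1.
have ziu := intg_quad_growth mu_ gu mid zi; have ziv := intg_quad_growth mv gv mid zi.
have diag : \int[zz]_z eucl z ^+ 2 <= \int[zz]_z u z + \int[zz]_z v z.
  rewrite -EED//; apply: EE_le => //; first exact: intgD.
  by move=> z; rewrite eucl_sqr; exact: fen.
have [idist _] := intg_dist2 g1 g2 p0 p1.
have j0 := haslaw_intg (f := fun x : Rd R d => eucl x ^+ 2) g1 p0.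
have j1 := haslaw_intg (f := fun x : Rd R d => eucl x ^+ 2) g2 p1.
have ju := haslaw_intg (f := fun x : Rd R d => u x) g1 iu.
have jv := haslaw_intg (f := fun x : Rd R d => v x) g2 iv.
apply: (W2sq_le_coupling g1 g2 idist).
have -> : \int[g]_z eucl ((z.1 : 'rV[R]_d) - z.2) ^+ 2 = \int[rho0]_x eucl x ^+ 2 + \int[rho1]_x eucl x ^+ 2 -
    2 * (\int[rho0]_x u x + \int[rho1]_x v x - \int[g]_z (u z.1 + v z.2 - dotv z.1 z.2)).
  rewrite -(haslaw_EE (f := fun x : Rd R d => eucl x ^+ 2) g1 (intg_measurable p0)).
  rewrite -(haslaw_EE (f := fun x : Rd R d => eucl x ^+ 2) g2 (intg_measurable p1)).
  rewrite -(haslaw_EE (f := fun x : Rd R d => u x) g1 (intg_measurable iu)).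
  rewrite -(haslaw_EE (f := fun x : Rd R d => v x) g2 (intg_measurable iv)).
  have juv := intgD ju jv; have jj := intgB juv isg; have jd := intgD j0 j1.
  rewrite -(EED ju jv) -(EEB juv isg) -(EED j0 j1) -(EEZ _ jj) -EEB//; last exact: intgZ.
  congr (Rintegral _ _ _); apply/funext => z; rewrite !eucl_sqr dotvBl !dotvBr [dotv z.2 z.1]dotvC.
  by move: (dotv _ _) (dotv _ _) (dotv _ _) (u _) (v _) => *; ring.
apply: le_trans (lin _ _ _ _ _ _ _ _ _ gapu gapv diag) _.
rewrite [leRHS]mulrDl -[4 * Ke * _]mulrA lerD2l ler_pM2l//; apply: le_trans Esg _.
by rewrite exprS ler_piMl// ltW.
Qed.

(** The radius depends on the diameter alone, not on the position of O: by centering, |y|^2 is the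
    mean over x of y.(y - x), which is at most |y| diam O. The domain is nonempty because it carries
    mass one. *)
Lemma Kset_target {R : realType} {d : nat} (O : set 'rV[R]_d) (th : R) (mu : probability (Rd R d) R) :
  compact O -> Kset O th mu -> 0 <= diam O /\ target mu (diam O) th.
Proof.
move=> cO [sO [ctr hth]].
have mO : measurable (O : set (Rd R d)).
  by apply: measurable_closed; apply: compact_closed => //; exact: norm_hausdorff.
have aO (Q : Rd R d -> Prop) : (forall y : 'rV[R]_d, O y -> Q y) -> {ae mu, forall y : Rd R d, Q y}.
  move=> h; exists (~` (O : set (Rd R d))); split => //; first exact: measurableC.
  by move=> y nQ Oy; apply: nQ; exact: h.
have [M hM] : exists M, forall y, O y -> eucl y <= M.
  have [M [_ hM]] := compact_bounded cO.
  exists (d%:R * (M + 1)) => y Oy; apply: eucl_le_max => i.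
  have := hM (M + 1) _ y Oy; rewrite ltrDl ltr01 => /(_ isT); apply: le_trans.
  by rewrite [leRHS]/Num.norm/= mx_normrE; apply: (le_bigmax _ (fun ij => `|y ij.1 ij.2|) (0, i)).
pose S := [set eucl (x - y) | x in O & y in O].
have ubS : has_ubound S.
  exists (M + M) => _ [x Ox [y Oy <-]]; apply: le_trans (euclB_le _ _) _; exact: lerD (hM _ Ox) (hM _ Oy).
have leD x y : O x -> O y -> eucl (x - y) <= diam O.
  by move=> Ox Oy; apply: ub_le_sup => //; exists x => //; exists y.
have [y0 Oy0] : exists y, O y.
  have mu1 : (0 < mu setT)%E by rewrite probability_setT.
  by have [y [_ Oy]] := ae_meets measurableT mu1 (aO _ (fun y => id)); exists y.
have D0 : 0 <= diam O by apply: le_trans (leD y0 y0 Oy0 Oy0); exact: eucl_ge0.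
split => //.
have ic i : intg mu (fun y : Rd R d => (y : 'rV[R]_d) 0 i).
  apply: (@intg_ae_bounded _ _ _ _ _ M); first exact: measurable_coord.
  by apply: (aO) => y Oy; apply: le_trans (coord_le_eucl _ _) (hM _ Oy).
have Ec i : \int[mu]_y (y : 'rV[R]_d) 0 i = 0 by rewrite /Rintegral ctr.
have dot (x : 'rV[R]_d) := EE_dotv_centered (fun i => conj (ic i) (Ec i)) x.
split => //.
- apply: (aO) => y Oy; have [iy Ey] := dot y.
  have y0' := eucl_ge0 y.
  suff h : eucl y ^+ 2 <= eucl y * diam O.
    have [e|e] := eqVneq (eucl y) 0; first by rewrite e.
    by rewrite -(ler_pM2l (_ : 0 < eucl y)) -?expr2// lt_neqAle eq_sym e.
  have -> : eucl y ^+ 2 = \int[mu]_x (dotv y y - dotv y x).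
    by rewrite EEB//; [rewrite EE_cst Ey subr0 eucl_sqr|exact: intg_cst].
  rewrite -(EE_cst mu (eucl y * diam O)); apply: EE_le_ae; [|exact: intg_cst|].
    by apply: intgB => //; exact: intg_cst.
  apply: (aO) => x Ox; rewrite -dotvBr; apply: le_trans (dotv_le _ _) _.
  by rewrite ler_wpM2l// leD.
- move=> x; have [e|e] := eqVneq (eucl x) 0.
    by rewrite e mulr0; apply: EE_ge0.
  have x0 : 0 < eucl x by rewrite lt_neqAle eq_sym e eucl_ge0.
  have [ix _] := dot x; have ia := intg_norm ix.
  have : (th%:E <= \int[mu]_y `|dotv y ((eucl x)^-1 *: x)|%:E)%E.
    apply: le_trans hth _; apply: ereal_inf_lbound; exists ((eucl x)^-1 *: x) => //=.
    by rewrite euclZ ger0_norm ?invr_ge0// ?mulVf// ltW.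
  under eq_integral do rewrite dotvZr normrM [`|_^-1|]ger0_norm ?invr_ge0 ?(ltW x0)// dotvC.
  by rewrite EE_fineK ?lee_fin; [rewrite EEZ// ler_pdivlMl// mulrC|exact: intgZ].
Qed.

Lemma exponent_bounds {R : realType} (p : R) : 2 < p -> 0 < (p - 2) / (6 * p - 4) <= 6^-1.
Proof.
move=> p2; have q0 : 0 < 6 * p - 4 by lra.
apply/andP; split; first by apply: divr_gt0 => //; lra.
by rewrite ler_pdivrMr// ler_pdivlMl//; lra.
Qed.

(** Three regimes for W = W2 mu nu: if W = 0 the estimate is used with s tending to 0; if W >= 1/2
    the product coupling and uniform moments suffice; otherwise s = (2 W)^(1/6). The constant
    obtained is the same for all p, and p >= 1 inserts the factor p. *)
Lemma stability {R : realType} (d : nat) (D th : R) : 0 < th -> 0 <= D ->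
  exists K, forall (leb : {measure set (Rd R d) -> \bar R}) (mu nu : probability (Rd R d) R) (p : R),
    is_lebesgue leb -> target mu D th -> target nu D th -> 2 < p ->
    (distW2 (Mset leb mu) (Mset leb nu) <= (K * p * (fine (W2 mu nu)) `^ ((p - 2) / (6 * p - 4)))%:E)%E.
Proof.
have lin1 (a b : R) : 0 <= b -> a <= (2 * a + 2 * b) * 1 * 2^-1 by move=> *; lra.
have lin2 (a b : R) : 0 <= a -> b * 2 <= (2 * a + 2 * b) * 1 by move=> *; lra.
move=> th0 D0; have L0 : 0 < D + 1 by rewrite ltr_wpDl.
have c0 : 0 < th / 6 by rewrite divr_gt0.
have [C hC] := nice_exists d th0 D0.
have [M [M0 hM]] := @moment_bound R d (D + 1) (th / 6) C 2 L0 c0.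
have [K1 [K10 hK1]] := @stability_small R d D th (D + 1) (th / 6) C D0 L0 c0.
pose A := Num.sqrt (2 * M + 2 * M); pose Bc := Num.sqrt K1.
have A0 : 0 <= A by exact: sqrtr_ge0.
have Bc0 : 0 <= Bc by exact: sqrtr_ge0.
exists (2 * A + 2 * Bc) => leb mu nu p Hleb Hmu Hnu p2.
have [rho0 [Psi0 [phi0 [N0 S0]]]] := hC leb mu Hleb Hmu.
have [rho1 [Psi1 [phi1 [N1 S1]]]] := hC leb nu Hleb Hnu.
apply: (@le_trans _ _ (W2 rho0 rho1)).
  by apply: ereal_inf_lbound; exists rho0 => //; exists rho1.
set e := _ / _; have /andP[e0 e6] : 0 < e <= 6^-1 by exact: exponent_bounds.
have crude : (W2 rho0 rho1 <= A%:E)%E.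
  apply: W2_le => //; rewrite sqr_sqrtr ?addr_ge0 ?mulr_ge0//.
  apply: le_trans (W2sq_product (nice_pow Hleb L0 c0 N0 2) (nice_pow Hleb L0 c0 N1 2)) _.
  by rewrite lee_fin; apply: lerD; rewrite ler_pM2l//; [exact: hM Hleb N0|exact: hM Hleb N1].
have tpow (m : probability (Rd R d) R) : target m D th -> intg m (fun x : Rd R d => eucl x ^+ 2).
  move=> Hm; apply: (@intg_ae_bounded _ _ _ _ _ (D ^+ 2)).
    by apply: measurable_funX; exact: measurable_eucl.
  apply: filterS (target_le Hm) => y h; rewrite ger0_norm ?sqr_ge0//.
  by apply: lerXn2r; rewrite ?nnegrE ?eucl_ge0.
have [W [W0 WE W2E]] : exists W, [/\ 0 <= W, W2sq mu nu = (W ^+ 2)%:E & fine (W2 mu nu) = W].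
  have := W2sq_product (tpow _ Hmu) (tpow _ Hnu); have := W2sq_ge0 mu nu; rewrite /W2.
  case: (W2sq mu nu) => [x| |]//; rewrite lee_fin => x0 _.
  by exists (Num.sqrt x); split => //=; rewrite ?sqr_sqrtr//; exact: sqrtr_ge0.
rewrite W2E.
have small s : 0 < s -> s <= 1 -> W < s ^+ 6 -> (W2 rho0 rho1 <= (Bc * s)%:E)%E.
  move=> s0 s1 Ws; apply: W2_le; first by rewrite mulr_ge0// ltW.
  (* The estimate needs a strict inequality W < s^6, so that some plan has cost below w^2; this is
     why 2 W replaces W in the choice of s. *)
  rewrite exprMn sqr_sqrtr//; apply: (hK1 _ _ _ _ _ _ _ _ _ Hleb Hmu Hnu N0 N1 _ s0 s1).
  rewrite WE lte_fin; apply: ltr_pM => //; by rewrite ?expr2.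
have We0 := powR_ge0 W e.
have p1 : 1 <= p by apply: ltW; apply: lt_trans p2; rewrite ltr1n.
have K0 : 0 <= 2 * A + 2 * Bc by rewrite addr_ge0// mulr_ge0.
have [Wz|Wz] := eqVneq W 0.
  rewrite Wz powR0 ?gt_eqF// mulr0.
  have h s : 0 < s -> s <= 1 -> (W2 rho0 rho1 <= (Bc * s)%:E)%E.
    by move=> s0 s1; apply: small => //; rewrite Wz exprn_gt0.
  case: (W2 rho0 rho1) crude h => [x| |] // _ h; last exact: leNye.
  rewrite lee_fin; apply/ler_addgt0Pr => eps eps0; rewrite add0r.
  have B1 : 0 < Bc + 1 by rewrite ltr_wpDl.
  have s0 : 0 < Num.min 1 (eps / (Bc + 1)) by rewrite lt_min ltr01 divr_gt0.
  have := h _ s0 (_ : _ <= 1); rewrite ge_min lexx => /(_ isT); rewrite lee_fin => /le_trans; apply.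
  apply: (@le_trans _ _ ((Bc + 1) * (eps / (Bc + 1)))); last by rewrite mulrCA mulfV ?gt_eqF// mulr1.
  apply: ler_pM => //; [exact: ltW|by rewrite lerDl|by rewrite ge_min lexx orbT].
have Wp : 0 < W by rewrite lt_neqAle eq_sym Wz.
have [Wh|Wh] := leP 2^-1 W.
  apply: le_trans crude _; rewrite lee_fin.
  have h : 2^-1 <= W `^ e.
    apply: (@le_trans _ _ (2^-1 `^ e)); last by rewrite ge0_ler_powR ?nnegrE ?(ltW e0)// ltW.
    rewrite -[leLHS]powRr1//; apply: ger_powR; first by rewrite invr_gt0 ltr0n/= invf_le1// ler1n.
    by apply: le_trans e6 _; rewrite invf_le1// ler1n.
  apply: (@le_trans _ _ ((2 * A + 2 * Bc) * 1 * 2^-1)); first exact: lin1.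
  by apply: ler_pM => //; [rewrite mulr1|rewrite ler_wpM2l].
have w0 : 0 < 2 * W by rewrite mulr_gt0.
have w1 : 2 * W <= 1 by rewrite mulrC -ler_pdivlMr// mul1r ltW.
pose s := (2 * W) `^ 6^-1.
have s0 : 0 < s by exact: powR_gt0.
have s6 : s ^+ 6 = 2 * W by rewrite -powR_mulrn ?(ltW s0)// -powRrM mulVf// powRr1// ltW.
have s1 : s <= 1 by rewrite -(powRr0 (2 * W)); apply: ger_powR; [rewrite w0|rewrite invr_ge0].
apply: le_trans (small s s0 s1 _) _; first by rewrite s6 ltr_pMl// ltr1n.
(* Both 2 W and the exponents lie in [0, 1], so lowering the exponent from 1/6 to e only increases
   the power; the factor 2^e is at most 2. *)
have sW : s <= 2 * W `^ e.
  apply: (@le_trans _ _ ((2 * W) `^ e)); first by apply: ger_powR; rewrite ?w0.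
  rewrite powRM// ?(ltW Wp)// ler_wpM2r//.
  rewrite -[leRHS]powRr1//; apply: ler_powR; first by rewrite ler1n.
  by apply: le_trans e6 _; rewrite invf_le1// ler1n.
rewrite lee_fin; apply: (@le_trans _ _ (Bc * (2 * W `^ e))); first by rewrite ler_wpM2l.
rewrite mulrA; apply: ler_wpM2r => //; apply: (@le_trans _ _ ((2 * A + 2 * Bc) * 1)); first exact: lin2.
by rewrite ler_wpM2l.
Qed.

Theorem theorem4p7 (R : realType) :
  exists K : nat -> R -> R -> R,
  forall (d : nat) (leb : {measure set (Rd R d) -> \bar R}),
    (0 < d)%N -> is_lebesgue leb ->
  forall (O : set 'rV[R]_d) (th p : R),
    is_convex O -> compact O -> 0 < th -> 2 < p ->
  forall mu nu : probability (Rd R d) R,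
    Kset O th mu -> Kset O th nu ->
    (distW2 (Mset leb mu) (Mset leb nu) <=
      (K d (diam O) th * p * (fine (W2 mu nu)) `^ ((p - 2) / (6 * p - 4)))%:E)%E.
Proof.
pose Q (x : nat * R * R) (K : R) := 0 < x.2 -> 0 <= x.1.2 ->
  forall (leb : {measure set (Rd R x.1.1) -> \bar R}) (mu nu : probability (Rd R x.1.1) R) (p : R),
    is_lebesgue leb -> target mu x.1.2 x.2 -> target nu x.1.2 x.2 -> 2 < p ->
    (distW2 (Mset leb mu) (Mset leb nu) <= (K * p * (fine (W2 mu nu)) `^ ((p - 2) / (6 * p - 4)))%:E)%E.
(* A single function of the dimension, the diameter and the threshold is obtained by choice over
   triples; 0 is the value where the sign conditions fail. *)
have /choice[K hK] : forall x, exists K, Q x K.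
  move=> [[d D] th]; have [th0|th0] := ltP 0 th; last by exists 0 => /= h; move: th0; rewrite leNgt h.
  have [D0|D0] := leP 0 D; last by exists 0 => /= _ h; move: D0; rewrite ltNge h.
  by have [K hK] := stability d th0 D0; exists K => _ _.
exists (fun d D th => K (d, D, th)) => d leb d0 Hleb O th p _ cO th0 p2 mu nu hmu hnu.
have [D0 Tmu] := Kset_target cO hmu; have [_ Tnu] := Kset_target cO hnu.
exact: (hK (d, diam O, th) th0 D0 leb mu nu p Hleb Tmu Tnu p2).
Qed.
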